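(* Let $u$ be the solution of the obstacle scattering problem $$(\nabla^2+k^2)u=0 \text{ in } D',\qquad u=0 \text{ on } S,\qquad u=u_0+A(\alpha',\alpha)\frac{e^{ikr}}{r}+o\left(\frac1r\right),\quad r=|x|\to\infty,\ \alpha'=\frac{x}{r},$$ and let $v=u-u_0$ be the scattered field. Then for every $\epsilon>0$ there exist a positive integer $L=L(\epsilon)$ and coefficients $c_\ell=c_\ell(\epsilon)$, $0\le \ell\le L(\epsilon)$, such that, with $$v_\epsilon(x)=\sum_{\ell=0}^{L(\epsilon)}c_\ell(\epsilon)\Psi_\ell(x),$$ the following hold: (i) $\|u_0+v_\epsilon\|_{L^2(S)}\le\epsilon$. (ii) $\|v_\epsilon-v\|_{L^2(S)}\le\epsilon$, and $|||v_\epsilon-v|||=O(\epsilon)$ as $\epsilon\to0$, where $|||\cdot|||=\|\cdot\|_{H^m_{loc}(D')}+\|\cdot\|_{L^2(D';(1+|x|)^{-\gamma})}$, $\gamma>1$, and $m>0$ is an arbitrary integer. (iii) $c_\ell(\epsilon)\to A_\ell$ as $\epsilon\to0$ for every $\ell$, where $A_\ell=A_\ell(\alpha)=\int_{S^2}A(\alpha',\alpha)\overline{Y_\ell(\alpha')}\,d\alpha'$.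
   Context: $D\subset\mathbb{R}^3$ is a bounded domain with Lipschitz boundary $S$, contained in a ball $B_R=\{x:|x|\le R\}$, and $D'=\mathbb{R}^3\setminus D$ is the exterior domain. $S^2$ is the unit sphere in $\mathbb{R}^3$, $\alpha\in S^2$ is a unit vector (incident direction), $k>0$ is the wavenumber, and $u_0(x)=e^{ik\alpha\cdot x}$ is the incident field. The scattering problem has a unique solution $u$; $A(\alpha',\alpha)$ is the scattering amplitude ($k$-dependence not shown). The scattered field $v$ is outgoing, i.e. it solves the Helmholtz equation in $D'$ and satisfies the radiation condition $\lim_{r\to\infty}\int_{|x|=r}\left|\frac{\partial v}{\partial|x|}-ikv\right|^2ds=0$. $Y_\ell=Y_{\ell m}$, $-\ell\le m\le\ell$, are the orthonormal spherical harmonics on $S^2$. The second index of the spherical harmonics is suppressed: a coefficient $c_\ell$ or $A_\ell$ stands for all $c_{\ell m}$ or $A_{\ell m}$, $-\ell\le m\le \ell$, and every sum over $\ell$ includes summation over $-\ell\le m\le\ell$. $h_\ell$ are the spherical Hankel functions, normalized so that $h_\ell(kr)\sim e^{ikr}/r$ as $r\to+\infty$, and $\Psi_\ell(x)=Y_\ell(x/|x|)\,h_\ell(k|x|)$. In (iii), $c_\ell(\epsilon)$ is understood as $0$ for $\ell>L(\epsilon)$. $\|\cdot\|_{L^2(D';(1+|x|)^{-\gamma})}$ is the $L^2$ norm on $D'$ with weight $(1+|x|)^{-\gamma}$. $H^m$ is the Sobolev space; $H^m_{loc}(D')$ is the set of functions lying in $H^m(\tilde D)$ for every compact strictly inner subdomain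 $\tilde D$ of $D'$ (so $\mathrm{dist}(\tilde D,S)>0$); an estimate in the $H^m_{loc}(D')$ norm means that the estimate holds in $H^m(\tilde D)$ for each such $\tilde D$, with constant allowed to depend on $\tilde D$ (and on $m$).
   Formalization: It is assumed in addition that the origin lies in D; when the origin is not in D, the functions Psi_l are singular at a point of D' and no such v_epsilon can satisfy (i) and (ii). *)

(* Defs.v *)
From HB Require Import structures.
From mathcomp Require Import all_boot all_order all_algebra.
From mathcomp Require Import all_classical all_reals all_analysis.
From mathcomp Require Import complex.

Set Implicit Arguments.
Unset Strict Implicit.
Unset Printing Implicit Defensive.

Import Order.TTheory GRing.Theory Num.Theory.
Import numFieldNormedType.Exports.
Import ComplexField.Normc.

Local Open Scope classical_set_scope.
Local Open Scope ring_scope.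
Local Open Scope complex_scope.

(* The topology (hence limits, derivatives) on ['rV[R]_3] is the one of its
   sup norm; wherever a length matters the Euclidean norm [enorm] is used. *)
Definition dot (R : realType) (x y : 'rV[R]_3) : R :=
  \sum_(i < 3) x 0 i * y 0 i.

Definition enorm (R : realType) (x : 'rV[R]_3) : R := Num.sqrt (dot x x).

Definition expi (R : realType) (t : R) : R[i] := cos t +i* sin t.

(* Complex-valued functions of real variables are differentiated and
   integrated through their real and imaginary parts. *)
Definition reP (R : realType) (T : Type) (f : T -> R[i]) : T -> R :=
  fun x => complex.Re (f x).
Definition imP (R : realType) (T : Type) (f : T -> R[i]) : T -> R :=
  fun x => complex.Im (f x).

Definition pd (R : realType) (i : 'I_3) (f : 'rV[R]_3 -> R) : 'rV[R]_3 -> R :=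
  fun x => 'D_(delta_mx 0 i) f x.

Fixpoint Ck (R : realType) (n : nat) (Om : set 'rV[R]_3) (f : 'rV[R]_3 -> R)
    : Prop :=
  (forall x, Om x -> {for x, continuous f}) /\
  if n is n'.+1 then
    forall i : 'I_3, (forall x, Om x -> derivable f x (delta_mx 0 i)) /\
                     Ck n' Om (pd i f)
  else True.

Definition laplacian (R : realType) (f : 'rV[R]_3 -> R) : 'rV[R]_3 -> R :=
  fun x => \sum_(i < 3) pd i (pd i f) x.

Definition claplacian (R : realType) (f : 'rV[R]_3 -> R[i])
    : 'rV[R]_3 -> R[i] :=
  fun x => laplacian (reP f) x +i* laplacian (imP f) x.

Definition pdmulti (R : realType) (b : 'I_3 -> nat) (f : 'rV[R]_3 -> R)
    : 'rV[R]_3 -> R :=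
  foldr (fun i g => iter (b i) (pd i) g) f (enum 'I_3).

Section hausdorff.
Variable R : realType.
Local Open Scope ereal_scope.
Implicit Types (A U : set 'rV[R]_3) (d : R).

(* [maxe 0] only serves the empty set, whose diameter is 0. *)
Definition ediam U : \bar R :=
  maxe 0 (ereal_sup [set (enorm (p.1 - p.2))%:E | p in U `*` U]).

Definition small_cover d A : set ((set 'rV[R]_3)^nat) :=
  [set U | A `<=` \bigcup_i U i /\ forall i, ediam (U i) <= d%:E].

(* pi / 4 * diam ^ 2 is the area of a plane disc of that diameter; with this
   normalization the measure is the usual surface area. *)
Definition disc_area U : \bar R := (pi / 4)%R%:E * ediam U ^+ 2.

Definition hausdorff2_pre d A : \bar R :=
  ereal_inf [set \sum_(i <oo) disc_area (U i) | U in small_cover d A].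

Definition hausdorff2 A : \bar R :=
  ereal_sup [set hausdorff2_pre d A | d in [set d | (0 < d)%R]].

Lemma ediam_ge0 U : 0 <= ediam U.
Proof. by rewrite le_max lexx. Qed.

Lemma ediam0 : ediam set0 = 0.
Proof. by rewrite /ediam setX0 image_set0 ereal_sup0 maxeNy. Qed.

Lemma disc_area_ge0 U : 0 <= disc_area U.
Proof.
rewrite /disc_area mule_ge0 ?expe_ge0 ?ediam_ge0//.
by rewrite lee_fin divr_ge0 ?pi_ge0.
Qed.

Lemma disc_area0 : disc_area set0 = 0.
Proof. by rewrite /disc_area ediam0 expe2 !mule0. Qed.

Lemma hausdorff2_pre_ge0 d A : 0 <= hausdorff2_pre d A.
Proof.
apply: le_ereal_inf_tmp => _ [U _ <-].
by apply: nneseries_ge0 => n _ _; exact: disc_area_ge0.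
Qed.

Lemma hausdorff2_pre0 d : (0 < d)%R -> hausdorff2_pre d set0 = 0.
Proof.
move=> d0; apply/eqP; rewrite eq_le hausdorff2_pre_ge0 andbT.
apply: ereal_inf_lbound; exists (fun=> set0).
  by split => // i; rewrite ediam0 lee_fin ltW.
by rewrite eseries0// => i _ _; exact: disc_area0.
Qed.

Lemma le_hausdorff2_pre d : {homo hausdorff2_pre d : A B / A `<=` B >-> A <= B}.
Proof.
move=> A B AB; apply: ereal_inf_le_tmp => _ [U [BU Ud] <-].
by exists U => //; split => //; exact: subset_trans BU.
Qed.

Lemma hausdorff2_pre_sigma_subadditive d : sigma_subadditive (hausdorff2_pre d).
Proof.
move=> A; have [[i ioo]|] := pselect (exists i, hausdorff2_pre d (A i) = +oo).
  rewrite (eseries_pinfty _ _ ioo) ?leey// => n _.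
  by rewrite -ltNye (lt_le_trans _ (hausdorff2_pre_ge0 _ _)).
rewrite -forallNE => Aoo.
suff add2e (e : {posnum R}) : hausdorff2_pre d (\bigcup_n A n) <=
    \sum_(i <oo) hausdorff2_pre d (A i) + e%:num%:E.
  by apply/lee_addgt0Pr => _/posnumP[].
rewrite (le_trans _ (epsilon_trick _ _ _))//; last first.
  by move=> n; exact: hausdorff2_pre_ge0.
pose P n (B : (set 'rV[R]_3)^nat) := small_cover d (A n) B /\
  \sum_(k <oo) disc_area (B k) <=
    hausdorff2_pre d (A n) + (e%:num / (2 ^ n.+1)%:R)%:E.
have [G PG] : {G : ((set 'rV[R]_3)^nat)^nat & forall n, P n (G n)}.
  apply: (@choice _ _ P) => n; rewrite /P /hausdorff2_pre.
  set S := (X in ereal_inf X); move infS : (ereal_inf S) => iS.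
  case: iS infS => [r Sr|Soo|Soo].
  - have en1 : (0 < e%:num / (2 ^ n.+1)%:R)%R by [].
    have /(lb_ereal_inf_adherent en1) : ereal_inf S \is a fin_num by rewrite Sr.
    move=> [x [B AnB muBx] xS].
    by exists B; split => //; rewrite muBx -Sr; exact/ltW.
  - by have := Aoo n; rewrite /hausdorff2_pre Soo.
  - suff : lbound S 0 by move/le_ereal_inf_tmp; rewrite Soo.
    move=> /= _ [B _ <-].
    by apply: nneseries_ge0 => k _ _; exact: disc_area_ge0.
have muG_ge0 x : 0 <= (disc_area \o uncurry G) x by exact: disc_area_ge0.
apply: (@le_trans _ _ (\esum_(i in setT) (disc_area \o uncurry G) i)).
  rewrite /hausdorff2_pre; apply: ereal_inf_lbound => /=.
  have /card_esym/ppcard_eqP[f] := card_nat2.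
  exists (uncurry G \o f).
    split; last first.
      by move=> i /=; case: (f i) => a b; exact: (PG a).1.2.
    apply: (@subset_trans _  (\bigcup_n \bigcup_k G n k)) => [t [i _]|].
      by move=> /((PG i).1.1) -[j _ ?]; exists i => //; exists j.
    move=> t [i _ [j _ Bijt]]; exists (f^-1%FUN (i, j)) => //=.
    by rewrite invK ?inE.
  rewrite -(esum_pred_image (disc_area \o uncurry G) _ xpredT) ?[fun=> _]set_true//.
  by rewrite image_eq.
rewrite (_ : esum _ _ = \sum_(i <oo) \sum_(j <oo ) disc_area (G i j)); last first.
  pose J : nat -> set (nat * nat) := fun i => [set (i, j) | j in setT].
  rewrite (_ : setT = \bigcup_k J k); last first.
    by rewrite predeqE => -[a b]; split => // _; exists a => //; exists b.
  rewrite esum_bigcupT /=; last 2 first.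
    - apply/trivIsetP => i j _ _ ij.
      rewrite predeqE => -[n m] /=; split => //= -[] [_] _ [<-{n} _].
      by move=> [m' _] [] /esym/eqP; rewrite (negbTE ij).
    - by move=> /= [n m]; exact: disc_area_ge0.
  rewrite -(image_id [set: nat]) -fun_true esum_pred_image//; last first.
    by move=> n _; apply: esum_ge0 => x _; exact: disc_area_ge0.
  apply: eq_eseriesr => /= j _.
  rewrite -(esum_pred_image (disc_area \o uncurry G) (pair j) predT)//=; last 2 first.
    by move=> n _; exact: disc_area_ge0.
    by move=> ? ? _ _; exact: (@can_inj _ _ _ snd).
  by congr esum; rewrite predeqE => -[a b]; split; move=> [i _ <-]; exists i.
apply: lee_lim.
- apply: is_cvg_nneseries => n *.
  by apply: nneseries_ge0 => m *; exact: (muG_ge0 (n, m)).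
- by apply: is_cvg_nneseries => n *; apply: adde_ge0 => //;
    exact: hausdorff2_pre_ge0.
- by near=> n; apply: lee_sum => i _; exact: (PG i).2.
Unshelve. all: by end_near. Qed.

Lemma hausdorff2_ge0 A : 0 <= hausdorff2 A.
Proof.
apply: (le_trans (hausdorff2_pre_ge0 1 A)).
by apply: ereal_sup_ubound; exists 1%R => //=.
Qed.

Lemma hausdorff2_0 : hausdorff2 set0 = 0.
Proof.
apply/eqP; rewrite eq_le hausdorff2_ge0 andbT.
by apply: ge_ereal_sup => _ [d /= d0 <-]; rewrite hausdorff2_pre0.
Qed.

Lemma le_hausdorff2 : {homo hausdorff2 : A B / A `<=` B >-> A <= B}.
Proof.
move=> A B AB; apply: ge_ereal_sup => _ [d /= d0 <-].
apply: (le_trans (le_hausdorff2_pre d AB)).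
by apply: ereal_sup_ubound; exists d.
Qed.

Lemma hausdorff2_sigma_subadditive : sigma_subadditive hausdorff2.
Proof.
move=> A; apply: ge_ereal_sup => _ [d /= d0 <-].
apply: (le_trans (hausdorff2_pre_sigma_subadditive d A)).
apply: lee_nneseries => [n _ _|n _]; first exact: hausdorff2_pre_ge0.
by apply: ereal_sup_ubound; exists d.
Qed.

HB.instance Definition _ := isOuterMeasure.Build R 'rV[R]_3 hausdorff2
  hausdorff2_0 hausdorff2_ge0 le_hausdorff2 hausdorff2_sigma_subadditive.

End hausdorff.

(* Surface area, as a measure on the Caratheodory sigma-algebra of
   [hausdorff2], which contains the Borel sets. *)
Definition hausdorff2_outer (R : realType) :
    {outer_measure set 'rV[R]_3 -> \bar R} :=
  @hausdorff2 R.

Definition area (R : realType) :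
    {measure set (caratheodory_type (hausdorff2_outer R)) -> \bar R} :=
  (hausdorff2_outer R :
    set (caratheodory_type (hausdorff2_outer R)) -> \bar R).

Definition leb3 (R : realType) :
    {measure set (measurableTypeR R * measurableTypeR R * measurableTypeR R)
       -> \bar R} :=
  ((@lebesgue_measure R \x @lebesgue_measure R) \x @lebesgue_measure R)%E.

Definition vec3 (R : realType) (p : R * R * R) : 'rV[R]_3 :=
  \row_(i < 3) [:: p.1.1; p.1.2; p.2]`_i.

Definition L2norm (d : measure_display) (T : measurableType d) (R : realType)
    (mu : {measure set T -> \bar R}) (A : set T) (f : T -> R[i]) : \bar R :=
  sqrte (\int[mu]_(x in A) (normc (f x) ^+ 2)%:E)%E.

Definition surfL2 (R : realType) (S : set 'rV[R]_3) (f : 'rV[R]_3 -> R[i])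
    : \bar R :=
  L2norm (area R) S f.

Definition volL2 (R : realType) (Om : set 'rV[R]_3) (f : 'rV[R]_3 -> R[i])
    : \bar R :=
  L2norm (leb3 R) (@vec3 R @^-1` Om) (f \o @vec3 R).

(* The norm of L^2(Om; (1 + |x|)^(-gamma)): the weight multiplies |f|^2. *)
Definition weightedL2 (R : realType) (gamma : R) (Om : set 'rV[R]_3)
    (f : 'rV[R]_3 -> R[i]) : \bar R :=
  sqrte (\int[leb3 R]_(p in @vec3 R @^-1` Om)
    (normc (f (vec3 p)) ^+ 2 * (1 + enorm (vec3 p)) `^ (- gamma))%:E)%E.

Definition test_function (R : realType) (Om : set 'rV[R]_3)
    (phi : 'rV[R]_3 -> R) : Prop :=
  (forall n, Ck n [set: 'rV[R]_3] phi) /\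
  compact (closure [set x | phi x != 0]) /\
  closure [set x | phi x != 0] `<=` Om.

Definition vol_integral (R : realType) (Om : set 'rV[R]_3)
    (f : 'rV[R]_3 -> R) : R :=
  (\int[leb3 R]_(p in @vec3 R @^-1` Om) f (vec3 p))%R.

Definition vol_measurable (R : realType) (Om : set 'rV[R]_3)
    (f : 'rV[R]_3 -> R[i]) : Prop :=
  measurable_fun (@vec3 R @^-1` Om) (reP f \o @vec3 R) /\
  measurable_fun (@vec3 R @^-1` Om) (imP f \o @vec3 R).

Definition real_weak_derivative (R : realType) (Om : set 'rV[R]_3)
    (b : 'I_3 -> nat) (f g : 'rV[R]_3 -> R) : Prop :=
  forall phi, test_function Om phi ->
    vol_integral Om (fun x => f x * pdmulti b phi x) =
    (-1) ^+ (\sum_(i < 3) b i)%N * vol_integral Om (fun x => g x * phi x).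

Definition weak_derivative (R : realType) (Om : set 'rV[R]_3)
    (b : 'I_3 -> nat) (f g : 'rV[R]_3 -> R[i]) : Prop :=
  real_weak_derivative Om b (reP f) (reP g) /\
  real_weak_derivative Om b (imP f) (imP g).

(* The multi-indices of order at most [m] are the [b] with values in
   ['I_m.+1] and total degree at most [m].  [H^m(Om)] asks for the weak
   derivatives up to order [m] to exist and to be in L^2; these are unique
   almost everywhere, so the infimum below is over a single value, or over
   the empty set (and then equal to [+oo]) when [f] is not in [H^m(Om)]. *)
Definition sobolev_norm (R : realType) (m : nat) (Om : set 'rV[R]_3)
    (f : 'rV[R]_3 -> R[i]) : \bar R :=
  ereal_inf [set N : \bar R |
    vol_measurable Om f /\ (volL2 Om f < +oo)%E /\
    exists g : {ffun 'I_3 -> 'I_m.+1} -> 'rV[R]_3 -> R[i],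
      (forall b : {ffun 'I_3 -> 'I_m.+1}, (\sum_(i < 3) b i <= m)%N ->
        vol_measurable Om (g b) /\ (volL2 Om (g b) < +oo)%E /\
        weak_derivative Om (fun i => b i : nat) f (g b)) /\
      N = sqrte (\sum_(b : {ffun 'I_3 -> 'I_m.+1} |
                       (\sum_(i < 3) b i <= m)%N) volL2 Om (g b) ^+ 2)%E].

Definition boundary (R : realType) (D : set 'rV[R]_3) : set 'rV[R]_3 :=
  closure D `\` D°.

(* Near each boundary point, in suitable orthonormal coordinates, the domain
   is the part of space above the graph of a Lipschitz function. *)
Definition lipschitz_boundary (R : realType) (D : set 'rV[R]_3) : Prop :=
  forall x0, boundary D x0 ->
    exists (Q : 'M[R]_3) (h : R * R -> R^o) (U : set 'rV[R]_3),
      Q *m Q^T = 1%:M /\ lipschitz h /\ nbhs x0 U /\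
      forall x, U x ->
        (D x <-> h ((x *m Q) 0 0, (x *m Q) 0 1) < (x *m Q) 0 (2%:R : 'I_3)).

Definition domain (R : realType) (D : set 'rV[R]_3) : Prop :=
  D !=set0 /\ open D /\ connected D.

Definition inner_subdomain (R : realType) (Om Om' : set 'rV[R]_3) : Prop :=
  domain Om' /\ compact (closure Om') /\ closure Om' `<=` Om.

Definition plane_wave (R : realType) (k : R) (alpha : 'rV[R]_3)
    : 'rV[R]_3 -> R[i] :=
  fun x => expi (k * dot alpha x).

Definition sphere (R : realType) : set 'rV[R]_3 := [set x | enorm x = 1].

(* [D' = ~` D] contains the boundary [S] of [D], and [u] is a classical
   solution: twice continuously differentiable in the interior of [D'] and
   continuous on [D'].  The remainder o(1/r) is uniform in the direction. *)
Definition scattering_solution (R : realType) (D : set 'rV[R]_3) (k : R)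
    (alpha : 'rV[R]_3) (A : 'rV[R]_3 -> 'rV[R]_3 -> R[i])
    (u : 'rV[R]_3 -> R[i]) : Prop :=
  Ck 2 (~` D)° (reP u) /\ Ck 2 (~` D)° (imP u) /\
  {within ~` D, continuous (reP u)} /\ {within ~` D, continuous (imP u)} /\
  (forall x, (~` D)° x -> claplacian u x + (k ^+ 2)%:C * u x = 0) /\
  (forall x, boundary D x -> u x = 0) /\
  (forall e : R, 0 < e -> exists rho : R, forall x, rho < enorm x ->
    normc (u x - (plane_wave k alpha x +
                  A ((enorm x)^-1 *: x) alpha *
                  (expi (k * enorm x) / (enorm x)%:C)))
      <= e / enorm x).

Definition sphere_integral (R : realType) (f : 'rV[R]_3 -> R[i]) : R[i] :=
  Rintegral (area R) (@sphere R) (reP f) +i*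
  Rintegral (area R) (@sphere R) (imP f).

Definition homogeneous_poly (R : realType) (l : nat)
    (P : 'rV[R]_3 -> R[i]) : Prop :=
  exists a : nat -> nat -> R[i], forall x,
    P x = \sum_(i < l.+1) \sum_(j < l.+1 | (i + j <= l)%N)
      a i j * (x 0 0 ^+ i * x 0 1 ^+ j * x 0 (2%:R : 'I_3) ^+ (l - i - j))%:C.

(* [Y l m] is the spherical harmonic of degree l and order m - l, so that
   the order runs through -l, ..., l.  No phase convention is fixed: [Y] is
   any orthonormal system made of 2 l + 1 spherical harmonics of each degree
   l.  Only the values of [Y l m] on the unit sphere are relevant. *)
Definition orthonormal_spherical_harmonics (R : realType)
    (Y : forall l : nat, 'I_(l.*2.+1) -> 'rV[R]_3 -> R[i]) : Prop :=
  (forall l m, exists P, homogeneous_poly l P /\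
    (forall x, claplacian P x = 0) /\
    (forall x, sphere x -> Y l m x = P x)) /\
  (forall l m l' m',
    sphere_integral (fun x => Y l m x * (Y l' m' x)^*) =
    ((l == l') && (m == m' :> nat))%:R).

(* The usual spherical Hankel function of the first kind, DLMF 10.49.6. *)
Definition hankel1 (R : realType) (l : nat) (z : R) : R[i] :=
  expi z * \sum_(j < l.+1)
    'i ^+ j * (- 'i) ^+ l.+1 *
    (((l + j)`!)%:R / (2 ^ j * j`! * (l - j)`!)%:R / z ^+ j.+1)%:C.

(* As [hankel1 l z] is equivalent to (-i)^(l+1) e^(iz) / z at infinity, the
   factor makes [hankel k l (k * r)] equivalent to e^(ikr) / r. *)
Definition hankel (R : realType) (k : R) (l : nat) (z : R) : R[i] :=
  k%:C * 'i ^+ l.+1 * hankel1 l z.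

Definition Psi (R : realType) (k : R)
    (Y : forall l : nat, 'I_(l.*2.+1) -> 'rV[R]_3 -> R[i])
    (l : nat) (m : 'I_(l.*2.+1)) : 'rV[R]_3 -> R[i] :=
  fun x => Y l m ((enorm x)^-1 *: x) * hankel k l (k * enorm x).

Definition outgoing_sum (R : realType) (k : R)
    (Y : forall l : nat, 'I_(l.*2.+1) -> 'rV[R]_3 -> R[i])
    (L : nat) (c : forall l : nat, 'I_(l.*2.+1) -> R[i])
    : 'rV[R]_3 -> R[i] :=
  fun x => \sum_(l < L.+1) \sum_(m < l.*2.+1) c l m * Psi k Y m x.

Definition amplitude_coef (R : realType)
    (Y : forall l : nat, 'I_(l.*2.+1) -> 'rV[R]_3 -> R[i])
    (A : 'rV[R]_3 -> 'rV[R]_3 -> R[i]) (alpha : 'rV[R]_3)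
    (l : nat) (m : 'I_(l.*2.+1)) : R[i] :=
  sphere_integral (fun beta => A beta alpha * (Y l m beta)^*).

(* Main.v *)
(* Write U for the total field extended by 0 to D.  It is continuous on the
   whole space and solves the Helmholtz equation off S, so mu = (Delta + k^2) U
   is a distribution carried by S, and the scattered field v is, up to a
   constant, the potential of mu: Green's formula gives this with a smoothed
   fundamental solution, the contribution of a large sphere being killed by the
   radiation condition.  With a partition of unity on S, cut mu into pieces, each
   supported where D is the region above a Lipschitz graph.  Translating the
   sources of a piece slightly upwards moves them inside D, and changes the
   potential little in the norm N(f) = sup (1 + |x|) |f x| over the complement of
   D, since U is continuous and the kernels are integrable (Hardy's inequality).
   A potential with sources in a compact subset of D is an N-limit of finite sums
   of fundamental solutions with poles in D.  The poles are pushed to the origin,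
   along chains of Taylor expansions, because D is connected; and a derivative at
   the origin of the fundamental solution is a finite outgoing sum.  Hence v is an
   N-limit of outgoing sums.  The norm N controls everything else: the surface
   has finite Hausdorff measure, (1 + |x|)^(-2-gamma) is integrable, interior
   derivatives are bounded by the sup norm, and c_lm is the Y_lm coefficient of
   the far field of v_eps, which is within N(v_eps - v) of A. *)
From HB Require Import structures.
From mathcomp Require Import all_boot all_order all_algebra.
From mathcomp Require Import all_classical all_reals all_analysis.
From mathcomp Require Import measurable_realfun.
From mathcomp Require Import complex ring lra zify.
Require Import Defs.

Set Implicit Arguments.
Unset Strict Implicit.
Unset Printing Implicit Defensive.

Import Order.TTheory GRing.Theory Num.Theory.
Import numFieldNormedType.Exports.
Import ComplexField.Normc.

Local Open Scope classical_set_scope.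
Local Open Scope ring_scope.
Local Open Scope complex_scope.

(** The solution is only assumed continuous up to a Lipschitz surface, so no normal derivative is
    available there. All derivatives are therefore put on the test side: mu occurs only paired with
    cutoffs times [Gk e x], a C^2 regularization of e^(ikr)/r at scale e. The bounds of
    [potential_bound] depend neither on e nor on x, which permits the decisive order of choices: the
    upward shift comes first, uniformly in e; then the shifted sources are approximated; e comes
    last and may depend on x. The same regularization, cut off, yields the reproducing identity
    [mvp]. It survives differentiation, hence stands in for elliptic regularity and gives the
    interior estimates. Radial functions are written in q = r^2, where each step of the Hankel
    ladder is one derivative. As [Y] is an abstract orthonormal family, that it spans the harmonics
    of each degree must be proved: this is done by counting Cauchy data on a plane. The weight 1 +
    |x| matches the decay of outgoing waves, so closeness in N passes to the far fields. *)

Lemma le_of_eq (R : realType) (a b : R) : a = b -> a <= b.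
Proof. by move=> ->. Qed.

(** * Pointwise continuity of real-valued functions *)

Section pointwise_continuity.
Context (R : realType) (T : topologicalType).
Implicit Types (f g : T -> R) (x : T).

Lemma contD f g x : {for x, continuous f} -> {for x, continuous g} ->
  {for x, continuous (fun y => f y + g y)}.
Proof. exact: continuousD. Qed.

Lemma contB f g x : {for x, continuous f} -> {for x, continuous g} ->
  {for x, continuous (fun y => f y - g y)}.
Proof. exact: continuousB. Qed.

Lemma contN f x : {for x, continuous f} ->
  {for x, continuous (fun y => - f y)}.
Proof. exact: continuousN. Qed.

Lemma contM f g x : {for x, continuous f} -> {for x, continuous g} ->
  {for x, continuous (fun y => f y * g y)}.
Proof. exact: continuousM. Qed.

Lemma contV f x : f x != 0 -> {for x, continuous f} ->
  {for x, continuous (fun y => (f y)^-1)}.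
Proof. exact: continuousV. Qed.

Lemma contC (c : R) x : {for x, continuous (fun _ : T => c)}.
Proof. exact: cst_continuous. Qed.

Lemma contcomp (S : topologicalType) (f : T -> S) (g : S -> R) x :
  {for x, continuous f} -> {for (f x), continuous g} ->
  {for x, continuous (fun y => g (f y))}.
Proof. exact: continuous_comp. Qed.

Lemma cont_sum (I : Type) (s : seq I) (P : pred I) (F : I -> T -> R) x :
  (forall i, {for x, continuous (F i)}) ->
  {for x, continuous (fun y => \sum_(i <- s | P i) F i y)}.
Proof.
move=> h; elim: s => [|i s IH].
  rewrite (_ : (fun y => _) = fun=> 0); first exact: contC.
  by apply/funext => y; rewrite big_nil.
have [Pi|Pi] := boolP (P i).
  rewrite (_ : (fun y => _) = fun y => F i y + \sum_(j <- s | P j) F j y); first exact: contD.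
  by apply/funext => y; rewrite big_cons Pi.
rewrite (_ : (fun y => _) = fun y => \sum_(j <- s | P j) F j y)//.
by apply/funext => y; rewrite big_cons (negbTE Pi).
Qed.

Lemma contX f x n : {for x, continuous f} ->
  {for x, continuous (fun y => f y ^+ n)}.
Proof.
move=> h; elim: n => [|n IH]; first exact: contC.
rewrite (_ : (fun y => _) = fun y => f y * f y ^+ n); first exact: contM.
by apply/funext => y; rewrite exprS.
Qed.

End pointwise_continuity.

(** * Euclidean space *)

Section euclid.
Variable R : realType.
Local Notation V := 'rV[R]_3.
Implicit Types (x y z : V) (e : R).

Lemma sum3 (S : nmodType) (F : 'I_3 -> S) :
  \sum_(i < 3) F i = F 0 + F 1 + F 2%:R.
Proof.
rewrite !big_ord_recr big_ord0 /= add0r; congr (F _ + F _ + F _); exact/val_inj.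
Qed.

Lemma forall3 (P : 'I_3 -> Prop) : P 0 -> P 1 -> P 2%:R -> forall i, P i.
Proof.
move=> p0 p1 p2 [[|[|[|//]]] h].
- by rewrite (_ : Ordinal h = 0)//; exact/val_inj.
- by rewrite (_ : Ordinal h = 1)//; exact/val_inj.
- by rewrite (_ : Ordinal h = 2%:R)//; exact/val_inj.
Qed.

Lemma dotE x y : dot x y = x 0 0 * y 0 0 + x 0 1 * y 0 1 + x 0 2%:R * y 0 2%:R.
Proof. by rewrite /dot sum3. Qed.

Lemma dotC x y : dot x y = dot y x.
Proof. by rewrite !dotE; ring. Qed.

Lemma dotDl x y z : dot (x + y) z = dot x z + dot y z.
Proof. by rewrite !dotE !mxE; ring. Qed.

Lemma dotDr x y z : dot z (x + y) = dot z x + dot z y.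
Proof. by rewrite !dotE !mxE; ring. Qed.

Lemma dotZl a x y : dot (a *: x) y = a * dot x y.
Proof. by rewrite !dotE !mxE; ring. Qed.

Lemma dotZr a x y : dot x (a *: y) = a * dot x y.
Proof. by rewrite !dotE !mxE; ring. Qed.

Lemma dotNl x y : dot (- x) y = - dot x y.
Proof. by rewrite !dotE !mxE; ring. Qed.

Lemma dotNr x y : dot x (- y) = - dot x y.
Proof. by rewrite !dotE !mxE; ring. Qed.

Lemma dot_ge0 x : 0 <= dot x x.
Proof. by rewrite /dot sumr_ge0// => i _; rewrite -expr2 sqr_ge0. Qed.

Lemma enorm_ge0 x : 0 <= enorm x.
Proof. exact: sqrtr_ge0. Qed.

Lemma enorm_sqr x : enorm x ^+ 2 = dot x x.
Proof. by rewrite sqr_sqrtr// dot_ge0. Qed.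

Lemma coord_le_enorm x i : `|x 0 i| <= enorm x.
Proof.
rewrite -ler_sqr ?nnegrE ?enorm_ge0// enorm_sqr real_normK ?num_real//.
by rewrite /dot (bigD1 i)//= expr2 lerDl sumr_ge0// => j _; rewrite -expr2 sqr_ge0.
Qed.

Lemma coord_le_norm x i : `|x 0 i| <= `|x|.
Proof.
rewrite [leRHS]/Num.norm /= mx_normrE.
by apply/bigmax_geP; right; exists (0, i).
Qed.

Lemma norm_leP x e : 0 <= e -> (forall i, `|x 0 i| <= e) -> `|x| <= e.
Proof.
move=> e0 H; rewrite [leLHS]/Num.norm /= mx_normrE.
by apply/bigmax_leP; split => // -[i j] _ /=; rewrite (ord1 i).
Qed.

Lemma norm_le_enorm x : `|x| <= enorm x.
Proof. by apply: norm_leP => [|i]; [exact: enorm_ge0|exact: coord_le_enorm]. Qed.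

(** The sharp constant is the square root of 3; the integer 2 keeps later constants rational. *)
Lemma enorm_le_norm x : enorm x <= 2 * `|x|.
Proof.
rewrite -ler_sqr ?nnegrE ?enorm_ge0 ?mulr_ge0// enorm_sqr dotE.
have h i : x 0 i * x 0 i <= `|x| ^+ 2.
  by rewrite -expr2 -real_normK ?num_real// ler_sqr ?nnegrE// coord_le_norm.
have := h 0; have := h 1; have := h 2%:R; rewrite exprMn; have := sqr_ge0 `|x|; lra.
Qed.

Lemma cauchy_schwarz x y : `|dot x y| <= enorm x * enorm y.
Proof.
rewrite -ler_sqr ?nnegrE ?mulr_ge0 ?enorm_ge0//.
rewrite real_normK ?num_real// exprMn !enorm_sqr !dotE -subr_ge0.
set a := x 0 0; set b := x 0 1; set c := x 0 2%:R.
set a' := y 0 0; set b' := y 0 1; set c' := y 0 2%:R.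
rewrite (_ : _ - _ = (a * b' - b * a') ^+ 2 + (a * c' - c * a') ^+ 2 +
  (b * c' - c * b') ^+ 2); last by ring.
by rewrite !addr_ge0 ?sqr_ge0.
Qed.

Lemma enormD x y : enorm (x + y) <= enorm x + enorm y.
Proof.
rewrite -ler_sqr ?nnegrE ?addr_ge0 ?enorm_ge0// enorm_sqr sqrrD !enorm_sqr.
rewrite dotDl !dotDr (dotC y x).
have := cauchy_schwarz x y; have := ler_norm (dot x y); lra.
Qed.

Lemma enormZ a x : enorm (a *: x) = `|a| * enorm x.
Proof.
by rewrite /enorm dotZl dotZr mulrA -expr2 sqrtrM ?sqr_ge0// sqrtr_sqr.
Qed.

Lemma enormN x : enorm (- x) = enorm x.
Proof. by rewrite -scaleN1r enormZ normrN normr1 mul1r. Qed.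

Lemma enormB x y : enorm (x - y) = enorm (y - x).
Proof. by rewrite -enormN opprB. Qed.

Lemma enorm0 : enorm (0 : V) = 0.
Proof. by rewrite /enorm dotE !mxE !mulr0 !addr0 sqrtr0. Qed.

Lemma enorm_gt0 x : x != 0 -> 0 < enorm x.
Proof.
by move=> x0; rewrite (lt_le_trans _ (norm_le_enorm x))// normr_gt0.
Qed.

Lemma enorm_triB x y : enorm x - enorm y <= enorm (x - y).
Proof. by rewrite lerBlDr; apply: le_trans (enormD _ _); rewrite subrK. Qed.

Lemma coord_cont i : continuous (fun x : V => x 0 i).
Proof. by move=> x; exact: coord_continuous. Qed.

Lemma dot_cont x : continuous (fun y : V => dot x y).
Proof.
by move=> y; apply: cont_sum => i; apply: contM; [exact: contC|exact: coord_cont].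
Qed.

Lemma dotxx_cont : continuous (fun y : V => dot y y).
Proof.
by move=> y; apply: cont_sum => i; apply: contM; exact: coord_cont.
Qed.

Lemma enorm_cont : continuous (@enorm R : V -> R).
Proof.
move=> y; apply: (@continuous_comp _ _ _ (fun y : V => dot y y) Num.sqrt).
  exact: dotxx_cont.
exact: sqrt_continuous.
Qed.

(** The topology comes from the sup norm; the two norms being equivalent, Euclidean balls are a base
    of the neighbourhoods as well. *)
Lemma enorm_ball x (A : set V) :
  nbhs x A <-> exists2 e : R, 0 < e & forall y, enorm (y - x) < e -> A y.
Proof.
split.
  move=> /nbhs_ballP[e /= e0 H]; exists e => // y yx; apply: H.
  by rewrite -ball_normE /= distrC (le_lt_trans (norm_le_enorm _)).
move=> [e e0 H]; apply/nbhs_ballP; exists (e / 2); first by rewrite /= divr_gt0.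
move=> y; rewrite -ball_normE /= distrC => yx; apply: H.
by rewrite (le_lt_trans (enorm_le_norm _))// mulrC -ltr_pdivlMr.
Qed.

Lemma shift_cont a : continuous (fun x : V => x + a).
Proof.
by move=> x; apply: (@continuousD _ _ _ id (fun=> a)); [exact: cvg_id|exact: cst_continuous].
Qed.

Lemma delta_coord i j : (delta_mx 0 i : V) 0 j = (i == j)%:R.
Proof. by rewrite mxE eqxx /= eq_sym. Qed.

End euclid.

(** * Measurability through coordinates *)

Section measurability.
Context (R : realType) (d : measure_display) (T : measurableType d).
Variable p : T -> 'rV[R]_3.
Hypothesis mp : forall i, measurable_fun setT (fun t => p t 0 i).

(** An open set is a countable union of cubes with rational centre and radius. The map [p] is
    abstract because it is used both for [vec3] on the product space and for the identity on the
    Caratheodory sigma-algebra of the surface measure. *)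
Lemma measurable_preimage_open (O : set 'rV[R]_3) : open O ->
  measurable (p @^-1` O).
Proof.
move=> oO.
pose B (a : 'rV[rat]_3 * rat) : set 'rV[R]_3 :=
  [set x | forall i, `|x 0 i - ratr (a.1 0 i)| < ratr a.2].
have -> : p @^-1` O = \bigcup_(a in [set a | B a `<=` O]) p @^-1` B a.
  apply/seteqP; split => [t /= Ot|t [a /= aO /aO]//].
  have /nbhs_ballP[e /= e0 He] := open_nbhs_nbhs (conj oO Ot).
  (* A cube of radius r whose centre is within r of the point lies within 2 r < e of it. *)
  have [r] := @rat_in_itvoo R 0 (e / 2) (divr_gt0 e0 (ltr0Sn _ 1)); rewrite in_itv/= => /andP[r0 re].
  have H i : exists q : rat, `|p t 0 i - ratr q| < ratr r :> R.
    have [|q] := @rat_in_itvoo R (p t 0 i - ratr r) (p t 0 i + ratr r).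
      by rewrite ltrD2l gtrN.
    by rewrite in_itv/= => /andP[q1 q2]; exists q; rewrite ltr_distlC q1 q2.
  have [a Ha] := choice H.
  exists (\row_i a i, r) => /=; last by move=> i; rewrite mxE.
  move=> x Bx; apply: He; split => // i j; rewrite (ord1 i) /ball/=.
  have := Bx j; rewrite /= mxE => Bj; have := Ha j => Hj.
  rewrite (_ : _ - _ = (p t 0 j - ratr (a j)) - (x 0 j - ratr (a j))); last by ring.
  rewrite (le_lt_trans (ler_normB _ _))// (splitr e) ltrD// (lt_trans _ re)//.
rewrite bigcup_mkcond; apply: countable_bigcupT_measurable; first exact: countableP.
move=> a; case: ifP => // _.
rewrite (_ : p @^-1` B a = \bigcap_(i in [set: 'I_3])
   ((fun t => p t 0 i) @^-1` `]ratr (a.1 0 i) - ratr a.2, ratr (a.1 0 i) + ratr a.2[)); last first.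
  apply/seteqP; split => [t Bt i _ /=|t Bt i].
    by have := Bt i; rewrite in_itv/= ltr_distl.
  by have := Bt i I; rewrite /= in_itv/= ltr_distl.
apply: fin_bigcap_measurable => // i _.
by rewrite -[X in measurable X]setTI; exact: mp.
Qed.

Lemma measurable_continuous_on (O : set 'rV[R]_3) (f : 'rV[R]_3 -> R) : open O ->
  (forall x, O x -> {for x, continuous f}) -> measurable_fun (p @^-1` O) (f \o p).
Proof.
move=> oO cf; apply: (measurability _ (RGenOpens.measurableE R)).
move=> _ [_ [a [b ->] <-]].
rewrite (_ : _ `&` _ = p @^-1` (O `&` f @^-1` `]a, b[))//.
apply: measurable_preimage_open.
rewrite openE => x [Ox fx]; apply: filterI; first exact: open_nbhs_nbhs.
by apply: cf => //; apply: open_nbhs_nbhs; split => //; exact: interval_open.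
Qed.

Lemma measurable_continuous (f : 'rV[R]_3 -> R) :
  continuous f -> measurable_fun setT (f \o p).
Proof.
move=> cf; rewrite -(preimage_setT p); apply: measurable_continuous_on; first exact: openT.
by move=> x _; exact: cf.
Qed.

End measurability.

(** * Translation invariance of Lebesgue measure *)

Section translation.
Variable R : realType.
Local Notation mR := (measurableTypeR R).
Local Notation T3 := (mR * mR * mR)%type.

(** By uniqueness of Lebesgue measure it suffices to compare the two measures on half-open
    intervals. *)
Lemma lebesgue_translation (a : R) (X : set mR) : measurable X ->
  lebesgue_measure X = pushforward (@lebesgue_measure R) (fun x : mR => x + a : mR) X.
Proof.
have mf : measurable_fun [set: mR] (fun x : mR => x + a : mR).
  by apply: measurable_funD; [exact: measurable_id|exact: measurable_cst].
pose m := measure_function_pushforward__canonical__measure_function_Measure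
  (@lebesgue_measure R) mf.
move=> mX; rewrite (@lebesgue_measure_unique R m)// => _ [[b c] _ <-].
have -> : m `]b, c]%classic = lebesgue_measure (`](b - a), (c - a)]%classic : set R).
  congr (lebesgue_measure _).
  by apply/seteqP; split => x /=; rewrite !in_itv/= ltrBlDr lerBrDr.
by rewrite !lebesgue_measure_itv/= !lte_fin ltrD2r; case: ifP => // _; rewrite -!EFinB; congr EFin; ring.
Qed.

(** The two measures agree on rectangles, and the product measure is the only one with these
    values. *)
Lemma product_measure_pushforward d1 d2 (T1 : measurableType d1) (T2 : measurableType d2)
    (m1 : {sigma_finite_measure set T1 -> \bar R}) (m2 : {sigma_finite_measure set T2 -> \bar R})
    (f1 : T1 -> T1) (f2 : T2 -> T2) :
  measurable_fun setT f1 -> measurable_fun setT f2 ->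
  (forall X, measurable X -> m1 X = pushforward m1 f1 X) ->
  (forall X, measurable X -> m2 X = pushforward m2 f2 X) ->
  forall X, measurable X ->
    (m1 \x m2)%E X = pushforward (m1 \x m2)%E (fun p => (f1 p.1, f2 p.2)) X.
Proof.
move=> mf1 mf2 h1 h2.
have mf : measurable_fun setT (fun p : T1 * T2 => (f1 p.1, f2 p.2)).
  by apply: measurable_fun_pair; apply: measurableT_comp.
pose m := measure_function_pushforward__canonical__measure_function_Measure
  (m1 \x m2)%E mf.
move=> X mX; rewrite (@product_measure_unique _ _ _ _ _ m1 m2 m)// => A B mA mB.
have -> : m (A `*` B) = (m1 \x m2)%E ((f1 @^-1` A) `*` (f2 @^-1` B)) by [].
rewrite product_measure1E; last 2 first.
- by rewrite -[X in measurable X]setTI; exact: mf1.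
- by rewrite -[X in measurable X]setTI; exact: mf2.
by congr (_ * _)%E; [rewrite (h1 A mA)|rewrite (h2 B mB)].
Qed.

(** A name for the planar measure, so that it can carry a sigma-finite structure and serve as first
    factor when the product theorem is applied a second time. *)
Definition leb2 : set (mR * mR)%type -> \bar R :=
  (@lebesgue_measure R \x @lebesgue_measure R)%E.

HB.instance Definition _ := Measure.on leb2.

Let leb2_sigma_finite : sigma_finite setT leb2.
Proof.
have /sigma_finiteP[F [TF ndF Foo]] := sigma_finiteT (@lebesgue_measure R).
exists (fun n => F n `*` F n).
 rewrite -setXTT TF predeqE => -[x y]; split.
    move=> [/= [n _ Fnx] [k _ Gky]]; exists (maxn n k) => //; split.
    - by move: x Fnx; exact/subsetPset/ndF/leq_maxl.
    - by move: y Gky; exact/subsetPset/ndF/leq_maxr.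
  by move=> [n _ []/= ? ?]; split; exists n.
move=> k; have [? ?] := Foo k.
split; first exact: measurableX.
by rewrite /leb2 product_measure1E// lte_mul_pinfty// ge0_fin_numE.
Qed.

HB.instance Definition _ := Measure_isSigmaFinite.Build _ _ _ leb2 leb2_sigma_finite.

Definition shift3 (a : 'rV[R]_3) (p : T3) : T3 :=
  ((p.1.1 + a 0 0 : mR, p.1.2 + a 0 1 : mR), p.2 + a 0 2%:R : mR).

Lemma leb3_translation a (X : set T3) : measurable X ->
  leb3 R X = pushforward (leb3 R) (shift3 a) X.
Proof.
have mf b : measurable_fun [set: mR] (fun x : mR => x + b : mR).
  by apply: measurable_funD; [exact: measurable_id|exact: measurable_cst].
have h2 Y : measurable Y -> (@lebesgue_measure R \x @lebesgue_measure R)%E Y =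
    pushforward (@lebesgue_measure R \x @lebesgue_measure R)%E
      (fun p : mR * mR => (p.1 + a 0 0 : mR, p.2 + a 0 1 : mR)) Y.
  apply: (@product_measure_pushforward _ _ _ _ (@lebesgue_measure R)
    (@lebesgue_measure R) (fun p : mR => p + a 0 0 : mR)
    (fun p : mR => p + a 0 1 : mR)) => //; exact: lebesgue_translation.
move=> mX.
have := @product_measure_pushforward _ _ _ _ leb2
  (@lebesgue_measure R) (fun p : mR * mR => (p.1 + a 0 0 : mR, p.2 + a 0 1 : mR))
  (fun p : mR => p + a 0 2%:R : mR) _ _ h2 _ X mX; apply => //.
- by apply: measurable_fun_pair; exact: (measurableT_comp (mf _)).
- exact: lebesgue_translation.
Qed.

End translation.

(** * Integration on space *)

Section integral_on_space.
Variable R : realType.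
Local Notation mR := (measurableTypeR R).
Local Notation T3 := (mR * mR * mR)%type.
Local Notation V := 'rV[R]_3.
Implicit Types (f g : V -> R) (x a : V) (M : R).

Lemma vec3_0 (p : T3) : vec3 p 0 0 = p.1.1. Proof. by rewrite mxE. Qed.
Lemma vec3_1 (p : T3) : vec3 p 0 1 = p.1.2. Proof. by rewrite mxE. Qed.
Lemma vec3_2 (p : T3) : vec3 p 0 2%:R = p.2. Proof. by rewrite mxE. Qed.

Lemma vec3_shift a (p : T3) : vec3 (shift3 a p) = vec3 p + a.
Proof.
by apply/rowP; apply: forall3; rewrite !mxE.
Qed.

Lemma measurable_vec3 i : measurable_fun [set: T3] (fun p => vec3 p 0 i).
Proof.
move: i; apply: forall3.
- rewrite (_ : (fun _ => _) = (fst \o fst)); last by apply/funext => p; rewrite vec3_0.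
  exact: measurableT_comp.
- rewrite (_ : (fun _ => _) = (snd \o fst)); last by apply/funext => p; rewrite vec3_1.
  exact: measurableT_comp.
- by rewrite (_ : (fun _ => _) = snd)//; apply/funext => p; rewrite vec3_2.
Qed.

Lemma measurable_vec3_continuous f : continuous f ->
  measurable_fun [set: T3] (f \o @vec3 R).
Proof. exact: (measurable_continuous measurable_vec3). Qed.

Lemma measurable_vec3_open (O : set V) : open O -> measurable (@vec3 R @^-1` O : set T3).
Proof. exact: (measurable_preimage_open measurable_vec3). Qed.

Definition box M : set V := [set x | `|x| <= M].

Lemma box_vec3 M : 0 <= M -> @vec3 R @^-1` box M =
  ((`[- M, M] : set mR) `*` (`[- M, M] : set mR)) `*` (`[- M, M] : set mR).
Proof.
move=> M0; apply/seteqP; split => [p /= pM|p /=].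
  rewrite !in_itv/= -!ler_norml -vec3_0 -vec3_1 -vec3_2.
  by split => //; [split|]; apply: le_trans pM; exact: coord_le_norm.
rewrite !in_itv/= -!ler_norml -vec3_0 -vec3_1 -vec3_2 => -[[h0 h1] h2].
by apply: norm_leP => //; apply: forall3.
Qed.

Lemma measurable_box M : 0 <= M -> measurable (@vec3 R @^-1` box M : set T3).
Proof.
by move=> M0; rewrite box_vec3//; apply: measurableX => //; exact: measurableX.
Qed.

Lemma leb3_box M : 0 <= M -> leb3 R (@vec3 R @^-1` box M) = ((2 * M) ^+ 3)%:E.
Proof.
move=> M0; rewrite box_vec3// /leb3.
have h : lebesgue_measure (`[- M, M]%classic : set R) = (2 * M)%:E.
  rewrite lebesgue_measure_itv/= lte_fin -EFinB opprK.
  case: ltP => h; first by rewrite mulr_natl mulr2n.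
  have -> : M = 0 by lra.
  by rewrite mulr0.
have mI : measurable (`[- M, M]%classic : set mR) by [].
have e2 := @product_measure1E _ _ _ _ R (@lebesgue_measure R) (@lebesgue_measure R) _ _ mI mI.
have e3 := @product_measure1E _ _ _ _ R (@leb2 R) (@lebesgue_measure R) _ _ (measurableX mI mI) mI.
rewrite [LHS]e3 [X in (X * _)%E]e2.
transitivity ((2 * M)%:E * (2 * M)%:E * (2 * M)%:E)%E; first by rewrite -h.
by rewrite -!EFinM; congr EFin; ring.
Qed.

Definition I3 f : R := vol_integral setT f.

Definition vanish_out M f := forall x, M < `|x| -> f x = 0.
(** The potential theory below integrates functions of this class only, for which integrability is
    automatic. *)
Definition Cc f := continuous f /\ exists M, vanish_out M f.

Lemma Cc_radius f : Cc f -> exists2 M, 0 <= M & vanish_out M f.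
Proof.
move=> [_ [M fM]]; exists (`|M|) => // x Mx; apply: fM.
by rewrite (le_lt_trans (ler_norm _)).
Qed.

Lemma compact_box M : compact (box M).
Proof.
apply: bounded_closed_compact; first by exists M; split; rewrite ?num_real// => y My x /= /le_trans; apply; exact/ltW.
apply: (@preimage_closed _ _ (fun x : V => `|x|) [set r : R | r <= M]); last exact: closed_le.
by move=> x _; exact: norm_continuous.
Qed.

Lemma cont_bounded_box f M : continuous f -> exists2 B, 0 <= B & forall x, `|x| <= M -> `|f x| <= B.
Proof.
move=> cf.
have : compact ((Num.norm \o f) @` box M).
  apply: continuous_compact; last exact: compact_box.
  apply: continuous_subspaceT => x; apply: continuous_comp; first exact: cf.
  exact: norm_continuous.
move=> /compact_bounded[B [_ hB]].
exists (`|B| + 1); first by rewrite addr_ge0.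
move=> x xM; have /= := hB (`|B| + 1) _ `|f x|; rewrite normr_id; apply.
  by rewrite (le_lt_trans (ler_norm _))// ltrDl.
by exists x.
Qed.

Lemma Cc_bounded f : Cc f -> exists2 B, 0 <= B & forall x, `|f x| <= B.
Proof.
move=> cf; have [M M0 fM] := Cc_radius cf.
have [B B0 fB] := cont_bounded_box M cf.1; exists B => // x.
by have [/fB//|/fM ->] := leP `|x| M; rewrite normr0.
Qed.

Lemma integrable_indic_box M : 0 <= M ->
  (leb3 R).-integrable setT (EFin \o (\1_(@vec3 R @^-1` box M : set T3) : T3 -> R)).
Proof.
move=> M0; apply/integrableP; split.
  by apply/measurable_EFinP; apply: measurable_indic; exact: measurable_box.
rewrite (eq_integral (fun x : T3 => (\1_(@vec3 R @^-1` box M : set T3) x)%:E)); last first.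
  by move=> t _ /=; rewrite ger0_norm.
by rewrite integral_indic//; [rewrite setIT leb3_box// ltry|exact: measurable_box].
Qed.

Lemma integrable_bounded_vanish f M B : measurable_fun [set: T3] (f \o @vec3 R) ->
  vanish_out M f -> (forall x, `|f x| <= B) ->
  (leb3 R).-integrable setT (EFin \o (f \o @vec3 R)).
Proof.
move=> mf fM fB.
have M0 : 0 <= `|M| by [].
have := @le_integrable _ _ R (leb3 R) setT measurableT (EFin \o (f \o @vec3 R))
  (fun p => B%:E * (\1_(@vec3 R @^-1` box `|M|) p)%:E)%E; apply.
- exact/measurable_EFinP.
- move=> p _ /=; rewrite lee_fin indicE.
  have B0 : 0 <= B by apply: le_trans (fB 0).
  case: (boolP (p \in _)) => [_|]; first by rewrite mulr1 (ger0_norm B0).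
  rewrite notin_setE /= => /negP; rewrite -ltNge => h.
  by rewrite fM ?normr0// (le_lt_trans (ler_norm _)).
- by apply: integrableZl => //; exact: integrable_indic_box.
Qed.

Lemma Cc_integrable f : Cc f -> (leb3 R).-integrable setT (EFin \o (f \o @vec3 R)).
Proof.
move=> cf; have [M M0 fM] := Cc_radius cf; have [B B0 fB] := Cc_bounded cf.
apply: integrable_bounded_vanish fM fB.
by apply: measurable_vec3_continuous; case: cf.
Qed.

Lemma I3E f : I3 f = \int[leb3 R]_p (f \o @vec3 R) p.
Proof. by rewrite /I3 /vol_integral preimage_setT. Qed.

Lemma I3D f g : Cc f -> Cc g -> I3 (fun x => f x + g x) = I3 f + I3 g.
Proof. by move=> cf cg; rewrite !I3E -RintegralD//; exact: Cc_integrable. Qed.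

Lemma I3B f g : Cc f -> Cc g -> I3 (fun x => f x - g x) = I3 f - I3 g.
Proof. by move=> cf cg; rewrite !I3E -RintegralB//; exact: Cc_integrable. Qed.

Lemma I3Z c f : Cc f -> I3 (fun x => c * f x) = c * I3 f.
Proof. by move=> cf; rewrite !I3E -RintegralZl//; exact: Cc_integrable. Qed.

Lemma I3_0 : I3 (fun=> 0) = 0.
Proof. by rewrite I3E Rintegral_cst// mul0r. Qed.

Lemma I3N f : Cc f -> I3 (fun x => - f x) = - I3 f.
Proof.
move=> cf; rewrite -mulN1r -I3Z//; congr I3; apply/funext => x; by rewrite mulN1r.
Qed.

Lemma le_I3 f g : Cc f -> Cc g -> (forall x, f x <= g x) -> I3 f <= I3 g.
Proof.
move=> cf cg fg; rewrite !I3E; apply: le_Rintegral => //.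
- exact: Cc_integrable.
- exact: Cc_integrable.
- by move=> p _; exact: fg.
Qed.

Lemma I3_ge0 f : (forall x, 0 <= f x) -> 0 <= I3 f.
Proof. by move=> f0; rewrite I3E; apply: Rintegral_ge0 => p _; exact: f0. Qed.

Lemma I3_bound f M B : 0 <= M -> continuous f -> vanish_out M f ->
  (forall x, `|f x| <= B) -> `|I3 f| <= B * (2 * M) ^+ 3.
Proof.
move=> M0 cf fM fB; rewrite I3E.
have B0 : 0 <= B by apply: le_trans (fB 0).
have If : (leb3 R).-integrable setT (EFin \o (f \o @vec3 R)).
  by apply: Cc_integrable; split => //; exists M.
apply: le_trans (le_normr_Rintegral _ If) _ => //.
have iZ := integrable_indic_box M0.
have -> : B * (2 * M) ^+ 3 = \int[leb3 R]_p (B * (\1_(@vec3 R @^-1` box M : set T3) p)).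
  rewrite RintegralZl// /Rintegral integral_indic//; last exact: measurable_box.
  by rewrite setIT leb3_box.
apply: le_Rintegral => //.
- rewrite (_ : _ \o _ = abse \o (EFin \o (f \o @vec3 R)))//; exact: integrable_abse.
- rewrite (_ : EFin \o _ = (fun p => B%:E * (EFin \o (\1_(@vec3 R @^-1` box M : set T3) : T3 -> R)) p)%E).
    exact: integrableZl.
  by apply/funext => p /=; rewrite EFinM.
- move=> p _; rewrite indicE; case: (boolP (p \in _)) => [_|]; first by rewrite mulr1; exact: fB.
  rewrite notin_setE /= => /negP; rewrite -ltNge => h.
  by rewrite fM ?normr0// mulr0.
Qed.

Lemma I3_translation f a : Cc f -> I3 (fun x => f (x + a)) = I3 f.
Proof.
move=> cf; rewrite !I3E.
have mf : measurable_fun [set: T3] (shift3 a : T3 -> T3).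
  have mf b : measurable_fun [set: mR] (fun x : mR => x + b : mR).
    by apply: measurable_funD; [exact: measurable_id|exact: measurable_cst].
  apply: measurable_fun_pair; last exact: (measurableT_comp (mf _)).
  by apply: measurable_fun_pair; apply: (measurableT_comp (mf _)); exact: measurableT_comp.
rewrite /Rintegral; congr fine.
have mfE : measurable_fun [set: T3] (EFin \o (f \o @vec3 R)).
  by have /integrableP[] := Cc_integrable cf.
rewrite -[RHS](@eq_measure_integral _ _ _ setT _
  (measure_function_pushforward__canonical__measure_function_Measure (leb3 R) mf)); last first.
  by move=> A mA _; rewrite (leb3_translation a).
rewrite integral_pushforward//.
  by rewrite preimage_setT; apply: eq_integral => p _ /=; rewrite vec3_shift.
rewrite preimage_setT.
rewrite (_ : _ \o _ = EFin \o ((fun x => f (x + a)) \o @vec3 R)); last first.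
  by apply/funext => p /=; rewrite vec3_shift.
apply: Cc_integrable; split.
  move=> x; apply: (@continuous_comp _ _ _ (fun x => x + a) f); last exact: cf.1.
  exact: shift_cont.
have [M M0 fM] := Cc_radius cf; exists (M + `|a|) => x; rewrite -ltrBDr => h.
by apply: fM; rewrite (lt_le_trans h)// lerB_normD.
Qed.

End integral_on_space.

(** * Differentiation *)

Section pointwise_derivative.
Variables (R : realType) (V : normedModType R).
Implicit Types (f g : V -> R) (x v : V) (h : R -> R).

(** Both difference quotients are the same function of h; directional derivatives are thereby
    reduced to one real variable. *)
Lemma is_derive_line f v x (t a : R) :
  is_derive (t *: v + x) v f a <-> is_derive t (1 : R) (fun s : R => f (s *: v + x)) a.
Proof.
have E : (fun h : R => h^-1 *: ((f \o shift (t *: v + x)) (h *: v) - f (t *: v + x))) =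
  (fun h : R => h^-1 *: (((fun s : R => f (s *: v + x)) \o shift t) (h *: 1) - f (t *: v + x))).
  apply/funext => h /=; congr (_ *: (f _ - _)).
  by rewrite -[h%:A]/(h * 1) mulr1 scalerDl addrA.
split => -[d1 d2]; split.
- by rewrite /derivable -E.
- by rewrite /derive -E.
- by rewrite /derivable E.
- by rewrite /derive E.
Qed.

Lemma is_derive_line0 f v x (a : R) :
  is_derive x v f a <-> is_derive (0 : R) (1 : R) (fun s : R => f (s *: v + x)) a.
Proof. by rewrite -is_derive_line scale0r add0r. Qed.

Lemma dD f g x v a b : is_derive x v f a -> is_derive x v g b ->
  is_derive x v (fun y => f y + g y) (a + b).
Proof. by move=> ? ?; exact: is_deriveD. Qed.

Lemma dB f g x v a b : is_derive x v f a -> is_derive x v g b ->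
  is_derive x v (fun y => f y - g y) (a - b).
Proof. by move=> ? ?; exact: is_deriveB. Qed.

Lemma dM f g x v a b : is_derive x v f a -> is_derive x v g b ->
  is_derive x v (fun y => f y * g y) (a * g x + f x * b).
Proof.
move=> fa gb; apply: is_derive_eq (is_deriveM fa gb) _.
by rewrite /GRing.scale /= addrC mulrC.
Qed.

Lemma dC (c : R) x v : is_derive x v (fun _ : V => c) 0.
Proof. exact: is_derive_cst. Qed.

Lemma dZ (c : R) f x v a : is_derive x v f a -> is_derive x v (fun y => c * f y) (c * a).
Proof. by move=> fa; apply: is_derive_eq (dM (dC c x v) fa) _; rewrite mul0r add0r. Qed.

Lemma dchain f h x v a b : is_derive (f x) 1 h b -> is_derive x v f a ->
  is_derive x v (fun y => h (f y)) (b * a).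
Proof.
move=> hb /is_derive_line0 fa; apply/is_derive_line0.
by apply: is_derive1_comp; rewrite ?scale0r ?add0r.
Qed.

Lemma dV f x v a : f x != 0 -> is_derive x v f a ->
  is_derive x v (fun y => (f y)^-1) (- a / f x ^+ 2).
Proof.
move=> f0 fa; apply/is_derive_line0; move/is_derive_line0 in fa.
apply: is_derive_eq (is_deriveV _ fa) _; first by rewrite scale0r add0r.
by rewrite /= scale0r add0r /GRing.scale /= mulNr mulrC mulNr.
Qed.

Lemma d_sum (I : Type) (s : seq I) (P : pred I) (F : I -> V -> R) (a : I -> R) x v :
  (forall i, is_derive x v (F i) (a i)) ->
  is_derive x v (fun y => \sum_(i <- s | P i) F i y) (\sum_(i <- s | P i) a i).
Proof.
move=> h; elim: s => [|i s IH].
  rewrite big_nil (_ : (fun y => _) = fun=> 0); first exact: dC.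
  by apply/funext => y; rewrite big_nil.
rewrite big_cons; have [Pi|Pi] := boolP (P i).
  rewrite (_ : (fun y => _) = fun y => F i y + \sum_(j <- s | P j) F j y); first exact: dD.
  by apply/funext => y; rewrite big_cons Pi.
rewrite (_ : (fun y => _) = fun y => \sum_(j <- s | P j) F j y)//.
by apply/funext => y; rewrite big_cons (negbTE Pi).
Qed.

Lemma d_near f g x v a : {near x, f =1 g} -> is_derive x v f a -> is_derive x v g a.
Proof.
move=> fg [df ef]; split; first exact: near_eq_derivable df.
by rewrite -ef; apply: near_eq_derive; apply: filterS fg => y ->.
Qed.

Lemma d_exp f x v a n : is_derive x v f a ->
  is_derive x v (fun y => f y ^+ n) (n%:R * f x ^+ n.-1 * a).
Proof.
move=> fa; elim: n => [|n IH].
  by rewrite !mul0r; exact: dC.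
rewrite (_ : (fun y => _) = fun y => f y * f y ^+ n); last by apply/funext => y; rewrite exprS.
apply: is_derive_eq (dM fa IH) _ => /=.
case: n {IH} => [|n]; first by rewrite !expr0 !mul0r mulr0 addr0; ring.
by rewrite exprS -[in RHS]natr1; ring.
Qed.

Lemma is_derive_unique f x v a b : is_derive x v f a -> is_derive x v f b -> a = b.
Proof. by move=> [_ <-] [_ <-]. Qed.

End pointwise_derivative.

Section MVT_bound.
Variable R : realType.
Implicit Types (f df : R -> R) (x : R).

Lemma deriv_continuous f (x a : R) : is_derive x 1 f a -> {for x, continuous f}.
Proof. by move=> [d _]; apply: differentiable_continuous; apply/derivable1_diffP. Qed.

Lemma MVT_le f df (a b K : R) : a <= b ->
  (forall x, a <= x <= b -> is_derive x 1 f (df x)) ->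
  (forall x, a <= x <= b -> `|df x| <= K) -> `|f b - f a| <= K * (b - a).
Proof.
move=> ab d1 d2.
have [|x|c] := @MVT_segment R f df a b ab.
- move=> x; rewrite in_itv/= => /andP[ax xb]; apply: d1; by rewrite !ltW.
- apply: derivable_within_continuous => y; rewrite in_itv/= => yab.
  by have [] := d1 _ yab.
- rewrite in_itv/= => cab ->; rewrite normrM (ger0_norm (_ : 0 <= b - a)) ?subr_ge0//.
  by rewrite ler_wpM2r ?subr_ge0// d2.
Qed.

Lemma MVT_abs f df (s K : R) :
  (forall x, `|x| <= `|s| -> is_derive x 1 f (df x)) ->
  (forall x, `|x| <= `|s| -> `|df x| <= K) -> `|f s - f 0| <= K * `|s|.
Proof.
move=> d1 d2; have [s0|s0] := leP 0 s.
  rewrite (ger0_norm s0) in d1 d2 *; rewrite -[X in _ * X]subr0.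
  by apply: (@MVT_le f df) => // x /andP[x0 xs]; [apply: d1|apply: d2]; rewrite ger0_norm.
have nse : `|s| = - s by rewrite ltr0_norm.
rewrite nse in d1 d2 *; rewrite distrC -[- s]add0r.
apply: (@MVT_le f df) => [|x /andP[sx x0]|x /andP[sx x0]]; first exact: ltW.
  by apply: d1; rewrite ler0_norm// lerN2.
by apply: d2; rewrite ler0_norm// lerN2.
Qed.

End MVT_bound.

(** * Functions of class C^n *)

Section smoothness_classes.
Variable R : realType.
Local Notation V := 'rV[R]_3.
Local Notation e_ i := (delta_mx 0 i : V).
Implicit Types (f g : V -> R) (x : V) (O : set V) (n : nat) (i : 'I_3).

Lemma pd_is_derive f x i a : is_derive x (e_ i) f a -> pd i f x = a.
Proof. by case. Qed.

Lemma Ck_cont n O f x : Ck n O f -> O x -> {for x, continuous f}.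
Proof. by case: n => [|n] [h _]; exact: h. Qed.

Lemma Ck_is_derive n O f x i : Ck n.+1 O f -> O x -> is_derive x (e_ i) f (pd i f x).
Proof. by move=> [_ /(_ i)[h _]] /h ?; exact/derivableP. Qed.

Lemma Ck_pd n O f i : Ck n.+1 O f -> Ck n O (pd i f).
Proof. by move=> [_ /(_ i)[]]. Qed.

Lemma Ck_intro n O f (df : 'I_3 -> V -> R) : (forall x, O x -> {for x, continuous f}) ->
  (forall i x, O x -> is_derive x (e_ i) f (df i x)) ->
  (forall i, Ck n O (pd i f)) -> Ck n.+1 O f.
Proof.
move=> cf df1 cdf; split => // i; split => // x Ox.
by have [] := df1 i x Ox.
Qed.

Lemma Ck_sub n O O' f : O' `<=` O -> Ck n O f -> Ck n O' f.
Proof.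
move=> O'O; elim: n f => [|n IH] f [cf h].
  by split => // x /O'O/cf.
split => [x /O'O/cf//|i]; have [h1 h2] := h i; split => [x /O'O/h1//|].
exact: IH.
Qed.

Lemma Ck_leq n m O f : (n <= m)%N -> Ck m O f -> Ck n O f.
Proof.
elim: n m f => [|n IH] [|m] f //; first by move=> _ [].
rewrite ltnS => nm [cf h]; split => // i; have [h1 h2] := h i; split => //.
exact: IH h2.
Qed.

Lemma Ck_eq n O f g : open O -> (forall x, O x -> f x = g x) -> Ck n O f -> Ck n O g.
Proof.
move=> oO; have near_eq (f1 g1 : V -> R) x : (forall x, O x -> f1 x = g1 x) -> O x -> {near x, f1 =1 g1}.
  by move=> fg Ox; apply: filterS (open_nbhs_nbhs (conj oO Ox)) => y; exact: fg.
have cont_eq (f1 g1 : V -> R) : (forall x, O x -> f1 x = g1 x) ->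
    (forall x, O x -> {for x, continuous f1}) -> (forall x, O x -> {for x, continuous g1}).
  move=> fg cf x Ox; rewrite /prop_for /continuous_at -(fg x Ox).
  apply: cvg_trans (cf x Ox).
  exact: (@near_eq_cvg _ _ (nbhs x) _ f1 g1 (near_eq _ _ x fg Ox)).
elim: n f g => [|n IH] f g fg [cf h]; first by split => //; exact: (cont_eq f).
split; first exact: (cont_eq f).
move=> i; have [h1 h2] := h i; split.
  by move=> x Ox; apply: near_eq_derivable (h1 x Ox); exact: near_eq.
apply: IH h2 => x Ox; apply: near_eq_derive.
by apply: filterS (near_eq _ _ x fg Ox) => y ->.
Qed.

Lemma CkD n O f g : open O -> Ck n O f -> Ck n O g -> Ck n O (fun x => f x + g x).
Proof.
move=> oO; elim: n f g => [|n IH] f g cf cg.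
  by split => // x Ox; apply: contD; [exact: (Ck_cont cf)|exact: (Ck_cont cg)].
have d i x : O x -> is_derive x (e_ i) (fun y => f y + g y) (pd i f x + pd i g x).
  by move=> Ox; apply: dD; [exact: (Ck_is_derive i cf)|exact: (Ck_is_derive i cg)].
apply: (Ck_intro _ d) => [x Ox|i].
  by apply: contD; [exact: (Ck_cont cf)|exact: (Ck_cont cg)].
apply: Ck_eq (IH _ _ (Ck_pd i cf) (Ck_pd i cg)) => // x Ox.
by apply/esym/pd_is_derive; exact: d.
Qed.

Lemma CkM n O f g : open O -> Ck n O f -> Ck n O g -> Ck n O (fun x => f x * g x).
Proof.
move=> oO; elim: n f g => [|n IH] f g cf cg.
  by split => // x Ox; apply: contM; [exact: (Ck_cont cf)|exact: (Ck_cont cg)].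
have d i x : O x -> is_derive x (e_ i) (fun y => f y * g y) (pd i f x * g x + f x * pd i g x).
  by move=> Ox; apply: dM; [exact: (Ck_is_derive i cf)|exact: (Ck_is_derive i cg)].
apply: (Ck_intro _ d) => [x Ox|i].
  by apply: contM; [exact: (Ck_cont cf)|exact: (Ck_cont cg)].
apply: Ck_eq (CkD _ (IH _ _ (Ck_pd i cf) (Ck_leq (leqnSn n) cg)) (IH _ _ (Ck_leq (leqnSn n) cf) (Ck_pd i cg))) => // x Ox.
by apply/esym/pd_is_derive; exact: d.
Qed.

Lemma Ck_cst n O (c : R) : open O -> Ck n O (fun=> c).
Proof.
move=> oO; elim: n c => [|n IH] c; first by split => // x Ox; exact: contC.
have d i x : O x -> is_derive x (e_ i) (fun=> c) 0 by move=> _; exact: dC.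
apply: (Ck_intro _ d) => [x Ox|i]; first exact: contC.
by apply: Ck_eq (IH 0) => // x Ox; apply/esym/pd_is_derive; exact: d.
Qed.

Lemma CkZ n O (c : R) f : open O -> Ck n O f -> Ck n O (fun x => c * f x).
Proof. by move=> oO cf; apply: CkM => //; exact: Ck_cst. Qed.

Lemma CkB n O f g : open O -> Ck n O f -> Ck n O g -> Ck n O (fun x => f x - g x).
Proof.
move=> oO cf cg; apply: (@Ck_eq _ _ (fun x => f x + -1 * g x)) => // [x _|].
  by rewrite mulN1r.
by apply: CkD => //; exact: CkZ.
Qed.

Lemma d_coord j x v : is_derive x v (fun y : V => y 0 j) (v 0 j).
Proof.
apply/is_derive_line0.
rewrite (_ : (fun s => _) = (fun s => s * v 0 j + x 0 j)); last by apply/funext => s; rewrite !mxE.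
apply: is_derive_eq (dD (dM (is_derive_id _ _) (dC _ _ _)) (dC _ _ _)) _.
by rewrite mulr0 !addr0 mul1r.
Qed.

Lemma Ck_coord n O j : open O -> Ck n O (fun y : V => y 0 j).
Proof.
move=> oO; case: n => [|n]; first by split => // x _; exact: coord_cont.
have d i x : O x -> is_derive x (e_ i) (fun y : V => y 0 j) ((e_ i) 0 j).
  by move=> _; exact: d_coord.
apply: (Ck_intro _ d) => [x Ox|i]; first exact: coord_cont.
by apply: Ck_eq (Ck_cst n ((e_ i) 0 j) oO) => // x Ox; apply/esym/pd_is_derive; exact: d.
Qed.

Lemma Ck_sum n O (I : Type) (s : seq I) (F : I -> V -> R) : open O ->
  (forall j : I, Ck n O (F j)) -> Ck n O (fun y => \sum_(j <- s) F j y).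
Proof.
move=> oO h; elim: s => [|j s IH].
  by apply: Ck_eq (Ck_cst n 0 oO) => // x _; rewrite big_nil.
by apply: Ck_eq (CkD oO (h j) IH) => // x _; rewrite big_cons.
Qed.

Lemma Ck_prod n O (I : Type) (s : seq I) (F : I -> V -> R) : open O ->
  (forall j : I, Ck n O (F j)) -> Ck n O (fun y => \prod_(j <- s) F j y).
Proof.
move=> oO h; elim: s => [|j s IH].
  by apply: Ck_eq (Ck_cst n 1 oO) => // x _; rewrite big_nil.
by apply: Ck_eq (CkM oO (h j) IH) => // x _; rewrite big_cons.
Qed.

(** Class C^n in one variable, with the derivative supplied as a witness and prescribed on [A] only:
    the radial profiles are smooth for q > 0 and arbitrary elsewhere. *)
Fixpoint Dn n (A : set R) (h : R -> R) : Prop :=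
  (forall t, A t -> {for t, continuous h}) /\
  if n is n'.+1 then exists2 h', (forall t : R, A t -> is_derive t 1 h (h' t)) & Dn n' A h'
  else True.

Lemma Ck_comp n O A (h : R -> R) f : open O -> (forall x, O x -> A (f x)) ->
  Dn n A h -> Ck n O f -> Ck n O (fun x => h (f x)).
Proof.
move=> oO OA; elim: n h => [|n IH] h [ch hh] cf.
  split => // x Ox; apply: contcomp; first exact: (Ck_cont cf).
  by apply: ch; exact: OA.
move: hh => [h' dh Dh'].
have d i x : O x -> is_derive x (e_ i) (fun y => h (f y)) (h' (f x) * pd i f x).
  by move=> Ox; apply: dchain; [apply: dh; exact: OA|exact: (Ck_is_derive i cf)].
apply: (Ck_intro _ d) => [x Ox|i].
  by apply: contcomp; [exact: (Ck_cont cf)|apply: ch; exact: OA].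
apply: Ck_eq (CkM oO (IH _ Dh' (Ck_leq (leqnSn n) cf)) (Ck_pd i cf)) => // x Ox.
by apply/esym/pd_is_derive; exact: d.
Qed.

End smoothness_classes.

(** * Continuous functions with compact support *)

Section compact_support.
Variable R : realType.
Local Notation V := 'rV[R]_3.
Local Notation e_ i := (delta_mx 0 i : V).
Implicit Types (f g psi : V -> R) (x : V) (O : set V) (n : nat) (i : 'I_3).

Lemma cont_ball f x (e : R) : {for x, continuous f} -> 0 < e ->
  exists2 d : R, 0 < d & forall y, `|y - x| < d -> `|f y - f x| < e.
Proof.
move=> cf e0; move/cvgrPdist_lt : (cf) => /(_ e e0) /nbhs_ballP[d /= d0 hd].
exists d => // y yx; rewrite distrC; apply: hd.
by rewrite -ball_normE /= distrC.
Qed.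

(** Heine's theorem with only one of the two points in [K], valid because [f] is continuous at the
    points of [K] as a function on the whole space. *)
Lemma compact_unif_cont f (K : set V) (e : R) : compact K ->
  (forall x, K x -> {for x, continuous f}) -> 0 < e ->
  exists2 d : R, 0 < d & forall x y, K x -> `|y - x| < d -> `|f y - f x| < e.
Proof.
move=> cK cf e0.
pose P (d : R) x := forall y, `|y - x| < d -> `|f y - f x| < e.
(* Compactness as a near-covering property: what holds around each point of [K] for all small d
   holds on all of [K] for all small d. *)
have H : \forall d \near (0 : R)^'+, K `<=` P d.
  apply: (compact_near_coveringP K).1 => // x Kx.
  have [d d0 hd] := cont_ball (cf x Kx) (divr_gt0 e0 (ltr0Sn _ 1)).
  exists (ball x (d / 2), [set t | t < d / 2]) => /=.
    split; first by apply: nbhsx_ballx; rewrite divr_gt0.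
    by apply: nbhs_right_lt; rewrite divr_gt0.
  move=> [x' t] /= []; rewrite -ball_normE /= => xx' td y yx'.
  rewrite (_ : _ - _ = (f y - f x) - (f x' - f x)); last by ring.
  rewrite (le_lt_trans (ler_normB _ _))// (splitr e) ltrD//.
    apply: hd; rewrite (_ : y - x = (y - x') + (x' - x)); last by rewrite addrA subrK.
    have h1 : `|y - x'| < d / 2 by exact: lt_trans td.
    have h2 : `|x' - x| < d / 2 by rewrite distrC.
    by rewrite (le_lt_trans (ler_normD _ _))// [ltRHS](splitr d) ltrD.
  apply: hd; rewrite distrC; apply: lt_trans xx' _.
  by rewrite ltr_pdivrMr// ltr_pMr// ltr1n.
have [d [d0 hd]] := filter_ex (filterI (nbhs_right_gt (0 : R)) H).
by exists d => // x y Kx; exact: hd.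
Qed.

Lemma Cc_unif f (e : R) : Cc f -> 0 < e ->
  exists2 d : R, 0 < d & forall x y, `|y - x| < d -> `|f y - f x| < e.
Proof.
move=> cf e0; have [M M0 fM] := Cc_radius cf.
have [d d0 hd] := compact_unif_cont (@compact_box R (M + 1)) (fun x _ => cf.1 x) e0.
exists (Num.min d 1); first by rewrite lt_min d0 ltr01.
move=> x y; rewrite lt_min => /andP[yd y1].
have [xM|xM] := leP `|x| (M + 1); first exact: hd.
rewrite !fM ?subrr ?normr0// ?(lt_trans _ xM) ?ltrDl//.
have := ler_distD y x 0; rewrite !subr0 distrC => h.
by rewrite -(ltrD2r 1) (lt_le_trans xM)// (le_trans h)// addrC lerD2l ltW.
Qed.

Lemma CcM f g : continuous g -> Cc f -> Cc (fun x => g x * f x).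
Proof.
move=> cg [cf [M fM]]; split; first by move=> x; apply: contM; [exact: cg|exact: cf].
by exists M => x /fM ->; rewrite mulr0.
Qed.

Lemma CcD f g : Cc f -> Cc g -> Cc (fun x => f x + g x).
Proof.
move=> cf cg; have [M M0 fM] := Cc_radius cf; have [N N0 gN] := Cc_radius cg.
split; first by move=> x; apply: contD; [exact: cf.1|exact: cg.1].
by exists (Num.max M N) => x; rewrite gt_max => /andP[/fM -> /gN ->]; rewrite addr0.
Qed.

Lemma CcZ (c : R) f : Cc f -> Cc (fun x => c * f x).
Proof. by move=> cf; apply: (@CcM f (fun=> c)) => //; exact: cst_continuous. Qed.

Lemma CcN f : Cc f -> Cc (fun x => - f x).
Proof.
by move=> /(CcZ (-1)); congr Cc; apply/funext => x; rewrite mulN1r.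
Qed.

Lemma CcB f g : Cc f -> Cc g -> Cc (fun x => f x - g x).
Proof. by move=> cf cg; exact: CcD (CcN cg). Qed.

Lemma Cc0 : Cc (fun _ : V => 0).
Proof. by split; [exact: cst_continuous|exists 0]. Qed.

Lemma Cc_sum (I : Type) (s : seq I) (F : I -> V -> R) : (forall j, Cc (F j)) ->
  Cc (fun x => \sum_(j <- s) F j x).
Proof.
move=> h; elim: s => [|j s IH].
  by rewrite (_ : (fun x => _) = fun=> 0); [exact: Cc0|apply/funext => x; rewrite big_nil].
rewrite (_ : (fun x => _) = fun x => F j x + \sum_(j <- s) F j x); first exact: CcD.
by apply/funext => x; rewrite big_cons.
Qed.

Lemma I3_sum (I : Type) (s : seq I) (F : I -> V -> R) : (forall j, Cc (F j)) ->
  I3 (fun x => \sum_(j <- s) F j x) = \sum_(j <- s) I3 (F j).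
Proof.
move=> h; elim: s => [|j s IH].
  rewrite big_nil (_ : (fun x => _) = fun=> 0); first exact: I3_0.
  by apply/funext => x; rewrite big_nil.
rewrite big_cons (_ : (fun x => _) = fun x => F j x + \sum_(j <- s) F j x); last first.
  by apply/funext => x; rewrite big_cons.
by rewrite I3D ?IH//; exact: Cc_sum.
Qed.

Lemma le_norm_I3 f g : Cc f -> Cc g -> (forall x, `|f x| <= g x) -> `|I3 f| <= I3 g.
Proof.
move=> cf cg fg; rewrite ler_norml; apply/andP; split.
  rewrite -I3N//; apply: le_I3 => // [|x]; first exact: CcN.
  by have := fg x; rewrite ler_norml => /andP[].
by apply: le_I3 => // x; have := fg x; rewrite ler_norml => /andP[].
Qed.

Lemma Cc_shift f a : Cc f -> Cc (fun x => f (x + a)).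
Proof.
move=> cf; split.
  by move=> x; apply: (@continuous_comp _ _ _ (fun x => x + a) f);
    [exact: shift_cont|exact: cf.1].
have [M M0 fM] := Cc_radius cf; exists (M + `|a|) => x; rewrite -ltrBDr => h.
by apply: fM; rewrite (lt_le_trans h)// lerB_normD.
Qed.

Lemma open_norm_gt M : open [set x : V | M < `|x|].
Proof.
apply: (@open_comp _ _ (fun x : V => `|x|) [set t | M < t]); last exact: open_gt.
by move=> x _; exact: norm_continuous.
Qed.

Lemma near0_is_derive f x v : (\near x, f x = 0) -> is_derive x v f 0.
Proof.
move=> h; apply: d_near (dC 0 x v); by apply: filterS h => y ->.
Qed.

Lemma vanish_out_pd M f i : vanish_out M f -> vanish_out M (pd i f).
Proof.
move=> fM x Mx; apply: pd_is_derive; apply: near0_is_derive.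
by apply: filterS (open_nbhs_nbhs (conj (@open_norm_gt M) Mx)) => y; exact: fM.
Qed.

Lemma norm_e i : `|e_ i| <= 1.
Proof.
by apply: norm_leP => // j; rewrite delta_coord; case: eqP; rewrite /= ?normr1 ?normr0.
Qed.

(** The difference quotients have integral 0 by translation invariance and converge uniformly to the
    derivative on a fixed box; this replaces an iterated integral. *)
Lemma I3_pd0 f i : Cc f -> (forall x, is_derive x (e_ i) f (pd i f x)) ->
  continuous (pd i f) -> I3 (pd i f) = 0.
Proof.
move=> cf df cdf; have [M M0 fM] := Cc_radius cf.
have cpf : Cc (pd i f) by split => //; exists M; exact: vanish_out_pd.
apply/eqP; rewrite -normr_le0; apply/ler_addgt0Pr => e e0; rewrite add0r.
(* The volume of a box that contains the support of [f] and of all its translates by h <= 1. *)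
pose C := (2 * (M + 1)) ^+ 3.
have C0 : 0 < C by rewrite exprn_gt0// mulr_gt0// ltr_wpDl.
have [d d0 hd] := Cc_unif cpf (divr_gt0 e0 C0).
pose h := Num.min (d / 2) 1.
have h0 : 0 < h by rewrite lt_min divr_gt0//= ltr01.
have h1 : h <= 1 by rewrite ge_min lexx orbT.
have hd2 : h < d.
  by rewrite (@le_lt_trans _ _ (d / 2))// ?ge_min ?lexx// ltr_pdivrMr// ltr_pMr// ltr1n.
pose F x := f (x + h *: e_ i).
have cF : Cc F by exact: Cc_shift.
pose G x := h^-1 * (F x - f x) - pd i f x.
have cG : Cc G by apply: CcB => //; apply: CcZ; exact: CcB.
have IG : I3 G = - I3 (pd i f).
  rewrite I3B//; last by apply: CcZ; exact: CcB.
  by rewrite I3Z ?I3B//; [rewrite I3_translation// subrr mulr0 sub0r|exact: CcB].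
rewrite -normrN -IG.
have -> : e = e / C * C by rewrite divfK// gt_eqF.
apply: I3_bound; first by rewrite addr_ge0.
- exact: cG.1.
- move=> x Mx; have Mx' : M < `|x| by rewrite (lt_trans _ Mx)// ltrDl.
  rewrite /G /F (fM x)// (vanish_out_pd i fM)// !subr0 fM ?mulr0//.
  rewrite (@lt_le_trans _ _ (`|x| - 1))// ?ltrBrDr//.
  apply: le_trans (lerB_normD _ _); rewrite lerD2l lerN2 normrZ (ger0_norm (ltW h0)).
  by rewrite (le_trans (ler_pM (ltW h0) _ h1 (norm_e i)))// mulr1.
- move=> x; rewrite /G /F.
  have H := @MVT_abs R (fun s : R => f (s *: e_ i + x) - s * pd i f x)
    (fun s => pd i f (s *: e_ i + x) - pd i f x) h (e / C) _ _.
  have {H} : `|f (h *: e_ i + x) - h * pd i f x - f x| <= e / C * h.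
    rewrite -[in X in _ <= X](ger0_norm (ltW h0)).
    have := H; rewrite scale0r add0r mul0r subr0; apply.
      move=> s _.
      have h2 : is_derive s (1 : R) (fun s : R => s * pd i f x) (pd i f x).
        apply: is_derive_eq (dM (is_derive_id s (1 : R)) (dC (pd i f x) s (1 : R))) _.
        by rewrite mul1r mulr0 addr0.
      have h3 : is_derive s (1 : R) (fun s : R => f (s *: e_ i + x)) (pd i f (s *: e_ i + x)).
        by rewrite -is_derive_line; exact: df.
      exact: dB h3 h2.
    move=> s sh; apply/ltW/hd; rewrite addrK normrZ.
    rewrite (le_lt_trans (ler_pM _ _ sh (norm_e i)))//.
    by rewrite mulr1 (ger0_norm (ltW h0)).
  rewrite -ler_pdivrMr// -[X in _ / X](ger0_norm (ltW h0)) -normf_div.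
  apply: le_trans; apply: le_of_eq; congr `|_|.
  by rewrite (addrC x) !mulrBl !mulrBr [h * _]mulrC mulfK ?gt_eqF//; ring.
Qed.

End compact_support.

(** * Integration by parts and Green's identity *)

Section green.
Variable R : realType.
Local Notation V := 'rV[R]_3.
Implicit Types (f g psi : V -> R) (x : V) (O : set V) (n : nat) (i : 'I_3).

(** Vanishing near every point off [O], and not merely at it: the product with a function that is
    smooth on [O] only is then smooth everywhere. *)
Definition near0_off O psi := forall x, ~ O x -> \near x, psi x = 0.

Lemma near0_off_pd O psi i : near0_off O psi -> near0_off O (pd i psi).
Proof.
move=> h x /h /nbhs_interior; apply: filterS => y hy.
by apply: pd_is_derive; exact: near0_is_derive.
Qed.

Lemma Ck_cut n O f psi : open O -> Ck n O f -> Ck n setT psi -> near0_off O psi ->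
  Ck n setT (fun x => f x * psi x).
Proof.
move=> oO cf cpsi h0.
have h1 x : O x \/ exists2 W, open W /\ W x & forall y, W y -> psi y = 0.
  have [?|/h0 nx] := pselect (O x); [by left|right].
  exists (interior [set y | psi y = 0]); last by move=> y /interior_subset.
  by split => //; exact: open_interior.
(* Smoothness is local: around each point the product is either a product of smooth functions or
   constantly 0. *)
have glue m g : (forall x, exists2 W, open W /\ W x & Ck m W g) -> Ck m setT g.
  clear; elim: m g => [|m IH] g H.
    by split => // x _; have [W [oW Wx] /Ck_cont] := H x; apply.
  split; first by move=> x _; have [W [oW Wx] /Ck_cont] := H x; apply.
  move=> i; split.
    by move=> x _; have [W [oW Wx] cW] := H x; have [] := Ck_is_derive i cW Wx.
  by apply: IH => x; have [W oW cW] := H x; exists W => //; exact: Ck_pd.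
apply: glue => x; have [Ox|[W [oW Wx] hW]] := h1 x.
  by exists O => //; apply: CkM => //; exact: Ck_sub cpsi.
exists W => //; apply: Ck_eq (Ck_cst n 0 oW) => // y /hW ->.
by rewrite mulr0.
Qed.

Lemma pd_cut O f psi i x : open O -> Ck 1 O f -> Ck 1 setT psi -> near0_off O psi ->
  pd i (fun x => f x * psi x) x = pd i f x * psi x + f x * pd i psi x.
Proof.
move=> oO cf cpsi h0; apply: pd_is_derive; have [Ox|/h0 nx] := pselect (O x).
  by apply: dM; [exact: (Ck_is_derive i cf)|exact: (Ck_is_derive i cpsi)].
have px : psi x = 0 by exact: nbhs_singleton nx.
have -> : pd i psi x = 0 by apply: pd_is_derive; exact: near0_is_derive.
rewrite px !mulr0 addr0; apply: near0_is_derive.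
by apply: filterS nx => y ->; rewrite mulr0.
Qed.

Lemma int_by_parts O f psi i M : open O -> Ck 1 O f -> Ck 1 setT psi ->
  near0_off O psi -> vanish_out M psi ->
  I3 (fun x => f x * pd i psi x) = - I3 (fun x => pd i f x * psi x).
Proof.
move=> oO cf cpsi h0 hM.
have cfp : Ck 1 setT (fun x => f x * psi x) by exact: (Ck_cut oO).
have Cc1 : Cc (fun x => f x * psi x).
  split; first by move=> x; exact: (Ck_cont cfp).
  by exists M => x /hM ->; rewrite mulr0.
have Cc2 : Cc (fun x => f x * pd i psi x).
  split.
    move=> x; apply: (@Ck_cont _ 0 setT) => //.
    by apply: (Ck_cut oO (Ck_leq _ cf)) => //; [exact: Ck_pd|exact: near0_off_pd].
  by exists M => x Mx; rewrite (vanish_out_pd i hM)// mulr0.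
have Cc3 : Cc (fun x => pd i f x * psi x).
  split.
    move=> x; apply: (@Ck_cont _ 0 setT) => //.
    exact: (Ck_cut oO (Ck_pd i cf) (Ck_leq (leqnSn 0) cpsi) h0).
  by exists M => x /hM ->; rewrite mulr0.
apply/eqP; rewrite -addr_eq0 -I3D//; apply/eqP.
rewrite -[RHS](@I3_pd0 _ (fun x => f x * psi x) i)//.
- by congr I3; apply/funext => x; rewrite (pd_cut _ _ oO)// addrC.
- by move=> x; exact: (Ck_is_derive i cfp).
- by move=> x; exact: (Ck_cont (Ck_pd i cfp)).
Qed.

Lemma green O f psi M : open O -> Ck 2 O f -> Ck 2 setT psi ->
  near0_off O psi -> vanish_out M psi ->
  I3 (fun x => f x * laplacian psi x) = I3 (fun x => laplacian f x * psi x).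
Proof.
move=> oO cf cpsi h0 hM.
have Ccf g h : Ck 0 O g -> Ck 0 setT h -> near0_off O h -> vanish_out M h ->
    Cc (fun x => g x * h x).
  move=> cg ch nh vh; split; first by move=> x; apply: (@Ck_cont _ 0 setT) => //; exact: (Ck_cut oO).
  by exists M => x /vh ->; rewrite mulr0.
have c1 i : Cc (fun x => f x * pd i (pd i psi) x).
  apply: Ccf; first exact: Ck_leq cf.
  - by do 2 apply: Ck_pd.
  - by do 2 apply: near0_off_pd.
  - by do 2 apply: vanish_out_pd.
have c2 i : Cc (fun x => pd i (pd i f) x * psi x).
  by apply: Ccf => //; [do 2 apply: Ck_pd|exact: Ck_leq cpsi].
transitivity (\sum_(i < 3) I3 (fun x => f x * pd i (pd i psi) x)).
  rewrite -I3_sum//; congr I3; apply/funext => x.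
  by rewrite /laplacian mulr_sumr.
transitivity (\sum_(i < 3) I3 (fun x => pd i (pd i f) x * psi x)); last first.
  by rewrite -I3_sum//; congr I3; apply/funext => x; rewrite /laplacian mulr_suml.
apply: eq_bigr => i _.
rewrite (@int_by_parts O f (pd i psi) i M)//; last 4 first.
- exact: Ck_leq cf.
- exact: Ck_pd.
- exact: near0_off_pd.
- exact: vanish_out_pd.
rewrite -[RHS]opprK -(@int_by_parts O (pd i f) psi i M)//; first exact: Ck_pd.
exact: Ck_leq cpsi.
Qed.

End green.

(** * Complex calculus *)

Section complex_numbers.
Variable R : realType.
Implicit Types (a b z : R[i]).
Local Notation Re := (@complex.Re R).
Local Notation Im := (@complex.Im R).

Lemma ReD a b : Re (a + b) = Re a + Re b. Proof. by case: a; case: b. Qed.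
Lemma ImD a b : Im (a + b) = Im a + Im b. Proof. by case: a; case: b. Qed.
Lemma ReN a : Re (- a) = - Re a. Proof. by case: a. Qed.
Lemma ReB a b : Re (a - b) = Re a - Re b. Proof. by case: a; case: b. Qed.
Lemma ImB a b : Im (a - b) = Im a - Im b. Proof. by case: a; case: b. Qed.
Lemma ReM a b : Re (a * b) = Re a * Re b - Im a * Im b. Proof. by case: a; case: b. Qed.
Lemma ImM a b : Im (a * b) = Re a * Im b + Im a * Re b.
Proof. by case: a; case: b. Qed.
Lemma ReZ (r : R) a : Re (r%:C * a) = r * Re a. Proof. by rewrite ReM mul0r subr0. Qed.
Lemma ImZ (r : R) a : Im (r%:C * a) = r * Im a. Proof. by rewrite ImM mul0r addr0. Qed.

Lemma complex_eq a b : Re a = Re b -> Im a = Im b -> a = b.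
Proof. by case: a; case: b => /= ? ? ? ? -> ->. Qed.

Lemma Re_sum (I : Type) (s : seq I) (P : pred I) (F : I -> R[i]) :
  Re (\sum_(i <- s | P i) F i) = \sum_(i <- s | P i) Re (F i).
Proof. by elim/big_rec2: _ => // i x y _ <-; rewrite ReD. Qed.

Lemma Im_sum (I : Type) (s : seq I) (P : pred I) (F : I -> R[i]) :
  Im (\sum_(i <- s | P i) F i) = \sum_(i <- s | P i) Im (F i).
Proof. by elim/big_rec2: _ => // i x y _ <-; rewrite ImD. Qed.

Lemma rcD (x y : R) : (x + y)%:C = x%:C + y%:C :> R[i].
Proof. exact: rmorphD. Qed.
Lemma rcN (x : R) : (- x)%:C = - x%:C :> R[i].
Proof. exact: rmorphN. Qed.
Lemma rcB (x y : R) : (x - y)%:C = x%:C - y%:C :> R[i].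
Proof. exact: rmorphB. Qed.
Lemma rcM (x y : R) : (x * y)%:C = x%:C * y%:C :> R[i].
Proof. exact: rmorphM. Qed.
Lemma rcV (x : R) : (x^-1)%:C = x%:C^-1 :> R[i].
Proof. exact: fmorphV. Qed.
Lemma rcX (x : R) n : (x ^+ n)%:C = x%:C ^+ n :> R[i].
Proof. exact: rmorphXn. Qed.
Lemma rc_nat n : (n%:R : R)%:C = n%:R :> R[i].
Proof. exact: rmorph_nat. Qed.
Lemma rc_neq0 (x : R) : x != 0 -> x%:C != 0 :> R[i].
Proof. by move=> x0; rewrite eq_complex /= (negbTE x0). Qed.

Lemma normcE2 z : normc z = Num.sqrt (Re z ^+ 2 + Im z ^+ 2). Proof. by case: z. Qed.

Lemma normc_ge0 z : 0 <= normc z.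
Proof. by rewrite normcE2 sqrtr_ge0. Qed.

Lemma normc_Re z : `|Re z| <= normc z.
Proof. by rewrite normcE2 -sqrtr_sqr ler_wsqrtr// lerDl sqr_ge0. Qed.

Lemma normc_Im z : `|Im z| <= normc z.
Proof. by rewrite normcE2 -sqrtr_sqr ler_wsqrtr// lerDr sqr_ge0. Qed.

Lemma normc_le_ReIm z : normc z <= `|Re z| + `|Im z|.
Proof.
rewrite -ler_sqr ?nnegrE ?addr_ge0 ?normc_ge0// normcE2 sqr_sqrtr ?addr_ge0 ?sqr_ge0//.
rewrite sqrrD !real_normK ?num_real// -subr_ge0.
rewrite (_ : _ - _ = 2 * (`|Re z| * `|Im z|)) ?mulr_ge0//; ring.
Qed.

Lemma normc_real (r : R) : normc r%:C = `|r|.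
Proof. by rewrite normcE2 /= expr0n/= addr0 sqrtr_sqr. Qed.

Lemma normcZ (r : R) z : normc (r%:C * z) = `|r| * normc z.
Proof. by rewrite normcM normc_real. Qed.

Lemma normcB a b : normc (a - b) = normc (b - a).
Proof. by rewrite -normcN opprB. Qed.

Lemma le_normcB a b : normc (a - b) <= normc a + normc b.
Proof. by rewrite (le_trans (le_normcD _ _))// normcN. Qed.

Lemma normc_triB a b : normc a - normc b <= normc (a - b).
Proof. by rewrite lerBlDr (le_trans _ (le_normcD _ _))// subrK. Qed.

Lemma le_normc_sum (I : Type) (s : seq I) (P : pred I) (F : I -> R[i]) :
  normc (\sum_(i <- s | P i) F i) <= \sum_(i <- s | P i) normc (F i).
Proof.
elim/big_rec2: _ => [|i x y _ h]; first by rewrite normc0.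
by rewrite (le_trans (le_normcD _ _))// lerD2l.
Qed.

Lemma normc_expi (t : R) : normc (expi t) = 1.
Proof. by rewrite normcE2 /= cos2Dsin2 sqrtr1. Qed.

Lemma normc_i : normc ('i : R[i]) = 1.
Proof. by rewrite normcE2 /= expr0n expr1n add0r sqrtr1. Qed.

Lemma normcX z n : normc (z ^+ n) = normc z ^+ n.
Proof. by elim: n => [|n IH]; rewrite ?expr0 ?normc1// !exprS normcM IH. Qed.

Lemma normc_gt0 z : z != 0 -> 0 < normc z.
Proof.
by move=> z0; rewrite lt_neqAle normc_ge0 andbT eq_sym; apply: contraNneq z0 => /eq0_normc ->.
Qed.

Lemma normc_conj z : normc z^* = normc z.
Proof. by case: z => x y; rewrite /= sqrrN. Qed.

Lemma expi0 : expi (0 : R) = 1. Proof. by rewrite /expi cos0 sin0. Qed.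

Lemma expiD (s t : R) : expi (s + t) = expi s * expi t.
Proof. by apply: complex_eq; rewrite ?ReM ?ImM /= ?cosD ?sinD//; ring. Qed.

Lemma expiNK (t : R) : expi t * expi (- t) = 1.
Proof. by rewrite -expiD subrr expi0. Qed.

End complex_numbers.

Section complex_calculus.
Variables (R : realType) (V : normedModType R).
Local Notation Re := (@complex.Re R).
Local Notation Im := (@complex.Im R).
Implicit Types (f g : V -> R[i]) (x v : V) (h : R -> R[i]) (a b : R[i]).

Definition cderive x v f a :=
  is_derive x v (reP f) (Re a) /\ is_derive x v (imP f) (Im a).

Lemma cderive_eq x v f a b : cderive x v f a -> a = b -> cderive x v f b.
Proof. by move=> h <-. Qed.

Lemma cdD x v f g a b : cderive x v f a -> cderive x v g b ->
  cderive x v (fun y => f y + g y) (a + b).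
Proof.
move=> [f1 f2] [g1 g2]; rewrite /cderive ReD ImD; split.
- rewrite (_ : reP _ = fun y => reP f y + reP g y); first exact: dD.
  by apply/funext => y; rewrite /reP ReD.
- rewrite (_ : imP _ = fun y => imP f y + imP g y); first exact: dD.
  by apply/funext => y; rewrite /imP ImD.
Qed.

Lemma cdM x v f g a b : cderive x v f a -> cderive x v g b ->
  cderive x v (fun y => f y * g y) (a * g x + f x * b).
Proof.
move=> [f1 f2] [g1 g2]; split.
- rewrite (_ : reP _ = fun y => reP f y * reP g y - imP f y * imP g y); last first.
    by apply/funext => y; rewrite /reP ReM.
  apply: is_derive_eq (dB (dM f1 g1) (dM f2 g2)) _.
  by rewrite ReD !ReM /reP /imP; ring.
- rewrite (_ : imP _ = fun y => reP f y * imP g y + imP f y * reP g y); last first.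
    by apply/funext => y; rewrite /imP ImM.
  apply: is_derive_eq (dD (dM f1 g2) (dM f2 g1)) _.
  by rewrite ImD !ImM /reP /imP; ring.
Qed.

Lemma cdC x v a : cderive x v (fun=> a) 0.
Proof. by split; exact: dC. Qed.

Lemma cdZ x v f a b : cderive x v f a -> cderive x v (fun y => b * f y) (b * a).
Proof. by move=> fa; apply: cderive_eq (cdM (cdC x v b) fa) _; rewrite mul0r add0r. Qed.

Lemma cdN x v f a : cderive x v f a -> cderive x v (fun y => - f y) (- a).
Proof.
move=> /(cdZ (-1)); rewrite mulN1r; congr cderive.
by apply/funext => y; rewrite mulN1r.
Qed.

Lemma cdB x v f g a b : cderive x v f a -> cderive x v g b ->
  cderive x v (fun y => f y - g y) (a - b).
Proof. by move=> fa /cdN gb; exact: cdD. Qed.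

Lemma cd_real x v (f : V -> R) (a : R) : is_derive x v f a ->
  cderive x v (fun y => (f y)%:C) a%:C.
Proof. by move=> fa; split => //; exact: dC. Qed.

Lemma cd_sum (I : Type) (s : seq I) (P : pred I) (F : I -> V -> R[i]) (A : I -> R[i]) x v :
  (forall i, cderive x v (F i) (A i)) ->
  cderive x v (fun y => \sum_(i <- s | P i) F i y) (\sum_(i <- s | P i) A i).
Proof.
move=> h; rewrite /cderive Re_sum Im_sum; split.
- rewrite (_ : reP _ = fun y => \sum_(i <- s | P i) reP (F i) y).
    by apply: d_sum => i; have [] := h i.
  by apply/funext => y; rewrite /reP Re_sum.
- rewrite (_ : imP _ = fun y => \sum_(i <- s | P i) imP (F i) y).
    by apply: d_sum => i; have [] := h i.
  by apply/funext => y; rewrite /imP Im_sum.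
Qed.

Lemma cd_near f g x v a : {near x, f =1 g} -> cderive x v f a -> cderive x v g a.
Proof.
move=> fg [h1 h2]; split.
- by apply: d_near h1; apply: filterS fg => y; rewrite /reP => ->.
- by apply: d_near h2; apply: filterS fg => y; rewrite /imP => ->.
Qed.

Lemma cd_unique f x v a b : cderive x v f a -> cderive x v f b -> a = b.
Proof.
move=> [h1 h2] [h3 h4]; apply: complex_eq; first exact: is_derive_unique h1 h3.
exact: is_derive_unique h2 h4.
Qed.

End complex_calculus.

Section complex_calculus_chain.
Variables (R : realType) (V : normedModType R).
Implicit Types (f g : V -> R[i]) (x v : V) (h : R -> R[i]) (a b : R[i]).

Lemma cdchain x v h (f : V -> R) a (b : R) : cderive (f x : R) (1 : R) h a -> is_derive x v f b ->
  cderive x v (fun y => h (f y)) (a * b%:C).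
Proof.
move=> [h1 h2] fb; split.
- apply: is_derive_eq (dchain h1 fb) _.
  by rewrite ReM /= mulr0 subr0.
- apply: is_derive_eq (dchain h2 fb) _.
  by rewrite ImM /= mulr0 add0r.
Qed.

Lemma cd_expi (t : R) : cderive t (1 : R) (@expi R) ('i * expi t).
Proof.
split.
- apply: is_derive_eq (is_derive_cos t) _.
  by rewrite ReM /= mul0r mul1r sub0r.
- apply: is_derive_eq (is_derive_sin t) _.
  by rewrite ImM /= mul0r mul1r add0r.
Qed.

(** The factor 2 comes from treating real and imaginary parts separately, a complex-valued function
    having no common mean value point. *)
Lemma cMVT_abs (f df : R -> R[i]) (s K : R) :
  (forall x : R, `|x| <= `|s| -> cderive x (1 : R) f (df x)) ->
  (forall x : R, `|x| <= `|s| -> normc (df x) <= K) -> normc (f s - f 0) <= 2 * K * `|s|.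
Proof.
move=> d1 d2; rewrite (le_trans (normc_le_ReIm _))// mulr_natl mulr2n mulrDl ReB ImB lerD//.
- apply: (@MVT_abs R (reP f) (reP df)) => x xs; first by have [] := d1 _ xs.
  by rewrite (le_trans (normc_Re _))// d2.
- apply: (@MVT_abs R (imP f) (imP df)) => x xs; first by have [] := d1 _ xs.
  by rewrite (le_trans (normc_Im _))// d2.
Qed.

End complex_calculus_chain.

Section complex_continuity.
Variables (R : realType) (T : topologicalType).
Implicit Types (f g : T -> R[i]) (x : T).

Definition ccontinuous_at x f := {for x, continuous (reP f)} /\ {for x, continuous (imP f)}.

Lemma ccD x f g : ccontinuous_at x f -> ccontinuous_at x g -> ccontinuous_at x (fun y => f y + g y).
Proof.
move=> [f1 f2] [g1 g2]; split.
- rewrite (_ : reP _ = fun y => reP f y + reP g y); first exact: contD.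
  by apply/funext => y; rewrite /reP ReD.
- rewrite (_ : imP _ = fun y => imP f y + imP g y); first exact: contD.
  by apply/funext => y; rewrite /imP ImD.
Qed.

Lemma ccM x f g : ccontinuous_at x f -> ccontinuous_at x g -> ccontinuous_at x (fun y => f y * g y).
Proof.
move=> [f1 f2] [g1 g2]; split.
- rewrite (_ : reP _ = fun y => reP f y * reP g y - imP f y * imP g y).
    by apply: contB; exact: contM.
  by apply/funext => y; rewrite /reP ReM.
- rewrite (_ : imP _ = fun y => reP f y * imP g y + imP f y * reP g y).
    by apply: contD; exact: contM.
  by apply/funext => y; rewrite /imP ImM.
Qed.

Lemma ccC x (a : R[i]) : ccontinuous_at x (fun=> a).
Proof. by split; exact: contC. Qed.

Lemma cc_real x (f : T -> R) : {for x, continuous f} -> ccontinuous_at x (fun y => (f y)%:C).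
Proof. by move=> cf; split => //; exact: contC. Qed.

Lemma ccB x f g : ccontinuous_at x f -> ccontinuous_at x g -> ccontinuous_at x (fun y => f y - g y).
Proof.
move=> cf cg; rewrite (_ : (fun y => _) = fun y => f y + (-1) * g y).
  exact: (ccD cf (ccM (ccC x (-1)) cg)).
by apply/funext => y; rewrite mulN1r.
Qed.

Lemma cc_sum x (I : Type) (s : seq I) (F : I -> T -> R[i]) :
  (forall i, ccontinuous_at x (F i)) -> ccontinuous_at x (fun y => \sum_(i <- s) F i y).
Proof.
move=> h; split.
- rewrite (_ : reP _ = fun y => \sum_(i <- s) reP (F i) y).
    by apply: cont_sum => i; have [] := h i.
  by apply/funext => y; rewrite /reP Re_sum.
- rewrite (_ : imP _ = fun y => \sum_(i <- s) imP (F i) y).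
    by apply: cont_sum => i; have [] := h i.
  by apply/funext => y; rewrite /imP Im_sum.
Qed.

Lemma cc_norm x f : ccontinuous_at x f -> {for x, continuous (fun y => normc (f y))}.
Proof.
move=> [f1 f2].
rewrite (_ : (fun y => _) = fun y => Num.sqrt (reP f y ^+ 2 + imP f y ^+ 2)).
  apply: (@contcomp R T _ (fun y => reP f y ^+ 2 + imP f y ^+ 2) Num.sqrt).
    by apply: contD; exact: contX.
  exact: sqrt_continuous.
by apply/funext => y; rewrite normcE2.
Qed.

End complex_continuity.

Section complex_continuity_comp.
Variables (R : realType) (T S : topologicalType).

Lemma cc_comp (f : T -> S) (g : S -> R[i]) x :
  {for x, continuous f} -> ccontinuous_at (f x) g -> ccontinuous_at x (fun y => g (f y)).
Proof. by move=> cf [g1 g2]; split; [exact: (contcomp (g := reP g) cf g1)|exact: (contcomp (g := imP g) cf g2)]. Qed.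

Lemma cc_expi (t : R) : ccontinuous_at t (@expi R).
Proof. by split; [exact: continuous_cos|exact: continuous_sin]. Qed.

End complex_continuity_comp.

Section complex_integral.
Variable R : realType.
Local Notation V := 'rV[R]_3.
Implicit Types (f g : V -> R[i]) (x : V) (a : R[i]) (M B : R).

Definition cI f : R[i] := I3 (reP f) +i* I3 (imP f).
Definition CCc f := Cc (reP f) /\ Cc (imP f).
Definition cvanish_out M f := forall x, M < `|x| -> f x = 0.

Lemma CCc_intro f M : (forall x, ccontinuous_at x f) -> cvanish_out M f -> CCc f.
Proof.
move=> cf vf; split; split.
- by move=> x; have [] := cf x.
- by exists M => x /vf; rewrite /reP => ->.
- by move=> x; have [] := cf x.
- by exists M => x /vf; rewrite /imP => ->.
Qed.

Lemma CCc_cont f x : CCc f -> ccontinuous_at x f.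
Proof. by move=> [[h1 _] [h2 _]]; split; [exact: h1|exact: h2]. Qed.

Lemma CCc_vanish f : CCc f -> exists2 M, 0 <= M & cvanish_out M f.
Proof.
move=> [h1 h2]; have [M M0 fM] := Cc_radius h1; have [N N0 fN] := Cc_radius h2.
exists (Num.max M N); first by rewrite le_max M0.
by move=> x; rewrite gt_max => /andP[xM xN]; apply: complex_eq; [exact: fM|exact: fN].
Qed.

Lemma CCcM f g : (forall x, ccontinuous_at x f) -> CCc g -> CCc (fun x => f x * g x).
Proof.
move=> cf cg; have [M M0 vM] := CCc_vanish cg; apply: (@CCc_intro _ M).
  by move=> x; apply: ccM => //; exact: CCc_cont.
by move=> x /vM ->; rewrite mulr0.
Qed.

Lemma CCcMr f g : CCc f -> (forall x, ccontinuous_at x g) -> CCc (fun x => f x * g x).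
Proof.
move=> cf cg; rewrite (_ : (fun x => _) = (fun x => g x * f x)); first exact: CCcM.
by apply/funext => x; rewrite mulrC.
Qed.

Lemma CCcD f g : CCc f -> CCc g -> CCc (fun x => f x + g x).
Proof.
move=> [f1 f2] [g1 g2]; split.
- rewrite (_ : reP _ = fun y => reP f y + reP g y); first exact: CcD.
  by apply/funext => y; rewrite /reP ReD.
- rewrite (_ : imP _ = fun y => imP f y + imP g y); first exact: CcD.
  by apply/funext => y; rewrite /imP ImD.
Qed.

Lemma CCcZ a f : CCc f -> CCc (fun x => a * f x).
Proof. by move=> cf; apply: CCcM => // x; exact: ccC. Qed.

Lemma CCcB f g : CCc f -> CCc g -> CCc (fun x => f x - g x).
Proof.
move=> cf cg; rewrite (_ : (fun y => _) = fun y => f y + (-1) * g y).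
  by apply: CCcD => //; exact: CCcZ.
by apply/funext => y; rewrite mulN1r.
Qed.

Lemma CCc0 : CCc (fun=> 0).
Proof. by split; exact: Cc0. Qed.

Lemma CCc_sum (I : Type) (s : seq I) (F : I -> V -> R[i]) : (forall j, CCc (F j)) ->
  CCc (fun x => \sum_(j <- s) F j x).
Proof.
move=> h; elim: s => [|j s IH].
  by rewrite (_ : (fun x => _) = fun=> 0); [exact: CCc0|apply/funext => x; rewrite big_nil].
rewrite (_ : (fun x => _) = fun x => F j x + \sum_(j <- s) F j x); first exact: CCcD.
by apply/funext => x; rewrite big_cons.
Qed.

Lemma cID f g : CCc f -> CCc g -> cI (fun x => f x + g x) = cI f + cI g.
Proof.
move=> [f1 f2] [g1 g2]; apply: complex_eq; rewrite ?ReD ?ImD /=.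
- by rewrite -I3D//; congr I3; apply/funext => x; rewrite /reP ReD.
- by rewrite -I3D//; congr I3; apply/funext => x; rewrite /imP ImD.
Qed.

Lemma cIZ a f : CCc f -> cI (fun x => a * f x) = a * cI f.
Proof.
move=> [f1 f2]; apply: complex_eq; rewrite ?ReM ?ImM /=.
- rewrite -!I3Z// -I3B//; [|exact: CcZ|exact: CcZ].
  by congr I3; apply/funext => x; rewrite /reP ReM.
- rewrite -!I3Z// -I3D//; [|exact: CcZ|exact: CcZ].
  by congr I3; apply/funext => x; rewrite /imP ImM.
Qed.

Lemma cIB f g : CCc f -> CCc g -> cI (fun x => f x - g x) = cI f - cI g.
Proof.
move=> cf cg; rewrite -mulN1r -cIZ// -cID//; last exact: CCcZ.
by congr cI; apply/funext => x; rewrite mulN1r.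
Qed.

Lemma cI0 : cI (fun=> 0) = 0.
Proof. by apply: complex_eq; rewrite /= -[RHS](@I3_0 R). Qed.

Lemma cI_sum (I : Type) (s : seq I) (F : I -> V -> R[i]) : (forall j, CCc (F j)) ->
  cI (fun x => \sum_(j <- s) F j x) = \sum_(j <- s) cI (F j).
Proof.
move=> h; elim: s => [|j s IH].
  rewrite big_nil (_ : (fun x => _) = fun=> 0); first exact: cI0.
  by apply/funext => y; rewrite big_nil.
rewrite big_cons (_ : (fun x => _) = fun x => F j x + \sum_(j <- s) F j x); last first.
  by apply/funext => x; rewrite big_cons.
by rewrite cID ?IH//; exact: CCc_sum.
Qed.

Lemma cI_translation f (a : V) : CCc f -> cI (fun x => f (x + a)) = cI f.
Proof. by move=> [f1 f2]; apply: complex_eq; rewrite /=; exact: (I3_translation a). Qed.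

Lemma CCc_shift f (a : V) : CCc f -> CCc (fun x => f (x + a)).
Proof. by move=> [f1 f2]; split; [exact: (Cc_shift a f1)|exact: (Cc_shift a f2)]. Qed.

Lemma cI_bound f M B : 0 <= M -> CCc f -> cvanish_out M f ->
  (forall x, normc (f x) <= B) -> normc (cI f) <= 2 * B * (2 * M) ^+ 3.
Proof.
move=> M0 [f1 f2] vf fB; rewrite (le_trans (normc_le_ReIm _))//= mulr_natl mulr2n mulrDl lerD//.
- apply: I3_bound => //; first exact: f1.1.
    by move=> x /vf; rewrite /reP => ->.
  by move=> x; rewrite (le_trans (normc_Re _)).
- apply: I3_bound => //; first exact: f2.1.
    by move=> x /vf; rewrite /imP => ->.
  by move=> x; rewrite (le_trans (normc_Im _)).
Qed.

Lemma le_norm_cI f (g : V -> R) : CCc f -> Cc g -> (forall x, normc (f x) <= g x) ->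
  normc (cI f) <= 2 * I3 g.
Proof.
move=> [f1 f2] cg fg; rewrite (le_trans (normc_le_ReIm _))//= mulr_natl mulr2n lerD//.
- by apply: le_norm_I3 => // x; rewrite (le_trans (normc_Re _)).
- by apply: le_norm_I3 => // x; rewrite (le_trans (normc_Im _)).
Qed.

End complex_integral.

(** * Gluing and cutoff functions *)

Section gluing.
Variable R : realType.
Implicit Types (f g : R -> R) (t : R).

(** A form of differentiability free of quotients and of the restriction h != 0; gluing two
    functions then becomes a case distinction on the increment. *)
Lemma is_derive_epsP f t (a : R) : is_derive t (1 : R) f a <->
  forall e : R, 0 < e -> exists2 d : R, 0 < d & forall h, `|h| < d ->
    `|f (h + t) - f t - a * h| <= e * `|h|.
Proof.
split.
  move=> [df ea] e e0.
  have : h^-1 *: ((f \o shift t) (h *: (1 : R)) - f t) @[h --> 0^'] --> a by rewrite -ea; exact: df.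
  move=> /cvgrPdist_le /(_ e e0) [d /= d0 hd]; exists d => // h hh.
  have [->|h0] := eqVneq h 0; first by rewrite add0r subrr mulr0 subrr normr0 mulr0.
  have := hd h; rewrite /= sub0r normrN => /(_ hh h0).
  rewrite -[h%:A]/(h * 1) mulr1 => H.
  have -> : f (h + t) - f t - a * h = - h * (a - h^-1 * (f (h + t) - f t)).
    by field.
  by rewrite normrM normrN mulrC ler_wpM2r.
move=> H.
have C : h^-1 *: ((f \o shift t) (h *: (1 : R)) - f t) @[h --> 0^'] --> a.
  apply/cvgrPdist_le => e e0; have [d d0 hd] := H e e0.
  exists d => //= h; rewrite /= sub0r normrN => hh h0.
  rewrite -[h%:A]/(h * 1) mulr1.
  have := hd h hh => {}hd.
  have -> : a - h^-1 *: (f (h + t) - f t) = - h^-1 * (f (h + t) - f t - a * h).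
    by rewrite /GRing.scale /=; field.
  by rewrite normrM normrN normfV mulrC ler_pdivrMr ?normr_gt0.
by split; [apply/cvg_ex; exists a|exact/cvg_lim].
Qed.

Definition glue (T : Type) (t0 : R) (f g : R -> T) : R -> T :=
  fun t => if t < t0 then f t else g t.

Lemma glue_cont t0 f g t : (t <= t0 -> {for t, continuous f}) ->
  (t0 <= t -> {for t, continuous g}) -> f t0 = g t0 -> {for t, continuous (glue t0 f g)}.
Proof.
move=> cf cg fg; have [tt|tt|tt] := ltgtP t t0.
- have nt : {near t, f =1 glue t0 f g}.
    by near=> s; rewrite /glue ifT//; near: s; exact: lt_nbhsl.
  have gt : glue t0 f g t = f t by rewrite /glue tt.
  rewrite /prop_for /continuous_at gt; apply: cvg_trans (cf (ltW tt)).
  by apply: near_eq_cvg; apply: filterS nt => s ->.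
- have nt : {near t, g =1 glue t0 f g}.
    by near=> s; rewrite /glue ifF//; apply/negbTE; rewrite -leNgt ltW//; near: s; exact: lt_nbhsr.
  have gt : glue t0 f g t = g t by rewrite /glue ltNge (ltW tt).
  rewrite /prop_for /continuous_at gt; apply: cvg_trans (cg (ltW tt)).
  by apply: near_eq_cvg; apply: filterS nt => s ->.
- rewrite tt in cf cg *; apply/cvgrPdist_lt => e e0.
  have gt : glue t0 f g t0 = g t0 by rewrite /glue ltxx.
  have /cvgrPdist_lt/(_ e e0) h1 := cf (lexx _).
  have /cvgrPdist_lt/(_ e e0) h2 := cg (lexx _).
  near=> s; rewrite gt /glue; case: ifP => _; first by rewrite -fg; near: s.
  by near: s.
Unshelve. all: by end_near. Qed.

Lemma glue_derive t0 f g df dg t : (t <= t0 -> is_derive t (1 : R) f (df t)) ->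
  (t0 <= t -> is_derive t (1 : R) g (dg t)) -> f t0 = g t0 -> df t0 = dg t0 ->
  is_derive t (1 : R) (glue t0 f g) (glue t0 df dg t).
Proof.
move=> cf cg fg dfg; have [tt|tt|tt] := ltgtP t t0.
- rewrite {2}/glue tt; apply: d_near (cf (ltW tt)).
  by near=> s; rewrite /glue ifT//; near: s; exact: lt_nbhsl.
- rewrite {2}/glue ltNge (ltW tt) /=; apply: d_near (cg (ltW tt)).
  by near=> s; rewrite /glue ifF//; apply/negbTE; rewrite -leNgt ltW//; near: s; exact: lt_nbhsr.
- rewrite {2}/glue tt ltxx; rewrite tt in cf cg.
  apply/is_derive_epsP => e e0.
  have [d1 d10 h1] := (is_derive_epsP f t0 (df t0)).1 (cf (lexx _)) e e0.
  have [d2 d20 h2] := (is_derive_epsP g t0 (dg t0)).1 (cg (lexx _)) e e0.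
  exists (Num.min d1 d2); first by rewrite lt_min d10.
  move=> h; rewrite lt_min => /andP[hd1 hd2]; rewrite {2}/glue ltxx /glue.
  by case: ifP => _; [rewrite -fg -dfg; exact: h1|exact: h2].
Unshelve. all: by end_near. Qed.

(* [pw n t = max 0 t ^+ n] for [0 < n]. *)
Definition pw n : R -> R := glue 0 (fun=> 0) (fun t => t ^+ n).

Lemma pw_derive n t : is_derive t (1 : R) (pw n.+2) (n.+2%:R * pw n.+1 t).
Proof.
have -> : n.+2%:R * pw n.+1 t = glue 0 (fun=> 0) (fun t => n.+2%:R * t ^+ n.+1) t.
  by rewrite /pw /glue; case: ifP; rewrite ?mulr0.
apply: (@glue_derive 0 (fun=> 0) (fun t => t ^+ n.+2) (fun=> 0) (fun t => n.+2%:R * t ^+ n.+1)).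
- by move=> _; apply: is_derive_eq (d_exp _ (is_derive_id t (1 : R))) _; rewrite mulr1.
- by rewrite expr0n.
- by rewrite expr0n mulr0.
Qed.

Lemma DnZ m A (c : R) f : Dn m A f -> Dn m A (fun t => c * f t).
Proof.
elim: m f => [|m IH] f [cf hf].
  by split => // t At; apply: contM; [exact: contC|exact: cf].
split; first by move=> t At; apply: contM; [exact: contC|exact: cf].
have [h' dh Dh] := hf; exists (fun t => c * h' t); last exact: IH.
by move=> t At; apply: dZ; exact: dh.
Qed.

Lemma pw_Dn m n : (m < n)%N -> Dn m setT (pw n).
Proof.
elim: m n => [|m IH] [//|n] mn.
  split => // t _; apply: glue_cont.
  - by move=> _; exact: contC.
  - by move=> _; apply: contX; exact: cvg_id.
  - by rewrite expr0n.
case: n mn => [//|n] mn; split.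
  by move=> t _; exact: deriv_continuous (pw_derive n t).
exists (fun t => n.+2%:R * pw n.+1 t); first by move=> t _; exact: pw_derive.
by apply: DnZ; exact: IH.
Qed.

Lemma pw_ge0 n t : 0 <= pw n t.
Proof. by rewrite /pw /glue; case: ltP => // t0; rewrite exprn_ge0. Qed.

Lemma pw_le0 n t : (0 < n)%N -> t <= 0 -> pw n t = 0.
Proof.
move=> n0; rewrite /pw /glue; case: ltgtP => // -> _.
by rewrite expr0n; case: n n0.
Qed.

Lemma pw_pos n t : 0 <= t -> pw n t = t ^+ n.
Proof. by rewrite /pw /glue ltNge => ->. Qed.

(** A piecewise polynomial cutoff, 1 for t <= 1 and 0 for t >= 2. The exponent 4 makes it C^3: three
    derivatives occur, for the gradient of the Laplacian of a bump. *)
Definition step (t : R) : R := pw 4 (1 - pw 4 (t - 1)).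

Lemma step1 t : t <= 1 -> step t = 1.
Proof.
move=> t1; rewrite /step (@pw_le0 4 (t - 1)) ?subr_le0// subr0.
by rewrite pw_pos// expr1n.
Qed.

Lemma step0 t : 2 <= t -> step t = 0.
Proof.
move=> t2; rewrite /step pw_le0// subr_le0 pw_pos; last by lra.
by rewrite exprn_ege1//; lra.
Qed.

Lemma step_ge0 t : 0 <= step t. Proof. exact: pw_ge0. Qed.

Lemma step_le1 t : step t <= 1.
Proof.
rewrite /step; have [h|h] := leP 0 (1 - pw 4 (t - 1)); last by rewrite pw_le0// ltW.
by rewrite pw_pos// exprn_ile1// lerBlDr lerDl pw_ge0.
Qed.

End gluing.

Section bumps.
Variable R : realType.
Local Notation V := 'rV[R]_3.
Implicit Types (x a : V) (r : R).

(** The argument is the squared distance, a polynomial in x. The value is 1 up to distance r and 0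
    from sqrt 2 r on, in particular from 2 r on. *)
Definition bump a r x : R := step (dot (x - a) (x - a) / r ^+ 2).

Lemma d_dist a x v : is_derive x v (fun y => dot (y - a) (y - a)) (2 * dot v (x - a)).
Proof.
have -> : 2 * dot v (x - a) = \sum_(i < 3) (v 0 i * (x - a) 0 i + (x - a) 0 i * v 0 i).
  by rewrite /dot mulr_sumr; apply: eq_bigr => i _; ring.
apply: d_sum => i.
have hd : is_derive x v (fun y : V => (y - a) 0 i) (v 0 i).
  rewrite (_ : (fun y => _) = fun y : V => y 0 i - a 0 i); last by apply/funext => y; rewrite !mxE.
  by apply: is_derive_eq (dB (d_coord i x v) (dC (a 0 i) x v)) _; rewrite subr0.
exact: (dM hd hd).
Qed.

Lemma Ck_dist n O a : open O -> Ck n O (fun y : V => dot (y - a) (y - a)).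
Proof.
move=> oO; apply: (@Ck_eq _ n O (fun y : V => \sum_(i <- enum 'I_3) ((y 0 i - a 0 i) * (y 0 i - a 0 i)))) => //.
  by move=> x _; rewrite /dot big_enum; apply: eq_bigr => i _; rewrite !mxE.
by apply: Ck_sum => // i; apply: CkM => //; apply: CkB => //; [exact: Ck_coord|exact: Ck_cst|exact: Ck_coord|exact: Ck_cst].
Qed.

Lemma Ck_bump n a r : (n <= 3)%N -> Ck n setT (bump a r).
Proof.
move=> n3; have oT : open [set: V] by exact: openT.
apply: (@Ck_comp _ n setT setT (pw 4) (fun x => 1 - pw 4 (dot (x - a) (x - a) / r ^+ 2 - 1))) => //.
  exact: pw_Dn.
apply: CkB => //; first exact: Ck_cst.
apply: (@Ck_comp _ n setT setT (pw 4) (fun x => dot (x - a) (x - a) / r ^+ 2 - 1)) => //.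
  exact: pw_Dn.
apply: CkB => //; last exact: Ck_cst.
by apply: CkM => //; [exact: Ck_dist|exact: Ck_cst].
Qed.

Lemma bump_ge0 a r x : 0 <= bump a r x. Proof. exact: step_ge0. Qed.
Lemma bump_le1 a r x : bump a r x <= 1. Proof. exact: step_le1. Qed.

Lemma bump_in a r x : 0 < r -> enorm (x - a) <= r -> bump a r x = 1.
Proof.
move=> r0 h; apply: step1; rewrite ler_pdivrMr ?exprn_gt0// mul1r -enorm_sqr.
by rewrite ler_sqr ?nnegrE ?enorm_ge0// ltW.
Qed.

Lemma bump_out a r x : 0 < r -> 2 * r <= enorm (x - a) -> bump a r x = 0.
Proof.
move=> r0 h; apply: step0; rewrite ler_pdivlMr ?exprn_gt0// -enorm_sqr.
have : (2 * r) ^+ 2 <= enorm (x - a) ^+ 2.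
  by rewrite ler_sqr ?nnegrE ?enorm_ge0 ?mulr_ge0// ltW.
by apply: le_trans; rewrite exprMn ler_wpM2r ?sqr_ge0//; lra.
Qed.

Lemma bump_supp a r x : 0 < r -> bump a r x != 0 -> enorm (x - a) < 2 * r.
Proof. by move=> r0; rewrite ltNge; apply: contraNN => h; rewrite bump_out. Qed.

End bumps.

(** * Radial outgoing waves *)

Section radial_functions.
Variables (R : realType) (k : R).
Hypothesis k0 : 0 < k.
Implicit Types (q r : R) (l j : nat).

Let ik : R[i] := 'i * k%:C.

(** The coefficients that result from applying (1 / r) d / dr to e^(ikr) / r l times: the derivative
    of e^(ikr) r^-n contributes ik at the same j and -n at the next one. *)
Fixpoint ecoef l j : R[i] :=
  if l is l'.+1 then
    ik * ecoef l' j - (if j is j'.+1 then (l' + j)%:R * ecoef l' j' else 0)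
  else (j == 0%N)%:R.

(* [eta l] is the function [r^-l h_l(k r)], up to a constant, seen as a function
   of [q = r ^ 2]; in this variable the ladder [(1 / r) d / dr] is [2 d / dq]. *)
Definition eta l q : R[i] :=
  expi (k * Num.sqrt q) *
  \sum_(j < l.+1) ecoef l j * ((Num.sqrt q)^-1 ^+ (l + j).+1)%:C.

Lemma ecoef_gt l j : (l < j)%N -> ecoef l j = 0.
Proof.
elim: l j => [|l IH] [|j] //= lj.
by rewrite !IH ?mulr0 ?subr0//; lia.
Qed.

Lemma sqr_i' : 'i * 'i = -1 :> R[i].
Proof. by rewrite -expr2 sqr_i. Qed.

Definition acoef l j : R := ((l + j)`!)%:R / (2 ^ j * j`! * (l - j)`!)%:R.

Lemma acoef_rec l j : (j < l)%N ->
  acoef l.+1 j.+1 = acoef l j.+1 + (l + j).+1%:R * acoef l j.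
Proof.
move=> jl; rewrite /acoef.
have [m lm] : exists m, l = (j + m).+1 by exists (l - j.+1)%N; lia.
rewrite lm.
have -> : ((j + m).+2 - j.+1 = m.+1)%N by lia.
have -> : ((j + m).+1 - j.+1 = m)%N by lia.
have -> : ((j + m).+1 - j = m.+1)%N by lia.
have -> : ((j + m).+2 + j.+1 = (j + m + j).+3)%N by lia.
have -> : ((j + m).+1 + j.+1 = (j + m + j).+2)%N by lia.
have -> : ((j + m).+1 + j = (j + m + j).+1)%N by lia.
rewrite !factS expnS !natrM.
set F := ((_ + _)`!)%:R; set P := (2 ^ j)%:R.
have nz (n : nat) : n`!%:R != 0 :> R by rewrite pnatr_eq0 -lt0n fact_gt0.
have P0 : P != 0 by rewrite pnatr_eq0 expn_eq0.
have := nz j; have := nz m; set J := (j`!)%:R; set M := (m`!)%:R => M0 J0.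
have h1 : j.+1%:R != 0 :> R by rewrite pnatr_eq0.
have h2 : m.+1%:R != 0 :> R by rewrite pnatr_eq0.
have -> : (j + m + j).+3%:R = 2 * j.+1%:R + m.+1%:R :> R by rewrite -natrM -natrD; congr _%:R; lia.
field.
by rewrite M0 J0 P0 !nat1r h1 h2.
Qed.

Lemma acoef_diag l : acoef l.+1 l.+1 = (l + l).+1%:R * acoef l l.
Proof.
rewrite /acoef !subnn addSn addnS !factS expnS !natrM.
have nz (n : nat) : n`!%:R != 0 :> R by rewrite pnatr_eq0 -lt0n fact_gt0.
have P0 : (2 ^ l)%:R != 0 :> R by rewrite pnatr_eq0 expn_eq0.
have := nz l; set L := (l`!)%:R => L0.
have h1 : l.+1%:R != 0 :> R by rewrite pnatr_eq0.
have -> : (l + l).+2%:R = 2%:R * l.+1%:R :> R by rewrite -natrM; congr _%:R; lia.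
field.
by rewrite !nz P0 nat1r h1.
Qed.

Lemma acoef0 l : acoef l 0 = 1.
Proof.
by rewrite /acoef addn0 subn0 expn0 fact0 !mul1n divff// pnatr_eq0 -lt0n fact_gt0.
Qed.

(** Identifies the ladder coefficients with those of the explicit Hankel polynomials, up to the
    powers of i and k that the ladder collects. *)
Lemma ecoefE l j : (j <= l)%N -> ecoef l j = ik ^+ l * ('i / k%:C) ^+ j * (acoef l j)%:C.
Proof.
have kC0 : k%:C != 0 :> R[i] by rewrite eq_complex /= gt_eqF.
elim: l j => [|l IH] j; first by rewrite leqn0 => /eqP ->; rewrite acoef0 !expr0 !mul1r.
case: j => [_|j jl] /=.
  by rewrite subr0 IH// !acoef0 !expr0 !mulr1 exprS.
have key : (l + j.+1)%:R * ik ^+ l * ('i / k%:C) ^+ j * (acoef l j)%:C =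
   - (ik ^+ l.+1 * ('i / k%:C) ^+ j.+1 * ((l + j).+1%:R * acoef l j)%:C).
  move: (acoef l j) => a; rewrite !exprS rcM rc_nat addnS.
  have -> : ik * ik ^+ l * ('i / k%:C * ('i / k%:C) ^+ j) =
     (ik * ('i / k%:C)) * (ik ^+ l * ('i / k%:C) ^+ j) by ring.
  have -> : ik * ('i / k%:C) = -1.
    by rewrite /ik mulrACA sqr_i' mulrV ?unitfE// mulr1.
  by ring.
have [jl'|jl'] := ltnP j l.
  rewrite !IH// ?(ltnW jl')// acoef_rec// rcD mulrDr.
  rewrite (_ : _ * ((l + j).+1%:R * acoef l j)%:C =
    - ((l + j.+1)%:R * ik ^+ l * ('i / k%:C) ^+ j * (acoef l j)%:C)); last by rewrite key opprK.
  by rewrite !exprS; ring.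
(* The diagonal is separate: under truncated subtraction [acoef l l.+1] is a nonzero junk value,
   while the ladder coefficient at that place is 0. *)
have jl2 : j = l by lia.
rewrite jl2 in key *; rewrite ecoef_gt// mulr0 sub0r IH// acoef_diag.
by apply: oppr_inj; rewrite opprK -key !mulrA.
Qed.

(** Ties the ladder to the normalized Hankel functions of the statement: the factor i^(l+1) of
    [hankel] cancels the (-i)^(l+1) of [hankel1]. *)
Lemma eta_hankel l q : 0 < q ->
  eta l q = ik ^+ l * ((Num.sqrt q)^-1 ^+ l)%:C * hankel k l (k * Num.sqrt q).
Proof.
move=> q0; set r := Num.sqrt q; have r0 : r != 0 by rewrite gt_eqF// sqrtr_gt0.
have kC0 : k%:C != 0 :> R[i] by rewrite eq_complex /= gt_eqF.
rewrite /eta /hankel /hankel1 -/r.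
rewrite [RHS](_ : _ = expi (k * r) * (ik ^+ l * (r^-1 ^+ l)%:C * (k%:C * 'i ^+ l.+1) *
   \sum_(j < l.+1) 'i ^+ j * (- 'i) ^+ l.+1 * (acoef l j / (k * r) ^+ j.+1)%:C)); last first.
  by rewrite /acoef; ring.
congr (_ * _); rewrite mulr_sumr; apply: eq_bigr => j _.
have jl : (j <= l)%N by rewrite -ltnS.
rewrite ecoefE//.
have hi : 'i ^+ l.+1 * (- 'i) ^+ l.+1 = 1 :> R[i].
  by rewrite -exprMn mulrN sqr_i' opprK expr1n.
have hX : ('i / k%:C) ^+ j = 'i ^+ j * (k^-1 ^+ j)%:C by rewrite exprMn rcX rcV.
rewrite hX; move: (acoef l j) => a.
have E : k^-1 ^+ j * a * r^-1 ^+ (l + j).+1 = k * r^-1 ^+ l * (a / (k * r) ^+ j.+1).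
  have := k0; rewrite lt0r => /andP[kn0 _].
  rewrite exprMn !exprVn !exprS exprD.
  have := expf_neq0 j kn0; have := expf_neq0 j r0; have := expf_neq0 l r0.
  move: (k ^+ j) (r ^+ j) (r ^+ l) => K J L L0 J0 K0; field.
  by rewrite kn0 r0 L0 J0 K0.
transitivity (ik ^+ l * 'i ^+ j * (k^-1 ^+ j * a * r^-1 ^+ (l + j).+1)%:C).
  by rewrite !rcM; ring.
transitivity (ik ^+ l * 'i ^+ j * ('i ^+ l.+1 * (- 'i) ^+ l.+1) *
  (k%:C * (r^-1 ^+ l)%:C * (a / (k * r) ^+ j.+1)%:C)); last by ring.
by rewrite hi E !rcM; ring.
Qed.

End radial_functions.

Section radial_derivatives.
Variables (R : realType) (k : R).
Hypothesis k0 : 0 < k.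
Local Notation Re := (@complex.Re R).
Local Notation Im := (@complex.Im R).
Local Notation eta := (eta k).
Implicit Types (q r : R) (l j : nat).

Let ik : R[i] := 'i * k%:C.

Lemma ecoef_sum l (X : nat -> R[i]) :
  \sum_(j < l.+2) ecoef k l.+1 j * X j =
  \sum_(j < l.+1) ecoef k l j * (ik * X j - (l + j.+1)%:R * X j.+1).
Proof.
rewrite (eq_bigr (fun j : 'I_l.+2 => ik * (ecoef k l j * X j) -
  (if val j is j'.+1 then (l + j)%:R * ecoef k l j' * X j else 0))); last first.
  move=> [[|j] jl] _ /=; first by rewrite !subr0 mulrA.
  by rewrite mulrBl mulrA.
rewrite sumrB -mulr_sumr big_ord_recr /= ecoef_gt// mul0r addr0.
rewrite [X in _ - X]big_ord_recl /= add0r mulr_sumr -sumrB.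
apply: eq_bigr => j _ /=.
have -> : fintype.bump 0 j = j.+1 by [].
by rewrite add0n; ring.
Qed.

Lemma d_invsqrt q n : 0 < q ->
  is_derive q (1 : R) (fun q => (Num.sqrt q)^-1 ^+ n.+1)
    (- (n.+1%:R / 2) * (Num.sqrt q)^-1 ^+ n.+3).
Proof.
move=> q0; have r0 : Num.sqrt q != 0 by rewrite gt_eqF// sqrtr_gt0.
apply: is_derive_eq (d_exp n.+1 (dV r0 (is_derive1_sqrt q0))) _ => /=.
move: (Num.sqrt q) r0 => r r0; rewrite !exprS !exprVn.
have := expf_neq0 n r0; move: (r ^+ n) => K K0; field.
by rewrite K0 r0.
Qed.

Lemma d_expi_sqrt q : 0 < q -> cderive q (1 : R) (fun q => expi (k * Num.sqrt q))
  (ik * expi (k * Num.sqrt q) * ((Num.sqrt q)^-1 / 2)%:C).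
Proof.
move=> q0; have r0 : Num.sqrt q != 0 by rewrite gt_eqF// sqrtr_gt0.
have h := dZ k (is_derive1_sqrt q0).
apply: cderive_eq (cdchain (cd_expi _) h) _.
rewrite /ik invfM !rcM; ring.
Qed.

Lemma eta_deriv l q : 0 < q -> cderive q (1 : R) (eta l) ((2^-1)%:C * eta l.+1 q).
Proof.
move=> q0; have r0 : Num.sqrt q != 0 by rewrite gt_eqF// sqrtr_gt0.
have h : cderive q (1 : R) (fun q => \sum_(j < l.+1) ecoef k l j * ((Num.sqrt q)^-1 ^+ (l + j).+1)%:C)
    (\sum_(j < l.+1) ecoef k l j * (- ((l + j).+1%:R / 2) * (Num.sqrt q)^-1 ^+ (l + j).+3)%:C).
  apply: cd_sum => j; apply: cdZ; apply: cd_real; exact: d_invsqrt.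
apply: cderive_eq (cdM (d_expi_sqrt q0) h) _.
rewrite /eta (ecoef_sum l (fun j => ((Num.sqrt q)^-1 ^+ (l.+1 + j).+1)%:C)).
set s := (Num.sqrt q)^-1; set E := expi _.
rewrite !mulr_sumr -big_split /=; apply: eq_bigr => j _.
rewrite !(addSn, addnS) !exprS; move: (ecoef k l j) (s ^+ (l + j)) => c X.
rewrite !(rcM, rcN, rc_nat); move: s%:C X%:C => S {}X.
by ring.

Qed.

Lemma eta_cont l q : 0 < q -> ccontinuous_at q (eta l).
Proof. by move=> q0; have [h1 h2] := eta_deriv l q0; split; exact: deriv_continuous. Qed.

Lemma eta_Dn l n : Dn n [set q | 0 < q] (fun q => Re (eta l q)) /\
  Dn n [set q | 0 < q] (fun q => Im (eta l q)).
Proof.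
elim: n l => [|n IH] l.
  by split; split => // t /= /(eta_cont l)[].
split; (split; first by move=> t /= /(eta_cont l)[]).
- exists (fun q => 2^-1 * Re (eta l.+1 q)).
    by move=> t /= /(eta_deriv l)[+ _]; rewrite ReZ.
  by apply: DnZ; have [] := IH l.+1.
- exists (fun q => 2^-1 * Im (eta l.+1 q)).
    by move=> t /= /(eta_deriv l)[_ +]; rewrite ImZ.
  by apply: DnZ; have [] := IH l.+1.
Qed.

Lemma eta0E q : eta 0 q = expi (k * Num.sqrt q) * ((Num.sqrt q)^-1)%:C.
Proof. by rewrite /eta big_ord1 /= expr1 mul1r. Qed.

Lemma eta1E q : eta 1 q = expi (k * Num.sqrt q) *
  (ik * ((Num.sqrt q)^-1 ^+ 2)%:C - ((Num.sqrt q)^-1 ^+ 3)%:C).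
Proof.
rewrite /eta (ecoef_sum 0 (fun j => ((Num.sqrt q)^-1 ^+ (1 + j).+1)%:C)) big_ord1 /=.
by rewrite !mul1r.
Qed.

Lemma eta2E q : eta 2 q = expi (k * Num.sqrt q) *
  (- (k ^+ 2)%:C * ((Num.sqrt q)^-1 ^+ 3)%:C - 3%:R * ik * ((Num.sqrt q)^-1 ^+ 4)%:C
   + 3%:R * ((Num.sqrt q)^-1 ^+ 5)%:C).
Proof.
rewrite /eta (ecoef_sum 1 (fun j => ((Num.sqrt q)^-1 ^+ (2 + j).+1)%:C)) !big_ord_recr big_ord0 /=.
congr (_ * _).
have h : ik * ik = - (k ^+ 2)%:C by rewrite /ik mulrACA sqr_i' mulN1r rcX expr2.
by rewrite -h -/ik; ring.
Qed.

(** The radial Helmholtz equation in the variable q. For l = 0 it is checked on explicit formulas;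
    differentiating the relation for l and doubling it gives the one for l + 1. *)
Lemma eta_ode l q : 0 < q ->
  q%:C * eta l.+2 q + (2 * l + 3)%:R * eta l.+1 q + (k ^+ 2)%:C * eta l q = 0.
Proof.
elim: l q => [|l IH] q q0.
  have r0 : Num.sqrt q != 0 by rewrite gt_eqF// sqrtr_gt0.
  rewrite eta0E eta1E eta2E -{1}(sqr_sqrtr (ltW q0)).
  move: (Num.sqrt q) r0 => r r0; rewrite !rcX !rcV.
  have := rc_neq0 r0; move: (r%:C) => z z0; move: (expi _) => E.
  by field.
pose F q := q%:C * eta l.+2 q + (2 * l + 3)%:R * eta l.+1 q + (k ^+ 2)%:C * eta l q.
have dF : cderive q (1 : R) F ((1%:C * eta l.+2 q + q%:C * ((2^-1)%:C * eta l.+3 q)) +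
    (2 * l + 3)%:R * ((2^-1)%:C * eta l.+2 q) + (k ^+ 2)%:C * ((2^-1)%:C * eta l.+1 q)).
  apply: cdD; first apply: cdD.
  - apply: cdM; last exact: eta_deriv.
    by apply: cd_real; exact: is_derive_id.
  - by apply: cdZ; exact: eta_deriv.
  - by apply: cdZ; exact: eta_deriv.
have dF0 : cderive q (1 : R) F 0.
  apply: cd_near (cdC q (1 : R) 0).
  have : \forall t \near q, 0 < t by exact: lt_nbhsr.
  by apply: filterS => t t0; rewrite /F IH.
have := cd_unique dF dF0.
rewrite rcV rc_nat => H.
have -> : (2 * l.+1 + 3)%:R = (2 * l + 3)%:R + 2%:R :> R[i].
  by rewrite -natrD; congr _%:R; lia.
have two0 : (2 : R[i]) != 0 by rewrite pnatr_eq0.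
transitivity (2%:R * (1%:C * eta l.+2 q + q%:C * (2%:R^-1 * eta l.+3 q) +
  (2 * l + 3)%:R * (2%:R^-1 * eta l.+2 q) + (k ^+ 2)%:C * (2%:R^-1 * eta l.+1 q))); last by rewrite H mulr0.
by field.
Qed.

Lemma normc_ik : normc ik = k.
Proof. by rewrite /ik normcM normc_i normc_real mul1r ger0_norm// ltW. Qed.

Lemma normc_eta0 q : 0 < q -> normc (eta 0 q) = (Num.sqrt q)^-1.
Proof.
by move=> q0; rewrite eta0E normcM normc_expi mul1r normc_real ger0_norm.
Qed.

Lemma normc_eta1 q : 0 < q ->
  normc (eta 1 q) <= k * (Num.sqrt q)^-1 ^+ 2 + (Num.sqrt q)^-1 ^+ 3.
Proof.
move=> q0; have s0 : 0 <= (Num.sqrt q)^-1 by rewrite invr_ge0 sqrtr_ge0.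
rewrite eta1E normcM normc_expi mul1r (le_trans (le_normcB _ _))//.
by rewrite normcM normc_ik !normc_real !ger0_norm ?exprn_ge0.
Qed.

Lemma normc_eta2 q : 0 < q -> normc (eta 2 q) <= k ^+ 2 * (Num.sqrt q)^-1 ^+ 3 +
  3 * k * (Num.sqrt q)^-1 ^+ 4 + 3 * (Num.sqrt q)^-1 ^+ 5.
Proof.
move=> q0; have s0 : 0 <= (Num.sqrt q)^-1 by rewrite invr_ge0 sqrtr_ge0.
have n3 : normc (3%:R : R[i]) = 3 by rewrite -rc_nat normc_real ger0_norm.
have k0' := ltW k0.
rewrite eta2E normcM normc_expi mul1r (le_trans (le_normcD _ _))// lerD//.
  rewrite (le_trans (le_normcB _ _))// lerD//.
    by rewrite normcM normcN !normc_real !ger0_norm ?exprn_ge0.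
  by rewrite normcM [normc (_ * ik)]normcM n3 normc_ik normc_real ger0_norm ?exprn_ge0.
by rewrite normcM n3 normc_real ger0_norm ?exprn_ge0.
Qed.

End radial_derivatives.

(** * Smoothness and Laplacian of complex functions *)

Section complex_smoothness.
Variable R : realType.
Local Notation V := 'rV[R]_3.
Local Notation e_ i := (delta_mx 0 i : V).
Local Notation Re := (@complex.Re R).
Local Notation Im := (@complex.Im R).
Implicit Types (f g : V -> R[i]) (x y a : V) (O : set V) (n : nat) (i : 'I_3).

Definition cpd i f : V -> R[i] := fun x => pd i (reP f) x +i* pd i (imP f) x.
Definition CkC n O f := Ck n O (reP f) /\ Ck n O (imP f).

Lemma CkC_cderive n O f x i : CkC n.+1 O f -> O x -> cderive x (e_ i) f (cpd i f x).
Proof. by move=> [c1 c2] Ox; split; [exact: (Ck_is_derive i c1)|exact: (Ck_is_derive i c2)]. Qed.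

Lemma cpd_cderive f x i (z : R[i]) : cderive x (e_ i) f z -> cpd i f x = z.
Proof. by move=> [h1 h2]; apply: complex_eq; rewrite /= (pd_is_derive _). Qed.

Lemma CkC_cont n O f x : CkC n O f -> O x -> ccontinuous_at x f.
Proof. by move=> [c1 c2] Ox; split; [exact: (Ck_cont c1)|exact: (Ck_cont c2)]. Qed.

Lemma CkC_pd n O f i : CkC n.+1 O f -> CkC n O (cpd i f).
Proof. by move=> [c1 c2]; split; [exact: (Ck_pd i c1)|exact: (Ck_pd i c2)]. Qed.

Lemma CkC_leq n m O f : (n <= m)%N -> CkC m O f -> CkC n O f.
Proof. by move=> nm [c1 c2]; split; [exact: Ck_leq c1|exact: Ck_leq c2]. Qed.

Lemma CkC_sub n O O' f : O' `<=` O -> CkC n O f -> CkC n O' f.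
Proof. by move=> nm [c1 c2]; split; [exact: Ck_sub c1|exact: Ck_sub c2]. Qed.

Lemma CkC_eq n O f g : open O -> (forall x, O x -> f x = g x) -> CkC n O f -> CkC n O g.
Proof.
move=> oO fg [c1 c2]; split; [apply: Ck_eq c1 => // x Ox|apply: Ck_eq c2 => // x Ox].
  by rewrite /reP fg.
by rewrite /imP fg.
Qed.

Lemma CkCD n O f g : open O -> CkC n O f -> CkC n O g -> CkC n O (fun x => f x + g x).
Proof.
move=> oO [f1 f2] [g1 g2]; split.
- by apply: Ck_eq (CkD oO f1 g1) => // x _; rewrite /reP ReD.
- by apply: Ck_eq (CkD oO f2 g2) => // x _; rewrite /imP ImD.
Qed.

Lemma CkCM n O f g : open O -> CkC n O f -> CkC n O g -> CkC n O (fun x => f x * g x).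
Proof.
move=> oO [f1 f2] [g1 g2]; split.
- by apply: Ck_eq (CkB oO (CkM oO f1 g1) (CkM oO f2 g2)) => // x _; rewrite /reP ReM.
- by apply: Ck_eq (CkD oO (CkM oO f1 g2) (CkM oO f2 g1)) => // x _; rewrite /imP ImM.
Qed.

Lemma CkC_cst n O (c : R[i]) : open O -> CkC n O (fun=> c).
Proof. by move=> oO; split; exact: Ck_cst. Qed.

Lemma CkC_real n O (f : V -> R) : open O -> Ck n O f -> CkC n O (fun x => (f x)%:C).
Proof. by move=> oO cf; split => //; exact: Ck_cst. Qed.

Lemma CkC_sum n O (I : Type) (s : seq I) (F : I -> V -> R[i]) : open O ->
  (forall j, CkC n O (F j)) -> CkC n O (fun x => \sum_(j <- s) F j x).
Proof.
move=> oO h; split.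
- apply: Ck_eq (@Ck_sum R n O _ s (fun j => reP (F j)) oO (fun j => (h j).1)) => // x _.
  by rewrite /reP Re_sum.
- apply: Ck_eq (@Ck_sum R n O _ s (fun j => imP (F j)) oO (fun j => (h j).2)) => // x _.
  by rewrite /imP Im_sum.
Qed.

Lemma claplacianE f x : claplacian f x = \sum_(i < 3) cpd i (cpd i f) x.
Proof. by apply: complex_eq; rewrite ?Re_sum ?Im_sum. Qed.

Lemma CkC_comp n O A (h : R -> R[i]) (f : V -> R) : open O -> (forall x, O x -> A (f x)) ->
  Dn n A (fun t => Re (h t)) -> Dn n A (fun t => Im (h t)) -> Ck n O f ->
  CkC n O (fun x => h (f x)).
Proof.
move=> oO OA h1 h2 cf; split; first exact: (Ck_comp oO OA h1 cf).
exact: (Ck_comp oO OA h2 cf).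
Qed.

Lemma cpd_radial O a (h h1 : R -> R[i]) i x : O x ->
  cderive (dot (x - a) (x - a) : R) (1 : R) h (h1 (dot (x - a) (x - a))) ->
  cpd i (fun y => h (dot (y - a) (y - a))) x = (2 * (x - a) 0 i)%:C * h1 (dot (x - a) (x - a)).
Proof.
move=> Ox dh; apply: cpd_cderive; apply: cderive_eq (@cdchain R V x (e_ i) h (fun y => dot (y - a) (y - a)) _ _ dh (d_dist a x (e_ i))) _.
rewrite mulrC; congr (_%:C * _); congr (_ * _).
by rewrite /dot (bigD1 i)//= delta_coord eqxx mul1r big1 ?addr0// => j ji;
  rewrite delta_coord eq_sym (negbTE ji) mul0r.
Qed.

Lemma claplacian_radial O a (h h1 h2 : R -> R[i]) x : open O -> O x ->
  (forall y, O y -> cderive (dot (y - a) (y - a) : R) (1 : R) h (h1 (dot (y - a) (y - a)))) ->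
  cderive (dot (x - a) (x - a) : R) (1 : R) h1 (h2 (dot (x - a) (x - a))) ->
  claplacian (fun y => h (dot (y - a) (y - a))) x =
  6%:R * h1 (dot (x - a) (x - a)) +
  (4 * dot (x - a) (x - a))%:C * h2 (dot (x - a) (x - a)).
Proof.
move=> oO Ox dh dh1; rewrite claplacianE.
have d2 i : cpd i (cpd i (fun y => h (dot (y - a) (y - a)))) x =
   2%:R * h1 (dot (x - a) (x - a)) +
   ((2 * (x - a) 0 i) * (2 * (x - a) 0 i))%:C * h2 (dot (x - a) (x - a)).
  apply: cpd_cderive.
  apply: (@cd_near _ _ (fun y => (2 * (y - a) 0 i)%:C * h1 (dot (y - a) (y - a)))).
    apply: filterS (open_nbhs_nbhs (conj oO Ox)) => y Oy.
    by rewrite (cpd_radial i Oy (dh y Oy)).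
  have dl : is_derive x (e_ i) (fun y : V => 2 * (y - a) 0 i) 2.
    rewrite (_ : (fun y => _) = fun y : V => 2 * (y 0 i - a 0 i)); last by apply/funext => y; rewrite !mxE.
    apply: is_derive_eq (dZ 2 (dB (d_coord i x (e_ i)) (dC (a 0 i) x (e_ i)))) _.
    by rewrite delta_coord eqxx subr0 mulr1.
  apply: cderive_eq (cdM (cd_real dl) (@cdchain R V x (e_ i) h1 (fun y => dot (y - a) (y - a)) _ _ dh1 (d_dist a x (e_ i)))) _.
  have -> : dot (e_ i) (x - a) = (x - a) 0 i.
    by rewrite /dot (bigD1 i)//= delta_coord eqxx mul1r big1 ?addr0// => j ji;
      rewrite delta_coord eq_sym (negbTE ji) mul0r.
  by rewrite !rcM rc_nat; ring.
rewrite (eq_bigr _ (fun i _ => d2 i)) big_split /= sumr_const card_ord.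
congr (_ + _); first by rewrite -mulr_natr; ring.
rewrite -mulr_suml; congr (_ * _); rewrite /dot mulr_sumr.
apply: complex_eq; rewrite ?Re_sum ?Im_sum /=; last by rewrite big1.
by apply: eq_bigr => i _; ring.
Qed.

End complex_smoothness.

(** * The regularized fundamental solution *)

Section regularized_kernel.
Variables (R : realType) (k : R).
Hypothesis k0 : 0 < k.
Local Notation V := 'rV[R]_3.
Local Notation Re := (@complex.Re R).
Local Notation Im := (@complex.Im R).
Local Notation eta := (eta k).
Implicit Types (q e : R) (x y a : V).

Lemma cglue_derive t0 (f g df dg : R -> R[i]) (t : R) :
  (t <= t0 -> cderive t (1 : R) f (df t)) ->
  (t0 <= t -> cderive t (1 : R) g (dg t)) -> f t0 = g t0 -> df t0 = dg t0 ->
  cderive t (1 : R) (glue t0 f g) (glue t0 df dg t).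
Proof.
move=> hf hg fg dfg; split.
- rewrite (_ : reP _ = glue t0 (reP f) (reP g)); last first.
    by apply/funext => s; rewrite /reP /glue; case: ifP.
  rewrite (_ : Re _ = glue t0 (reP df) (reP dg) t); last by rewrite /reP /glue; case: ifP.
  by apply: glue_derive; rewrite ?/reP ?fg ?dfg// => h; [have [] := hf h|have [] := hg h].
- rewrite (_ : imP _ = glue t0 (imP f) (imP g)); last first.
    by apply/funext => s; rewrite /imP /glue; case: ifP.
  rewrite (_ : Im _ = glue t0 (imP df) (imP dg) t); last by rewrite /imP /glue; case: ifP.
  by apply: glue_derive; rewrite ?/imP ?fg ?dfg// => h; [have [] := hf h|have [] := hg h].
Qed.

(* [reg e] replaces [eta 0], for [q < e ^ 2], by its Taylor polynomial of
   order 2 at [e ^ 2]; [reg1 e] and [reg2 e] are its first two derivatives. *)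
Definition reg e q : R[i] := glue (e ^+ 2)
  (fun q => eta 0 (e ^+ 2) + (2^-1)%:C * eta 1 (e ^+ 2) * (q - e ^+ 2)%:C
            + (8^-1)%:C * eta 2 (e ^+ 2) * ((q - e ^+ 2)%:C * (q - e ^+ 2)%:C)) (eta 0) q.
Definition reg1 e q : R[i] := glue (e ^+ 2)
  (fun q => (2^-1)%:C * eta 1 (e ^+ 2) + (4^-1)%:C * eta 2 (e ^+ 2) * (q - e ^+ 2)%:C)
  (fun q => (2^-1)%:C * eta 1 q) q.
Definition reg2 e q : R[i] := glue (e ^+ 2)
  (fun=> (4^-1)%:C * eta 2 (e ^+ 2)) (fun q => (4^-1)%:C * eta 2 q) q.

Let d_lin q c : cderive q (1 : R) (fun q => (q - c)%:C) 1.
Proof.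
apply: cd_real; apply: is_derive_eq (dB (is_derive_id q (1 : R)) (dC c q (1 : R))) _.
by rewrite subr0.
Qed.

Lemma reg_derive e q : 0 < e -> cderive q (1 : R) (reg e) (reg1 e q).
Proof.
move=> e0; apply: cglue_derive.
- move=> _; have l := d_lin q (e ^+ 2).
  apply: cderive_eq (cdD (cdD (cdC q (1 : R) (eta 0 (e ^+ 2))) (cdZ ((2^-1)%:C * eta 1 (e ^+ 2)) l))
    (cdZ ((8^-1)%:C * eta 2 (e ^+ 2)) (cdM l l))) _.
  have -> : (4^-1)%:C = 2%:R * (8^-1)%:C :> R[i].
    by rewrite -rc_nat -rcM; congr (_%:C); field.
  by ring.
- by move=> eq; apply: eta_deriv => //; apply: lt_le_trans eq; rewrite exprn_gt0.
- by rewrite subrr !mulr0 !addr0.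
- by rewrite subrr mulr0 addr0.
Qed.

Lemma reg1_derive e q : 0 < e -> cderive q (1 : R) (reg1 e) (reg2 e q).
Proof.
move=> e0; have e4 : (4^-1)%:C = (2^-1)%:C * (2^-1)%:C :> R[i].
  by rewrite -rcM; congr (_%:C); field.
apply: cglue_derive.
- move=> _; have l := d_lin q (e ^+ 2).
  apply: cderive_eq (cdD (cdC q (1 : R) ((2^-1)%:C * eta 1 (e ^+ 2)))
    (cdZ ((4^-1)%:C * eta 2 (e ^+ 2)) l)) _.
  by rewrite add0r mulr1.
- move=> eq; rewrite e4 -mulrA; apply: cdZ; apply: eta_deriv => //.
  by apply: lt_le_trans eq; rewrite exprn_gt0.
- by rewrite subrr mulr0 addr0.
- by [].
Qed.

Lemma reg2_cont e q : 0 < e -> ccontinuous_at q (reg2 e).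
Proof.
move=> e0.
have ce : e ^+ 2 <= q -> ccontinuous_at q (fun q => (4^-1)%:C * eta 2 q).
  move=> eq; apply: ccM; first exact: ccC.
  by apply: eta_cont => //; apply: lt_le_trans eq; rewrite exprn_gt0.
split.
- rewrite (_ : reP _ = glue (e ^+ 2) (reP (fun=> (4^-1)%:C * eta 2 (e ^+ 2)))
     (reP (fun q => (4^-1)%:C * eta 2 q))); last first.
    by apply/funext => s; rewrite /reP /reg2 /glue; case: ifP.
  by apply: glue_cont; [move=> _; exact: contC|move=> /ce[]|].
- rewrite (_ : imP _ = glue (e ^+ 2) (imP (fun=> (4^-1)%:C * eta 2 (e ^+ 2)))
     (imP (fun q => (4^-1)%:C * eta 2 q))); last first.
    by apply/funext => s; rewrite /imP /reg2 /glue; case: ifP.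
  by apply: glue_cont; [move=> _; exact: contC|move=> /ce[]|].
Qed.

Lemma reg_Dn e A : 0 < e -> Dn 2 A (fun q => Re (reg e q)) /\ Dn 2 A (fun q => Im (reg e q)).
Proof.
move=> e0; split.
- split; first by move=> t _; have [h _] := reg_derive t e0; exact: deriv_continuous h.
  exists (fun q => Re (reg1 e q)); first by move=> t _; have [] := reg_derive t e0.
  split; first by move=> t _; have [h _] := reg1_derive t e0; exact: deriv_continuous h.
  exists (fun q => Re (reg2 e q)); first by move=> t _; have [] := reg1_derive t e0.
  by split => // t _; have [] := reg2_cont t e0.
- split; first by move=> t _; have [_ h] := reg_derive t e0; exact: deriv_continuous h.
  exists (fun q => Im (reg1 e q)); first by move=> t _; have [] := reg_derive t e0.
  split; first by move=> t _; have [_ h] := reg1_derive t e0; exact: deriv_continuous h.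
  exists (fun q => Im (reg2 e q)); first by move=> t _; have [] := reg1_derive t e0.
  by split => // t _; have [] := reg2_cont t e0.
Qed.

Definition Gk e a y : R[i] := reg e (dot (y - a) (y - a)).
(** The Helmholtz operator on a radial function h of q = r^2, which reads 6 h' + 4 q h'' + k^2 h. *)
Definition dipole e q : R[i] := 6%:R * reg1 e q + (4 * q)%:C * reg2 e q + (k ^+ 2)%:C * reg e q.
(* The Helmholtz operator applied to [Gk e a], see [claplacian_Gk]: minus an
   approximate delta function at [a]. *)
Definition Kk e a y : R[i] := dipole e (dot (y - a) (y - a)).

Lemma Gk_CkC e a O : open O -> 0 < e -> CkC 2 O (Gk e a).
Proof.
move=> oO e0; have [h1 h2] := reg_Dn setT e0.
by apply: (CkC_comp oO (A := setT)) => //; exact: Ck_dist.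
Qed.

Lemma cpd_Gk e a i y : 0 < e ->
  cpd i (Gk e a) y = (2 * (y - a) 0 i)%:C * reg1 e (dot (y - a) (y - a)).
Proof. by move=> e0; apply: (@cpd_radial _ setT) => //; exact: reg_derive. Qed.

Lemma claplacian_Gk e a y : 0 < e ->
  claplacian (Gk e a) y + (k ^+ 2)%:C * Gk e a y = Kk e a y.
Proof.
move=> e0; rewrite (@claplacian_radial _ setT a (reg e) (reg1 e) (reg2 e))//.
- exact: openT.
- by move=> z _; exact: reg_derive.
- exact: reg1_derive.
Qed.

Lemma Kk_cont e a y : 0 < e -> ccontinuous_at y (Kk e a).
Proof.
move=> e0; have cq : {for y, continuous (fun y : V => dot (y - a) (y - a))}.
  exact: (Ck_cont (@Ck_dist R 0 setT a openT)).
apply: (@cc_comp _ _ _ (fun y : V => dot (y - a) (y - a)) (dipole e) y cq).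
move: (dot _ _) => q {cq}.
apply: ccD; first apply: ccD.
- apply: ccM; first exact: ccC.
  by have [h1 h2] := reg1_derive q e0; split; exact: deriv_continuous.
- apply: ccM; last exact: reg2_cont.
  by apply: cc_real; apply: contM; [exact: contC|exact: cvg_id].
- apply: ccM; first exact: ccC.
  by have [h1 h2] := reg_derive q e0; split; exact: deriv_continuous.
Qed.

Lemma regE e q : e ^+ 2 <= q -> reg e q = eta 0 q.
Proof. by move=> h; rewrite /reg /glue ltNge h. Qed.

Lemma reg1E e q : e ^+ 2 <= q -> reg1 e q = (2^-1)%:C * eta 1 q.
Proof. by move=> h; rewrite /reg1 /glue ltNge h. Qed.

Lemma dipole_out e q : 0 < e -> e ^+ 2 <= q -> dipole e q = 0.
Proof.
move=> e0 h; have q0 : 0 < q by apply: lt_le_trans h; rewrite exprn_gt0.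
rewrite /dipole regE// reg1E// /reg2 /glue ltNge h /=.
rewrite -[RHS](eta_ode k0 0 q0) muln0 add0n.
have -> : 6%:R * ((2^-1)%:C * eta 1 q) = 3%:R * eta 1 q.
  by rewrite mulrA; congr (_ * _); rewrite -!rc_nat -rcM; congr (_%:C); field.
have -> : (4 * q)%:C * ((4^-1)%:C * eta 2 q) = q%:C * eta 2 q.
  by rewrite mulrA; congr (_ * _); rewrite -rcM; congr (_%:C); field.
by ring.
Qed.

(** [reg e] agrees with [eta 0] to second order at q = e^2, so by [eta_ode] the expression vanishes
    there; the explicit factor q - e^2 is what later determines its sign. *)
Lemma dipole_in e q : 0 < e -> q < e ^+ 2 -> dipole e q = (q - e ^+ 2)%:C *
  ((5 / 2)%:C * eta 2 (e ^+ 2) + (k ^+ 2 / 2)%:C * eta 1 (e ^+ 2) +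
   (k ^+ 2 / 8 * (q - e ^+ 2))%:C * eta 2 (e ^+ 2)).
Proof.
move=> e0 h; have E0 : 0 < e ^+ 2 by rewrite exprn_gt0.
rewrite /dipole /reg /reg1 /reg2 /glue h.
have H := eta_ode k0 0 E0; rewrite muln0 add0n in H.
set d := q - e ^+ 2; have -> : q = e ^+ 2 + d by rewrite /d addrC subrK.
move: d => d.
have r6 : 6%:R = 6%:C :> R[i] by rewrite rc_nat.
have -> : (4 * (e ^+ 2 + d))%:C = 4%:C * ((e ^+ 2)%:C + d%:C) :> R[i] by rewrite (rcM 4) (rcD (e ^+ 2)).
have h2 : (2^-1)%:C = 4%:C * (8^-1)%:C :> R[i] by rewrite -rcM; congr _%:C; field.
have h4 : (4^-1)%:C = 2%:C * (8^-1)%:C :> R[i] by rewrite -rcM; congr _%:C; field.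
have h5 : (5 / 2)%:C = 20%:C * (8^-1)%:C :> R[i] by rewrite -rcM; congr _%:C; field.
have h8 : 1 = 8%:C * (8^-1)%:C :> R[i] by rewrite -rcM mulfV.
have hk : (k ^+ 2)%:C * eta 0 (e ^+ 2) = - ((e ^+ 2)%:C * eta 2 (e ^+ 2)) - 3%:R * eta 1 (e ^+ 2).
  by apply/eqP; rewrite -subr_eq0; apply/eqP; rewrite -[RHS]H; ring.
have n3 : 3%:R = 3%:C :> R[i] by rewrite rc_nat.
rewrite (rcM (k ^+ 2 / 8)) (rcM (k ^+ 2) 8^-1) (rcM (k ^+ 2) 2^-1) h2 h4 h5 r6.
move: hk; rewrite n3; move: (eta 0 _) (eta 1 _) (eta 2 _) (k ^+ 2)%:C (e ^+ 2)%:C d%:C.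
move=> a b c K E D hk.
have h8' : 8%:C = 8%:R :> R[i] by rewrite rc_nat.
have -> : 4%:C = 4%:R :> R[i] by rewrite rc_nat.
have -> : 6%:C = 6%:R :> R[i] by rewrite rc_nat.
have -> : 2%:C = 2%:R :> R[i] by rewrite rc_nat.
have -> : 20%:C = 20%:R :> R[i] by rewrite rc_nat.
have n3' : 3%:C = 3%:R :> R[i] by rewrite rc_nat.
rewrite n3' in hk; rewrite h8' in h8.
move: h8; move: (8^-1)%:C => u h8.
transitivity (6%:R * (4%:R * u * b + 2%:R * u * c * D) + 4%:R * (E + D) * (2%:R * u * c) +
  K * (4%:R * u * b * D + u * c * (D * D)) + K * a); first by ring.
rewrite hk; transitivity (D * (20%:R * u * c + K * (4%:R * u) * b + K * u * D * c) +
   (8%:R * u - 1) * (E * c + 3%:R * b)); first by ring.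
by rewrite -h8 subrr mul0r addr0.
Qed.

End regularized_kernel.

(** * Green's identity for complex solutions *)

Section complex_green.
Variable R : realType.
Local Notation V := 'rV[R]_3.
Implicit Types (f g : V -> R[i]) (x y a : V) (O : set V) (i : 'I_3).

Definition cnear0_off O f := forall x, ~ O x -> \near x, f x = 0.

Lemma CkC_cut n O f g : open O -> CkC n O f -> CkC n setT g -> cnear0_off O g ->
  CkC n setT (fun x => f x * g x).
Proof.
move=> oO [f1 f2] [g1 g2] h.
have h1 : near0_off O (reP g) by move=> x /h; apply: filterS => y; rewrite /reP => ->.
have h2 : near0_off O (imP g) by move=> x /h; apply: filterS => y; rewrite /imP => ->.
split.
- apply: Ck_eq (CkB openT (Ck_cut oO f1 g1 h1) (Ck_cut oO f2 g2 h2)); first exact: openT.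
  by move=> x _; rewrite /reP ReM.
- apply: Ck_eq (CkD openT (Ck_cut oO f1 g2 h2) (Ck_cut oO f2 g1 h1)); first exact: openT.
  by move=> x _; rewrite /imP ImM.
Qed.

Lemma cvanish_out_pd M f i : cvanish_out M f -> cvanish_out M (cpd i f).
Proof.
move=> fM x Mx; apply: complex_eq => /=; apply: vanish_out_pd Mx => y /fM.
  by rewrite /reP => ->.
by rewrite /imP => ->.
Qed.

Lemma cnear0_cderive f x v : (\near x, f x = 0) -> cderive x v f 0.
Proof. by move=> h; apply: cd_near (cdC x v 0); apply: filterS h => y ->. Qed.

Lemma cnear0_off_pd O f i : cnear0_off O f -> cnear0_off O (cpd i f).
Proof.
move=> h x /h /nbhs_interior; apply: filterS => y hy.
by apply: cpd_cderive; exact: cnear0_cderive.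
Qed.

Lemma cpdM O f g i x : O x -> CkC 1 O f -> CkC 1 O g ->
  cpd i (fun y => f y * g y) x = cpd i f x * g x + f x * cpd i g x.
Proof.
move=> Ox cf cg; apply: cpd_cderive.
exact: cdM (CkC_cderive i cf Ox) (CkC_cderive i cg Ox).
Qed.

Lemma claplacianM O f g x : open O -> O x -> CkC 2 O f -> CkC 2 O g ->
  claplacian (fun y => f y * g y) x =
  claplacian f x * g x + 2%:R * (\sum_(i < 3) cpd i f x * cpd i g x) + f x * claplacian g x.
Proof.
move=> oO Ox cf cg; rewrite !claplacianE mulr_suml !mulr_sumr -!big_split /=.
apply: eq_bigr => i _; apply: cpd_cderive.
have cf1 := CkC_leq (leqnSn 1) cf; have cg1 := CkC_leq (leqnSn 1) cg.
apply: (@cd_near _ _ (fun y => cpd i f y * g y + f y * cpd i g y)).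
  apply: filterS (open_nbhs_nbhs (conj oO Ox)) => y Oy.
  by rewrite (cpdM i Oy cf1 cg1).
have df := CkC_cderive i cf1 Ox; have dg := CkC_cderive i cg1 Ox.
have ddf := CkC_cderive i (CkC_pd i cf) Ox; have ddg := CkC_cderive i (CkC_pd i cg) Ox.
apply: (cderive_eq (cdD (cdM ddf dg) (cdM df ddg))).
move: (cpd i (cpd i f) x) (cpd i (cpd i g) x) (cpd i f x) (cpd i g x) (f x) (g x) => a b c d u v.
by ring.
Qed.

Lemma cint_by_parts O f g i M : open O -> CkC 1 O f -> CkC 1 setT g ->
  cnear0_off O g -> cvanish_out M g ->
  cI (fun x => f x * cpd i g x) = - cI (fun x => cpd i f x * g x).
Proof.
move=> oO cf cg h0 vg.
have c1 : CCc (fun x => f x * cpd i g x).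
  apply: (@CCc_intro _ _ M); last by move=> x Mx; rewrite (cvanish_out_pd i vg)// mulr0.
  move=> x; have H := CkC_cut oO (CkC_leq (leqnSn 0) cf) (CkC_pd i cg) (cnear0_off_pd i h0).
  exact: (CkC_cont H I).
have c2 : CCc (fun x => cpd i f x * g x).
  apply: (@CCc_intro _ _ M); last by move=> x Mx; rewrite vg// mulr0.
  move=> x; have H := CkC_cut oO (CkC_pd i cf) (CkC_leq (leqnSn 0) cg) h0.
  exact: (CkC_cont H I).
have cfg := CkC_cut oO cf cg h0.
have vfg : cvanish_out M (fun x => f x * g x) by move=> x /vg ->; rewrite mulr0.
apply/eqP; rewrite -addr_eq0 -cID//; apply/eqP.
have E : (fun x => f x * cpd i g x + cpd i f x * g x) = cpd i (fun x => f x * g x).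
  apply/funext => x; apply/esym/cpd_cderive; have [Ox|/h0 nx] := pselect (O x).
    by apply: cderive_eq (cdM (CkC_cderive i cf Ox) (CkC_cderive i cg I)) _; rewrite addrC.
  have gx : g x = 0 by exact: nbhs_singleton nx.
  have -> : cpd i g x = 0 by apply: cpd_cderive; exact: cnear0_cderive.
  rewrite gx !mulr0 addr0; apply: cnear0_cderive.
  by apply: filterS nx => y ->; rewrite mulr0.
rewrite E; have [C1 C2] : CCc (fun x => f x * g x).
  by apply: (@CCc_intro _ _ M) => // x; exact: (CkC_cont cfg I).
have d x := CkC_cderive i cfg (I : setT x).
apply: complex_eq => /=; apply: I3_pd0 => //.
- by move=> x; have [] := d x.
- by move=> x; have [] := CkC_cont (CkC_pd i cfg) (I : setT x).
- by move=> x; have [] := d x.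
- by move=> x; have [] := CkC_cont (CkC_pd i cfg) (I : setT x).
Qed.

(** Two integrations by parts move the operator onto [f], where it gives 0 on [O]; off [O] the test
    function is 0. *)
Lemma cgreen (k : R) O f g M : open O -> CkC 2 O f ->
  (forall x, O x -> claplacian f x + (k ^+ 2)%:C * f x = 0) ->
  CkC 2 setT g -> cnear0_off O g -> cvanish_out M g ->
  cI (fun x => f x * (claplacian g x + (k ^+ 2)%:C * g x)) = 0.
Proof.
move=> oO cf hf cg h0 vg.
have C1 (f1 g1 : V -> R[i]) : CkC 0 O f1 -> CkC 0 setT g1 -> cnear0_off O g1 -> cvanish_out M g1 ->
    CCc (fun x => f1 x * g1 x).
  move=> cf1 cg1 n1 v1; apply: (@CCc_intro _ _ M); last by move=> x /v1 ->; rewrite mulr0.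
  by move=> x; exact: (CkC_cont (CkC_cut oO cf1 cg1 n1) I).
have c1 i : CCc (fun x => f x * cpd i (cpd i g) x).
  apply: C1; first exact: CkC_leq cf.
  - by do 2 apply: CkC_pd.
  - by do 2 apply: cnear0_off_pd.
  - by do 2 apply: cvanish_out_pd.
have c2 i : CCc (fun x => cpd i (cpd i f) x * g x).
  by apply: C1 => //; [do 2 apply: CkC_pd|exact: CkC_leq cg].
have c3 : CCc (fun x => (k ^+ 2)%:C * (f x * g x)).
  by apply: CCcZ; apply: C1 => //; [exact: CkC_leq cf|exact: CkC_leq cg].
have E1 : (fun x => f x * (claplacian g x + (k ^+ 2)%:C * g x)) =
    (fun x => \sum_(i < 3) f x * cpd i (cpd i g) x + (k ^+ 2)%:C * (f x * g x)).
  by apply/funext => x; rewrite claplacianE mulrDr mulr_sumr; congr (_ + _); ring.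
rewrite E1 cID ?cI_sum//; last exact: CCc_sum.
have E2 : forall i, cI (fun x => f x * cpd i (cpd i g) x) = cI (fun x => cpd i (cpd i f) x * g x).
  move=> i; rewrite (@cint_by_parts O f (cpd i g) i M)//; last 4 first.
  - exact: CkC_leq cf.
  - exact: CkC_pd.
  - exact: cnear0_off_pd.
  - exact: cvanish_out_pd.
  rewrite -[RHS]opprK -(@cint_by_parts O (cpd i f) g i M)//; first exact: CkC_pd.
  exact: CkC_leq cg.
rewrite (eq_bigr _ (fun i _ => E2 i)) -cI_sum// -cID//; last exact: CCc_sum.
rewrite -[RHS](cI0 R); congr cI; apply/funext => x; rewrite -mulr_suml -claplacianE mulrA -mulrDl.
have [Ox|/h0 nx] := pselect (O x); first by rewrite hf// mul0r.
by rewrite (nbhs_singleton nx) mulr0.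
Qed.

End complex_green.

(** * Bounds on the regularized kernels *)

Section kernel_bounds.
Variables (R : realType) (k : R).
Hypothesis k0 : 0 < k.
Local Notation V := 'rV[R]_3.
Local Notation Re := (@complex.Re R).
Local Notation eta := (eta k).
Implicit Types (q e : R) (x y a : V).

Definition rho e (z : V) : R := Num.max (enorm z) e.

(** For e <= 1 the highest power of 1/e dominates in [eta 1] and [eta 2] at q = e^2; [A1] and [A2]
    are the resulting sums of coefficients. *)
Let A1 := k + 1.
Let A2 := k ^+ 2 + 3 * k + 3.
Definition kbound : R := 1 + A1 + A2 * 3 + k ^+ 2 * A1 + k ^+ 2 * A2.

Let k0' : 0 <= k := ltW k0.
Let A1_ge0 : 0 <= A1. Proof. exact: addr_ge0. Qed.
Let A2_ge0 : 0 <= A2.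
Proof. by rewrite /A2 !addr_ge0 ?mulr_ge0 ?exprn_ge0. Qed.
Let kA1 : 0 <= k ^+ 2 * A1. Proof. by rewrite mulr_ge0 ?exprn_ge0. Qed.
Let kA2 : 0 <= k ^+ 2 * A2. Proof. by rewrite mulr_ge0 ?exprn_ge0. Qed.

Lemma kbound_gt0 : 0 < kbound.
Proof. by rewrite /kbound; move: A1_ge0 A2_ge0 kA1 kA2; lra. Qed.

Let small_eta e : 0 < e -> e <= 1 ->
  [/\ normc (eta 0 (e ^+ 2)) = e^-1, normc (eta 1 (e ^+ 2)) <= A1 * e^-1 ^+ 3 &
      normc (eta 2 (e ^+ 2)) <= A2 * e^-1 ^+ 5].
Proof.
move=> e0 e1; have E0 : 0 < e ^+ 2 by rewrite exprn_gt0.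
have se : Num.sqrt (e ^+ 2) = e by rewrite sqrtr_sqr ger0_norm// ltW.
have s1 : 1 <= e^-1 by rewrite invf_ge1.
have s0 : 0 <= e^-1 by apply: le_trans s1.
split; first by rewrite normc_eta0// se.
- apply: le_trans (normc_eta1 k0 E0) _; rewrite se /A1 mulrDl mul1r lerD2r.
  have H : e^-1 ^+ 2 <= e^-1 ^+ 3 by exact: ler_weXn2l.
  exact: (ler_wpM2l (ltW k0) H).
- apply: le_trans (normc_eta2 k0 E0) _; rewrite se /A2 (mulrDl (_ + _)) (mulrDl (k ^+ 2)) lerD2r.
  have H3 : e^-1 ^+ 3 <= e^-1 ^+ 5 by exact: ler_weXn2l.
  have H4 : e^-1 ^+ 4 <= e^-1 ^+ 5 by exact: ler_weXn2l.
  apply: lerD; first exact: (ler_wpM2l (exprn_ge0 2 (ltW k0)) H3).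
  exact: (ler_wpM2l (mulr_ge0 (ler0n R 3) (ltW k0)) H4).
Qed.

Lemma normc_Gk e a y : 0 < e -> e <= 1 -> normc (Gk k e a y) <= kbound / rho e (y - a).
Proof.
move=> e0 e1; rewrite /Gk /rho -enorm_sqr; move: (enorm _) (enorm_ge0 (y - a)) => r r0.
have hC : 1 <= kbound by rewrite /kbound; move: A1_ge0 A2_ge0 kA1 kA2; lra.
have [re|re] := leP e r.
  have r1 : 0 < r by apply: lt_le_trans re.
  rewrite regE ?ler_sqr ?nnegrE ?(ltW e0)// normc_eta0 ?exprn_gt0// sqrtr_sqr ger0_norm//.
  by rewrite ler_peMl// invr_ge0.
have re2 : r ^+ 2 < e ^+ 2 by rewrite ltr_sqr ?nnegrE// ltW.
rewrite /reg /glue re2; have [h0 h1 h2] := small_eta e0 e1.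
move: (eta 0 (e ^+ 2)) (eta 1 (e ^+ 2)) (eta 2 (e ^+ 2)) h0 h1 h2 => f0 f1 f2 h0 h1 h2.
have s0 : 0 < e^-1 by rewrite invr_gt0.
have d1 : `|r ^+ 2 - e ^+ 2| <= e ^+ 2.
  by rewrite ler_norml; have := sqr_ge0 r; move: re2 => ? ?; apply/andP; split; lra.
have ee : e * e^-1 = 1 by rewrite divff// gt_eqF.
rewrite (le_trans (le_normcD _ _))// (@le_trans _ _ (e^-1 + A1 * e^-1 + A2 * e^-1))//; last first.
  have -> : e^-1 + A1 * e^-1 + A2 * e^-1 = (1 + A1 + A2) * e^-1 by ring.
  apply: (ler_wpM2r (ltW s0)).
  by rewrite /kbound; move: A1_ge0 A2_ge0 kA1 kA2; lra.
rewrite lerD//; last first.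
  rewrite !normcM !normc_real (ger0_norm (_ : 0 <= 8^-1))//.
  apply: (@le_trans _ _ (1 * (A2 * e^-1 ^+ 5) * (e ^+ 2 * e ^+ 2))).
    apply: ler_pM; [|exact: mulr_ge0| |exact: ler_pM].
      by rewrite mulr_ge0 ?normc_ge0.
    by apply: ler_pM => //; [exact: normc_ge0|lra].
  rewrite mul1r; apply: le_of_eq.
  by rewrite -[RHS]mulr1 -[in RHS](expr1n _ 4) -ee; ring.
rewrite (le_trans (le_normcD _ _))// lerD ?h0//.
rewrite !normcM !normc_real (ger0_norm (_ : 0 <= 2^-1))//.
apply: (@le_trans _ _ (1 * (A1 * e^-1 ^+ 3) * e ^+ 2)).
  apply: ler_pM => //; first by rewrite mulr_ge0 ?normc_ge0.
  by apply: ler_pM => //; [exact: normc_ge0|lra].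
rewrite mul1r; apply: le_of_eq.
by rewrite -[RHS]mulr1 -[in RHS](expr1n _ 2) -ee; ring.
Qed.

Lemma normc_cpd_Gk e a i y : 0 < e -> e <= 1 ->
  normc (cpd i (Gk k e a) y) <= kbound * ((rho e (y - a))^-1 + (rho e (y - a))^-1 ^+ 2).
Proof.
move=> e0 e1; rewrite cpd_Gk// normcM normc_real /rho -enorm_sqr normrM (ger0_norm (_ : 0 <= 2))//.
have := coord_le_enorm (y - a) i; move: (enorm _) (enorm_ge0 (y - a)) `|(y - a) 0 i| (normr_ge0 ((y - a) 0 i)) => r r0 z z0 zr.
have hC : 1 + k + A1 + A2 <= kbound by rewrite /kbound /A1; move: A1_ge0 A2_ge0 kA1 kA2; rewrite /A1 /A2; nra.
have [re|re] := leP e r.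
  have r1 : 0 < r by apply: lt_le_trans re.
  rewrite reg1E ?ler_sqr ?nnegrE ?(ltW e0)// normcM normc_real (ger0_norm (_ : 0 <= 2^-1))//.
  have H := normc_eta1 k0 (exprn_gt0 2 r1); rewrite sqrtr_sqr ger0_norm// in H.
  have s0 : 0 < r^-1 by rewrite invr_gt0.
  have rr : r * r^-1 = 1 by rewrite divff// gt_eqF.
  apply: (@le_trans _ _ (2 * r * (2^-1 * (k * r^-1 ^+ 2 + r^-1 ^+ 3)))).
    by rewrite ler_pM ?mulr_ge0 ?normc_ge0// ?ler_wpM2l.
  have -> : 2 * r * (2^-1 * (k * r^-1 ^+ 2 + r^-1 ^+ 3)) = (r * r^-1) * (k * r^-1 + r^-1 ^+ 2).
    by field; rewrite gt_eqF.
  have hk : k <= kbound by move: A1_ge0 A2_ge0; lra.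
  have h1 : 1 <= kbound by move: A1_ge0 A2_ge0 k0; lra.
  rewrite rr mul1r mulrDr; apply: lerD; first exact: (ler_wpM2r (ltW s0) hk).
  by rewrite ler_peMl// exprn_ge0// ltW.
have re2 : r ^+ 2 < e ^+ 2 by rewrite ltr_sqr ?nnegrE// ltW.
rewrite /reg1 /glue re2; have [h0 h1 h2] := small_eta e0 e1.
move: (eta 0 (e ^+ 2)) (eta 1 (e ^+ 2)) (eta 2 (e ^+ 2)) h0 h1 h2 => f0 f1 f2 h0 h1 h2.
have s0 : 0 < e^-1 by rewrite invr_gt0.
have d1 : `|r ^+ 2 - e ^+ 2| <= e ^+ 2.
  by rewrite ler_norml; have := sqr_ge0 r; move: re2 => ? ?; apply/andP; split; lra.
have ee : e * e^-1 = 1 by rewrite divff// gt_eqF.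
apply: (@le_trans _ _ (2 * e * (2^-1 * (A1 * e^-1 ^+ 3) + 2^-1 * (A2 * e^-1 ^+ 5) * e ^+ 2))).
  apply: ler_pM; rewrite ?mulr_ge0 ?normc_ge0//.
    by rewrite ler_wpM2l// (le_trans zr)// ltW.
  rewrite (le_trans (le_normcD _ _))// !normcM !normc_real lerD//.
    by rewrite (ger0_norm (_ : 0 <= 2^-1))// ler_wpM2l.
  rewrite (ger0_norm (_ : 0 <= 4^-1))//.
  apply: ler_pM => //; first by rewrite mulr_ge0 ?normc_ge0.
  by apply: ler_pM => //; [exact: normc_ge0|lra].
have -> : 2 * e * (2^-1 * (A1 * e^-1 ^+ 3) + 2^-1 * (A2 * e^-1 ^+ 5) * e ^+ 2) =
   (A1 + A2) * e^-1 ^+ 2 by field; rewrite gt_eqF.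
rewrite mulrDr; apply: (@le_trans _ _ (kbound * e^-1 ^+ 2)).
  by rewrite ler_wpM2r ?exprn_ge0 ?(ltW s0)//; move: k0 hC; lra.
by rewrite lerDr mulr_ge0 ?(ltW s0)// ltW// kbound_gt0.
Qed.

Lemma Kk_out e a y : 0 < e -> e <= enorm (y - a) -> Kk k e a y = 0.
Proof.
move=> e0 h; rewrite /Kk dipole_out// -enorm_sqr ler_sqr ?nnegrE ?enorm_ge0//.
exact: ltW.
Qed.

(** Together with the support in a ball of radius e, the height e^-3 keeps the total mass bounded as
    e tends to 0. *)
Lemma normc_Kk e a y : 0 < e -> e <= 1 -> normc (Kk k e a y) <= kbound * e^-1 ^+ 3.
Proof.
move=> e0 e1; have s0 : 0 < e^-1 by rewrite invr_gt0.
have [h|h] := leP e (enorm (y - a)).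
  by rewrite Kk_out// normc0 mulr_ge0 ?exprn_ge0 ?(ltW s0)// ltW// kbound_gt0.
rewrite /Kk -enorm_sqr; move: h; move: (enorm _) (enorm_ge0 (y - a)) => r r0 re.
have re2 : r ^+ 2 < e ^+ 2 by rewrite ltr_sqr ?nnegrE// ltW.
rewrite dipole_in//; have [h0 h1 h2] := small_eta e0 e1.
move: (eta 0 (e ^+ 2)) (eta 1 (e ^+ 2)) (eta 2 (e ^+ 2)) h0 h1 h2 => f0 f1 f2 h0 h1 h2.
have d1 : `|r ^+ 2 - e ^+ 2| <= e ^+ 2.
  by rewrite ler_norml; have := sqr_ge0 r; move: re2 => ? ?; apply/andP; split; lra.
have ee : e * e^-1 = 1 by rewrite divff// gt_eqF.
have k20 : 0 <= k ^+ 2 by rewrite exprn_ge0// ltW.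
have e21 : e ^+ 2 <= 1 by rewrite exprn_ile1// ltW.
rewrite normcM normc_real.
apply: (@le_trans _ _ (e ^+ 2 * (5 / 2 * (A2 * e^-1 ^+ 5) + k ^+ 2 * (A1 * e^-1 ^+ 3) + k ^+ 2 * (e ^+ 2) * (A2 * e^-1 ^+ 5)))).
  apply: ler_pM; rewrite ?normc_ge0//.
  rewrite (le_trans (le_normcD _ _))// lerD//; last first.
    rewrite normcM normc_real normrM (ger0_norm (_ : 0 <= k ^+ 2 / 8)) ?mulr_ge0//.
    apply: ler_pM => //; first by rewrite !mulr_ge0.
      exact: normc_ge0.
    by apply: ler_pM => //; [exact: mulr_ge0|rewrite ler_piMr//; lra].
  rewrite (le_trans (le_normcD _ _))// lerD//.
    by rewrite normcM normc_real (ger0_norm (_ : 0 <= 5 / 2))// ler_wpM2l.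
  rewrite normcM normc_real (ger0_norm (_ : 0 <= k ^+ 2 / 2)) ?mulr_ge0//.
  by apply: ler_pM => //; [exact: mulr_ge0|exact: normc_ge0|rewrite ler_piMr//; lra].
have -> : e ^+ 2 * (5 / 2 * (A2 * e^-1 ^+ 5) + k ^+ 2 * (A1 * e^-1 ^+ 3) + k ^+ 2 * (e ^+ 2) * (A2 * e^-1 ^+ 5))
  = (5 / 2 * A2 + e ^+ 2 * (k ^+ 2 * A1) + e ^+ 2 * (k ^+ 2 * A2)) * e^-1 ^+ 3.
  by field; rewrite gt_eqF.
rewrite ler_wpM2r ?exprn_ge0 ?(ltW s0)//.
have := ler_wpM2r kA1 e21; have := ler_wpM2r kA2 e21.
by rewrite /kbound !mul1r; move: A1_ge0 A2_ge0; lra.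
Qed.

Lemma expi_near1 (t : R) : normc (expi t - 1) <= 2 * `|t|.
Proof.
have := @cMVT_abs R (@expi R) (fun s => 'i * expi s) t 1.
rewrite expi0 mulr1; apply => x _; first exact: cd_expi.
by rewrite normcM normc_i mul1r normc_expi.
Qed.

(** For small ke one has [eta 2] (e^2) = e^-5 (3 + O(ke)), and the term 5/2 [eta 2] dominates the
    others; this fixes the sign inside the ball. The bound 1/100 is a comfortable margin. *)
Lemma Re_dipole e q : 0 < e -> e <= 1 -> k * e <= 100^-1 -> 0 <= q -> q < e ^+ 2 ->
  e^-1 ^+ 5 * (e ^+ 2 - q) <= - Re (dipole k e q).
Proof.
move=> e0 e1 ke q0 qe; rewrite dipole_in// ReZ -mulNr opprB mulrC ler_wpM2l ?subr_ge0 ?ltW//.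
have E0 : 0 < e ^+ 2 by rewrite exprn_gt0.
have se : Num.sqrt (e ^+ 2) = e by rewrite sqrtr_sqr ger0_norm// ltW.
have s0 : 0 < e^-1 by rewrite invr_gt0.
have t0 : 0 <= k * e by rewrite mulr_ge0 ?ltW.
have kE : k = (k * e) * e^-1 by rewrite mulfK// gt_eqF.
have [t tE] : exists t, t = k * e by exists (k * e).
rewrite -tE in ke t0 kE.
have n1 : normc (eta 1 (e ^+ 2)) <= (t + 1) * e^-1 ^+ 3.
  apply: le_trans (normc_eta1 k0 E0) _; rewrite se {1}kE; apply: le_of_eq; ring.
have n2 : normc (eta 2 (e ^+ 2) - (3 * e^-1 ^+ 5)%:C) <= 5^-1 * e^-1 ^+ 5.
  have kC : k%:C = t%:C * (e^-1)%:C :> R[i] by rewrite -rcM -kE.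
  have -> : eta 2 (e ^+ 2) - (3 * e^-1 ^+ 5)%:C = (e^-1 ^+ 5)%:C *
     ((expi t - 1) * (3%:C - (t ^+ 2)%:C - 'i * (3 * t)%:C) - (t ^+ 2)%:C - 'i * (3 * t)%:C).
    rewrite eta2E// se -tE kC !(rcM, rcX) kC -!rc_nat.
    move: (expi t) (e^-1)%:C t%:C => E S T; ring.
  rewrite normcZ (ger0_norm (exprn_ge0 5 (ltW s0))) [leRHS]mulrC ler_wpM2l ?exprn_ge0 ?(ltW s0)//.
  have b1 : normc (t ^+ 2)%:C <= 100^-1 :> R.
    by rewrite normc_real ger0_norm ?exprn_ge0//; nra.
  have b2 : normc ('i * (3 * t)%:C) <= 3 / 100 :> R.
    by rewrite normcM normc_i mul1r normc_real ger0_norm ?mulr_ge0//; lra.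
  rewrite (le_trans (le_normcB _ _))// (@le_trans _ _ (2 * 100^-1 * 4 + 100^-1 + 3 / 100))//; last by lra.
  rewrite lerD// (le_trans (le_normcB _ _))// lerD//.
  rewrite normcM ler_pM ?normc_ge0//.
    by rewrite (le_trans (expi_near1 _))// ger0_norm//; lra.
  rewrite (le_trans (le_normcB _ _))// (@le_trans _ _ (3 + 100^-1 + 3 / 100))//; last by lra.
  by rewrite lerD// (le_trans (le_normcB _ _))// lerD// normc_real ger0_norm.
have r2 : 28 / 10 * e^-1 ^+ 5 <= Re (eta 2 (e ^+ 2)).
  have := le_trans (normc_Re _) n2; rewrite ReB /= ler_norml => /andP[+ _]; lra.
have n2' : normc (eta 2 (e ^+ 2)) <= 4 * e^-1 ^+ 5.
  have := normc_triB (eta 2 (e ^+ 2)) (3 * e^-1 ^+ 5)%:C.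
  rewrite normc_real (ger0_norm (_ : 0 <= 3 * e^-1 ^+ 5)) ?mulr_ge0 ?exprn_ge0 ?(ltW s0)//.
  have : 0 <= e^-1 ^+ 5 by rewrite exprn_ge0 ?(ltW s0).
  by move: n2; lra.
rewrite !ReD !ReZ.
have ee : e * e^-1 = 1 by rewrite divff// gt_eqF.
have s5 : 0 <= e^-1 ^+ 5 by rewrite exprn_ge0 ?(ltW s0).
have t2 : t ^+ 2 <= 100^-1 by nra.
have b1 : - (100^-1 * e^-1 ^+ 5) <= k ^+ 2 / 2 * Re (eta 1 (e ^+ 2)).
  rewrite lerNl -mulrN.
  apply: (@le_trans _ _ (k ^+ 2 / 2 * ((t + 1) * e^-1 ^+ 3))).
    rewrite ler_wpM2l ?mulr_ge0 ?exprn_ge0 ?(ltW k0)//.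
    by rewrite (le_trans _ n1)// (le_trans _ (normc_Re _))// -normrN ler_norm.
  rewrite {1}kE; have -> : (t * e^-1) ^+ 2 / 2 * ((t + 1) * e^-1 ^+ 3) = (t ^+ 2 / 2 * (t + 1)) * e^-1 ^+ 5 by ring.
  by rewrite ler_wpM2r//; nra.
have b2 : - (100^-1 * e^-1 ^+ 5) <= k ^+ 2 / 8 * (q - e ^+ 2) * Re (eta 2 (e ^+ 2)).
  rewrite lerNl; apply: (@le_trans _ _ (k ^+ 2 / 8 * (e ^+ 2) * (4 * e^-1 ^+ 5))).
    have -> : - (k ^+ 2 / 8 * (q - e ^+ 2) * Re (eta 2 (e ^+ 2))) = k ^+ 2 / 8 * (e ^+ 2 - q) * Re (eta 2 (e ^+ 2)) by ring.
    rewrite ler_pM//.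
    - by rewrite !mulr_ge0 ?exprn_ge0 ?subr_ge0 ?ltW.
    - by rewrite (le_trans _ r2)// mulr_ge0.
    - by rewrite ler_wpM2l ?mulr_ge0 ?exprn_ge0 ?(ltW k0)// gerBl.
    - by rewrite (le_trans _ n2')// (le_trans _ (normc_Re _))// ler_norm.
  have -> : k ^+ 2 / 8 * e ^+ 2 * (4 * e^-1 ^+ 5) = (t ^+ 2 / 2) * e^-1 ^+ 5.
    by rewrite tE; field; rewrite gt_eqF.
  by rewrite ler_wpM2r//; lra.
have s5' : 0 < e^-1 ^+ 5 by exact: exprn_gt0.
by move: b1 b2 r2 s5'; lra.
Qed.

End kernel_bounds.

(** * Plane waves *)

Section plane_waves.
Variable R : realType.
Local Notation V := 'rV[R]_3.
Local Notation e_ i := (delta_mx 0 i : V).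
Local Notation Re := (@complex.Re R).
Local Notation Im := (@complex.Im R).
Implicit Types (f g : V -> R[i]) (x y a : V) (O : set V) (i : 'I_3).

Lemma CkC_intro n O f (df : 'I_3 -> V -> R[i]) :
  (forall x, O x -> ccontinuous_at x f) ->
  (forall i x, O x -> cderive x (e_ i) f (df i x)) ->
  (forall i, CkC n O (cpd i f)) -> CkC n.+1 O f.
Proof.
move=> cf d cdf; split.
- apply: (@Ck_intro _ _ _ _ (fun i x => Re (df i x))).
  + by move=> x /cf[].
  + by move=> i x /(d i)[].
  + by move=> i; have [] := cdf i.
- apply: (@Ck_intro _ _ _ _ (fun i x => Im (df i x))).
  + by move=> x /cf[].
  + by move=> i x /(d i)[].
  + by move=> i; have [] := cdf i.
Qed.

Lemma d_dot (alpha x v : V) : is_derive x v (fun y => dot alpha y) (dot alpha v).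
Proof. by apply: d_sum => i; exact: dZ (d_coord i x v). Qed.

Lemma cderive_plane_wave (k : R) alpha x v :
  cderive x v (plane_wave k alpha) ('i * (k * dot alpha v)%:C * plane_wave k alpha x).
Proof.
apply: cderive_eq (@cdchain R V x v (@expi R) (fun y => k * dot alpha y) _ _
  (cd_expi (k * dot alpha x)) (dZ k (d_dot alpha x v))) _.
by rewrite /plane_wave mulrAC.
Qed.

Lemma plane_wave_CkC (k : R) alpha n : CkC n setT (plane_wave k alpha).
Proof.
have cp x : ccontinuous_at x (plane_wave k alpha).
  apply: (@cc_comp R _ _ (fun y => k * dot alpha y) (@expi R)); last exact: cc_expi.
  by apply: contM; [exact: contC|exact: dot_cont].
elim: n => [|n IH]; first by split; split => // x _; have [] := cp x.
have d i x : setT x -> cderive x (e_ i) (plane_wave k alpha)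
  ('i * (k * dot alpha (e_ i))%:C * plane_wave k alpha x).
  by move=> _; exact: cderive_plane_wave.
apply: (CkC_intro _ d) => [x _|i]; first exact: cp.
apply: (CkC_eq openT _ (CkCM openT (CkC_cst n ('i * (k * dot alpha (e_ i))%:C) openT) IH)).
by move=> x _; rewrite (cpd_cderive (d i x I)).
Qed.

Lemma plane_wave_helmholtz (k : R) alpha x : dot alpha alpha = 1 ->
  claplacian (plane_wave k alpha) x + (k ^+ 2)%:C * plane_wave k alpha x = 0.
Proof.
move=> a1; rewrite claplacianE.
have E i y : cpd i (plane_wave k alpha) y = 'i * (k * dot alpha (e_ i))%:C * plane_wave k alpha y.
  exact: cpd_cderive (cderive_plane_wave _ _ _ _).
have E2 i : cpd i (cpd i (plane_wave k alpha)) x = - ((k ^+ 2 * (alpha 0 i * alpha 0 i))%:C * plane_wave k alpha x).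
  rewrite (_ : cpd i (plane_wave k alpha) = fun y => 'i * (k * dot alpha (e_ i))%:C * plane_wave k alpha y); last exact/funext/E.
  rewrite (cpd_cderive (cdZ _ (cderive_plane_wave k alpha x (e_ i)))).
  have -> : dot alpha (e_ i) = alpha 0 i.
    by rewrite /dot (bigD1 i)//= delta_coord eqxx mulr1 big1 ?addr0// => j ji;
      rewrite delta_coord eq_sym (negbTE ji) mulr0.
  rewrite (_ : k ^+ 2 * (alpha 0 i * alpha 0 i) = k * alpha 0 i * (k * alpha 0 i)); last by ring.
  rewrite [in RHS](rcM (k * alpha 0 i) (k * alpha 0 i)); move: (k * alpha 0 i)%:C (plane_wave k alpha x) => c p.
  rewrite (_ : 'i * c * ('i * c * p) = 'i * 'i * (c * c * p)); last by rewrite !mulrA; congr (_ * _); rewrite -!mulrA; congr (_ * _); rewrite mulrCA.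
  by rewrite sqr_i' mulN1r.
rewrite (eq_bigr _ (fun i _ => E2 i)) sumrN -mulr_suml.
have -> : \sum_(i < 3) (k ^+ 2 * (alpha 0 i * alpha 0 i))%:C = (k ^+ 2)%:C :> R[i].
  apply: complex_eq; rewrite ?Re_sum ?Im_sum /=; last by rewrite big1.
  by rewrite -mulr_sumr -[X in _ * X]/(dot alpha alpha) a1 mulr1.
by rewrite addNr.
Qed.

(** A real entire solution with value 1 at [a] and positive near it: the reference function against
    which the mass of the regularized delta is measured. *)
Definition coswave (k : R) a y : R[i] := (cos (k * (y - a) 0 0))%:C.

Lemma coswave_reP (k : R) y : coswave k 0 y = (reP (plane_wave k (e_ 0)) y)%:C.
Proof.
rewrite /coswave /reP /plane_wave /= subr0; congr (cos (_ * _))%:C.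
by rewrite dotE !delta_coord /= !mul0r mul1r !addr0.
Qed.

Lemma coswave_CkC (k : R) n : CkC n setT (coswave k 0).
Proof.
rewrite (_ : coswave k 0 = fun y => (reP (plane_wave k (e_ 0)) y)%:C); last exact/funext/coswave_reP.
by apply: CkC_real; [exact: openT|have [] := plane_wave_CkC k (e_ 0) n].
Qed.

Lemma coswave_helmholtz (k : R) y : claplacian (coswave k 0) y + (k ^+ 2)%:C * coswave k 0 y = 0.
Proof.
rewrite (_ : coswave k 0 = fun y => (reP (plane_wave k (e_ 0)) y)%:C); last exact/funext/coswave_reP.
have H : dot (e_ 0) (e_ 0) = 1 by rewrite dotE !delta_coord /= !mul0r mul1r !addr0.
have := plane_wave_helmholtz k y H => /(congr1 Re); rewrite ReD ReZ /= => h.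
apply: complex_eq; rewrite ?ReD ?ImD ?ReZ ?ImZ /=.
  by rewrite -[RHS]h.
rewrite mulr0 addr0 /laplacian big1// => i _.
have E : pd i (imP (fun y => (reP (plane_wave k (e_ 0)) y)%:C)) = fun=> 0.
  by apply/funext => z; apply: pd_is_derive; exact: dC.
by rewrite E; apply: pd_is_derive; exact: dC.
Qed.

Lemma I3_ge_box (f : V -> R) (c d : R) : Cc f -> (forall x, 0 <= f x) -> 0 < d -> 0 <= c ->
  (forall x, `|x| <= d -> c <= f x) -> c * (2 * d) ^+ 3 <= I3 f.
Proof.
move=> cf f0 d0 c0 fc; rewrite I3E.
have iZ := @integrable_indic_box R d (ltW d0).
have -> : c * (2 * d) ^+ 3 = \int[leb3 R]_p (c * (\1_(@vec3 R @^-1` box d : set (measurableTypeR R * measurableTypeR R * measurableTypeR R)) p)).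
  rewrite RintegralZl// /Rintegral integral_indic//; last exact: measurable_box (ltW d0).
  by rewrite setIT leb3_box// ltW.
apply: le_Rintegral => //.
- rewrite (_ : EFin \o _ = (fun p => c%:E * (EFin \o (\1_(@vec3 R @^-1` box d : set (measurableTypeR R * measurableTypeR R * measurableTypeR R)) : (measurableTypeR R * measurableTypeR R * measurableTypeR R)%type -> R)) p)%E).
    exact: integrableZl.
  by apply/funext => p /=; rewrite EFinM.
- exact: Cc_integrable.
- move=> p _; rewrite indicE; case: (boolP (p \in _)) => [|_]; last by rewrite mulr0; exact: f0.
  by rewrite inE mulr1 => /fc.
Qed.

End plane_waves.

(** * The regularized delta function *)

Section delta.
Variables (R : realType) (k : R).
Hypothesis k0 : 0 < k.
Local Notation V := 'rV[R]_3.
Local Notation e_ i := (delta_mx 0 i : V).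
Local Notation Re := (@complex.Re R).
Implicit Types (f g : V -> R[i]) (x y a : V) (O : set V) (i : 'I_3) (e r : R).

Definition cbump a r : V -> R[i] := fun y => (bump a r y)%:C.

(* [Kk r a + Wk r a] is the Helmholtz operator applied to the cut off
   fundamental solution; [Wk r a] is supported in [r <= |y - a| <= 2 r]. *)
Definition Wk r a y : R[i] :=
  2%:R * (\sum_(i < 3) cpd i (cbump a r) y * cpd i (Gk k r a) y) +
  claplacian (cbump a r) y * Gk k r a y.

Lemma cbump_CkC n a r : (n <= 3)%N -> CkC n setT (cbump a r).
Proof. by move=> n3; apply: CkC_real; [exact: openT|exact: Ck_bump]. Qed.

Lemma enorm_near a x r : enorm (x - a) < r -> \near x, enorm (x - a) < r.
Proof.
move=> h; apply: (open_nbhs_nbhs (A := [set y | enorm (y - a) < r])); split => //.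
apply: (@open_comp _ _ (fun y : V => enorm (y - a)) [set t | t < r]); last exact: open_lt.
move=> z _; apply: (@continuous_comp _ _ _ (fun y => y - a) (@enorm R)); first exact: shift_cont.
exact: enorm_cont.
Qed.

Lemma enorm_near_gt a x r : r < enorm (x - a) -> \near x, r < enorm (x - a).
Proof.
move=> h; apply: (open_nbhs_nbhs (A := [set y | r < enorm (y - a)])); split => //.
apply: (@open_comp _ _ (fun y : V => enorm (y - a)) [set t | r < t]); last exact: open_gt.
move=> z _; apply: (@continuous_comp _ _ _ (fun y => y - a) (@enorm R)); first exact: shift_cont.
exact: enorm_cont.
Qed.

Lemma cpd_near_cst f x i (c : R[i]) : (\near x, f x = c) -> cpd i f x = 0.
Proof.
by move=> h; apply: cpd_cderive; apply: cd_near (cdC x (e_ i) c); apply: filterS h => y ->.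
Qed.

Lemma claplacian_near_cst f x (c : R[i]) : (\near x, f x = c) -> claplacian f x = 0.
Proof.
move=> h; rewrite claplacianE big1// => i _; apply: (@cpd_near_cst _ _ _ 0).
by have := nbhs_interior h; apply: filterS => y; exact: cpd_near_cst.
Qed.

Lemma cbump_near1 a r y : 0 < r -> enorm (y - a) < r -> \near y, cbump a r y = 1.
Proof.
move=> r0 /enorm_near; apply: filterS => z /ltW h.
by rewrite /cbump bump_in.
Qed.

Lemma cbump_near0 a r y : 0 < r -> 2 * r < enorm (y - a) -> \near y, cbump a r y = 0.
Proof.
move=> r0 /enorm_near_gt; apply: filterS => z /ltW h.
by rewrite /cbump bump_out.
Qed.

Lemma Wk_in r a y : 0 < r -> enorm (y - a) < r -> Wk r a y = 0.
Proof.
move=> r0 h; have n := cbump_near1 r0 h.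
by rewrite /Wk big1 ?(claplacian_near_cst n) ?mul0r ?mulr0 ?addr0// => i _; rewrite (cpd_near_cst i n) mul0r.
Qed.

Lemma Wk_out r a y : 0 < r -> 2 * r < enorm (y - a) -> Wk r a y = 0.
Proof.
move=> r0 h; have n := cbump_near0 r0 h.
by rewrite /Wk big1 ?(claplacian_near_cst n) ?mul0r ?mulr0 ?addr0// => i _; rewrite (cpd_near_cst i n) mul0r.
Qed.

Lemma Gk_far e a y : 0 < e -> e <= enorm (y - a) -> Gk k e a y = eta k 0 (dot (y - a) (y - a)).
Proof.
by move=> e0 h; rewrite /Gk regE// -enorm_sqr ler_sqr ?nnegrE ?enorm_ge0// ltW.
Qed.

Lemma cpd_Gk_far e a i y : 0 < e -> e <= enorm (y - a) ->
  cpd i (Gk k e a) y = ((y - a) 0 i)%:C * eta k 1 (dot (y - a) (y - a)).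
Proof.
move=> e0 h; rewrite cpd_Gk// reg1E; last by rewrite -enorm_sqr ler_sqr ?nnegrE ?enorm_ge0// ltW.
rewrite mulrA; congr (_ * _); rewrite -rcM; congr (_%:C); by field.
Qed.

(** Where the cutoff varies, the kernels at scales e and r coincide; so e enters the first term only
    and can be sent to 0 there, while the second stays fixed. *)
Lemma cutoff_kernel e r a y : 0 < e -> e <= r ->
  claplacian (fun y => cbump a r y * Gk k e a y) y + (k ^+ 2)%:C * (cbump a r y * Gk k e a y) =
  Kk k e a y + Wk r a y.
Proof.
move=> e0 er; have r0 : 0 < r by apply: lt_le_trans er.
rewrite (@claplacianM _ setT) //; [|exact: openT|exact: cbump_CkC|exact: Gk_CkC openT e0].
transitivity (cbump a r y * (claplacian (Gk k e a) y + (k ^+ 2)%:C * Gk k e a y) +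
  (2%:R * (\sum_(i < 3) cpd i (cbump a r) y * cpd i (Gk k e a) y) + claplacian (cbump a r) y * Gk k e a y)).
  move: (claplacian _ _) (\sum_(i < 3) _) (claplacian _ _) (k ^+ 2)%:C (cbump a r y) (Gk k e a y) => A B C D E F.
  by ring.
rewrite claplacian_Gk//; congr (_ + _).
  have [h|h] := leP e (enorm (y - a)); first by rewrite Kk_out// mulr0.
  by rewrite /cbump bump_in ?mul1r// ltW// (lt_le_trans h).
have [h|h] := ltP (enorm (y - a)) r.
  have n := cbump_near1 r0 h; rewrite Wk_in// (claplacian_near_cst n) big1 ?mul0r ?mulr0 ?addr0// => i _.
  by rewrite (cpd_near_cst i n) mul0r.
have h' := le_trans er h.
have E : Gk k e a y = Gk k r a y by rewrite (Gk_far r0 h) (Gk_far e0 h').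
have E2 i : cpd i (Gk k e a) y = cpd i (Gk k r a) y by rewrite (cpd_Gk_far i r0 h) (cpd_Gk_far i e0 h').
by rewrite /Wk E; under eq_bigr => i _ do rewrite E2.
Qed.

Lemma cc_near f g x : (\near x, f x = g x) -> ccontinuous_at x f -> ccontinuous_at x g.
Proof.
move=> n [c1 c2]; have e0 := nbhs_singleton n.
split; rewrite /prop_for /continuous_at.
- have -> : reP g x = reP f x by rewrite /reP e0.
  apply: cvg_trans c1; apply: (@near_eq_cvg _ _ (nbhs x) _ (reP f) (reP g)).
  by apply: filterS n => y; rewrite /reP => ->.
- have -> : imP g x = imP f x by rewrite /imP e0.
  apply: cvg_trans c2; apply: (@near_eq_cvg _ _ (nbhs x) _ (imP f) (imP g)).
  by apply: filterS n => y; rewrite /imP => ->.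
Qed.

Lemma supp_out a y r : r + `|a| < `|y| -> r < enorm (y - a).
Proof.
rewrite -ltrBrDr => h; apply: lt_le_trans h _; apply: le_trans (norm_le_enorm _).
by rewrite lerBlDr -{1}(subrK a y) ler_normD.
Qed.

Section local.
Variables (O : set V) (f : V -> R[i]) (a : V) (r : R).
Hypotheses (oO : open O) (r0 : 0 < r) (aO : forall y, enorm (y - a) <= 2 * r -> O y).
Hypothesis cf : forall x, O x -> ccontinuous_at x f.

Lemma off_ball y : ~ O y -> 2 * r < enorm (y - a).
Proof. by move=> nO; rewrite ltNge; apply/negP => /aO. Qed.

Lemma CCc_local (h : V -> R[i]) : (forall x, ccontinuous_at x h) ->
  (forall y, 2 * r < enorm (y - a) -> h y = 0) -> CCc (fun y => f y * h y).
Proof.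
move=> ch h0; apply: (@CCc_intro _ _ (2 * r + `|a|)).
  move=> x; have [Ox|/off_ball/enorm_near_gt n] := pselect (O x).
    by apply: ccM; [exact: cf|exact: ch].
  have n' : \near x, 0 = f x * h x by apply: filterS n => z hz; rewrite h0// mulr0.
  exact: cc_near n' (ccC x 0).
by move=> y /supp_out/h0 ->; rewrite mulr0.
Qed.

Lemma CCc_Kk e : 0 < e -> e <= r -> CCc (fun y => f y * Kk k e a y).
Proof.
move=> e0 er; apply: CCc_local => [x|y h]; first exact: Kk_cont.
by rewrite Kk_out//; move: r0 => ?; lra.
Qed.

End local.

Lemma Wk_cont r a y : 0 < r -> ccontinuous_at y (Wk r a).
Proof.
move=> r0; have cG := Gk_CkC k0 a openT r0.
have cb : CkC 2 setT (cbump a r) by exact: cbump_CkC.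
apply: ccD; apply: ccM.
- exact: ccC.
- apply: cc_sum => i; apply: ccM; [exact: CkC_cont (CkC_pd i cb) I|exact: CkC_cont (CkC_pd i cG) I].
- rewrite (_ : claplacian (cbump a r) = fun y => \sum_(i < 3) cpd i (cpd i (cbump a r)) y).
    by apply: cc_sum => i; exact: CkC_cont (CkC_pd i (CkC_pd i cb)) I.
  by apply/funext => z; rewrite claplacianE.
- exact: CkC_cont cG I.
Qed.

Lemma helmholtz_kernel O f a e r : open O -> 0 < e -> e <= r ->
  (forall y, enorm (y - a) <= 2 * r -> O y) -> CkC 2 O f ->
  (forall x, O x -> claplacian f x + (k ^+ 2)%:C * f x = 0) ->
  cI (fun y => f y * Kk k e a y) = - cI (fun y => f y * Wk r a y).
Proof.
move=> oO e0 er aO cf hf; have r0 : 0 < r by apply: lt_le_trans er.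
have cf0 x : O x -> ccontinuous_at x f by move=> Ox; exact: CkC_cont cf Ox.
apply/eqP; rewrite -addr_eq0 -cID; last 2 first.
- exact: (CCc_Kk r0 aO cf0 e0 er).
- apply: (CCc_local aO cf0) => [x|y h]; first exact: Wk_cont.
  exact: Wk_out.
apply/eqP; rewrite -[RHS](@cgreen R k O f (fun y => cbump a r y * Gk k e a y) (2 * r + `|a|) oO cf hf).
- congr cI; apply/funext => y; rewrite -mulrDr; congr (_ * _).
  by rewrite -cutoff_kernel.
- apply: CkCM; [exact: openT|exact: cbump_CkC|exact: Gk_CkC openT e0].
- move=> x /(off_ball aO) h; apply: filterS (cbump_near0 r0 h) => y ->; exact: mul0r.
- move=> x /supp_out h; by rewrite (nbhs_singleton (cbump_near0 r0 h)) mul0r.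
Qed.

(* Minus the integral of a plane wave against the regularized delta function
   [Kk e]: it does not depend on [e], and stands for the 4 pi of the
   fundamental solution. *)
Definition delta_const : R[i] := cI (fun y => coswave k 0 y * Wk 1 0 y).

Lemma Kk_shift e a y : Kk k e a y = Kk k e 0 (y - a).
Proof. by rewrite /Kk subr0. Qed.

Lemma coswave_cont a x : ccontinuous_at x (coswave k a).
Proof.
rewrite (_ : coswave k a = fun y => coswave k 0 (y - a)); last by apply/funext => y; rewrite /coswave subr0.
apply: (@cc_comp R _ _ (fun y => y - a) (coswave k 0)); first exact: shift_cont.
exact: CkC_cont (coswave_CkC k 0) I.
Qed.

Lemma coswave_Kk e a : 0 < e -> e <= 1 ->
  cI (fun y => coswave k a y * Kk k e a y) = - delta_const.
Proof.
move=> e0 e1.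
have H : cI (fun y => coswave k 0 y * Kk k e 0 y) = - delta_const.
  apply: (@helmholtz_kernel setT) => //; first exact: openT.
    exact: coswave_CkC.
  by move=> x _; exact: coswave_helmholtz.
rewrite -H -(@cI_translation _ (fun y => coswave k 0 y * Kk k e 0 y) (- a)).
  by congr cI; apply/funext => y; rewrite /coswave subr0 -Kk_shift.
by apply: (@CCc_Kk setT (coswave k 0) 0 1) => // x _; exact: coswave_cont.
Qed.

(** For small e the integrand cos times - Re [Kk] is nonnegative by [Re_dipole], and bounded below
    on a box, so the real part of the constant is positive. *)
Lemma delta_const_neq0 : delta_const != 0.
Proof.
pose e := Num.min 1 (100 * k)^-1.
have e0 : 0 < e by rewrite lt_min ltr01 invr_gt0 mulr_gt0.
have e1 : e <= 1 by rewrite ge_min lexx.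
have ke : k * e <= 100^-1.
  have h : e <= (100 * k)^-1 by rewrite ge_min lexx orbT.
  have -> : 100^-1 = k * (100 * k)^-1 by field; rewrite gt_eqF.
  by rewrite ler_pM2l.
have H := coswave_Kk (0 : V) e0 e1.
suff : 0 < Re delta_const by move=> h; apply: contraTneq h => ->; rewrite ltxx.
have -> : Re delta_const = I3 (fun y => cos (k * y 0 0) * - Re (Kk k e 0 y)).
  rewrite -[delta_const]opprK -H ReN /= -I3N.
    by congr I3; apply/funext => y; rewrite /reP /coswave ReZ subr0 mulrN.
  have [] // : CCc (fun y => coswave k 0 y * Kk k e 0 y).
  by apply: (@CCc_Kk setT (coswave k 0) 0 1) => // x _; exact: coswave_cont.
have key y : enorm y < e -> e^-1 ^+ 5 * (e ^+ 2 - dot y y) / 2 <= cos (k * y 0 0) * - Re (Kk k e 0 y) /\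
    0 <= e^-1 ^+ 5 * (e ^+ 2 - dot y y) / 2.
  move=> ye.
  have qe : dot y y < e ^+ 2 by rewrite -enorm_sqr ltr_sqr ?nnegrE ?enorm_ge0// ltW.
  have := Re_dipole k0 e0 e1 ke (dot_ge0 y) qe => hd.
  have p0 : 0 <= e^-1 ^+ 5 * (e ^+ 2 - dot y y).
    by rewrite mulr_ge0 ?exprn_ge0 ?invr_ge0 ?(ltW e0)// subr_ge0 ltW.
  split; last by rewrite divr_ge0.
  rewrite /Kk subr0; have c2 : 1 / 2 <= cos (k * y 0 0).
    have := le_trans (normc_Re _) (expi_near1 (k * y 0 0)); rewrite ReB /= ler_norml => /andP[+ _].
    have : `|k * y 0 0| <= 100^-1.
      rewrite normrM (ger0_norm (ltW k0)); apply: le_trans ke.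
      by rewrite ler_pM2l// (le_trans (coord_le_enorm y 0))// ltW.
    by lra.
  by nra.
(* In the box of half-side e/4 the Euclidean norm is at most e/2, so e^2 - |y|^2 >= e^2/2; the
   cosine accounts for the other factor 1/2. *)
apply: lt_le_trans (_ : e^-1 ^+ 5 * (e ^+ 2 / 2) / 2 * (2 * (e / 4)) ^+ 3 <= _).
  by rewrite !mulr_gt0 ?exprn_gt0 ?mulr_gt0 ?invr_gt0 ?exprn_gt0.
apply: I3_ge_box.
- have [h _] : CCc (fun y => coswave k 0 y * - Kk k e 0 y).
    rewrite (_ : (fun y => _) = fun y => (-1) * (coswave k 0 y * Kk k e 0 y)).
      by apply: CCcZ; apply: (@CCc_Kk setT (coswave k 0) 0 1) => // x _; exact: coswave_cont.
    by apply/funext => y; rewrite mulrN mulN1r.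
  by apply: (eq_ind _ (@Cc R) h); apply/funext => y; rewrite /reP /coswave ReZ subr0 ReN.
- move=> y; have [/key[h1 h2]|h] := ltP (enorm y) e; first exact: le_trans h1.
  by rewrite Kk_out ?subr0//= oppr0 mulr0.
- by rewrite divr_gt0.
- by rewrite !mulr_ge0 ?exprn_ge0 ?invr_ge0// ltW.
- move=> y hy; have hn : enorm y <= e / 2.
    by rewrite (le_trans (enorm_le_norm y))//; lra.
  have [|h1 h2] := key y; first by rewrite (le_lt_trans hn)//; move: e0; lra.
  apply: le_trans h1; rewrite ler_pM2r// ler_pM2l ?exprn_gt0 ?invr_gt0//.
  have := enorm_sqr y; have : enorm y ^+ 2 <= (e / 2) ^+ 2.
    by rewrite ler_sqr ?nnegrE ?enorm_ge0// divr_ge0// ltW.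
  by rewrite expr_div_n; have := exprn_gt0 2 e0; lra.
Qed.

(** Subtracting f(a) times the cosine wave, whose pairing is known exactly, leaves a function that
    vanishes at [a] and is tested on a kernel of bounded mass shrinking to [a]. *)
Lemma delta_bound O f a r (eps : R) : 0 < r ->
  (forall y, enorm (y - a) <= 2 * r -> O y) ->
  (forall x, O x -> ccontinuous_at x f) -> 0 < eps ->
  exists2 d : R, 0 < d & forall e, 0 < e -> e < d ->
    normc (cI (fun y => f y * Kk k e a y) + delta_const * f a) <= eps.
Proof.
move=> r0 aO cf eps0.
have aa : O a by apply: aO; rewrite subrr enorm0 mulr_ge0// ltW.
pose F y := f y - f a * coswave k a y.
have Fa : F a = 0 by rewrite /F /coswave subrr mxE mulr0 cos0 mulr1 subrr.
have cF : {for a, continuous (fun y => normc (F y))}.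
  apply: cc_norm; apply: ccB; first exact: cf.
  by apply: ccM; [exact: ccC|exact: coswave_cont].
have kb := kbound_gt0 k0.
(* 16 is the factor 2 of [cI_bound] times 2^3, from the volume (2 e)^3 against the height e^-3. *)
have t0 : 0 < eps / (16 * kbound k) by rewrite divr_gt0 ?mulr_gt0.
have [d d0 hd] := cont_ball cF t0.
exists (Num.min d (Num.min r 1)); first by rewrite !lt_min d0 r0 ltr01.
move=> e e0; rewrite !lt_min => /andP[ed /andP[/ltW er /ltW e1]].
have c1 := CCc_Kk r0 aO cf e0 er.
have c2 : CCc (fun y => coswave k a y * Kk k e a y).
  by apply: (@CCc_Kk setT (coswave k a) a r) => // x _; exact: coswave_cont.
have E : cI (fun y => F y * Kk k e a y) = cI (fun y => f y * Kk k e a y) + delta_const * f a.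
  rewrite (_ : (fun y => F y * _) = fun y => f y * Kk k e a y - f a * (coswave k a y * Kk k e a y)).
    by rewrite cIB// ?cIZ// ?coswave_Kk//; [rewrite mulrN opprK mulrC|exact: CCcZ].
  by apply/funext => y; rewrite /F mulrBl mulrA.
have cFK : CCc (fun y => F y * Kk k e a y).
  rewrite (_ : (fun y => _) = fun y => f y * Kk k e a y - f a * (coswave k a y * Kk k e a y)).
    by apply: CCcB => //; exact: CCcZ.
  by apply/funext => y; rewrite /F mulrBl mulrA.
rewrite -E -(cI_translation a cFK).
apply: le_trans (cI_bound (B := eps / (16 * kbound k) * (kbound k * e^-1 ^+ 3)) (ltW e0) (CCc_shift a cFK) _ _) _.
- move=> y ye; rewrite /= Kk_out ?mulr0//; rewrite addrK.
  by rewrite (le_trans (ltW ye))// norm_le_enorm.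
- move=> y; have [h|h] := leP e (enorm y).
    rewrite Kk_out ?addrK// mulr0 normc0 !mulr_ge0 ?exprn_ge0 ?invr_ge0 ?mulr_ge0 ?(ltW eps0) ?(ltW kb)//; exact: ltW.
  rewrite normcM; apply: ler_pM; rewrite ?normc_ge0//; last exact: normc_Kk.
  have := hd (y + a); rewrite addrK Fa normc0 subr0 => H.
  have /H : `|y| < d by rewrite (le_lt_trans (norm_le_enorm _))// (lt_trans h).
  by rewrite ger0_norm ?normc_ge0// => /ltW.
- apply: le_of_eq; field.
  by rewrite (gt_eqF e0) (gt_eqF kb).
Qed.

Lemma normc_eq0_le (z w : R[i]) : (forall e : R, 0 < e -> normc (z - w) <= e) -> z = w.
Proof.
move=> h; apply/eqP; rewrite -subr_eq0; apply/eqP/eq0_normc/eqP.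
rewrite eq_le normc_ge0 andbT; apply/ler_addgt0Pr => e e0; rewrite add0r; exact: h.
Qed.

(** The left side does not involve e: by [helmholtz_kernel] it is minus the pairing with [Kk e a]
    for every small e, whose limit is known. *)
Lemma helmholtz_mean O f a r : open O -> 0 < r ->
  (forall y, enorm (y - a) <= 2 * r -> O y) -> CkC 2 O f ->
  (forall x, O x -> claplacian f x + (k ^+ 2)%:C * f x = 0) ->
  cI (fun y => f y * Wk r a y) = delta_const * f a.
Proof.
move=> oO r0 aO cf hf; apply: normc_eq0_le => eps eps0.
have cf0 x : O x -> ccontinuous_at x f by move=> Ox; exact: CkC_cont cf Ox.
have [d d0 hd] := delta_bound r0 aO cf0 eps0.
pose e := Num.min (d / 2) r.
have e0 : 0 < e by rewrite lt_min divr_gt0.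
have er : e <= r by rewrite ge_min lexx orbT.
have ed : e < d by rewrite (@le_lt_trans _ _ (d / 2)) ?ge_min ?lexx//; move: d0; lra.
have := hd e e0 ed; rewrite (helmholtz_kernel oO e0 er aO cf hf).
by rewrite -normcN opprD opprK.
Qed.

End delta.

(** * Convolution with a compactly supported kernel *)

Section convolution.
Variable R : realType.
Local Notation V := 'rV[R]_3.
Local Notation e_ i := (delta_mx 0 i : V).
Local Notation Re := (@complex.Re R).
Local Notation Im := (@complex.Im R).
Implicit Types (f g h om : V -> R[i]) (x y a z : V) (O : set V) (i : 'I_3).

Lemma cderive_line f v x (t : R) (a : R[i]) :
  cderive (t *: v + x) v f a <-> cderive t (1 : R) (fun s : R => f (s *: v + x)) a.
Proof. by split => -[h1 h2]; split; apply/(is_derive_line _ v x t). Qed.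

Lemma cderive_eps f v x (a : R[i]) :
  (forall e : R, 0 < e -> exists2 d : R, 0 < d & forall t : R, `|t| < d ->
     normc (f (t *: v + x) - f x - t%:C * a) <= e * `|t|) -> cderive x v f a.
Proof.
move=> H; split; apply/is_derive_line0/is_derive_epsP => e /H[d d0 hd];
  exists d => // t /hd; rewrite addr0 scale0r add0r; apply: le_trans.
- by apply: le_trans (normc_Re _); rewrite !ReB ReZ mulrC.
- by apply: le_trans (normc_Im _); rewrite !ImB ImZ mulrC.
Qed.

Lemma cd_id (t : R) : cderive t (1 : R) (fun s : R => s%:C) 1.
Proof.
rewrite (_ : (fun s : R => s%:C) = fun s : R => (s - 0)%:C :> R[i]); last by apply/funext => s; rewrite subr0.
apply: cd_real; apply: is_derive_eq (dB (is_derive_id t (1 : R)) (dC 0 t (1 : R))) _.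
by rewrite subr0.
Qed.

Lemma CCc_pd om M i : CkC 1 setT om -> cvanish_out M om -> CCc (cpd i om).
Proof.
move=> c v; apply: (@CCc_intro _ _ M); last exact: cvanish_out_pd.
by move=> x; exact: (CkC_cont (CkC_pd i c)).
Qed.

Lemma CkC0 O f : (forall x, O x -> ccontinuous_at x f) -> CkC 0 O f.
Proof. by move=> c; split; split=> [x /c[]|]. Qed.

Lemma cont_eps (f : V -> R) x :
  (forall e : R, 0 < e -> exists2 d : R, 0 < d & forall y, `|y - x| < d -> `|f y - f x| <= e) ->
  {for x, continuous f}.
Proof.
move=> H; rewrite /prop_for /continuous_at.
apply/(@cvgrPdist_le _ _ _ (nbhs x) _ f (f x)) => e e0; have [d d0 hd] := H e e0.
apply/nbhs_ballP; exists d => // y; rewrite -ball_normE => h.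
by rewrite distrC; apply: hd; rewrite distrC; exact: h.
Qed.

Lemma cc_eps f x :
  (forall e : R, 0 < e -> exists2 d : R, 0 < d & forall y, `|y - x| < d -> normc (f y - f x) <= e) ->
  ccontinuous_at x f.
Proof.
move=> H; split; apply: cont_eps => e /H[d d0 hd]; exists d => // y /hd; apply: le_trans.
- by rewrite /reP -ReB normc_Re.
- by rewrite /imP -ImB normc_Im.
Qed.

Lemma CCc_unif f (e : R) : CCc f -> 0 < e ->
  exists2 d : R, 0 < d & forall x y, `|y - x| < d -> normc (f y - f x) <= e.
Proof.
move=> [c1 c2] e0; have e2 : 0 < e / 2 by rewrite divr_gt0.
have [d1 d10 h1] := Cc_unif c1 e2; have [d2 d20 h2] := Cc_unif c2 e2.
exists (Num.min d1 d2); first by rewrite lt_min d10.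
move=> x y; rewrite lt_min => /andP[/h1 a1 /h2 a2].
apply: le_trans (normc_le_ReIm _) _; rewrite ReB ImB.
by rewrite [leRHS]splitr lerD// ltW.
Qed.

Lemma CCc_bounded f : CCc f -> exists2 B : R, 0 <= B & forall x, normc (f x) <= B.
Proof.
move=> [/Cc_bounded[B1 b1 h1] /Cc_bounded[B2 b2 h2]]; exists (B1 + B2); first exact: addr_ge0.
by move=> x; apply: le_trans (normc_le_ReIm _) _; exact: lerD (h1 x) (h2 x).
Qed.

Lemma C1_unif om M i (e : R) : CkC 1 setT om -> cvanish_out M om -> 0 < e ->
  exists2 d : R, 0 < d & forall z (s : R), `|s| < d ->
    normc (om (s *: e_ i + z) - om z - s%:C * cpd i om z) <= e * `|s|.
Proof.
move=> c v e0; have e2 : 0 < e / 2 by rewrite divr_gt0.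
have [d d0 hd] := CCc_unif (CCc_pd i c v) e2; exists d => // z s sd.
pose F (s : R) := om (s *: e_ i + z) - s%:C * cpd i om z.
have dF (t : R) : cderive t (1 : R) F (cpd i om (t *: e_ i + z) - cpd i om z).
  apply: cdB; first by apply/cderive_line; exact: CkC_cderive c I.
  apply: cderive_eq (cdM (cd_id t) (cdC t (1 : R) (cpd i om z))) _.
  by rewrite mulr0 addr0 mul1r.
have := @cMVT_abs R F _ s (e / 2) (fun t _ => dF t) _.
rewrite /F scale0r add0r mul0r subr0 addrAC mulrCA divff// mulr1; apply.
move=> t ts; apply: hd; rewrite addrK normrZ.
by apply: le_lt_trans sd; apply: le_trans ts; rewrite ler_piMr// norm_e.
Qed.

Lemma CCc_conv h om a : CCc h -> (forall x, ccontinuous_at x om) ->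
  CCc (fun y => h y * om (y - a)).
Proof.
move=> ch co; rewrite (_ : (fun _ => _) = fun y => om (y - a) * h y); last by apply/funext => y; rewrite mulrC.
apply: CCcM => // x; apply: (@cc_comp R _ _ (fun y => y - a) om) => //; exact: shift_cont.
Qed.

Lemma conv_estimate h : CCc h -> exists2 C : R, 0 < C & forall (F : V -> R[i]) (e : R),
  0 <= e -> CCc (fun y => h y * F y) -> (forall y, normc (F y) <= e) ->
  normc (cI (fun y => h y * F y)) <= C * e.
Proof.
move=> ch; have [B B0 hB] := CCc_bounded ch; have [M M0 hM] := CCc_vanish ch.
pose m : R := (2 * M) ^+ 3.
exists (2 * B * m + 1); first by rewrite ltr_pwDr// !mulr_ge0// exprn_ge0// mulr_ge0.
move=> F e e0 cF hF; apply: le_trans (cI_bound (M := M) (B := B * e) M0 cF _ _) _.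
- by move=> y /hM ->; rewrite mul0r.
- by move=> y; rewrite normcM ler_pM// normc_ge0.
- have -> : 2 * (B * e) * (2 * M) ^+ 3 = 2 * B * m * e by rewrite [RHS]mulrAC -!(mulrA 2).
  have -> : (2 * B * m + 1) * e = 2 * B * m * e + e by rewrite mulrDl mul1r.
  by rewrite lerDl.
Qed.

(** The difference quotients of the kernel converge uniformly ([C1_unif]), and integration against
    [h] is bounded in the sup norm. *)
Lemma conv_deriv h om M i a : CCc h -> CkC 1 setT om -> cvanish_out M om ->
  cderive a (e_ i) (fun a => cI (fun y => h y * om (y - a)))
    (- cI (fun y => h y * cpd i om (y - a))).
Proof.
move=> ch co vo; have [C C0 hC] := conv_estimate ch.
have co0 x : ccontinuous_at x om by exact: CkC_cont co I.
have cd0 x : ccontinuous_at x (cpd i om) by exact: CkC_cont (CkC_pd i co) I.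
apply: cderive_eps => e e0; have eC : 0 < e / C by rewrite divr_gt0.
have [d d0 hd] := C1_unif i co vo eC; exists d => // t td.
set a' := t *: e_ i + a.
have e1 := CCc_conv a' ch co0; have e2 := CCc_conv a ch co0; have e3 := CCc_conv a ch cd0.
have -> : cI (fun y => h y * om (y - a')) - cI (fun y => h y * om (y - a)) -
    t%:C * - cI (fun y => h y * cpd i om (y - a)) =
    cI (fun y => h y * (om (y - a') - om (y - a) - (- t)%:C * cpd i om (y - a))).
  rewrite (_ : (fun y => h y * (_ - _ - _)) = fun y => h y * om (y - a') - h y * om (y - a) - (- t)%:C * (h y * cpd i om (y - a))).
    by rewrite (cIB (CCcB e1 e2) (CCcZ _ e3)) (cIB e1 e2) (cIZ _ e3) rcN mulrN mulNr.
  by apply/funext => y; rewrite !mulrBr; congr (_ - _); rewrite mulrCA.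
apply: le_trans (hC _ (e / C * `|t|) _ _ _) _.
- by rewrite mulr_ge0// ltW.
- rewrite (_ : (fun y => h y * _) = fun y => h y * om (y - a') - h y * om (y - a) - (- t)%:C * (h y * cpd i om (y - a))).
    exact: CCcB (CCcB e1 e2) (CCcZ _ e3).
  by apply/funext => y; rewrite !mulrBr; congr (_ - _); rewrite mulrCA.
- move=> y; have -> : y - a' = (- t) *: e_ i + (y - a) by rewrite /a' scaleNr opprD addrCA addrA.
  by rewrite -[`|t|]normrN; apply: hd; rewrite normrN.
- by rewrite mulrA mulrCA divff ?gt_eqF// mulr1.
Qed.

Lemma conv_cont h om a : CCc h -> CCc om ->
  ccontinuous_at a (fun a => cI (fun y => h y * om (y - a))).
Proof.
move=> ch co; have [C C0 hC] := conv_estimate ch.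
have co0 x : ccontinuous_at x om by exact: CCc_cont.
apply: cc_eps => e e0; have eC : 0 < e / C by rewrite divr_gt0.
have [d d0 hd] := CCc_unif co eC; exists d => // a' ad.
have e1 := CCc_conv a' ch co0; have e2 := CCc_conv a ch co0.
rewrite -(cIB e1 e2).
rewrite (_ : (fun y => _) = fun y => h y * (om (y - a') - om (y - a))); last by apply/funext => y; rewrite mulrBr.
apply: le_trans (hC _ (e / C) (ltW eC) _ _) _.
- rewrite (_ : (fun y => _) = fun y => h y * om (y - a') - h y * om (y - a)); first exact: CCcB.
  by apply/funext => y; rewrite mulrBr.
- move=> y; apply: hd; have -> : y - a' - (y - a) = a - a' by rewrite opprB addrC addrA subrK.
  by rewrite distrC.
- by rewrite mulrCA divff ?gt_eqF// mulr1.
Qed.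

Lemma cpd_shift f a i : cpd i (fun y => f (y - a)) = fun y => cpd i f (y - a).
Proof.
have H (F : V -> R) y : pd i (fun y => F (y - a)) y = pd i F (y - a).
  have E : (fun t : R => t^-1 *: (((fun y => F (y - a)) \o shift y) (t *: e_ i) - F (y - a))) =
    (fun t : R => t^-1 *: ((F \o shift (y - a)) (t *: e_ i) - F (y - a))).
    by apply/funext => t /=; rewrite addrA.
  by rewrite /pd /derive E.
by apply/funext => y; rewrite /cpd /reP /imP (H (fun y => Re (f y))) (H (fun y => Im (f y))).
Qed.

Lemma cderive_shift f a x v (b : R[i]) :
  cderive (x - a) v f b -> cderive x v (fun y => f (y - a)) b.
Proof.
have -> : x - a = 0 *: v + (x - a) by rewrite scale0r add0r.
move/cderive_line => h; have : cderive (0 *: v + x) v (fun y => f (y - a)) b.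
  apply/cderive_line; rewrite (_ : (fun _ => _) = fun s : R => f (s *: v + (x - a)))//.
  by apply/funext => s; rewrite addrA.
by rewrite scale0r add0r.
Qed.

End convolution.

(** * The mean value property *)

Section mean_value_property.
Variables (R : realType) (k : R).
Hypothesis k0 : 0 < k.
Local Notation V := 'rV[R]_3.
Local Notation e_ i := (delta_mx 0 i : V).
Local Notation W := (Wk k).
Implicit Types (f g h om : V -> R[i]) (x y a z : V) (O : set V) (i : 'I_3) (r s : R).

Lemma Wk_shift r a y : W r a y = W r 0 (y - a).
Proof.
have E1 : cbump a r = fun y => cbump 0 r (y - a) by apply/funext => z; rewrite /cbump /bump subr0.
have E2 : Gk k r a = fun y => Gk k r 0 (y - a) by apply/funext => z; rewrite /Gk subr0.
have E3 i : cpd i (cbump a r) = fun y => cpd i (cbump 0 r) (y - a) by rewrite E1 (cpd_shift (cbump 0 r)).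
have E4 i : cpd i (Gk k r a) = fun y => cpd i (Gk k r 0) (y - a) by rewrite E2 (cpd_shift (Gk k r 0)).
have E5 : claplacian (cbump a r) y = claplacian (cbump 0 r) (y - a).
  by rewrite !claplacianE; apply: eq_bigr => i _; rewrite E3 (cpd_shift (cpd i (cbump 0 r))).
have E6 : Gk k r a y = Gk k r 0 (y - a) by rewrite E2.
have H (A B A' B' : R[i]) : A = A' -> B = B' -> 2%:R * A + B = 2%:R * A' + B' by move=> -> ->.
rewrite /Wk; apply: H; last by rewrite E5 E6.
by apply: eq_bigr => i _; rewrite E3 E4.
Qed.

Local Opaque Wk cpd cI.

Lemma Wk_CkC1 r : 0 < r -> CkC 1 setT (W r 0).
Proof.
Transparent Wk.
move=> r0; have cG := Gk_CkC k0 0 openT r0.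
have cb : CkC 3 setT (cbump (0 : V) r) by exact: cbump_CkC.
apply: CkCD; first exact: openT.
- apply: CkCM; [exact: openT|exact: CkC_cst openT|].
  apply: CkC_sum; first exact: openT.
  by move=> i; apply: CkCM; [exact: openT|apply: CkC_leq (CkC_pd i cb)|exact: CkC_pd].
- apply: CkCM; [exact: openT| |exact: CkC_leq cG].
  rewrite (_ : claplacian (cbump 0 r) = fun y => \sum_(i < 3) cpd i (cpd i (cbump 0 r)) y).
    by apply: CkC_sum; [exact: openT|move=> i; exact: CkC_pd (CkC_pd i cb)].
  by apply/funext => z; rewrite claplacianE.
Opaque Wk.
Qed.

Lemma Wk_vanish r : 0 < r -> cvanish_out (2 * r) (W r 0).
Proof. by move=> r0 x h; rewrite Wk_out// subr0 (lt_le_trans h)// norm_le_enorm. Qed.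

(* A weak form of the Helmholtz equation: [W r a] is what remains of the
   equation for the cut off fundamental solution with pole [a], so that a
   solution reproduces itself. It is stable under differentiation. *)
Definition mvp O f := (forall x, O x -> ccontinuous_at x f) /\
  forall a r s, 0 < r -> 2 * r < s -> (forall y, enorm (y - a) < s -> O y) ->
    cI (fun y => f y * W r a y) = delta_const k * f a.

Lemma helmholtz_mvp O f : open O -> CkC 2 O f ->
  (forall x, O x -> claplacian f x + (k ^+ 2)%:C * f x = 0) -> mvp O f.
Proof.
move=> oO cf hf; split=> [x Ox|a r s r0 rs aO]; first exact: CkC_cont cf Ox.
by apply: (helmholtz_mean k0 oO r0) => // y /le_lt_trans/(_ rs)/aO.
Qed.

Lemma mvp_sub O O' f : O' `<=` O -> mvp O f -> mvp O' f.
Proof.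
move=> s [c m]; split => [x /s|a r t r0 rt h]; first exact: c.
by apply: m r0 rt _ => y /h/s.
Qed.

Lemma mvpB O f g : mvp O f -> mvp O g -> mvp O (fun x => f x - g x).
Proof.
move=> [cf mf] [cg mg]; split => [x Ox|a r s r0 rs aO]; first by apply: ccB; [exact: cf|exact: cg].
rewrite mulrBr -(mf a r s)// -(mg a r s)// -cIB.
- by congr cI; apply/funext => y; rewrite mulrBl.
- apply: (@CCc_local R O f a r _ cf) => [y h|x|y]; [apply: aO; exact: le_lt_trans rs|exact: Wk_cont|exact: Wk_out].
- apply: (@CCc_local R O g a r _ cg) => [y h|x|y]; [apply: aO; exact: le_lt_trans rs|exact: Wk_cont|exact: Wk_out].
Qed.

Lemma mvpZ O f (c : R[i]) : mvp O f -> mvp O (fun x => c * f x).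
Proof.
move=> [cf mf]; split => [x Ox|a r s r0 rs aO]; first by apply: ccM; [exact: ccC|exact: cf].
rewrite mulrCA -(mf a r s)// -cIZ.
  by congr cI; apply/funext => y; rewrite mulrA.
by apply: (@CCc_local R O f a r _ cf) => [y h|x|y]; [apply: aO; exact: le_lt_trans rs|exact: Wk_cont|exact: Wk_out].
Qed.

Lemma cutoff a r s : 0 < r -> r < s -> exists chi : V -> R,
  [/\ continuous chi, forall y, enorm (y - a) <= r -> chi y = 1 &
      forall y, s < enorm (y - a) -> chi y = 0].
Proof.
move=> r0 rs; pose t y : R := 1 + (enorm (y - a) - r) / (s - r).
have sr : 0 < s - r by rewrite subr_gt0.
exists (fun y => step (t y)); split.
- move=> x; have cpw (n : nat) (u : R) : {for u, continuous (@pw R n.+1)} by have [H _] := @pw_Dn R 0 n.+1 (ltn0Sn n); exact: H.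
  have ct : {for x, continuous t}.
    apply: contD; first exact: contC.
    apply: contM; last exact: contC.
    apply: contB; last exact: contC.
    by apply: (@contcomp R _ _ (fun y => y - a) (@enorm R)); [exact: shift_cont|exact: enorm_cont].
  apply: (@contcomp R _ _ (fun y => 1 - pw 4 (t y - 1)) (@pw R 4)); last exact: cpw.
  apply: contB; first exact: contC.
  apply: (@contcomp R _ _ (fun y => t y - 1) (@pw R 4)); last exact: cpw.
  by apply: contB; [exact: ct|exact: contC].
- by move=> y h; apply: step1; rewrite /t gerDl pmulr_lle0 ?invr_gt0// subr_le0.
- move=> y h; apply: step0; rewrite /t (_ : 2 = 1 + 1)// lerD2l ler_pdivlMr// mul1r lerD2r; exact: ltW.
Qed.

(** Near [a] the function is a convolution of a compactly supported density with a fixed kernel,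
    hence inherits its smoothness; the gap s - 2 r is the room for moving the point. *)
Lemma mvp_local O f a r s : mvp O f -> 0 < r -> 2 * r < s -> (forall y, enorm (y - a) < s -> O y) ->
  exists2 h, CCc h & (forall y, enorm (y - a) <= 2 * r -> h y = f y) /\
   \forall a' \near a, f a' = (delta_const k)^-1 * cI (fun y => h y * W r 0 (y - a')).
Proof.
move=> [cf mf] r0 rs aO; pose d := (s - 2 * r) / 4.
have d0 : 0 < d by rewrite divr_gt0// subr_gt0.
have ds : s = 2 * r + 4 * d by rewrite /d; field.
have [chi [cc c1 c0]] := @cutoff a (2 * r + d) (2 * r + 2 * d) ltac:(move: r0 d0; lra) ltac:(move: r0 d0; lra).
exists (fun y => f y * (chi y)%:C).
  have E2 : 2 * (r + d) = 2 * r + 2 * d by rewrite mulrDr.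
  apply: (@CCc_local R O f a (r + d) _ cf).
  - by move=> y; rewrite E2 => h; apply: aO; apply: le_lt_trans h _; move: d0; rewrite ds; lra.
  - by move=> x; apply: cc_real; exact: cc.
  - by move=> y; rewrite E2 => /c0 ->.
split=> [y h|]; first by rewrite c1 ?mulr1// (le_trans h)// lerDl ltW.
apply: filterS (@enorm_near R a a d _) => [a' h|]; last by rewrite subrr enorm0.
have H y : enorm (y - a) <= enorm (y - a') + enorm (a' - a).
  by rewrite (_ : y - a = (y - a') + (a' - a)) ?enormD// addrA subrK.
apply: (mulfI (delta_const_neq0 k0)); rewrite mulrA divff ?delta_const_neq0// mul1r.
have h1 : 2 * r < 2 * r + d by rewrite ltrDl.
have h2 y : enorm (y - a') < 2 * r + d -> O y.
  by move=> hy; apply: aO; apply: le_lt_trans (H y) _; move: hy h d0; rewrite ds; lra.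
suff -> : (fun y => f y * (chi y)%:C * W r 0 (y - a')) = (fun y => f y * W r a' y).
  exact/esym/(mf a' r (2 * r + d) r0 h1 h2).
apply/funext => y; rewrite -(Wk_shift r a' y).
have [h3|h3] := leP (enorm (y - a')) (2 * r); last by rewrite Wk_out// !mulr0.
by rewrite c1 ?mulr1// (le_trans (H y))//; move: h h3; lra.
Qed.

Lemma open_room O a : open O -> O a -> exists2 r : R, 0 < r & forall y, enorm (y - a) < 3 * r -> O y.
Proof.
move=> oO Oa; have /enorm_ball[e e0 h] : nbhs a O by exact: open_nbhs_nbhs.
by exists (e / 3); [rewrite divr_gt0|move=> y hy; apply: h; apply: lt_le_trans hy _; rewrite mulrCA divff// mulr1].
Qed.

Lemma cvanish_dW r i y : 0 < r -> 2 * r < enorm y -> cpd i (W r 0) y = 0.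
Proof.
move=> r0 hy; apply: (@cpd_near_cst R _ _ _ 0).
have : \near y, 2 * r < enorm (y - 0) by apply: enorm_near_gt; rewrite subr0.
by apply: filterS => z; rewrite subr0 => hz; rewrite Wk_out// subr0.
Qed.

Lemma mvp_cderive O f a r s i : mvp O f -> 0 < r -> 2 * r < s -> (forall y, enorm (y - a) < s -> O y) ->
  cderive a (e_ i) f (- (delta_const k)^-1 * cI (fun y => f y * cpd i (W r 0) (y - a))).
Proof.
move=> mf r0 rs aO; have [h ch [hf hn]] := mvp_local mf r0 rs aO.
have E : cI (fun y => f y * cpd i (W r 0) (y - a)) = cI (fun y => h y * cpd i (W r 0) (y - a)).
  congr cI; apply/funext => y; have [hy|hy] := leP (enorm (y - a)) (2 * r); first by rewrite hf.
  by rewrite cvanish_dW// !mulr0.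
rewrite E; apply: (@cd_near _ _ _ _ _ _ _ (filterS _ hn)) => [a' -> //|].
apply: cderive_eq (cdZ ((delta_const k)^-1) (conv_deriv i a ch (Wk_CkC1 r0) (Wk_vanish r0))) _.
by rewrite mulrN mulNr.
Qed.

Lemma mvp_cpd_cont O f a i : open O -> mvp O f -> O a -> ccontinuous_at a (cpd i f).
Proof.
move=> oO mf Oa; have [r r0 ha] := open_room oO Oa.
have r2 : 2 * r < 3 * r by rewrite ltr_pM2r// ltr_nat.
have [h ch [_ hn]] := mvp_local mf r0 r2 ha.
apply: (@cc_near _ (fun a => - (delta_const k)^-1 * cI (fun y => h y * cpd i (W r 0) (y - a)))).
  have := nbhs_interior hn; apply: filterS => a' hn'; symmetry; apply: cpd_cderive.
  apply: (@cd_near _ _ _ _ _ _ _ (filterS _ hn')) => [b -> //|].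
  apply: cderive_eq (cdZ ((delta_const k)^-1) (conv_deriv i a' ch (Wk_CkC1 r0) (Wk_vanish r0))) _.
  by rewrite mulrN mulNr.
apply: ccM; first exact: ccC.
by apply: conv_cont => //; exact: CCc_pd (Wk_CkC1 r0) (Wk_vanish r0).
Qed.

Lemma mvp_cderive1 O f a i : open O -> mvp O f -> O a -> cderive a (e_ i) f (cpd i f a).
Proof.
move=> oO mf Oa; have [r r0 ha] := open_room oO Oa.
have r2 : 2 * r < 3 * r by rewrite ltr_pM2r// ltr_nat.
by have D := mvp_cderive i mf r0 r2 ha; rewrite (cpd_cderive D).
Qed.

Lemma mvp_CkC1 O f : open O -> mvp O f -> CkC 1 O f.
Proof.
move=> oO mf; apply: (@CkC_intro _ _ _ _ (fun j => cpd j f)).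
- by have [] := mf.
- by move=> j x Ox; exact: mvp_cderive1 oO mf Ox.
- by move=> j; apply: CkC0 => x; exact: mvp_cpd_cont oO mf.
Qed.

(** Differentiating the reproducing formula puts the derivative on the kernel; one integration by
    parts brings it back to [f], which is C^1 by now. *)
Lemma mvp_cpd O f i : open O -> mvp O f -> mvp O (cpd i f).
Proof.
move=> oO mf; split; first by move=> a; exact: mvp_cpd_cont.
move=> a r s r0 rs aO.
rewrite (cpd_cderive (mvp_cderive i mf r0 rs aO)) mulNr mulrN mulrA divff ?delta_const_neq0// mul1r.
have Wa : W r a = fun y => W r 0 (y - a) by apply/funext => y; exact: Wk_shift.
have Wc j : cpd j (W r a) = fun y => cpd j (W r 0) (y - a) by rewrite Wa; exact: (cpd_shift (W r 0) a j).
have -> : (fun y => f y * cpd i (W r 0) (y - a)) = (fun y => f y * cpd i (W r a) y) by rewrite [in RHS]Wc.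
have C1W : CkC 1 setT (W r a).
  have dW j x : setT x -> cderive x (e_ j) (W r a) (cpd j (W r 0) (x - a)).
    move=> _; have D := CkC_cderive j (Wk_CkC1 r0) (I : setT (x - a)).
    by rewrite Wa; exact: cderive_shift.
  apply: (CkC_intro _ dW) => [x _|j]; first exact: Wk_cont.
  have cj x : ccontinuous_at x (cpd j (W r a)).
    rewrite Wc; apply: (@cc_comp R _ _ (fun y => y - a) (cpd j (W r 0))); first exact: shift_cont.
    exact: CkC_cont (CkC_pd j (Wk_CkC1 r0)) I.
  by apply: CkC0 => x _; exact: cj.
have nW : cnear0_off O (W r a).
  move=> x nO; have h : 2 * r < enorm (x - a).
    by apply: lt_le_trans rs _; rewrite leNgt; apply/negP => /aO.
  by apply: filterS (enorm_near_gt h) => y hy; rewrite Wk_out.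
have vW : cvanish_out (2 * r + `|a|) (W r a) by move=> x /supp_out h; rewrite Wk_out.
by have P := cint_by_parts i oO (mvp_CkC1 oO mf) C1W nW vW; rewrite P opprK.
Qed.

(** The kernel is only C^1, but each derivative is again in the class, so that regularity is gained
    one order at a time. *)
Lemma mvp_CkC O f n : open O -> mvp O f -> CkC n O f.
Proof.
move=> oO; elim: n f => [|n IH] f mf; first by split; split => // x /mf.1[].
apply: (@CkC_intro _ _ _ _ (fun j => cpd j f)).
- by have [] := mf.
- by move=> j x Ox; exact: mvp_cderive1 oO mf Ox.
- by move=> j; apply: IH; exact: mvp_cpd.
Qed.

(** An interior gradient estimate; its constant depends on k and r alone, being the size and volume
    of the differentiated kernel. *)
Lemma mvp_gradient r : 0 < r -> exists2 C : R, 0 <= C & forall O f a i (B : R), mvp O f ->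
  (forall y, enorm (y - a) < 3 * r -> O y) -> (forall y, enorm (y - a) < 3 * r -> normc (f y) <= B) ->
  normc (cpd i f a) <= C * B.
Proof.
move=> r0.
have [K K0 hK] : exists2 K : R, 0 <= K & forall i y, normc (cpd i (W r 0) y) <= K.
  have H i := CCc_bounded (CCc_pd i (Wk_CkC1 r0) (Wk_vanish r0)).
  have [K1 k1 h1] := H 0; have [K2 k2 h2] := H 1; have [K3 k3 h3] := H 2%:R.
  exists (K1 + K2 + K3); first by rewrite !addr_ge0.
  apply: forall3 => y; [have := h1 y|have := h2 y|have := h3 y]; move: k1 k2 k3; lra.
exists (normc (delta_const k)^-1 * (2 * K * (2 * (2 * r)) ^+ 3)).
  by rewrite !mulr_ge0 ?normc_ge0 ?exprn_ge0 ?mulr_ge0// ltW.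
move=> O f a i B mf aO fB.
have r2 : 2 * r < 3 * r by rewrite ltr_pM2r// ltr_nat.
have B0 : 0 <= B by apply: le_trans (normc_ge0 (f a)) (fB a _); rewrite subrr enorm0 mulr_gt0.
rewrite (cpd_cderive (mvp_cderive i mf r0 r2 aO)) mulNr normcN normcM -[leRHS]mulrA.
apply: ler_wpM2l; first exact: normc_ge0.
have cf : CCc (fun y => f y * cpd i (W r 0) (y - a)).
  apply: (@CCc_local R O f a r _ mf.1) => [y h|x|y h].
  - by apply: aO; exact: le_lt_trans r2.
  - apply: (@cc_comp R _ _ (fun y => y - a) (cpd i (W r 0))); first exact: shift_cont.
    exact: CkC_cont (CkC_pd i (Wk_CkC1 r0)) I.
  - by apply: cvanish_dW => //.
rewrite -(cI_translation a cf).
apply: le_trans (cI_bound (M := 2 * r) (B := B * K) _ (CCc_shift a cf) _ _) _.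
- by rewrite mulr_ge0// ltW.
- move=> y hy; rewrite /= addrK (cvanish_out_pd i (Wk_vanish r0)) ?mulr0//.
- move=> y; rewrite normcM addrK.
  have [hy|hy] := ltP (enorm y) (3 * r).
    by rewrite ler_pM ?normc_ge0// fB// addrK.
  by rewrite (cvanish_dW i r0 (lt_le_trans r2 hy)) normc0 mulr0 mulr_ge0.
- by apply: le_of_eq; ring.
Qed.

End mean_value_property.

(** * Moving a pole *)

Section taylor_at_a_pole.
Variables (R : realType) (k : R) (d : 'rV[R]_3).
Hypotheses (k0 : 0 < k) (d1 : dot d d = 1).
Local Notation V := 'rV[R]_3.
Implicit Types (z : V) (n m : nat).
Let ik : R[i] := 'i * k%:C.

(* The entries are E_(n-1), F_(n-1), E_n, F_n, where E_n and F_n are the Taylor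
   coefficients at s = 0 of exp(ik|z - s d|) and exp(ik|z - s d|)/|z - s d|. *)
Fixpoint taylor n z : (R[i] * R[i]) * (R[i] * R[i]) :=
  if n is n'.+1 then
    let p := taylor n' z in
    let b := (dot d z)%:C in
    (p.2, (- ik * (b * p.2.2 - p.1.2) / (n'%:R + 1),
           ((2%:R * n'%:R + 1) * b * p.2.2 - n'%:R * p.1.2 - ik * (b * p.2.1 - p.1.1))
             * ((dot z z)^-1)%:C / (n'%:R + 1)))
  else ((0, 0), (expi (k * Num.sqrt (dot z z)), eta k 0 (dot z z))).

Definition polar n z : R[i] := (taylor n z).2.2.
Definition phase n z : R[i] := (taylor n z).2.1.

Lemma nat1_neq0 n : (n%:R + 1 : R[i]) != 0.
Proof. by rewrite natr1 pnatr_eq0. Qed.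

Lemma normc_nat1 n : normc (n%:R + 1 : R[i]) = n%:R + 1.
Proof. by rewrite natr1 -rc_nat normc_real ger0_norm// natr1. Qed.

Lemma d_sqr z v : is_derive z v (fun y : V => dot y y) (2 * dot v z).
Proof.
have := d_dist (0 : V) z v; rewrite subr0.
by rewrite (_ : (fun y : V => dot (y - 0) (y - 0)) = fun y => dot y y)//; apply/funext => y; rewrite subr0.
Qed.

(** With b = d.z, r = |z - s d|, E = exp(ikr), F = E / r one has E' = - ik (b - s) F and r^2 F' = (b
    - s) F - ik (b - s) E; comparing powers of s gives the recursion, which for k = 0 is that of the
    Legendre polynomials. Moving z by - d differentiates in s, whence the factor n + 1. The
    recursion couples the four entries, so they are treated together. *)
Lemma taylor_derive n z : 0 < dot z z ->
  [/\ cderive z (- d) (fun y => (taylor n y).1.1) (n%:R * phase n z),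
      cderive z (- d) (fun y => (taylor n y).1.2) (n%:R * polar n z),
      cderive z (- d) (phase n) ((n%:R + 1) * phase n.+1 z) &
      cderive z (- d) (polar n) ((n%:R + 1) * polar n.+1 z)].
Proof.
elim: n z => [|n IH] z z0; rewrite /phase /polar.
  have q0 : (dot z z)%:C != 0 :> R[i] by rewrite rc_neq0// gt_eqF.
  have dq : is_derive z (- d) (fun y : V => dot y y) (- 2 * dot d z).
    by apply: is_derive_eq (d_sqr z (- d)) _; rewrite dotNl mulrN mulNr.
  have s0 : Num.sqrt (dot z z) != 0 by rewrite gt_eqF// sqrtr_gt0.
  have qs : dot z z = Num.sqrt (dot z z) ^+ 2 by rewrite sqr_sqrtr// ltW.
  have n1 := nat1_neq0 0.
  split.
  - by rewrite mul0r; exact: cdC.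
  - by rewrite mul0r; exact: cdC.
  - have D := @cdchain R V z (- d) (fun q : R => expi (k * Num.sqrt q)) (fun y => dot y y) _ _ (d_expi_sqrt k z0) dq.
    apply: cderive_eq (D : cderive z (- d) (fun y => (taylor 0 y).2.1) _) _; rewrite /= eta0E.
    rewrite mulrCA divff// mulr1 subr0 -/ik; move: (expi _) => e.
    rewrite -[LHS]mulrA -rcM (_ : (Num.sqrt (dot z z))^-1 / 2 * (- 2 * dot d z) = - (dot d z / Num.sqrt (dot z z))); last by field.
    rewrite rcN (rcM (dot d z)); move: (dot d z)%:C ((Num.sqrt (dot z z))^-1)%:C => b c; ring.
  - have D := @cdchain R V z (- d) (eta k 0) (fun y => dot y y) _ _ (eta_deriv k0 0 z0) dq.
    apply: cderive_eq (D : cderive z (- d) (fun y => (taylor 0 y).2.2) _) _; rewrite /= eta0E (eta1E k0).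
    rewrite mulr0 mul0r !subr0 !add0r divr1 !mul1r -/ik (_ : (dot z z)^-1 = (Num.sqrt (dot z z) ^+ 2)^-1); last by rewrite -qs.
    rewrite mulrAC -rcM (_ : 2^-1 * (- 2 * dot d z) = - dot d z); last by field.
    rewrite rcN !rcX !rcV rcX; have : (Num.sqrt (dot z z))%:C != 0 :> R[i] by rewrite rc_neq0.
    move: (expi _) (Num.sqrt _)%:C ik (dot d z)%:C => e s a b sn; by field.
have [h1 h2 h3 h4] := IH z z0.
have q0 : (dot z z)%:C != 0 :> R[i] by rewrite rc_neq0// gt_eqF.
have db : cderive z (- d) (fun y => (dot d y)%:C) (- 1).
  by apply: cderive_eq (cd_real (d_dot d z (- d))) _; rewrite dotNr d1 rcN.
have dq : cderive z (- d) (fun y : V => ((dot y y)^-1)%:C) (2%:R * (dot d z)%:C / (dot z z)%:C ^+ 2).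
  apply: cderive_eq (cd_real (dV _ (d_sqr z (- d)))) _; first by rewrite gt_eqF.
  by rewrite dotNl mulrN opprK !rcM rcV rcX rc_nat.
have n1 := nat1_neq0 n.
have n2 : (n%:R + 1 + 1 : R[i]) != 0 by have := nat1_neq0 n.+1; rewrite -natr1.
have hE : phase n.+1 z = - ik * ((dot d z)%:C * polar n z - (taylor n z).1.2) / (n%:R + 1) by [].
have hF : polar n.+1 z = ((2%:R * n%:R + 1) * (dot d z)%:C * polar n z - n%:R * (taylor n z).1.2 - ik * ((dot d z)%:C * phase n z - (taylor n z).1.1))
             * ((dot z z)^-1)%:C / (n%:R + 1) by [].
have hE2 : phase n.+2 z = - ik * ((dot d z)%:C * polar n.+1 z - polar n z) / (n%:R + 1 + 1) by rewrite natr1.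
have hF2 : polar n.+2 z = ((2%:R * (n%:R + 1) + 1) * (dot d z)%:C * polar n.+1 z - (n%:R + 1) * polar n z - ik * ((dot d z)%:C * phase n.+1 z - phase n z))
             * ((dot z z)^-1)%:C / (n%:R + 1 + 1) by rewrite natr1.
split.
- by apply: cderive_eq h3 _; rewrite natr1.
- by apply: cderive_eq h4 _; rewrite natr1.
- have D := cdM (cdZ (- ik) (cdB (cdM db h4) h2)) (cdC z (- d) (n%:R + 1)^-1).
  apply: cderive_eq D _; rewrite -(@natr1 _ n) -/(phase n.+2 z) hE2 -/(polar n z).
  rewrite mulr0 addr0; move: (polar n.+1 z) (polar n z) (dot d z)%:C ik => A B b c; by field; rewrite n1 n2.
- have D := cdM (cdM (cdB (cdB (cdM (cdZ (2%:R * n%:R + 1) db) h4) (cdZ n%:R h2)) (cdZ ik (cdB (cdM db h3) h1))) dq) (cdC z (- d) (n%:R + 1)^-1).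
  apply: cderive_eq D _; rewrite -(@natr1 _ n) -/(polar n.+2 z) -/(polar n z) -/(phase n z) hF2.
  move: hF; rewrite !rcV mulr0 addr0.
  move: (polar n.+1 z) (phase n.+1 z) (polar n z) (phase n z) (taylor n z).1.1 (taylor n z).1.2 (dot d z)%:C (dot z z)%:C ik n%:R q0 n1 n2
    => F1 E1 F E Em Fm b q c N q0 n1 n2 hF.
  have -> : ((2%:R * N + 1) * b * F - N * Fm - c * (b * E - Em)) = F1 * q * (N + 1).
    by rewrite hF; field; rewrite q0 n1.
  by field; rewrite q0 n1 n2.
Qed.

Lemma abs_dot_le z : `|dot d z| <= enorm z.
Proof.
apply: le_trans (cauchy_schwarz d z) _.
by rewrite /enorm d1 sqrtr1 mul1r.
Qed.

Section bounds.
Variable delta : R.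
Hypothesis delta0 : 0 < delta.
(** A geometric rate for the Taylor coefficients: 1/delta is the inverse distance to the pole, k the
    oscillation, and the factor 4 lets the induction close. *)
Definition kap : R := 4 * (delta^-1 + k).

Lemma kap_gt0 : 0 < kap.
Proof. by rewrite /kap mulr_gt0// addr_gt0// invr_gt0. Qed.

(** The entries of index n - 1 are bounded with [kap] on the left, so that the hypothesis also makes
    sense at n = 0. *)
Lemma taylor_bound n z : delta <= enorm z ->
  [/\ normc (taylor n z).1.1 * kap <= kap ^+ n,
      normc (taylor n z).1.2 * kap <= kap ^+ n / enorm z,
      normc (phase n z) <= kap ^+ n & normc (polar n z) <= kap ^+ n / enorm z].
Proof.
move=> dz; have z0 : 0 < enorm z by exact: lt_le_trans dz.
have K0 := kap_gt0.
have rK : 4 <= enorm z * kap.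
  apply: le_trans (_ : delta * kap <= _); last by rewrite ler_pM2r.
  have -> : delta * kap = 4 * (1 + delta * k) by rewrite /kap; field; rewrite gt_eqF.
  have : 0 <= delta * k by rewrite mulr_ge0// ltW.
  by lra.
have kK : 4 * k <= kap by rewrite /kap ler_pM2l// lerDr invr_ge0 ltW.
have ikN : normc (- ik) = k by rewrite normcN normcM normc_i mul1r normc_real ger0_norm// ltW.
have ikN' : normc ik = k by rewrite -normcN ikN.
elim: n => [|n [h1 h2 h3 h4]].
  rewrite expr0 div1r; split.
  - by rewrite (_ : (taylor 0 z).1.1 = 0)// normc0 mul0r.
  - by rewrite (_ : (taylor 0 z).1.2 = 0)// normc0 mul0r invr_ge0 ltW.
  - by rewrite (_ : phase 0 z = expi (k * Num.sqrt (dot z z)))// normc_expi.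
  - by rewrite (_ : polar 0 z = eta k 0 (dot z z))// normc_eta0// -enorm_sqr exprn_gt0.
have bz : normc (dot d z)%:C <= enorm z by rewrite normc_real abs_dot_le.
set X := kap ^+ n in h1 h2 h3 h4.
have X0 : 0 < X by rewrite exprn_gt0.
have N1 : 0 < (n%:R + 1 : R) by rewrite ltr_wpDl.
have nV : normc (n%:R + 1 : R[i])^-1 = (n%:R + 1)^-1.
  rewrite natr1 -rc_nat -rcV normc_real ger0_norm ?invr_ge0// natr1//.
have b1 : normc ((dot d z)%:C * polar n z) <= X.
  rewrite normcM; apply: le_trans (_ : enorm z * (X / enorm z) <= _).
    by apply: ler_pM; rewrite ?normc_ge0.
  by rewrite mulrCA divff ?mulr1// gt_eqF.
have b2 : normc (taylor n z).1.2 <= X / 4.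
  have e1 : normc (taylor n z).1.2 * (enorm z * kap) <= X.
    rewrite mulrA mulrAC -(@ler_pM2r _ (enorm z)^-1) ?invr_gt0//.
    by rewrite mulrK ?unitfE ?gt_eqF// mulrC; rewrite mulrC in h2; rewrite mulrC.
  have := ler_wpM2l (normc_ge0 (taylor n z).1.2) rK; lra.
have b3 : normc ((dot d z)%:C * phase n z) <= enorm z * X.
  by rewrite normcM; apply: ler_pM; rewrite ?normc_ge0.
have b4 : normc (taylor n z).1.1 <= enorm z * X / 4.
  have e1 : normc (taylor n z).1.1 * (enorm z * kap) <= enorm z * X.
    by rewrite mulrCA; apply: ler_wpM2l; [exact: ltW|].
  have := ler_wpM2l (normc_ge0 (taylor n z).1.1) rK; lra.
split.
- by rewrite /= exprSr ler_pM2r.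
- by rewrite /= exprSr -/X mulrAC ler_pM2r.
- rewrite /phase /= normcM normcM ikN nV ler_pdivrMr// exprSr -/X.
  have t := le_normcB ((dot d z)%:C * polar n z) (taylor n z).1.2.
  have t2 : k * normc ((dot d z)%:C * polar n z - (taylor n z).1.2) <= k * (X + X / 4).
    by apply: ler_wpM2l; [exact: ltW|lra].
  apply: le_trans t2 _.
  have h : 4 * k * X <= kap * X by rewrite ler_pM2r.
  have : 0 <= X * kap * n%:R by rewrite mulr_ge0// mulr_ge0// ltW.
  have -> : X * kap * (n%:R + 1) = X * kap * n%:R + X * kap by ring.
  have kX : 0 < k * X by rewrite mulr_gt0.
  lra.
- rewrite /polar /= normcM nV normcM normc_real.
  have -> : `|(dot z z)^-1| = (enorm z ^+ 2)^-1 by rewrite -enorm_sqr ger0_norm// invr_ge0 exprn_ge0// ltW.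
  rewrite ler_pdivrMr// -/(polar n z) -/(phase n z).
  rewrite ler_pdivrMr ?exprn_gt0//.
  have -> : kap ^+ n.+1 / enorm z * (n%:R + 1) * enorm z ^+ 2 = X * (enorm z * kap) * (n%:R + 1).
    by rewrite exprSr -/X; field; rewrite gt_eqF.
  have c1 : normc ((2%:R * n%:R + 1) * (dot d z)%:C * polar n z) <= (2 * n%:R + 1) * X.
    rewrite -mulrA normcM (_ : 2%:R * n%:R + 1 = (2 * n%:R + 1 : R)%:C); last by rewrite rcD rcM !rc_nat.
    rewrite normc_real ger0_norm; last by rewrite addr_ge0// mulr_ge0.
    by apply: ler_wpM2l => //; rewrite addr_ge0// mulr_ge0.
  have c2 : normc (n%:R * (taylor n z).1.2) <= n%:R * (X / 4).
    by rewrite normcM -rc_nat normc_real ger0_norm//; apply: ler_wpM2l.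
  have c3 : normc (ik * ((dot d z)%:C * phase n z - (taylor n z).1.1)) <= k * (enorm z * X + enorm z * X / 4).
    rewrite normcM ikN'; apply: ler_wpM2l; first exact: ltW.
    by apply: le_trans (le_normcB _ _) _; exact: lerD.
  apply: le_trans (le_normcB _ _) _.
  apply: le_trans (lerD (le_trans (le_normcB _ _) (lerD c1 c2)) c3) _.
  have f1 : 4 * X <= enorm z * kap * X by rewrite ler_pM2r.
  have f2 : 4 * k * (enorm z * X) <= kap * (enorm z * X) by rewrite ler_pM2r// mulr_gt0.
  have f3 : 4 * X * n%:R <= enorm z * kap * X * n%:R by apply: ler_wpM2r.
  have f4 : 0 <= X * n%:R by rewrite mulr_ge0// ltW.
  have f5 : 0 <= enorm z * kap * X * n%:R by lra.
  lra.
Qed.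

Lemma line_far z (s : R) : 2 * delta <= enorm z -> `|s| <= delta ->
  delta <= enorm (z - s *: d) /\ enorm z <= 2 * enorm (z - s *: d).
Proof.
move=> hz hs; have : enorm z - enorm (s *: d) <= enorm (z - s *: d) by exact: enorm_triB.
have -> : enorm (s *: d) = `|s| by rewrite enormZ /enorm d1 sqrtr1 mulr1.
move=> h; split; lra.
Qed.

Lemma polar_line_derive n z (s : R) : 2 * delta <= enorm z -> `|s| <= delta ->
  cderive s (1 : R) (fun s => polar n (z - s *: d)) ((n%:R + 1) * polar n.+1 (z - s *: d)).
Proof.
move=> hz hs; have [h _] := line_far hz hs.
have E (t : R) : z - t *: d = t *: (- d) + z by rewrite scalerN addrC.
rewrite (_ : (fun s => polar n (z - s *: d)) = fun s => polar n (s *: (- d) + z)); last by apply/funext => t; rewrite E.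
apply/cderive_line; rewrite -E.
have q0 : 0 < dot (z - s *: d) (z - s *: d) by rewrite -enorm_sqr exprn_gt0// (lt_le_trans delta0).
by have [] := taylor_derive n q0.
Qed.

Lemma polar_line_bound n z (s : R) : 2 * delta <= enorm z -> `|s| <= delta ->
  normc (polar n (z - s *: d)) <= kap ^+ n * (2 / enorm z).
Proof.
move=> hz hs; have [h1 h2] := line_far hz hs; have K0 := exprn_gt0 n kap_gt0.
have [_ _ _ h] := taylor_bound n h1; apply: le_trans h _; rewrite ler_pM2l//.
have z0 : 0 < enorm z by move: delta0 hz; lra.
have z1 : 0 < enorm (z - s *: d) by move: delta0 h1; lra.
by rewrite -[leLHS]mul1r ler_pdivrMr// mulrAC ler_pdivlMr// mul1r.
Qed.

Lemma polar_diff n z (s : R) : 2 * delta <= enorm z -> `|s| <= delta ->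
  normc (polar n (z - s *: d) - polar n z) <= 2 * (n%:R + 1) * (kap ^+ n.+1 * (2 / enorm z)) * `|s|.
Proof.
move=> hz hs.
have := @cMVT_abs R (fun s => polar n (z - s *: d)) _ s ((n%:R + 1) * (kap ^+ n.+1 * (2 / enorm z)))
  (fun t ht => polar_line_derive n hz (le_trans ht hs)) _.
rewrite scale0r subr0 !mulrA; apply=> t ht; rewrite normcM normc_nat1.
rewrite -!mulrA; apply: ler_wpM2l; first by rewrite addr_ge0.
by rewrite !mulrA -mulrA; exact: polar_line_bound hz (le_trans ht hs).
Qed.

Lemma polar_diff2 n z (s : R) : 2 * delta <= enorm z -> `|s| <= delta ->
  normc (polar n (z - s *: d) - polar n z - s%:C * ((n%:R + 1) * polar n.+1 z))
    <= 2 * (n%:R + 1) * (2 * (n.+1%:R + 1) * (kap ^+ n.+2 * (2 / enorm z))) * `|s| ^+ 2.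
Proof.
move=> hz hs.
pose G (t : R) := polar n (z - t *: d) - t%:C * ((n%:R + 1) * polar n.+1 z).
have dG (t : R) : `|t| <= `|s| -> cderive t (1 : R) G ((n%:R + 1) * (polar n.+1 (z - t *: d) - polar n.+1 z)).
  move=> ht; have D := cdB (polar_line_derive n hz (le_trans ht hs)) (cdM (cd_id t) (cdC t (1 : R) ((n%:R + 1) * polar n.+1 z))).
  by apply: cderive_eq D _; rewrite mulr0 addr0 mul1r mulrBr.
have := @cMVT_abs R G _ s ((n%:R + 1) * (2 * (n.+1%:R + 1) * (kap ^+ n.+2 * (2 / enorm z)) * `|s|)) dG _.
have -> : G s - G 0 = polar n (z - s *: d) - polar n z - s%:C * ((n%:R + 1) * polar n.+1 z).
  by rewrite /G scale0r subr0 mul0r subr0 addrAC.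
move=> H; apply: le_trans (H _) _; last by apply: le_of_eq; ring.
move=> t ht; rewrite normcM normc_nat1.
apply: ler_wpM2l; first by rewrite addr_ge0.
apply: le_trans (polar_diff n.+1 hz (le_trans ht hs)) _; apply: ler_wpM2l ht.
have K0 := exprn_gt0 n.+2 kap_gt0.
apply: mulr_ge0; first by apply: mulr_ge0 => //; apply: addr_ge0.
by apply: mulr_ge0; [exact: ltW|apply: divr_ge0 => //; exact: enorm_ge0].
Qed.

(** The condition 8 kap |s| <= 1 makes the remainder at most 2 (n + 1) 4^-(n+1) / |z|, which is
    below 1 / ((n + 1) |z|). *)
Lemma polar_taylor n z (s : R) : 2 * delta <= enorm z -> `|s| <= delta -> 8 * kap * `|s| <= 1 ->
  normc (polar 0 (z - s *: d) - \sum_(m < n.+1) polar m z * (s ^+ m)%:C) <= (n.+1%:R)^-1 / enorm z.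
Proof.
move=> hz hs ks; have z0 : 0 < enorm z by move: delta0 hz; lra.
have K0 := kap_gt0.
(* The Taylor polynomial with base point t, evaluated at s: [H 0] is the polynomial of the
   statement, [H s] the exact value, and the derivative in t telescopes to the term of order n +
   1. *)
pose H (t : R) := \sum_(m < n.+1) polar m (z - t *: d) * ((s - t) ^+ m)%:C.
have dH (t : R) : `|t| <= `|s| -> cderive t (1 : R) H ((n%:R + 1) * polar n.+1 (z - t *: d) * ((s - t) ^+ n)%:C).
  move=> ht.
  have dp m : cderive t (1 : R) (fun t => ((s - t) ^+ m)%:C) (- (m%:R * ((s - t) ^+ m.-1)%:C)).
    have D := cd_real (d_exp m (dB (dC s t (1 : R)) (is_derive_id t (1 : R)))).
    by apply: cderive_eq D _; rewrite sub0r mulrN1 rcN rcM rc_nat.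
  have D := @cd_sum R _ _ (index_enum 'I_n.+1) xpredT (fun (m : 'I_n.+1) (t : R) => polar m (z - t *: d) * ((s - t) ^+ m)%:C) _ t (1 : R)
     (fun m : 'I_n.+1 => cdM (polar_line_derive m hz (le_trans ht hs)) (dp m)).
  apply: cderive_eq D _.
  pose g m := m%:R * polar m (z - t *: d) * ((s - t) ^+ m.-1)%:C.
  transitivity (\sum_(m < n.+1) (g m.+1 - g m)).
    by apply: eq_bigr => m _; rewrite /g /= -natr1 mulrN; congr (_ - _); rewrite mulrCA mulrA.
  by rewrite -(big_mkord xpredT (fun m => g m.+1 - g m)) telescope_sumr// /g /= !mul0r subr0 -natr1.
have Hs : H s = polar 0 (z - s *: d).
  rewrite /H big_ord_recl /= subrr expr0 mulr1 big1 ?addr0// => m _.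
  by rewrite /= exprS mul0r mulr0.
have H0 : H 0 = \sum_(m < n.+1) polar m z * (s ^+ m)%:C.
  by apply: eq_bigr => m _; rewrite scale0r !subr0.
rewrite -Hs -H0.
apply: le_trans (@cMVT_abs R H _ s ((n%:R + 1) * (kap ^+ n.+1 * (2 / enorm z)) * (2 * `|s|) ^+ n) dH _) _.
  move=> t ht; rewrite (normcM ((n%:R + 1) * polar n.+1 (z - t *: d))) (normcM (n%:R + 1)) normc_nat1 normc_real normrX.
  apply: ler_pM; [by apply: mulr_ge0; [exact: addr_ge0|exact: normc_ge0]|exact: exprn_ge0| |].
    by apply: ler_wpM2l; [rewrite addr_ge0|exact: polar_line_bound hz (le_trans ht hs)].
  by rewrite lerXn2r ?nnegrE ?mulr_ge0// (le_trans (ler_normB _ _))// mulr2n mulrDl mul1r lerD.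
have -> : 2 * ((n%:R + 1) * (kap ^+ n.+1 * (2 / enorm z)) * (2 * `|s|) ^+ n) * `|s| =
   (n%:R + 1) * ((2 * kap * `|s|) ^+ n.+1) * (2 / enorm z).
  by rewrite !exprMn !exprS; ring.
have X : (2 * kap * `|s|) ^+ n.+1 <= (4^-1) ^+ n.+1.
  have e1 : 2 * kap * `|s| <= 4^-1 by lra.
  have e0 : 0 <= 2 * kap * `|s| by apply: mulr_ge0 => //; apply: mulr_ge0 => //; exact: ltW.
  by rewrite lerXn2r// nnegrE invr_ge0.
have N1 : 0 < (n%:R + 1 : R) by rewrite ltr_wpDl.
rewrite mulrA ler_pM2r ?invr_gt0//.
apply: le_trans (_ : (n%:R + 1) * 4^-1 ^+ n.+1 * 2 <= _).
  by rewrite ler_pM2r// ler_pM2l.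
rewrite -(@natr1 _ n) -[leRHS]mul1r ler_pdivlMr//.
have n2 : (n%:R + 1 : R) <= 2 ^+ n by rewrite natr1 -natrX ler_nat ltn_expl.
have E4 : (4^-1 : R) ^+ n.+1 = 4^-1 * (2^-1 ^+ n * 2^-1 ^+ n).
  by rewrite exprS -exprMn; congr (_ * _ ^+ _); field.
rewrite E4.
have p0 : (0 : R) <= 2^-1 ^+ n by rewrite exprn_ge0// invr_ge0.
have u : (n%:R + 1) * 2^-1 ^+ n <= (1 : R).
  apply: le_trans (ler_wpM2r p0 n2) _; by rewrite -exprMn divff// expr1n.
have v : 0 <= (n%:R + 1) * 2^-1 ^+ n :> R by rewrite mulr_ge0// ltW.
have w : ((n%:R + 1) * 2^-1 ^+ n) * ((n%:R + 1) * 2^-1 ^+ n) <= (1 : R) by rewrite -[leRHS]mulr1 ler_pM.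
lra.
Qed.

End bounds.
End taylor_at_a_pole.

(** * Harmonic polynomials *)

Section homogeneous_polynomials.
Variable R : realType.
Local Notation V := 'rV[R]_3.
Local Notation e_ i := (delta_mx 0 i : V).
Implicit Types (x v : V) (l : nat) (P Q : V -> R[i]) (b : nat * nat * nat) (i j : 'I_3).

Definition mon b x : R := x 0 0 ^+ b.1.1 * x 0 1 ^+ b.1.2 * x 0 2%:R ^+ b.2.
Definition mdeg3 b := (b.1.1 + b.1.2 + b.2)%N.
Definition mexp b i : nat := nth 0%N [:: b.1.1; b.1.2; b.2] i.
Definition mup i b := if i == 0 then (b.1.1.+1, b.1.2, b.2) else
  if i == 1 then (b.1.1, b.1.2.+1, b.2) else (b.1.1, b.1.2, b.2.+1).
Definition mdn i b := if i == 0 then (b.1.1.-1, b.1.2, b.2) else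
  if i == 1 then (b.1.1, b.1.2.-1, b.2) else (b.1.1, b.1.2, b.2.-1).

Definition evalp (s : seq (R[i] * (nat * nat * nat))) x : R[i] :=
  \sum_(t <- s) t.1 * (mon t.2 x)%:C.

(** A polynomial is a list of monomials, repetitions allowed, so that sums, multiplication by a
    coordinate and derivatives are operations on lists. *)
Definition hp l P := exists2 s : seq (R[i] * (nat * nat * nat)),
  (forall t, t \in s -> mdeg3 t.2 = l) & forall x, P x = evalp s x.

Lemma mon_mup i b x : mon (mup i b) x = x 0 i * mon b x.
Proof.
by rewrite /mon; move: i; apply: forall3; rewrite /mup /= exprS; ring.
Qed.

Lemma mon_derive b x v : is_derive x v (mon b) (\sum_(i < 3) v 0 i * ((mexp b i)%:R * mon (mdn i b) x)).
Proof.
apply: is_derive_eq (dM (dM (d_exp b.1.1 (d_coord 0 x v)) (d_exp b.1.2 (d_coord 1 x v))) (d_exp b.2 (d_coord 2%:R x v))) _.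
by rewrite sum3 /mon /mdn /mexp /=; ring.
Qed.

Lemma hp_eq l P Q : hp l P -> (forall x, Q x = P x) -> hp l Q.
Proof. by move=> [s s1 s2] h; exists s => // x; rewrite h. Qed.

Lemma hpD l P Q : hp l P -> hp l Q -> hp l (fun x => P x + Q x).
Proof.
move=> [s s1 s2] [t t1 t2]; exists (s ++ t).
  by move=> u; rewrite mem_cat => /orP[/s1|/t1].
by move=> x; rewrite /evalp big_cat s2 t2.
Qed.

Lemma hp0 l : hp l (fun=> 0).
Proof. by exists [::] => // x; rewrite /evalp big_nil. Qed.

Lemma hp_sum l (I : Type) (r : seq I) (F : I -> V -> R[i]) :
  (forall a : I, hp l (F a)) -> hp l (fun x => \sum_(a <- r) F a x).
Proof.
move=> h; elim: r => [|a r IH]; first by apply: hp_eq (hp0 l) _ => x; rewrite big_nil.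
by apply: hp_eq (hpD (h a) IH) _ => x; rewrite big_cons.
Qed.

Lemma hp_mon l (c : R[i]) b : mdeg3 b = l -> hp l (fun x => c * (mon b x)%:C).
Proof.
move=> h; exists [:: (c, b)]; first by move=> t; rewrite inE => /eqP ->.
by move=> x; rewrite /evalp big_seq1.
Qed.

Lemma hpZ l P (c : R[i]) : hp l P -> hp l (fun x => c * P x).
Proof.
move=> [s s1 s2]; exists [seq (c * t.1, t.2) | t <- s]; first by move=> t /mapP[u /s1 h ->].
by move=> x; rewrite s2 /evalp big_map mulr_sumr; apply: eq_bigr => t _; rewrite /= mulrA.
Qed.

Lemma hp_coord l P i : hp l P -> hp l.+1 (fun x => (x 0 i)%:C * P x).
Proof.
move=> [s s1 s2]; exists [seq (t.1, mup i t.2) | t <- s].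
  by move=> t /mapP[u /s1 <- ->]; rewrite /mdeg3 /mup /=; case: ifP => _; [|case: ifP => _]; rewrite /= ?addnS ?addSn.
move=> x; rewrite s2 /evalp big_map mulr_sumr; apply: eq_bigr => t _.
by rewrite /= mon_mup (rcM (x 0 i) (mon t.2 x)) mulrCA.
Qed.

Lemma evalp_cderive s x v : cderive x v (evalp s)
  (\sum_(i < 3) (v 0 i)%:C * evalp [seq ((mexp t.2 i)%:R * t.1, mdn i t.2) | t <- s] x).
Proof.
have D := @cd_sum R _ _ s xpredT (fun t x => t.1 * (mon t.2 x)%:C) _ x v
  (fun t => cdZ t.1 (cd_real (mon_derive t.2 x v))).
apply: cderive_eq D _.
under [RHS]eq_bigr => i _ do rewrite /evalp big_map mulr_sumr.
rewrite exchange_big; apply: eq_bigr => t _ /=.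
rewrite (rmorph_sum (real_complex R)) mulr_sumr; apply: eq_bigr => i _.
by rewrite /= !rcM rc_nat; ring.
Qed.

Lemma hp_cpd l P i : hp l P -> hp l.-1 (cpd i P).
Proof.
(* Monomials free of x_i are removed: the truncated predecessor would leave their degree
   unchanged. *)
move=> [s s1 s2]; pose s' := [seq t <- s | (0 < mexp t.2 i)%N].
have E x : cpd i P x = evalp [seq ((mexp t.2 i)%:R * t.1, mdn i t.2) | t <- s'] x.
  have -> : P = evalp s by exact/funext.
  rewrite (cpd_cderive (evalp_cderive s x (e_ i))) (bigD1 i)//= delta_coord eqxx mul1r big1 ?addr0; last first.
    by move=> j ji; rewrite delta_coord eq_sym (negbTE ji) mul0r.
  rewrite /evalp !big_map big_filter [RHS]big_mkcond; apply: eq_bigr => t _.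
  by case: posnP => // ->; rewrite !mul0r.
exists [seq ((mexp t.2 i)%:R * t.1, mdn i t.2) | t <- s'] => // t /mapP[u].
rewrite mem_filter => /andP[h /s1 <-] -> /=; move: h; rewrite /mdeg3 /mexp /mdn; move: i {s' E}.
by apply: forall3 => /=; case: u => u [[a b] c] /=; lia.
Qed.

Lemma hp_CkC l P n : hp l P -> CkC n setT P.
Proof.
move=> [s _ s2]; have -> : P = evalp s by exact/funext.
apply: CkC_sum; first exact: openT.
move=> t; apply: CkCM; [exact: openT|exact: CkC_cst openT|apply: CkC_real; first exact: openT].
have cX i m : Ck n setT (fun x : V => x 0 i ^+ m).
  have h := @Ck_prod R n setT _ (iota 0 m) (fun _ (x : V) => x 0 i) openT (fun _ => Ck_coord n i openT).
  by apply: Ck_eq openT _ h => x _; rewrite big_const_seq count_predT size_iota iter_mulr_1.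
by apply: CkM openT (CkM openT (cX _ _) (cX _ _)) (cX _ _).
Qed.

Lemma hp_cont l P x : hp l P -> ccontinuous_at x P.
Proof. by move=> h; exact: CkC_cont (hp_CkC 0 h) I. Qed.

Lemma hp_cderive l P x v : hp l P -> cderive x v P (\sum_(i < 3) (v 0 i)%:C * cpd i P x).
Proof.
move=> [s s1 s2]; have -> : P = evalp s by exact/funext.
apply: cderive_eq (evalp_cderive s x v) _; apply: eq_bigr => i _; congr (_ * _).
rewrite (cpd_cderive (evalp_cderive s x (e_ i))) (bigD1 i)//= delta_coord eqxx mul1r big1 ?addr0//.
by move=> j ji; rewrite delta_coord eq_sym (negbTE ji) mul0r.
Qed.

Lemma mdnC b i j : (mexp b i * mexp (mdn i b) j)%N = (mexp b j * mexp (mdn j b) i)%N /\ mdn i (mdn j b) = mdn j (mdn i b).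
Proof.
move: i j; apply: forall3; apply: forall3; rewrite /mexp /mdn /=; split => //; lia.
Qed.

Lemma hp_cpdC l P i j x : hp l P -> cpd i (cpd j P) x = cpd j (cpd i P) x.
Proof.
move=> [s s1 s2]; have -> : P = evalp s by exact/funext.
have E r i' : cpd i' (evalp r) = evalp [seq ((mexp t.2 i')%:R * t.1, mdn i' t.2) | t <- r].
  apply/funext => y; rewrite (cpd_cderive (evalp_cderive r y (e_ i'))) (bigD1 i')//= delta_coord eqxx mul1r big1 ?addr0//.
  by move=> j' ji; rewrite delta_coord eq_sym (negbTE ji) mul0r.
rewrite !E -!map_comp /evalp !big_map; apply: eq_bigr => t _ /=.
have [h ->] := mdnC t.2 i j; rewrite !mulrA -!natrM; congr (_%:R * _ * _).
by rewrite mulnC -h mulnC.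
Qed.

Lemma mon_euler b x :
  \sum_(i < 3) x 0 i * ((mexp b i)%:R * mon (mdn i b) x) = (mdeg3 b)%:R * mon b x.
Proof.
have H i : x 0 i * ((mexp b i)%:R * mon (mdn i b) x) = (mexp b i)%:R * mon b x.
  move: i; apply: forall3; rewrite /mexp /mdn /mon /=;
    [case: b.1.1 => [|n]|case: b.1.2 => [|n]|case: b.2 => [|n]]; rewrite /= ?mul0r ?mulr0// exprS; ring.
by rewrite (eq_bigr _ (fun i _ => H i)) sum3 /mexp /mdeg3 /= !natrD; ring.
Qed.

Lemma hp_euler l P x : hp l P -> \sum_(i < 3) (x 0 i)%:C * cpd i P x = l%:R * P x.
Proof.
move=> hP; apply: (cd_unique (hp_cderive x x hP)).
move: hP => [s s1 s2]; have -> : P = evalp s by exact/funext.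
apply: cderive_eq (@cd_sum R _ _ s xpredT (fun t x => t.1 * (mon t.2 x)%:C) _ x x
  (fun t => cdZ t.1 (cd_real (mon_derive t.2 x x)))) _.
rewrite /evalp mulr_sumr big_seq [RHS]big_seq; apply: eq_bigr => t /s1 <-.
by rewrite mon_euler rcM rc_nat mulrCA.
Qed.

Lemma hp_scale l P x (t : R) : hp l P -> P (t *: x) = (t ^+ l)%:C * P x.
Proof.
move=> [s s1 s2]; rewrite !s2 /evalp mulr_sumr big_seq [RHS]big_seq; apply: eq_bigr => u /s1 <-.
by rewrite /mon /mdeg3 !mxE !exprMn !exprD !rcM; ring.
Qed.

Definition harmonic P := forall x, claplacian P x = 0.

Lemma homogeneous_hp l P : homogeneous_poly l P -> hp l P.
Proof.
move=> [a h].
have H (i j : 'I_l.+1) : hp l (fun x => if (i + j <= l)%N then a i j * (mon (nat_of_ord i, nat_of_ord j, l - i - j)%N x)%:C else 0).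
  have [h'|_] := boolP (i + j <= l)%N; last exact: hp0.
  by apply: hp_mon; rewrite /mdeg3 /=; lia.
have K := hp_sum (index_enum 'I_l.+1) (fun p : 'I_l.+1 => hp_sum (index_enum 'I_l.+1) (fun q : 'I_l.+1 => H p q)).
apply: (hp_eq K) => x.
by rewrite h; apply: eq_bigr => i _; rewrite [LHS]big_mkcond.
Qed.

Lemma harmonic_cpd l P i : hp l P -> harmonic P -> harmonic (cpd i P).
Proof.
move=> hP hh x; rewrite claplacianE.
have E j : cpd j (cpd j (cpd i P)) x = cpd i (cpd j (cpd j P)) x.
  have A : cpd j (cpd i P) = cpd i (cpd j P) by apply/funext => y; exact: hp_cpdC hP.
  have gen (T : Type) (cj ci : T -> T) (p : T) (ev : T -> R[i]) : cj (ci p) = ci (cj p) ->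
    ev (cj (ci (cj p))) = ev (ci (cj (cj p))) -> ev (cj (cj (ci p))) = ev (ci (cj (cj p))) by move=> ->.
  exact: (gen _ (cpd j) (cpd i) P (fun F => F x) A (hp_cpdC j i x (hp_cpd j hP))).
rewrite (eq_bigr _ (fun j _ => E j)).
have D : cderive x (e_ i) (fun y => \sum_(j < 3) cpd j (cpd j P) y) (\sum_(j < 3) cpd i (cpd j (cpd j P)) x).
  by apply: cd_sum => j; exact: CkC_cderive (CkC_pd j (CkC_pd j (hp_CkC 3 hP))) I.
apply: (cd_unique D); rewrite (_ : (fun y => _) = fun=> 0); first exact: cdC.
by apply/funext => y; rewrite -claplacianE.
Qed.

Lemma cpd_plane P i x : i != 2%:R -> (forall y : V, y 0 2%:R = 0 -> P y = 0) -> x 0 2%:R = 0 -> cpd i P x = 0.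
Proof.
move=> i2 h x0; apply: cpd_cderive; apply: cderive_eps => e e0; exists 1 => // t _.
rewrite !h ?x0// ?mulr0 ?subr0 ?normc0 ?mulr_ge0 ?(ltW e0)//.
by rewrite !mxE x0 addr0 eq_sym /= (negbTE i2) /= mulr0.
Qed.

Lemma hp0_const P x : hp 0 P -> P x = P 0.
Proof.
move=> [s s1 s2]; rewrite !s2 /evalp big_seq [RHS]big_seq; apply: eq_bigr => t /s1.
by case: t => t [[[|a] [|b]] [|c]]; rewrite /mdeg3 /mon //= !expr0.
Qed.

(** Uniqueness for the Cauchy problem on the plane x_3 = 0, by induction on the degree: the normal
    derivative is harmonic of lower degree, and its own normal derivative on the plane is minus the
    tangential second derivatives of P, that is, 0. *)
Lemma harmonic_eq0 l P : hp l P -> harmonic P ->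
  (forall x : V, x 0 2%:R = 0 -> P x = 0) -> (forall x : V, x 0 2%:R = 0 -> cpd 2%:R P x = 0) ->
  forall x, P x = 0.
Proof.
elim: l P => [|l IH] P hP hh P0 P1 x.
  by rewrite (hp0_const x hP) P0// mxE.
have Q0 : forall y, cpd 2%:R P y = 0.
  apply: IH (hp_cpd 2%:R hP) (harmonic_cpd 2%:R hP hh) P1 _ => y y0.
  have := hh y; rewrite claplacianE sum3.
  rewrite (@cpd_plane (cpd 0 P) 0 y)//; last by move=> z z0; rewrite (@cpd_plane P 0 z).
  rewrite (@cpd_plane (cpd 1 P) 1 y)//; last by move=> z z0; rewrite (@cpd_plane P 1 z).
  by rewrite !add0r.
pose y := x - x 0 2%:R *: e_ 2%:R.
have y0 : y 0 2%:R = 0 by rewrite !mxE eqxx mulr1 subrr.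
have D (t : R) : cderive t (1 : R) (fun s : R => P (s *: e_ 2%:R + y)) 0.
  by apply/cderive_line; rewrite -(Q0 (t *: e_ 2%:R + y)); exact: CkC_cderive (hp_CkC 1 hP) I.
have := @cMVT_abs R _ _ (x 0 2%:R) 0 (fun t _ => D t) _.
rewrite scale0r add0r (P0 _ y0) subr0 mulr0 mul0r /y addrC subrK => H.
apply/eqP; rewrite -[_ == _]negbK; apply/negP => /normc_gt0; rewrite ltNge => /negP; apply; apply: H.
by move=> t _; rewrite normc0.
Qed.

Definition coef (s : seq (R[i] * (nat * nat * nat))) b : R[i] := \sum_(t <- s | t.2 == b) t.1.

(** Enumerates the 2 l + 1 exponents of degree l whose power of x_3 is 0 (l + 1 of them) or 1 (l of
    them); their coefficients are exactly the Cauchy data. *)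
Definition lowexp l (r : nat) : nat * nat * nat :=
  if (r <= l)%N then (r, l - r, 0)%N else (r - l.+1, l.*2 - r, 1)%N.

Lemma evalp_low l s (g : nat * nat * nat -> R[i]) : (forall t, t \in s -> mdeg3 t.2 = l) ->
  (forall b, (1 < b.2)%N -> g b = 0) ->
  \sum_(t <- s) t.1 * g t.2 = \sum_(r < l.*2.+1) coef s (lowexp l r) * g (lowexp l r).
Proof.
move=> sl g0; under [RHS]eq_bigr => r _ do rewrite /coef mulr_suml.
rewrite (exchange_big_dep xpredT)//= big_seq [RHS]big_seq; apply: eq_bigr => -[t [[a b] c]] /sl /=.
rewrite /mdeg3 /= => h.
have [c1|c1] := leqP c 1; last by rewrite g0// mulr0 big_pred0// => r; apply/eqP; rewrite /lowexp; case: ifP => _ [] _ _ E; move: c1; rewrite E.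
have r0 : ((if c == 0%N then a else a + l.+1) < l.*2.+1)%N by case: eqP; lia.
rewrite (bigD1 (Ordinal r0)) /=; last first.
  by apply/eqP; rewrite /lowexp; case: eqP => c0; case: ifP => hr; congr (_, _, _); lia.
rewrite big1 ?addr0.
  by congr (_ * g _); rewrite /lowexp; case: eqP => c0; case: ifP => hr; congr (_, _, _); lia.
move=> r /andP[/eqP E /negP nr]; exfalso; apply: nr; apply/eqP/val_inj => /=.
by move: E; rewrite /lowexp; case: ifP => hr [] ? ? ?; case: eqP; lia.
Qed.

(** There are 2 l + 2 polynomials for 2 l + 1 Cauchy coefficients, so some nontrivial combination
    has zero Cauchy data, hence vanishes. *)
Lemma harmonic_dim l (P : 'I_(l.*2.+2) -> V -> R[i]) : (forall r, hp l (P r)) -> (forall r, harmonic (P r)) ->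
  exists2 u : 'I_(l.*2.+2) -> R[i], (exists r, u r != 0) & forall x, \sum_r u r * P r x = 0.
Proof.
move=> hP hh.
have {hP}[s hs] : {s : 'I_(l.*2.+2) -> seq (R[i] * (nat * nat * nat)) &
    forall r, (forall t, t \in s r -> mdeg3 t.2 = l) /\ forall x, P r x = evalp (s r) x}.
  by apply: (@choice _ _ (fun r s => (forall t, t \in s -> mdeg3 t.2 = l) /\ forall x, P r x = evalp s x)) => r; have [s ? ?] := hP r; exists s.
pose M := \matrix_(r < l.*2.+2, c < l.*2.+1) coef (s r) (lowexp l c).
have kM : kermx M != 0 by rewrite kermx_eq0 /row_free neq_ltn ltnS rank_leq_col.
pose u := nz_row (kermx M).
have uM : u *m M = 0 by apply/sub_kermxP; exact: nz_row_sub.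
have u0 : u != 0 by rewrite nz_row_eq0.
exists (fun r => u 0 r); first by move/rV0Pn: u0.
have hP r : hp l (P r) by have [h1 h2] := hs r; exists (s r).
pose Q x := \sum_r u 0 r * P r x.
have hQ : hp l Q by apply: hp_sum => r; exact: hpZ.
(* Any linear functional that sees only the powers 0 and 1 of x_3 kills the combination: this covers
   both the value and the normal derivative on the plane. *)
have low (g : nat * nat * nat -> R[i]) : (forall b, (1 < b.2)%N -> g b = 0) ->
    \sum_r u 0 r * (\sum_(t <- s r) t.1 * g t.2) = 0.
  move=> g0; under eq_bigr => r _ do rewrite (evalp_low (hs r).1 g0) mulr_sumr.
  rewrite exchange_big big1// => c _.
  have := congr1 (fun A : 'rV_(l.*2.+1) => A 0 c) uM; rewrite !mxE => e.
  under eq_bigr => r _ do rewrite mulrA.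
  have E : \sum_r u 0 r * coef (s r) (lowexp l c) = 0 by rewrite -[RHS]e; apply: eq_bigr => r _; rewrite mxE.
  by rewrite -mulr_suml E mul0r.
have dQ i x : cpd i Q x = \sum_r u 0 r * cpd i (P r) x.
  by apply: cpd_cderive; apply: cd_sum => r; apply: cdZ; exact: CkC_cderive (hp_CkC 1 (hP r)) I.
apply: (harmonic_eq0 hQ).
- move=> x; rewrite claplacianE.
  have d2 i : cpd i (cpd i Q) x = \sum_r u 0 r * cpd i (cpd i (P r)) x.
    have -> : cpd i Q = fun x => \sum_r u 0 r * cpd i (P r) x by apply/funext => y; exact: dQ.
    by apply: cpd_cderive; apply: cd_sum => r; apply: cdZ; exact: CkC_cderive (CkC_pd i (hp_CkC 2 (hP r))) I.
  rewrite (eq_bigr _ (fun i _ => d2 i)) exchange_big big1// => r _.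
  by rewrite -mulr_sumr -claplacianE hh mulr0.
- move=> x x0; rewrite /Q; under eq_bigr => r _ do rewrite (hs r).2 /evalp.
  apply: (low (fun b => (mon b x)%:C)) => b b1.
  by rewrite /mon x0 expr0n; case: b.2 b1 => // n _; rewrite mulr0.
- move=> x x0; rewrite dQ.
  have E r : cpd 2%:R (P r) x = \sum_(t <- s r) t.1 * ((mexp t.2 2)%:R * (mon (mdn 2%:R t.2) x)%:C).
    have -> : P r = evalp (s r) by apply/funext => y; rewrite (hs r).2.
    rewrite (cpd_cderive (evalp_cderive (s r) x (e_ 2%:R))) (bigD1 2%:R)//= delta_coord eqxx mul1r big1 ?addr0; last first.
      by move=> j ji; rewrite delta_coord eq_sym (negbTE ji) mul0r.
    by rewrite /evalp big_map; apply: eq_bigr => t _; rewrite /=; ring.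
  under eq_bigr => r _ do rewrite E.
  apply: (low (fun b => (mexp b 2)%:R * (mon (mdn 2%:R b) x)%:C)) => b b1.
  by rewrite /mon /mdn /= x0; case: b.2 b1 => [|[|n]]// _; rewrite expr0n mulr0 mulr0.
Qed.

End homogeneous_polynomials.

(** * Outgoing waves and their derivatives *)

Section outgoing_waves.
Variables (R : realType) (k : R).
Hypothesis k0 : 0 < k.
Local Notation V := 'rV[R]_3.
Local Notation e_ i := (delta_mx 0 i : V).
Implicit Types (x v : V) (l : nat) (P Q : V -> R[i]) (i j : 'I_3).

(** Equalities are asked off the origin only, the value at the pole being arbitrary. *)
Inductive waves : (V -> R[i]) -> Prop :=
| waves_one l P f : hp l P -> harmonic P -> (forall x, x != 0 -> f x = P x * eta k l (dot x x)) -> waves f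
| waves_add f g h : waves f -> waves g -> (forall x, x != 0 -> h x = f x + g x) -> waves h.

Lemma waves_ext f g : waves f -> (forall x, x != 0 -> g x = f x) -> waves g.
Proof.
move=> h; elim: h g => [l P f1 hP hh hf|f1 g1 h1 wf _ wg _ hh] g hg.
  by apply: (waves_one hP hh) => x x0; rewrite hg// hf.
by apply: (waves_add wf wg) => x x0; rewrite hg// hh.
Qed.

Lemma waves_scale f (c : R[i]) : waves f -> waves (fun x => c * f x).
Proof.
elim=> [l P f1 hP hh hf|f1 g1 h1 _ wf _ wg hh].
  apply: (@waves_one l (fun x => c * P x)) => [|x|x x0]; first exact: hpZ.
    have C := hp_CkC 2 hP; have d1 i : cpd i (fun y => c * P y) = fun y => c * cpd i P y.
      by apply/funext => y; apply: cpd_cderive; apply: cdZ; exact: CkC_cderive C I.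
    transitivity (c * claplacian P x); last by rewrite hh mulr0.
    rewrite !claplacianE mulr_sumr; apply: eq_bigr => i _.
    by rewrite d1; apply: cpd_cderive; apply: cdZ; exact: CkC_cderive (CkC_pd i C) I.
  by rewrite hf// mulrA.
by apply: (waves_add wf wg) => x x0; rewrite hh// mulrDr.
Qed.

Lemma hp_dot v : hp 1 (fun x => (dot v x)%:C).
Proof.
have h0 : hp 0 (fun _ : V => 1 : R[i]).
  by apply: hp_eq (hp_mon (l := 0) 1 (b := (0, 0, 0)%N) erefl) _ => x; rewrite /mon /= !expr0 !mulr1.
apply: hp_eq (hp_sum (index_enum 'I_3) (fun i => hpZ (v 0 i)%:C (hp_coord i h0))) _ => x.
by rewrite /dot (rmorph_sum (real_complex R)); apply: eq_bigr => i _; rewrite /= rcM mulr1.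
Qed.

Lemma hp_sqr l P : hp l P -> hp l.+2 (fun x => (dot x x)%:C * P x).
Proof.
move=> hP; apply: hp_eq (hp_sum (index_enum 'I_3) (fun i => hp_coord i (hp_coord i hP))) _ => x.
rewrite /dot (rmorph_sum (real_complex R)) mulr_suml; apply: eq_bigr => i _.
by rewrite /= rcM mulrA.
Qed.

Lemma cpd_dot v x i : cpd i (fun x => (dot v x)%:C) x = (v 0 i)%:C.
Proof.
apply: cpd_cderive; apply: cderive_eq (cd_real (d_dot v x (e_ i))) _; congr (_%:C).
by rewrite /dot (bigD1 i)//= delta_coord eqxx mulr1 big1 ?addr0// => j ji; rewrite delta_coord eq_sym (negbTE ji) mulr0.
Qed.

Lemma cpd_sqr x i : cpd i (fun x : V => (dot x x)%:C) x = (2 * x 0 i)%:C.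
Proof.
have D : is_derive x (e_ i) (fun y : V => dot y y) (2 * dot (e_ i) x).
  have := d_dist (0 : V) x (e_ i); rewrite subr0.
  by rewrite (_ : (fun y : V => dot (y - 0) (y - 0)) = fun y => dot y y)//; apply/funext => y; rewrite subr0.
apply: cpd_cderive; apply: cderive_eq (cd_real D) _; congr (_ * _)%:C.
by rewrite /dot (bigD1 i)//= delta_coord eqxx mul1r big1 ?addr0// => j ji; rewrite delta_coord eq_sym (negbTE ji) mul0r.
Qed.

Lemma laplacian_dotM l P v x : hp l P -> harmonic P ->
  claplacian (fun x => (dot v x)%:C * P x) x = 2%:R * \sum_(i < 3) (v 0 i)%:C * cpd i P x.
Proof.
move=> hP hh; rewrite (claplacianM openT I (hp_CkC 2 (hp_dot v)) (hp_CkC 2 hP)) hh mulr0 addr0.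
rewrite claplacianE big1 ?mul0r ?add0r; last first.
  move=> i _; have -> : cpd i (fun x => (dot v x)%:C) = fun=> (v 0 i)%:C by apply/funext => y; exact: cpd_dot.
  by apply: cpd_cderive; exact: cdC.
by congr (_ * _); apply: eq_bigr => i _; rewrite cpd_dot.
Qed.

Lemma laplacian_sqrM l P x : hp l P -> harmonic P ->
  claplacian (fun x => (dot x x)%:C * P x) x = (4 * l + 6)%:R * P x.
Proof.
move=> hP hh.
have c2 : CkC 2 setT (fun x : V => (dot x x)%:C).
  have h0 : hp 0 (fun _ : V => 1 : R[i]).
    by apply: hp_eq (hp_mon (l := 0) 1 (b := (0, 0, 0)%N) erefl) _ => y; rewrite /mon /= !expr0 !mulr1.
  apply: CkC_eq openT _ (hp_CkC 2 (hp_sqr h0)) => y _; exact: mulr1.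
rewrite (claplacianM openT I c2 (hp_CkC 2 hP)) hh mulr0 addr0 claplacianE.
have d2 i : cpd i (cpd i (fun x : V => (dot x x)%:C)) x = 2%:R.
  have -> : cpd i (fun x : V => (dot x x)%:C) = fun y => (2 * y 0 i)%:C by apply/funext => y; exact: cpd_sqr.
  apply: cpd_cderive; apply: cderive_eq (cd_real (dZ 2 (d_coord i x (e_ i)))) _.
  by rewrite delta_coord eqxx mulr1 rc_nat.
rewrite (eq_bigr _ (fun i _ => d2 i)) sumr_const card_ord.
have -> : \sum_(i < 3) cpd i (fun x : V => (dot x x)%:C) x * cpd i P x = 2%:R * (l%:R * P x).
  rewrite -(hp_euler x hP) mulr_sumr; apply: eq_bigr => i _.
  by rewrite cpd_sqr rcM rc_nat mulrA.
by rewrite natrD natrM -mulr_natr; ring.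
Qed.

Lemma eta_radial l x v : x != 0 ->
  cderive x v (fun y => eta k l (dot y y)) ((dot v x)%:C * eta k l.+1 (dot x x)).
Proof.
move=> x0; have q0 : 0 < dot x x by rewrite -enorm_sqr exprn_gt0// enorm_gt0.
have D : is_derive x v (fun y : V => dot y y) (2 * dot v x).
  have := d_dist (0 : V) x v; rewrite subr0.
  by rewrite (_ : (fun y : V => dot (y - 0) (y - 0)) = fun y => dot y y)//; apply/funext => y; rewrite subr0.
have C := @cdchain R V x v (eta k l) (fun y => dot y y) _ _ (eta_deriv k0 l q0) D; apply: cderive_eq C _.
by rewrite mulrAC -rcM mulrA mulVf// mul1r mulrC.
Qed.

Lemma near_neq0 x : x != 0 -> \near x, x != 0.
Proof.
move=> x0; have : \near x, 0 < enorm (x - 0) by apply: enorm_near_gt; rewrite subr0 enorm_gt0.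
by apply: filterS => y; rewrite subr0; apply: contraTneq => ->; rewrite enorm0 ltxx.
Qed.

Lemma claplacianDZ P Q (c : R[i]) x : CkC 2 setT P -> CkC 2 setT Q ->
  claplacian (fun x => P x + c * Q x) x = claplacian P x + c * claplacian Q x.
Proof.
move=> cP cQ; have d1 i : cpd i (fun x => P x + c * Q x) = fun y => cpd i P y + c * cpd i Q y.
  by apply/funext => y; apply: cpd_cderive; apply: cdD; [exact: CkC_cderive cP I|apply: cdZ; exact: CkC_cderive cQ I].
rewrite !claplacianE mulr_sumr -big_split; apply: eq_bigr => i _; rewrite d1.
apply: cpd_cderive; apply: cdD; first exact: CkC_cderive (CkC_pd i cP) I.
by apply: cdZ; exact: CkC_cderive (CkC_pd i cQ) I.
Qed.

(** The derivative of P times a radial function contains (v.x) P, which is not harmonic; a multiple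
    of |x|^2 times the derivative of P corrects it. The radial equation then collects the remaining
    terms, so that degree l + 1 is sent to degrees l + 2 and l. *)
Lemma waves_derive f v : waves f ->
  exists2 g, waves g & forall x, x != 0 -> cderive x v f (g x).
Proof.
elim=> [l P f1 hP hh hf|f1 g1 h1 _ [f' wf df] _ [g' wg dg] hh]; last first.
  exists (fun x => f' x + g' x); first by apply: (waves_add wf wg).
  move=> x x0; apply: cd_near (cdD (df x x0) (dg x x0)).
  by apply: filterS (near_neq0 x0) => y /hh ->.
pose G x := \sum_(i < 3) (v 0 i)%:C * cpd i P x.
have D x : x != 0 -> cderive x v f1 (G x * eta k l (dot x x) + P x * ((dot v x)%:C * eta k l.+1 (dot x x))).
  move=> x0; apply: cd_near (cdM (hp_cderive x v hP) (eta_radial l v x0)).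
  by apply: filterS (near_neq0 x0) => y /hf ->.
case: l hP hf D => [|l] hP hf D.
  exists (fun x => (dot v x)%:C * P x * eta k 1 (dot x x)).
    apply: (@waves_one 1 (fun x => (dot v x)%:C * P x)); last by [].
      by apply: hp_eq (hp_sum (index_enum 'I_3) (fun i => hpZ (v 0 i)%:C (hp_coord i hP))) _ => x;
        rewrite /dot (rmorph_sum (real_complex R)) mulr_suml; apply: eq_bigr => i _; rewrite /= rcM mulrA.
    move=> x; rewrite (laplacian_dotM v x hP hh) big1 ?mulr0// => i _.
    by rewrite (@cpd_near_cst R P x i (P 0)) ?mulr0//; near=> y; exact: hp0_const.
  move=> x x0; apply: cderive_eq (D x x0) _.
  rewrite /G big1 ?mul0r ?add0r ?mulrA ?[P x * _]mulrC// => i _.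
  by rewrite (@cpd_near_cst R P x i (P 0)) ?mulr0//; near=> y; exact: hp0_const.
have hG : hp l G by apply: hp_sum => i; apply: hpZ; exact: (hp_cpd i hP).
have hhG : harmonic G.
  move=> x; rewrite claplacianE.
  have d1 i : cpd i G = fun y => \sum_(j < 3) (v 0 j)%:C * cpd i (cpd j P) y.
    by apply/funext => y; apply: cpd_cderive; apply: cd_sum => j; apply: cdZ; exact: CkC_cderive (hp_CkC 1 (hp_cpd j hP)) I.
  have d2 i : cpd i (cpd i G) x = \sum_(j < 3) (v 0 j)%:C * cpd i (cpd i (cpd j P)) x.
    by rewrite d1; apply: cpd_cderive; apply: cd_sum => j; apply: cdZ; exact: CkC_cderive (CkC_pd i (hp_CkC 2 (hp_cpd j hP))) I.
  rewrite (eq_bigr _ (fun i _ => d2 i)) exchange_big big1// => j _.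
  by rewrite -mulr_sumr -claplacianE (harmonic_cpd j hP hh) mulr0.
pose c : R[i] := (2 * l + 3)%:R^-1.
have c0 : (2 * l + 3)%:R != 0 :> R[i] by rewrite pnatr_eq0 addn3.
(* The Laplacians of (v.x) P and |x|^2 G are 2 G and (4 l + 6) G; c is their ratio, which makes Q
   harmonic. *)
pose Q x := (dot v x)%:C * P x + - c * ((dot x x)%:C * G x).
have hvP : hp l.+2 (fun x => (dot v x)%:C * P x).
  by apply: hp_eq (hp_sum (index_enum 'I_3) (fun i => hpZ (v 0 i)%:C (hp_coord i hP))) _ => x;
    rewrite /dot (rmorph_sum (real_complex R)) mulr_suml; apply: eq_bigr => i _; rewrite /= rcM mulrA.
have hQ : hp l.+2 Q by apply: hpD hvP (hpZ _ (hp_sqr hG)).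
have hhQ : harmonic Q.
  move=> x; rewrite (claplacianDZ _ _ (hp_CkC 2 hvP) (hp_CkC 2 (hp_sqr hG))).
  rewrite (laplacian_dotM v x hP hh) (laplacian_sqrM x hG hhG) -/(G x).
  have -> : (4 * l + 6)%:R = 2%:R * (2 * l + 3)%:R :> R[i] by rewrite -natrM; congr (_%:R); lia.
  by rewrite /c; move: (G x) ((2 * l + 3)%:R : R[i]) c0 => g n n0; field.
have w1 : waves (fun x => Q x * eta k l.+2 (dot x x)) by apply: (waves_one hQ hhQ).
have w2 : waves (fun x => - (k ^+ 2)%:C * c * (G x * eta k l (dot x x))).
  by apply: waves_scale; apply: (waves_one hG hhG).
exists (fun x => Q x * eta k l.+2 (dot x x) + - (k ^+ 2)%:C * c * (G x * eta k l (dot x x))).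
  by apply: (waves_add w1 w2).
move=> x x0; apply: cderive_eq (D x x0) _; rewrite /Q /c.
have q0 : 0 < dot x x by rewrite -enorm_sqr exprn_gt0// enorm_gt0.
have := eta_ode k0 l q0.
move: (eta k l _) (eta k l.+1 _) (eta k l.+2 _) (G x) (P x) (dot v x)%:C (dot x x)%:C (k ^+ 2)%:C ((2 * l + 3)%:R : R[i]) c0
  => a0 a1 a2 g p w q kk n n0 ode.
have -> : a1 = - n^-1 * (q * a2 + kk * a0).
  apply: (mulfI n0); rewrite mulrA mulrN divff// mulN1r; apply/eqP; rewrite -subr_eq0 opprK.
  by rewrite -ode; apply/eqP; ring.
by field.
Unshelve. all: by end_near. Qed.

End outgoing_waves.

(** * Surface measure *)

Section surface_measure.
Variable R : realType.
Local Notation V := 'rV[R]_3.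
Local Notation mu := (hausdorff2_outer R).
Local Open Scope ereal_scope.
Implicit Types (A B X U : set V) (x y : V).

Lemma enorm_ediam U x y : U x -> U y -> (enorm (x - y))%:E <= ediam U.
Proof.
move=> Ux Uy; rewrite /ediam le_max; apply/orP; right.
by apply: ereal_sup_ubound; exists (x, y).
Qed.

Lemma ediam_le U (r : R) : (0 <= r)%R -> (forall x y, U x -> U y -> (enorm (x - y) <= r)%R) -> ediam U <= r%:E.
Proof.
move=> r0 h; rewrite /ediam ge_max lee_fin r0 /=.
by apply: ge_ereal_sup => _ [[x y] [Ux Uy] <-]; rewrite lee_fin h.
Qed.

Definition separated (e : R) A B := forall x y, A x -> B y -> (e <= enorm (x - y))%R.

(** A set of diameter at most d < e cannot meet both parts, so a cover of the union splits into
    covers of each. *)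
Lemma hausdorff2_pre_sep (d e : R) A B : (0 < d)%R -> (d < e)%R -> separated e A B ->
  hausdorff2_pre d A + hausdorff2_pre d B <= hausdorff2_pre d (A `|` B).
Proof.
move=> d0 de sAB; apply: le_ereal_inf_tmp => _ [U [ABU Ud] <-].
pose res C i := if `[< U i `&` C !=set0 >] then U i else set0.
have resU C : C `<=` \bigcup_i U i -> hausdorff2_pre d C <= \sum_(i <oo) disc_area (res C i).
  move=> CU; apply: ereal_inf_lbound; exists (res C) => //; split.
    move=> x Cx; have [i _ Ui] := CU x Cx; exists i => //; rewrite /res.
    by case: asboolP => // h; exfalso; apply: h; exists x.
  by move=> i; rewrite /res; case: ifP => // _; rewrite ediam0 lee_fin ltW.
apply: le_trans (leeD (resU A _) (resU B _)) _.
- by move=> x Ax; apply: ABU; left.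
- by move=> x Bx; apply: ABU; right.
rewrite -nneseriesD; try by move=> *; exact: disc_area_ge0.
apply: lee_nneseries => [i _ _|i _]; first by apply: adde_ge0; exact: disc_area_ge0.
rewrite /res; case: asboolP => [[a [Ua Aa]]|_]; case: asboolP => [[b [Ub Bb]]|_];
  rewrite ?disc_area0 ?adde0 ?add0e ?disc_area_ge0//.
have := le_trans (enorm_ediam Ua Ub) (Ud i); rewrite lee_fin => h.
by have := lt_le_trans de (sAB _ _ Aa Bb); rewrite ltNge h.
Qed.

Lemma hausdorff2_pre_anti (d d' : R) A : (d <= d')%R -> hausdorff2_pre d' A <= hausdorff2_pre d A.
Proof.
move=> dd; apply: ereal_inf_le_tmp => _ [U [AU Ud] <-]; exists U => //; split => // i.
by apply: le_trans (Ud i) _; rewrite lee_fin.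
Qed.

Lemma hausdorff2_sep (e : R) A B : (0 < e)%R -> separated e A B -> mu A + mu B <= mu (A `|` B).
Proof.
move=> e0 sAB; have [->|Moo] := eqVneq (mu (A `|` B)) +oo; first exact: leey.
have M_oo : mu (A `|` B) < +oo by rewrite ltey.
have fA : mu A \is a fin_num.
  rewrite ge0_fin_numE ?outer_measure_ge0//; apply: le_lt_trans M_oo; apply: le_outer_measure; exact: subsetUl.
have fB : mu B \is a fin_num.
  rewrite ge0_fin_numE ?outer_measure_ge0//; apply: le_lt_trans M_oo; apply: le_outer_measure; exact: subsetUr.
apply/lee_addgt0Pr => t t0; have t2 : (0 < t / 2)%R by rewrite divr_gt0.
have [_ [d1 d10 <-] hA] := ub_ereal_sup_adherent t2 fA.
have [_ [d2 d20 <-] hB] := ub_ereal_sup_adherent t2 fB.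
have d10' : (0 < d1)%R by []. have d20' : (0 < d2)%R by [].
(* A scale fine enough for both suprema and still below the separation e. *)
pose d : R := Num.min d1 (Num.min d2 (e / 2)%R).
have d0 : (0 < d)%R by rewrite !lt_min d10' d20' divr_gt0.
have de : (d < e)%R by rewrite !gt_min; apply/orP; right; apply/orP; right; rewrite ltr_pdivrMr// ltr_pMr// ltr1n.
have H : hausdorff2_pre d1 A + hausdorff2_pre d2 B <= mu (A `|` B).
  apply: le_trans (leeD (_ : _ <= hausdorff2_pre d A) (_ : _ <= hausdorff2_pre d B)) _.
  - by apply: hausdorff2_pre_anti; rewrite ge_min lexx.
  - by apply: hausdorff2_pre_anti; rewrite !ge_min lexx orbT.
  apply: le_trans (hausdorff2_pre_sep d0 de sAB) _.
  by apply: ereal_sup_ubound; exists d.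
have hA' : mu A <= hausdorff2_pre d1 A + (t / 2)%:E by rewrite -leeBlDr// ltW.
have hB' : mu B <= hausdorff2_pre d2 B + (t / 2)%:E by rewrite -leeBlDr// ltW.
apply: le_trans (leeD hA' hB') _; rewrite addeACA -EFinD -splitr.
exact: leeD2r.
Qed.

Lemma sum_even_odd (f : nat -> \bar R) n : (forall m, 0 <= f m) ->
  \sum_(0 <= m < n.*2) f m = \sum_(0 <= m < n) f m.*2 + \sum_(0 <= m < n) f m.*2.+1.
Proof.
move=> f0; elim: n => [|n IH]; first by rewrite !big_nil adde0.
by rewrite doubleS !big_nat_recr//= IH -addeA addeACA.
Qed.

(** Caratheodory's criterion for a metric outer measure, applied to a sublevel set of a 1-Lipschitz
    function. [X] off the set is exhausted by the separated parts [Y n]; what [Y n] misses is a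
    union of layers [Q m] with m >= n, and the measures of all layers have a finite sum. *)
Lemma caratheodory_level (phi : V -> R) : (forall x y, `|phi x - phi y| <= enorm (x - y))%R ->
  mu.-caratheodory [set x | (phi x <= 0)%R].
Proof.
move=> lip; apply: le_caratheodory_measurable => X; set F := [set x | _].
have [->|Xoo] := eqVneq (mu X) +oo; first exact: leey.
pose Y n := X `&` [set x | ((n.+2%:R)^-1 <= phi x)%R].
pose Q m := X `&` [set x | ((m.+3%:R)^-1 <= phi x)%R /\ (phi x < (m.+2%:R)^-1)%R].
have inv_lt (n : nat) : ((n.+2%:R)^-1 < (n.+1%:R)^-1 :> R)%R by rewrite ltf_pV2 ?posrE// ltr_nat.
have inv_le (n m : nat) : (n <= m)%N -> ((m.+1%:R)^-1 <= (n.+1%:R)^-1 :> R)%R.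
  by move=> h; rewrite lef_pV2 ?posrE// ler_nat.
have c1 n : mu (X `&` F) + mu (Y n) <= mu X.
  apply: le_trans (@hausdorff2_sep (n.+2%:R)^-1 _ _ _ _) _; first by rewrite invr_gt0.
    move=> x y [_ Fx] [_ Yy]; rewrite enormB; apply: le_trans (lip y x).
    have a : (phi x <= 0)%R := Fx; have b : ((n.+2%:R)^-1 <= phi y)%R := Yy.
    by apply: le_trans (ler_norm _); apply: le_trans b _; rewrite lerDl oppr_ge0.
  by apply: le_outer_measure => x [[]|[]].
(* Layers whose indices have the same parity p are separated by the layer between them, so their
   measures add up to at most that of [X]. *)
have c2 p n : \sum_(0 <= m < n) mu (Q (m.*2 + p)%N) <= mu (X `&` [set x | (((n.*2 + p).+1%:R)^-1 <= phi x)%R]).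
  elim: n => [|n IH]; first by rewrite big_nil outer_measure_ge0.
  rewrite big_nat_recr//=; apply: le_trans (leeD2r _ IH) _.
  apply: le_trans (@hausdorff2_sep (((n.*2 + p).+1%:R)^-1 - ((n.*2 + p).+2%:R)^-1) _ _ _ _) _.
  - by rewrite subr_gt0 inv_lt.
  - move=> x y [_ Fx] [_ [_ Yy]]; apply: le_trans (lip x y).
    by apply: le_trans (ler_norm _); apply: lerB; [exact: Fx|exact: ltW Yy].
  - apply: le_outer_measure => x [[Xx h]|[Xx [h _]]]; split => //=.
    by apply: le_trans h; apply: inv_le; lia.
have c3 N : \sum_(0 <= m < N) mu (Q m) <= mu X + mu X.
  apply: le_trans (_ : \sum_(0 <= m < N.*2) mu (Q m) <= _).
    by apply: (@ereal_nondecreasing_series _ (fun m => mu (Q m)) xpredT 0) => [m _ _|]; [exact: outer_measure_ge0|rewrite -addnn leq_addr].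
  rewrite sum_even_odd; last by move=> m; exact: outer_measure_ge0.
  apply: leeD.
    under eq_bigr => m _ do rewrite -[m.*2]addn0.
    by apply: le_trans (c2 0%N N) _; apply: le_outer_measure => x [].
  under eq_bigr => m _ do rewrite -[m.*2.+1]addn1.
  by apply: le_trans (c2 1%N N) _; apply: le_outer_measure => x [].
have c4 : \sum_(m <oo) mu (Q m) < +oo.
  apply: (@le_lt_trans _ _ (mu X + mu X)); last by rewrite lte_add_pinfty// ltey.
  apply: lime_le; first by apply: is_cvg_nneseries => m _ _; exact: outer_measure_ge0.
  by apply: nearW => N; exact: c3.
have c5 n : X `&` ~` F `<=` Y n `|` \bigcup_(m in ~` `I_n) Q m.
  move=> x [Xx /negP]; rewrite -ltNge => px.
  have [h|h] := leP ((n.+2%:R)^-1)%R (phi x); first by left; split.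
  right.
  have ex : exists m : nat, ((m.+3%:R)^-1 <= phi x)%R.
    exists (Num.truncn (phi x)^-1); rewrite -[leRHS]invrK lef_pV2 ?posrE ?invr_gt0//.
    by apply: le_trans (ltW (truncnS_gt _)) _; rewrite ler_nat; exact: leq_trans (leqnSn _) (leqnSn _).
  case: (ex_minnP ex) => m hm mm; exists m.
    move=> mn0; have mn : (m < n)%N := mn0.
    have := le_lt_trans hm h; rewrite ltf_pV2 ?posrE// ltr_nat; move: mn; clear; lia.
  split => //; split => //; rewrite ltNge; apply/negP => hm2.
  case: m hm mm hm2 => [|m] hm mm hm2; last by have := mm m hm2; rewrite ltnn.
  by have := lt_le_trans h (inv_le 1%N n.+1 isT); rewrite ltNge hm2.
have c6 := nneseries_tail_cvg c4 (fun m _ => outer_measure_ge0 mu (Q m)).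
apply/lee_addgt0Pr => t t0.
have [n hn] : exists n, \sum_(n <= m <oo) mu (Q m) <= t%:E.
  move/fine_cvgP: c6 => [[N _ fN]] /cvgrPdist_le/(_ t t0)[M _ hM].
  exists (maxn N M); have := hM (maxn N M) (leq_maxr _ _); rewrite sub0r normrN /= => h.
  rewrite -(fineK (fN _ (leq_maxl N M))) lee_fin; exact: le_trans (ler_norm _) h.
apply: le_trans (leeD2l _ (le_trans (le_outer_measure mu _ _ (c5 n)) (outer_measureU2 mu _ _))) _.
rewrite addeA; apply: leeD (c1 n) _.
by apply: le_trans (outer_measure_sigma_subadditive_tail mu n Q) hn.
Qed.

Local Notation T := (caratheodory_type mu).

Lemma area_coord_measurable (i : 'I_3) : measurable_fun [set: T] (fun t : T => (t : V) 0%R i : R).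
Proof.
apply: (measurability _ (RGenCInfty.measurableE R)) => //= _ [_ [a ->] <-].
rewrite setTI (_ : _ @^-1` _ = [set x : V | (a - x 0%R i <= 0)%R]).
  apply: (@caratheodory_level (fun x => a - x 0 i)%R) => x y.
  have -> : (a - x 0 i - (a - y 0 i) = (y - x) 0 i)%R by rewrite !mxE; ring.
  by rewrite enormB coord_le_enorm.
by apply/seteqP; split => x /=; rewrite in_itv /= andbT subr_le0.
Qed.

Lemma area_open_measurable (O : set V) : open O -> measurable (O : set T).
Proof. exact: (measurable_preimage_open area_coord_measurable). Qed.

Lemma area_continuous_measurable (O : set V) (f : V -> R) : open O ->
  (forall x, O x -> {for x, continuous f}) -> measurable_fun (O : set T) (f : T -> R).
Proof. exact: (measurable_continuous_on area_coord_measurable). Qed.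

Lemma area_sphere_measurable : measurable (@sphere R : set T).
Proof.
rewrite (_ : @sphere R = ~` (@enorm R @^-1` ~` [set 1%R])); last by rewrite preimage_setC setCK.
apply: measurableC; apply: area_open_measurable; apply: open_comp.
  by move=> x _; exact: enorm_cont.
by rewrite openC; exact: closed_eq.
Qed.

Lemma hausdorff2_finU A B : mu A < +oo -> mu B < +oo -> mu (A `|` B) < +oo.
Proof. by move=> a b; apply: le_lt_trans (outer_measureU2 mu A B) _; rewrite lte_add_pinfty. Qed.

Lemma grid_cell (M : R) (N : nat) (t : R) : (0 < M)%R -> (`|t| <= M)%R ->
  exists2 i, (i < N.+1)%N & (- M + i%:R * (2 * M / N.+1%:R) <= t <= - M + i.+1%:R * (2 * M / N.+1%:R))%R.
Proof.
move=> M0 tM; have N0 : (0 < N.+1%:R :> R)%R by [].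
have ex : exists i, (t <= - M + i.+1%:R * (2 * M / N.+1%:R))%R.
  exists N; have -> : (- M + N.+1%:R * (2 * M / N.+1%:R) = M)%R by field; rewrite gt_eqF.
  exact: le_trans (ler_norm _) tM.
case: (ex_minnP ex) => i hi mi; exists i.
  have -> : (i < N.+1)%N = (i <= N)%N by []. apply: mi.
  have -> : (- M + N.+1%:R * (2 * M / N.+1%:R) = M)%R by field; rewrite gt_eqF.
  exact: le_trans (ler_norm _) tM.
rewrite hi andbT; case: i hi mi => [|i] _ mi.
  by rewrite mul0r addr0; move: tM; rewrite ler_norml => /andP[].
by rewrite leNgt; apply/negP => /ltW/mi; rewrite ltnn.
Qed.

(** With a grid of (N + 1)^2 cells the images have diameter at most 4 M L / (N + 1), so the total
    disc area is bounded independently of N. *)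
Lemma hausdorff2_lipschitz_image (psi : R * R -> V) (L M : R) : (0 <= L)%R -> (0 < M)%R ->
  (forall p q : R * R, (`|p.1| <= M -> `|p.2| <= M -> `|q.1| <= M -> `|q.2| <= M ->
    enorm (psi p - psi q) <= L * (`|p.1 - q.1| + `|p.2 - q.2|))%R) ->
  mu (psi @` [set p | (`|p.1| <= M /\ `|p.2| <= M)%R]) < +oo.
Proof.
move=> L0 M0 lip; apply: le_lt_trans (_ : (pi / 4 * (4 * M * L) ^+ 2)%:E < +oo); last exact: ltey.
apply: ge_ereal_sup => _ [d /= d0 <-].
(* Fine enough for the images of the cells to have diameter at most d. *)
pose N := Num.truncn (4 * M * L / d)%R.
have hN : (4 * M * L / N.+1%:R <= d)%R.
  by rewrite ler_pdivrMr// -ler_pdivrMl// mulrC; exact/ltW/truncnS_gt.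
pose w : R := (2 * M / N.+1%:R)%R.
pose cell i j := [set p : R * R | [/\ (`|p.1| <= M)%R, (`|p.2| <= M)%R,
  (- M + i%:R * w <= p.1 <= - M + i.+1%:R * w)%R & (- M + j%:R * w <= p.2 <= - M + j.+1%:R * w)%R]].
(* Cells are numbered by quotient and remainder; the sequence is completed with empty sets, of area
   0. *)
pose U n := if (n < N.+1 * N.+1)%N then psi @` cell (n %/ N.+1)%N (n %% N.+1)%N else set0.
have dU n : ediam (U n) <= (4 * M * L / N.+1%:R)%:E.
  apply: ediam_le; first by rewrite !mulr_ge0 ?invr_ge0 ?(ltW M0).
  rewrite /U; case: ifP => // _ _ _ [p [p1 p2 p3 p4] <-] [q [q1 q2 q3 q4] <-].
  apply: le_trans (lip p q p1 p2 q1 q2) _.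
  have -> : (4 * M * L / N.+1%:R = L * (w + w))%R by rewrite /w; ring.
  have step (i : nat) (a b : R) : (- M + i%:R * w <= a <= - M + i.+1%:R * w)%R ->
      (- M + i%:R * w <= b <= - M + i.+1%:R * w)%R -> (`|a - b| <= w)%R.
    by rewrite -natr1 mulrDl mul1r => /andP[a1 a2] /andP[b1 b2]; rewrite ler_norml; apply/andP; split; lra.
  by apply: ler_wpM2l => //; apply: lerD; apply: step; eassumption.
apply: le_trans (_ : \sum_(n <oo) disc_area (U n) <= _).
  apply: ereal_inf_lbound; exists U => //; split; last by move=> n; apply: le_trans (dU n) _; rewrite lee_fin.
  move=> _ [p [p1 p2] <-].
  have [i iN hi] := grid_cell N M0 p1; have [j jN hj] := grid_cell N M0 p2.
  exists (i * N.+1 + j)%N => //; rewrite /U ifT; last by nia.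
  by exists p => //; rewrite divnMDl// divn_small// addn0 modnMDl modn_small.
set K := (N.+1 * N.+1)%N in U dU *.
rewrite (nneseries_split _ K) ?add0n; last by move=> n _; exact: disc_area_ge0.
rewrite [X in _ + X]eseries0 ?adde0; last first.
  by move=> n nN _; rewrite /U ltnNge nN /= disc_area0.
apply: le_trans (_ : \sum_(0 <= n < K) (pi / 4 * (4 * M * L / N.+1%:R) ^+ 2)%:E <= _).
  apply: lee_sum => n _; rewrite /disc_area [leRHS]EFinM; apply: lee_pmul.
  - by rewrite lee_fin divr_ge0 ?pi_ge0.
  - by rewrite expe_ge0 ?ediam_ge0.
  - by [].
  - by rewrite EFin_expe !expe2; apply: lee_pmul; rewrite ?ediam_ge0 ?dU.
rewrite sumEFin lee_fin big_const_nat iter_addr_0 subn0 -[(_ *+ K)%R]mulr_natl /K natrM.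
by apply: le_of_eq; field; rewrite gt_eqF.
Qed.

Lemma compact_subcover (K : set V) (r : V -> R) : compact K -> (forall x, K x -> (0 < r x)%R) ->
  exists2 s : seq V, (forall p, p \in s -> K p) & forall x, K x -> exists2 p, p \in s & (enorm (x - p) < r p)%R.
Proof.
rewrite compact_cover => cK r0.
have [||D sD KD] := cK V K (fun p => [set x | (enorm (x - p) < r p)%R]).
- move=> p Kp; apply: (@open_comp _ _ (fun y : V => enorm (y - p)) [set t | (t < r p)%R]); last exact: open_lt.
  move=> z _; apply: (@continuous_comp _ _ _ (fun y => y - p)%R (@enorm R)); first exact: shift_cont.
  exact: enorm_cont.
- by move=> x Kx; exists x => //=; rewrite subrr enorm0 r0.
exists (finmap.enum_fset D) => [p /sD|x /KD[p pD xp]]; first by rewrite inE.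
by exists p.
Qed.

Lemma compact_hausdorff2 (K : set V) : compact K ->
  (forall x, K x -> exists2 r : R, (0 < r)%R & mu (K `&` [set y | (enorm (y - x) < r)%R]) < +oo) -> mu K < +oo.
Proof.
move=> cK loc.
have [r hr] : {r : V -> R & forall x, K x -> (0 < r x)%R /\ mu (K `&` [set y | (enorm (y - x) < r x)%R]) < +oo}.
  apply: (@choice _ _ (fun x r => K x -> (0 < r)%R /\ mu (K `&` [set y | (enorm (y - x) < r)%R]) < +oo)) => x.
  have [Kx|nK] := pselect (K x); last by exists 0%R.
  by have [r r0 h] := loc x Kx; exists r.
have [s sK Ks] := compact_subcover cK (fun x Kx => (hr x Kx).1).
pose W p := K `&` [set y | (enorm (y - p) < r p)%R].
have : mu (\bigcup_(p in [set p | p \in s]) W p) < +oo.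
  elim: s sK {Ks} => [|p s IH] sK.
    by rewrite (_ : bigcup _ _ = set0) ?outer_measure0//; apply/seteqP; split => x // [].
  apply: le_lt_trans (hausdorff2_finU (hr p (sK p (mem_head _ _))).2 (IH _)).
    apply: le_outer_measure => x [q]; rewrite /= inE => /orP[/eqP ->|qs] Wx; first by left.
    by right; exists q.
  by move=> q qs; apply: sK; rewrite inE qs orbT.
apply: le_lt_trans; apply: le_outer_measure => x Kx.
by have [p ps xp] := Ks x Kx; exists p.
Qed.

End surface_measure.

(** * Approximation by outgoing sums *)

Section approximation_by_outgoing_sums.
Variables (R : realType) (D : set 'rV[R]_3) (k : R)
  (Y : forall l : nat, 'I_(l.*2.+1) -> 'rV[R]_3 -> R[i]).
Hypothesis k0 : 0 < k.
Hypothesis D0 : D 0.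
Hypothesis Yspan : forall l (P : 'rV[R]_3 -> R[i]), hp l P -> harmonic P ->
  exists c : 'I_(l.*2.+1) -> R[i], forall x, sphere x -> P x = \sum_m c m * Y m x.
Local Notation V := 'rV[R]_3.
Implicit Types (f g w : V -> R[i]) (x y z : V).

(** The coefficients beyond the degree vanish, as in the convention of the statement; sums of
    different degrees can then be brought to a common one and added. *)
Definition outgoing w := exists L (c : forall l : nat, 'I_(l.*2.+1) -> R[i]),
  (forall l (m : 'I_(l.*2.+1)), (L < l)%N -> c l m = 0) /\
  forall x, ~ D x -> w x = outgoing_sum k Y L c x.

Lemma outgoing_sum_widen L L' (c : forall l : nat, 'I_(l.*2.+1) -> R[i]) x : (L <= L')%N ->
  (forall l (m : 'I_(l.*2.+1)), (L < l)%N -> c l m = 0) ->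
  outgoing_sum k Y L' c x = outgoing_sum k Y L c x.
Proof.
move=> LL c0; rewrite /outgoing_sum.
pose g (l : nat) := \sum_(m < l.*2.+1) c l m * Psi k Y m x.
rewrite -(big_mkord xpredT g) -[RHS](big_mkord xpredT g).
rewrite (@big_cat_nat _ _ _ L.+1)//= [X in _ + X]big_nat_cond [X in _ + X]big1 ?addr0// => l /andP[/andP[h _] _].
by rewrite /g big1// => m _; rewrite c0// mul0r.
Qed.

Lemma outgoing_add v w : outgoing v -> outgoing w -> outgoing (fun x => v x + w x).
Proof.
move=> [L1 [c1 [h1 e1]]] [L2 [c2 [h2 e2]]].
exists (maxn L1 L2); exists (fun l m => c1 l m + c2 l m); split.
  by move=> l m; rewrite gtn_max => /andP[a b]; rewrite h1// h2// addr0.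
move=> x nD; rewrite e1// e2// -(outgoing_sum_widen x (leq_maxl L1 L2) h1) -(outgoing_sum_widen x (leq_maxr L1 L2) h2).
rewrite /outgoing_sum -big_split; apply: eq_bigr => l _; rewrite -big_split; apply: eq_bigr => m _.
by rewrite /= mulrDl.
Qed.

Lemma outgoing_scale w (a : R[i]) : outgoing w -> outgoing (fun x => a * w x).
Proof.
move=> [L [c [h e]]]; exists L; exists (fun l m => a * c l m); split.
  by move=> l m /h ->; rewrite mulr0.
move=> x nD; rewrite e// /outgoing_sum mulr_sumr; apply: eq_bigr => l _; rewrite mulr_sumr; apply: eq_bigr => m _.
by rewrite mulrA.
Qed.

Lemma outgoing_wave l P : hp l P -> harmonic P -> outgoing (fun x => P x * eta k l (dot x x)).
Proof.
move=> hP hh; have [c hc] := Yspan hP hh.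
(* Only degree l occurs, and (ik)^l is the ratio of [eta l] to the Hankel function on the unit
   sphere, from [eta_hankel]. *)
pose c' l' (m : 'I_(l'.*2.+1)) := if l' == l then ('i * k%:C) ^+ l * c (inord m) else 0.
exists l; exists c'; split; first by move=> l' m h; rewrite /c' ifN// neq_ltn h orbT.
move=> x nD; have x0 : x != 0 by apply/eqP => e; apply: nD; rewrite e.
have r0 := enorm_gt0 x0.
rewrite /outgoing_sum big_ord_recr /= big1 ?add0r; last first.
  by move=> l' _; rewrite big1// => m _; rewrite /c' ifN ?mul0r// neq_ltn ltn_ord.
have xE : x = enorm x *: ((enorm x)^-1 *: x) by rewrite scalerA divff ?scale1r// gt_eqF.
have s1 : sphere ((enorm x)^-1 *: x).
  by rewrite /sphere /= enormZ ger0_norm ?mulVf ?gt_eqF// invr_ge0 ltW.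
have q0 : 0 < dot x x by rewrite -enorm_sqr exprn_gt0.
rewrite {1}xE (hp_scale _ _ hP) hc// (eta_hankel k0 l q0) -/(enorm x) mulr_sumr mulr_suml.
apply: eq_bigr => m _; rewrite /c' eqxx inord_val /Psi.
have E : ((enorm x) ^+ l)%:C * ((enorm x)^-1 ^+ l)%:C = 1 :> R[i].
  by rewrite -rcM -exprMn divff ?expr1n// gt_eqF.
move: (('i * k%:C) ^+ l) (c m) (Y m _) (hankel _ _ _) E => a b y h E.
move: ((enorm x ^+ l)%:C) (((enorm x)^-1 ^+ l)%:C) E => u v E.
transitivity ((u * v) * (a * b * (y * h))); last by rewrite E mul1r.
by ring.
Qed.

(* Approximability by outgoing sums off [D], in the norm sup (1 + |x|) |f x|. *)
Definition approx f := forall e : R, 0 < e -> exists2 w, outgoing w &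
  forall x, ~ D x -> (1 + enorm x) * normc (f x - w x) <= e.

Let wt_ge0 x : 0 <= 1 + enorm x. Proof. by rewrite addr_ge0// enorm_ge0. Qed.

(** Lets approximations be chained: Riemann sums, difference quotients, Taylor series and shifts
    each contribute one limit. *)
Lemma approx_closed f : (forall e : R, 0 < e -> exists2 g, approx g &
  forall x, ~ D x -> (1 + enorm x) * normc (f x - g x) <= e) -> approx f.
Proof.
move=> H e e0; have e2 : 0 < e / 2 by rewrite divr_gt0.
have [g /(_ _ e2)[w ow hw] hg] := H _ e2; exists w => // x nD.
rewrite (_ : f x - w x = (f x - g x) + (g x - w x)); last by rewrite addrA subrK.
apply: le_trans (ler_wpM2l (wt_ge0 x) (le_normcD _ _)) _.
by rewrite mulrDr [leRHS]splitr lerD// ?hg ?hw.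
Qed.

Lemma approx_ext f g : approx f -> (forall x, ~ D x -> g x = f x) -> approx g.
Proof. by move=> H E e /H[w ow hw]; exists w => // x nD; rewrite E// hw. Qed.

Lemma outgoing_approx w : outgoing w -> approx w.
Proof. by move=> ow e e0; exists w => // x _; rewrite subrr normc0 mulr0 ltW. Qed.

Lemma approx_add f g : approx f -> approx g -> approx (fun x => f x + g x).
Proof.
move=> hf hg e e0; have e2 : 0 < e / 2 by rewrite divr_gt0.
have [v ov hv] := hf _ e2; have [w ow hw] := hg _ e2.
exists (fun x => v x + w x); first exact: outgoing_add.
move=> x nD; rewrite (_ : f x + g x - _ = (f x - v x) + (g x - w x)); last by rewrite opprD addrACA.
apply: le_trans (ler_wpM2l (wt_ge0 x) (le_normcD _ _)) _.
by rewrite mulrDr [leRHS]splitr lerD// ?hv ?hw.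
Qed.

Lemma approx_scale f (a : R[i]) : approx f -> approx (fun x => a * f x).
Proof.
move=> hf e e0; have a1 : 0 < normc a + 1 by rewrite ltr_wpDl// normc_ge0.
have [w ow hw] := hf (e / (normc a + 1)) (divr_gt0 e0 a1).
exists (fun x => a * w x); first exact: outgoing_scale.
move=> x nD; rewrite -mulrBr normcM mulrCA.
apply: le_trans (ler_wpM2l (normc_ge0 a) (hw x nD)) _.
rewrite mulrCA -[leRHS]mulr1 ler_pM2l// ler_pdivrMr// mul1r lerDl//.
Qed.

Lemma approx0 : approx (fun=> 0).
Proof.
apply: outgoing_approx; exists 0%N; exists (fun _ _ => 0); split => // x _.
by rewrite /outgoing_sum big1// => l _; rewrite big1// => m _; rewrite mul0r.
Qed.

Lemma approx_sum (I : Type) (s : seq I) (F : I -> V -> R[i]) :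
  (forall a : I, approx (F a)) -> approx (fun x => \sum_(a <- s) F a x).
Proof.
move=> h; elim: s => [|a s IH]; first by apply: approx_ext approx0 _ => x _; rewrite big_nil.
by apply: approx_ext (approx_add (h a) IH) _ => x _; rewrite big_cons.
Qed.

Lemma waves_approx f : waves k f -> approx f.
Proof.
have nz x : ~ D x -> x != 0 by move=> nD; apply/eqP => e; apply: nD; rewrite e.
elim=> [l P f1 hP hh hf|f1 g1 h1 _ vf _ vg hh].
  by apply: approx_ext (outgoing_approx (outgoing_wave hP hh)) _ => x /nz/hf.
by apply: approx_ext (approx_add vf vg) _ => x /nz/hh.
Qed.

(** Trades the weight at x for the distance to a pole, against which the 1/|z| decay of the kernels
    cancels. *)
Lemma weight_le (delta : R) x p : 0 < delta -> delta <= enorm (x - p) ->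
  1 + enorm x <= ((1 + enorm p) / delta + 1) * enorm (x - p).
Proof.
move=> d0 h; rewrite mulrDl mul1r.
have h1 : 1 + enorm p <= (1 + enorm p) / delta * enorm (x - p).
  by rewrite mulrAC ler_pdivlMr// ler_wpM2l// addr_ge0// enorm_ge0.
have h2 : enorm x <= enorm p + enorm (x - p) by rewrite -{1}(subrK p x) addrC enormD.
move: h1 h2; lra.
Qed.

(** The next Taylor coefficient is a derivative in the position of the pole, hence the limit of
    difference quotients between two poles near y. The statement ranges over a whole segment of
    poles so that the induction can displace them. *)
Lemma polar_down (d : V) y (delta eta : R) : dot d d = 1 -> 0 < delta -> 0 < eta -> eta <= delta ->
  (forall x, ~ D x -> 3 * delta <= enorm (x - y)) ->
  (forall s : R, `|s| < eta -> approx (fun x => polar k d 0 (x - y - s *: d))) ->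
  forall n (s : R), `|s| < eta -> approx (fun x => polar k d n (x - y - s *: d)).
Proof.
move=> d1 dl0 et0 etd far V0; elim=> [//|n IH] s hs; apply: approx_closed => e e0.
have K0 := kap_gt0 k0 dl0.
pose p := y + s *: d.
pose Cw := (1 + enorm p) / delta + 1.
have Cw0 : 0 < Cw by rewrite ltr_wpDl// divr_ge0 ?addr_ge0 ?enorm_ge0// ltW.
(* The second-order error of [polar_diff2], divided by h (n + 1), is K h / |z|. *)
pose K := 8 * (n.+1%:R + 1) * kap k delta ^+ n.+2.
have KK : 0 < K.
  by apply: mulr_gt0; [apply: mulr_gt0 => //; exact: ltr_wpDl|exact: exprn_gt0].
pose h := Num.min ((eta - `|s|) / 2) (e / (K * Cw)).
have h0 : 0 < h by rewrite lt_min divr_gt0 ?subr_gt0//= divr_gt0// mulr_gt0.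
have hh1 : h <= (eta - `|s|) / 2 by rewrite ge_min lexx.
have hh2 : h <= e / (K * Cw) by rewrite ge_min lexx orbT.
have hn : `|h| = h by rewrite ger0_norm// ltW.
have hd : `|h| <= delta by rewrite hn; have := normr_ge0 s; move: hh1 etd; lra.
have hsh : `|s + h| < eta.
  by apply: le_lt_trans (ler_normD _ _) _; rewrite hn; move: hh1 h0; lra.
pose a : R[i] := (h%:C * (n%:R + 1))^-1.
exists (fun x => a * (polar k d n (x - y - (s + h) *: d) + - 1 * polar k d n (x - y - s *: d))).
  by apply: approx_scale; apply: approx_add; [exact: IH|apply: approx_scale; exact: IH].
move=> x nD; set z := x - y - s *: d.
have zE : z = x - p by rewrite /z /p opprD addrA.
have ed : enorm (s *: d) = `|s| by rewrite enormZ /enorm d1 sqrtr1 mulr1.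
have hz : 2 * delta <= enorm z.
  have := enorm_triB (x - y) (s *: d); rewrite ed -/z; have := far x nD; move: hs etd; lra.
have z0 : 0 < enorm z by move: hz dl0; lra.
have n1 : (n%:R + 1 : R[i]) != 0 by exact: nat1_neq0.
have hc : h%:C != 0 :> R[i] by rewrite rc_neq0// gt_eqF.
have -> : x - y - (s + h) *: d = z - h *: d by rewrite /z scalerDl opprD addrA.
have -> : polar k d n.+1 z - a * (polar k d n (z - h *: d) + - 1 * polar k d n z) =
    - a * (polar k d n (z - h *: d) - polar k d n z - h%:C * ((n%:R + 1) * polar k d n.+1 z)).
  by rewrite /a; field; rewrite hc n1.
have E := polar_diff2 k0 d1 dl0 n hz hd.
have na : normc (- a) = (h * (n%:R + 1))^-1.
  have -> : a = ((h * (n%:R + 1))^-1)%:C by rewrite /a rcV rcM rcD rc_nat.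
  by rewrite normcN normc_real ger0_norm// invr_ge0 mulr_ge0// ?addr_ge0// ltW.
rewrite normcM na hn in E *.
have N1 : 0 < (n%:R + 1 : R) by rewrite ltr_wpDl.
have hN : 0 < h * (n%:R + 1) by rewrite mulr_gt0.
have E2 : (h * (n%:R + 1))^-1 * normc (polar k d n (z - h *: d) - polar k d n z - h%:C * ((n%:R + 1) * polar k d n.+1 z)) <= K * h / enorm z.
  rewrite mulrC ler_pdivrMr//; apply: le_trans E _; apply: le_of_eq.
  by rewrite /K; field; rewrite gt_eqF.
apply: le_trans (ler_wpM2l (wt_ge0 x) E2) _.
have w := weight_le dl0 (_ : delta <= enorm (x - p)); rewrite -zE in w.
have {}w : 1 + enorm x <= Cw * enorm z by apply: w; move: hz dl0; lra.
apply: le_trans (_ : Cw * enorm z * (K * h / enorm z) <= _).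
  by apply: ler_wpM2r w; rewrite divr_ge0 ?enorm_ge0// mulr_ge0// ltW.
have -> : Cw * enorm z * (K * h / enorm z) = h * (K * Cw) by field; rewrite gt_eqF.
by rewrite -ler_pdivlMr// mulr_gt0.
Qed.

(** The converse passage: the Taylor series at y reaches the pole displaced by s, and its partial
    sums converge in the weighted norm because the remainder carries a factor 1/|x - y|. *)
Lemma polar_up (d : V) y (delta s : R) : dot d d = 1 -> 0 < delta ->
  (forall x, ~ D x -> 2 * delta <= enorm (x - y)) -> `|s| <= delta -> 8 * kap k delta * `|s| <= 1 ->
  (forall n, approx (fun x => polar k d n (x - y))) -> approx (fun x => polar k d 0 (x - y - s *: d)).
Proof.
move=> d1 dl0 far hs ks Vn; apply: approx_closed => e e0.
pose Cw := (1 + enorm y) / delta + 1.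
have Cw0 : 0 < Cw by rewrite ltr_wpDl// divr_ge0 ?addr_ge0 ?enorm_ge0// ltW.
pose n := Num.truncn (Cw / e).
exists (fun x => \sum_(m <- index_enum 'I_n.+1) (s ^+ m)%:C * polar k d m (x - y)).
  by apply: approx_sum => m; apply: approx_scale; exact: Vn.
move=> x nD; have hz := far x nD.
have z0 : 0 < enorm (x - y) by move: hz dl0; lra.
have -> : \sum_(m <- index_enum 'I_n.+1) (s ^+ m)%:C * polar k d m (x - y) = \sum_(m < n.+1) polar k d m (x - y) * (s ^+ m)%:C.
  by apply: eq_bigr => m _; rewrite mulrC.
have E := polar_taylor k0 d1 dl0 n hz hs ks.
have w : 1 + enorm x <= Cw * enorm (x - y) by apply: weight_le => //; move: hz dl0; lra.
apply: le_trans (ler_pM (wt_ge0 x) (normc_ge0 _) w E) _.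
have -> : Cw * enorm (x - y) * (n.+1%:R^-1 / enorm (x - y)) = Cw / n.+1%:R.
  by rewrite -mulrA; congr (_ * _); rewrite mulrCA divff ?mulr1// gt_eqF.
by rewrite ler_pdivrMr// -ler_pdivrMl// mulrC ltW// truncnS_gt.
Qed.

(** Asking for a whole ball of poles makes the condition open and allows differentiation in the
    position of the pole. *)
Definition pole y := exists2 r : R, 0 < r & forall z, enorm (z - y) < r -> approx (fun x => eta k 0 (dot (x - z) (x - z))).

Let tau delta : R := Num.min delta (8 * kap k delta)^-1.

Lemma tau_gt0 delta : 0 < delta -> 0 < tau delta.
Proof. by move=> d0; rewrite lt_min d0 invr_gt0 mulr_gt0// kap_gt0. Qed.

Lemma unit_dir (v : V) : v != 0 -> exists2 d, dot d d = 1 & v = enorm v *: d.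
Proof.
move=> v0; have n0 := enorm_gt0 v0; exists ((enorm v)^-1 *: v); last by rewrite scalerA divff ?scale1r// gt_eqF.
by rewrite dotZl dotZr -enorm_sqr mulrA -expr2 -exprMn mulVf ?expr1n// gt_eqF.
Qed.

Lemma pole_ball_taylor y delta : 0 < delta -> (forall x, ~ D x -> 2 * delta <= enorm (x - y)) ->
  (forall d n, dot d d = 1 -> approx (fun x => polar k d n (x - y))) ->
  forall z, enorm (z - y) <= tau delta -> approx (fun x => eta k 0 (dot (x - z) (x - z))).
Proof.
move=> d0 far Vn z; rewrite le_min => /andP[h1 h2].
have [->|zy] := eqVneq z y.
  have e1 : dot (delta_mx 0 0 : V) (delta_mx 0 0) = 1 by rewrite dotE !delta_coord /= !mul0r mul1r !addr0.
  by apply: approx_ext (Vn _ 0%N e1) _ => x _.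
have [d d1 hd] := @unit_dir (z - y) ltac:(by rewrite subr_eq0).
have := @polar_up d y delta (enorm (z - y)) d1 d0 far _ _ (fun n => Vn d n d1).
rewrite ger0_norm ?enorm_ge0// => H; apply: approx_ext (H h1 _) _.
  have K : 0 < 8 * kap k delta by apply: mulr_gt0 => //; exact: kap_gt0.
  by have := ler_wpM2l (ltW K) h2; rewrite mulfV// gt_eqF.
by move=> x _; rewrite -hd opprB addrA subrK.
Qed.

Lemma pole_taylor y delta : 0 < delta -> (forall x, ~ D x -> 3 * delta <= enorm (x - y)) -> pole y ->
  forall d n, dot d d = 1 -> approx (fun x => polar k d n (x - y)).
Proof.
move=> d0 far [r r0 hr] d n d1.
pose et := Num.min delta r; have et0 : 0 < et by rewrite lt_min d0.
have et1 : et <= delta by rewrite ge_min lexx.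
have := @polar_down d y delta et d1 d0 et0 et1 far _ n 0.
rewrite normr0 => H; apply: approx_ext (H _ et0) _; last by move=> x _; rewrite scale0r subr0.
move=> s hs; apply: approx_ext (hr (y + s *: d) _) _.
  rewrite addrAC subrr add0r enormZ /enorm d1 sqrtr1 mulr1.
  by apply: lt_le_trans hs _; rewrite ge_min lexx orbT.
by move=> x _; rewrite opprD addrA.
Qed.

Lemma pole_origin : open D -> pole 0.
Proof.
move=> oD; have /enorm_ball[e e0 he] : nbhs (0 : V) D by exact: open_nbhs_nbhs.
pose delta := e / 2; have d0 : 0 < delta by rewrite divr_gt0.
have far x : ~ D x -> 2 * delta <= enorm (x - 0).
  by move=> nD; rewrite leNgt; apply/negP => h; apply: nD; apply: he; apply: lt_le_trans h _; rewrite /delta mulrCA divff// mulr1.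
exists (tau delta) => [|z /ltW hz]; first exact: tau_gt0.
apply: (pole_ball_taylor d0 far _ hz) => d n d1.
have w : waves k (polar k d n).
  elim: n => [|n IH].
    have h0 : hp 0 (fun _ : V => 1 : R[i]).
      by apply: hp_eq (hp_mon (l := 0) 1 (b := (0, 0, 0)%N) erefl) _ => x; rewrite /mon /= !expr0 !mulr1.
    apply: (@waves_one R k 0 (fun=> 1)) => // [x|x _]; last by rewrite mul1r.
    by rewrite (@claplacian_near_cst R _ x 1)//; near=> y.
  have [g wg dg] := waves_derive k0 (- d) IH.
  apply: waves_ext (waves_scale (n%:R + 1)^-1 wg) _ => x x0.
  have q0 : 0 < dot x x by rewrite -enorm_sqr exprn_gt0// enorm_gt0.
  have [_ _ _ D1] := taylor_derive k0 d1 n q0.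
  by rewrite (cd_unique (dg x x0) D1) mulrA mulVf ?mul1r// nat1_neq0.
by apply: approx_ext (waves_approx w) _ => x _; rewrite subr0.
Unshelve. all: by end_near. Qed.

Lemma room y : open D -> D y -> exists2 delta : R, 0 < delta & forall x, ~ D x -> 4 * delta <= enorm (x - y).
Proof.
move=> oD Dy; have /enorm_ball[e e0 he] : nbhs y D by exact: open_nbhs_nbhs.
exists (e / 4) => [|x nD]; first by rewrite divr_gt0.
by rewrite mulrCA divff// mulr1 leNgt; apply/negP => /he.
Qed.

Lemma tau_le delta : tau delta <= delta. Proof. by rewrite ge_min lexx. Qed.

(** The chains take the form of an open and closed subset of the connected set [D]. *)
Lemma all_poles : open D -> connected D -> forall y, D y -> pole y.
Proof.
move=> oD cD.
suff E : D `&` pole = D by move=> y; rewrite -{1}E => -[].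
apply: cD.
- by exists 0; split; [exact: D0|exact: pole_origin].
- exists pole => //; rewrite openE => y [r r0 hr]; apply/enorm_ball; exists (r / 2); first by rewrite divr_gt0.
  move=> y' h; exists (r / 2) => [|z hz]; first by rewrite divr_gt0.
  apply: hr; have := enormD (z - y') (y' - y); rewrite addrA subrK; move: h hz; lra.
- exists (closure (D `&` pole)); first exact: closed_closure.
  apply/seteqP; split => y; first by move=> h; split; [exact: h.1|exact: subset_closure].
  (* Relative closedness: a good pole y' within tau/2 of the limit point y is still 3 delta away
     from the complement, so its Taylor ball, of radius tau, contains the ball of radius tau/2 about
     y. *)
  move=> [Dy cy]; split => //; have [delta d0 far] := room oD Dy.
  have t0 := tau_gt0 d0.
  have : nbhs y [set y' | enorm (y' - y) < tau delta / 2].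
    by apply/enorm_ball; exists (tau delta / 2); rewrite ?divr_gt0.
  move=> /cy[y' [[Dy' py'] hy']].
  have far' x : ~ D x -> 3 * delta <= enorm (x - y').
    move=> nD; have := far x nD; have := enormD (x - y') (y' - y); rewrite addrA subrK.
    have := tau_le delta; move: hy'; rewrite /=; lra.
  have far2 x : ~ D x -> 2 * delta <= enorm (x - y') by move=> /far'; move: d0; lra.
  exists (tau delta / 2) => [|z hz]; first by rewrite divr_gt0.
  apply: (pole_ball_taylor d0 far2 (pole_taylor d0 far' py')).
  have := enormD (z - y) (y - y'); rewrite addrA subrK (enormB y y'); move: hy' hz; rewrite /=; lra.
Qed.

End approximation_by_outgoing_sums.

(** * Integrals over the sphere and completeness of the harmonics *)

Section sphere_integrals.
Variable R : realType.
Local Notation V := 'rV[R]_3.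
Local Notation Re := (@complex.Re R).
Local Notation Im := (@complex.Im R).
Local Notation T := (caratheodory_type (hausdorff2_outer R)).
Local Notation S := (@sphere R : set T).
Local Notation sI := (@sphere_integral R).
Variable Y : forall l : nat, 'I_(l.*2.+1) -> V -> R[i].
Hypothesis hY : orthonormal_spherical_harmonics Y.
Implicit Types (f g : V -> R[i]) (x : V).

Definition sgood f := measurable_fun S (reP f : T -> R) /\ measurable_fun S (imP f : T -> R) /\
  exists B : R, forall x, sphere x -> normc (f x) <= B.

Let mS : measurable S. Proof. exact: area_sphere_measurable. Qed.

(* If the area were infinite, every constant would have the junk integral 0,
   against the normalization of the constant Y_00. *)
Lemma hausdorff2_sphere : (hausdorff2 (@sphere R) < +oo)%E.
Proof.
rewrite ltey; apply/eqP => H.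
have [P [/homogeneous_hp hP [_ e]]] := hY.1 0%N ord0.
have := hY.2 0%N ord0 0%N ord0; rewrite eqxx /sphere_integral => -[+ _].
rewrite (@eq_Rintegral _ _ _ _ _ (fun=> Re (P 0 * (P 0)^*))); last first.
  by move=> x; rewrite inE => /e; rewrite /reP => ->; rewrite (hp0_const _ hP).
rewrite /Rintegral integral_cst// /area /= H mulry.
by case: sgrP => _; rewrite ?mul0e ?mul1e ?mulN1e /= => /esym/eqP; rewrite oner_eq0.
Qed.

Lemma bounded_integrable (g : V -> R) (B : R) : measurable_fun S (g : T -> R) ->
  (forall x, sphere x -> `|g x| <= B) -> (area R).-integrable S (EFin \o (g : T -> R)).
Proof.
move=> mg gB; apply: (measurable_bounded_integrable mS _ mg); first exact: hausdorff2_sphere.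
exists B; split; first exact: num_real.
by move=> M BM x Sx; apply: le_trans (gB x Sx) (ltW BM).
Qed.

Lemma sgood_re f : sgood f -> (area R).-integrable S (EFin \o (reP f : T -> R)).
Proof. by move=> [m1 [_ [B h]]]; apply: (bounded_integrable m1) => x /h; apply: le_trans; exact: normc_Re. Qed.

Lemma sgood_im f : sgood f -> (area R).-integrable S (EFin \o (imP f : T -> R)).
Proof. by move=> [_ [m2 [B h]]]; apply: (bounded_integrable m2) => x /h; apply: le_trans; exact: normc_Im. Qed.

Lemma sI_eq f g : (forall x, sphere x -> f x = g x) -> sI f = sI g.
Proof.
move=> h; rewrite /sphere_integral; congr (_ +i* _); apply: eq_Rintegral => x; rewrite inE => /h;
  by rewrite /reP /imP => ->.
Qed.

Lemma sgood_eq f g : (forall x, sphere x -> f x = g x) -> sgood f -> sgood g.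
Proof.
move=> h [m1 [m2 [B hB]]]; split; [|split].
- by apply: eq_measurable_fun m1 => x; rewrite inE => /h; rewrite /reP => ->.
- by apply: eq_measurable_fun m2 => x; rewrite inE => /h; rewrite /imP => ->.
- by exists B => x Sx; rewrite -h// hB.
Qed.

Lemma sgood_cont f (B : R) : (forall x, x != 0 -> ccontinuous_at x f) ->
  (forall x, sphere x -> normc (f x) <= B) -> sgood f.
Proof.
move=> cf fB; have oO : open [set x : V | x != 0].
  by rewrite openE => x /near_neq0.
have SO : S `<=` ([set x : V | x != 0] : set T).
  by move=> x; rewrite /sphere /= => x1; apply/eqP => x0; move: x1; rewrite x0 enorm0 => /eqP; rewrite eq_sym oner_eq0.
split; [|split; last by exists B].
- apply: (measurable_funS (area_open_measurable oO) SO); apply: area_continuous_measurable => // x /cf[h _]; exact: h.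
- apply: (measurable_funS (area_open_measurable oO) SO); apply: area_continuous_measurable => // x /cf[_ h]; exact: h.
Qed.

Lemma sgoodD f g : sgood f -> sgood g -> sgood (fun x => f x + g x).
Proof.
move=> [m1 [m2 [B hB]]] [m3 [m4 [C hC]]]; split; [|split].
- rewrite (_ : reP _ = (reP f \+ reP g)%R); first exact: measurable_funD.
  by apply/funext => x; rewrite /reP ReD.
- rewrite (_ : imP _ = (imP f \+ imP g)%R); first exact: measurable_funD.
  by apply/funext => x; rewrite /imP ImD.
- by exists (B + C) => x Sx; apply: le_trans (le_normcD _ _) _; rewrite lerD ?hB ?hC.
Qed.

Lemma sgoodM f g : sgood f -> sgood g -> sgood (fun x => f x * g x).
Proof.
move=> [m1 [m2 [B hB]]] [m3 [m4 [C hC]]]; split; [|split].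
- rewrite (_ : reP _ = (reP f \* reP g \- imP f \* imP g)%R); first by apply: measurable_funB; exact: measurable_funM.
  by apply/funext => x; rewrite /reP ReM.
- rewrite (_ : imP _ = (reP f \* imP g \+ imP f \* reP g)%R); first by apply: measurable_funD; exact: measurable_funM.
  by apply/funext => x; rewrite /imP ImM.
- by exists (B * C) => x Sx; rewrite normcM ler_pM ?normc_ge0 ?hB ?hC.
Qed.

Lemma sgood_conj f : sgood f -> sgood (fun x => (f x)^*).
Proof.
move=> [m1 [m2 [B hB]]]; split; [|split].
- by rewrite (_ : reP _ = reP f)//; apply/funext => x; rewrite /reP; case: (f x).
- rewrite (_ : imP _ = (\- imP f)%R); first exact: measurableT_comp.
  by apply/funext => x; rewrite /imP /=; case: (f x).
- by exists B => x Sx; rewrite normc_conj hB.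
Qed.

Lemma sgood_cst (c : R[i]) : sgood (fun=> c).
Proof.
split; [|split; last by exists (normc c)].
- exact: (@measurable_cst _ _ T _ S (Re c)).
- exact: (@measurable_cst _ _ T _ S (Im c)).
Qed.

Lemma sgoodZ (c : R[i]) f : sgood f -> sgood (fun x => c * f x).
Proof. by move=> gf; apply: sgoodM (sgood_cst c) gf. Qed.

Lemma sgood_sum (I : Type) (s : seq I) (F : I -> V -> R[i]) :
  (forall a : I, sgood (F a)) -> sgood (fun x => \sum_(a <- s) F a x).
Proof.
move=> h; elim: s => [|a s IH].
  by apply: sgood_eq (sgood_cst 0) => x _; rewrite big_nil.
by apply: sgood_eq (sgoodD (h a) IH) => x _; rewrite big_cons.
Qed.

Lemma sI_D f g : sgood f -> sgood g -> sI (fun x => f x + g x) = sI f + sI g.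
Proof.
move=> gf gg; apply: complex_eq; rewrite ?ReD ?ImD /=.
- rewrite -(RintegralD mS (sgood_re gf) (sgood_re gg)).
  by apply: eq_Rintegral => x _; rewrite /reP ReD.
- rewrite -(RintegralD mS (sgood_im gf) (sgood_im gg)).
  by apply: eq_Rintegral => x _; rewrite /imP ImD.
Qed.

Lemma integrableZ (g : V -> R) (a : R) : (area R).-integrable S (EFin \o (g : T -> R)) ->
  (area R).-integrable S (EFin \o ((fun x => a * g x) : T -> R)).
Proof.
move=> h; rewrite (_ : EFin \o _ = (fun x => a%:E * (EFin \o (g : T -> R)) x)%E); first exact: integrableZl.
by apply/funext => x /=; rewrite EFinM.
Qed.

Lemma sI_Z (c : R[i]) f : sgood f -> sI (fun x => c * f x) = c * sI f.
Proof.
move=> gf; have r := sgood_re gf; have i := sgood_im gf; apply: complex_eq; rewrite ?ReM ?ImM /=.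
- rewrite -(RintegralZl (Re c) mS r) -(RintegralZl (Im c) mS i).
  rewrite -(RintegralB mS (integrableZ (Re c) r) (integrableZ (Im c) i)).
  by apply: eq_Rintegral => x _; rewrite /reP ReM.
- rewrite -(RintegralZl (Re c) mS i) -(RintegralZl (Im c) mS r).
  rewrite -(RintegralD mS (integrableZ (Re c) i) (integrableZ (Im c) r)).
  by apply: eq_Rintegral => x _; rewrite /imP ImM.
Qed.

Lemma sI_sum (I : Type) (s : seq I) (F : I -> V -> R[i]) :
  (forall a : I, sgood (F a)) -> sI (fun x => \sum_(a <- s) F a x) = \sum_(a <- s) sI (F a).
Proof.
move=> h; elim: s => [|a s IH].
  rewrite big_nil -[RHS](mul0r (sI (fun=> 0))) -(sI_Z 0 (sgood_cst 0)).
  by apply: sI_eq => x _; rewrite big_nil mul0r.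
rewrite big_cons -IH -(sI_D (h a) (sgood_sum s h)).
by apply: sI_eq => x _; rewrite big_cons.
Qed.

Lemma sI_bound f (B : R) : sgood f -> (forall x, sphere x -> normc (f x) <= B) ->
  normc (sI f) <= 2 * B * fine (hausdorff2 (@sphere R)).
Proof.
move=> gf fB.
have H (g : V -> R) : (area R).-integrable S (EFin \o (g : T -> R)) -> (forall x, sphere x -> `|g x| <= B) ->
    `|Rintegral (area R) S (g : T -> R)| <= B * fine (hausdorff2 (@sphere R)).
  move=> ig gB; apply: le_trans (le_normr_Rintegral mS ig) _.
  rewrite -(Rintegral_cst (area R) mS B); apply: le_Rintegral => //.
  - exact: (integrable_norm ig).
  - apply: (@bounded_integrable (fun=> B) `|B|) => //; exact: (@measurable_cst _ _ T _ S B).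
apply: le_trans (normc_le_ReIm _) _; rewrite -mulrA mulr2n mulrDl mul1r; apply: lerD.
- by apply: H (sgood_re gf) _ => x /fB; apply: le_trans; exact: normc_Re.
- by apply: H (sgood_im gf) _ => x /fB; apply: le_trans; exact: normc_Im.
Qed.

Lemma sgood_hp l (P : V -> R[i]) : hp l P -> sgood P.
Proof.
move=> hP; have c x : ccontinuous_at x P := hp_cont x hP.
have [B1 b1 h1] := @cont_bounded_box R (reP P) 1 (fun x => (c x).1).
have [B2 b2 h2] := @cont_bounded_box R (imP P) 1 (fun x => (c x).2).
apply: (@sgood_cont P (B1 + B2)) => [x _//|x Sx].
have x1 : `|x| <= 1 by rewrite -[leRHS](Sx : enorm x = 1) norm_le_enorm.
by apply: le_trans (normc_le_ReIm _) _; apply: lerD; [exact: h1|exact: h2].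
Qed.

Lemma sgood_Y l m : sgood (@Y l m).
Proof.
have [P [/homogeneous_hp hP [_ e]]] := hY.1 l m.
by apply: sgood_eq (sgood_hp hP) => x /e ->.
Qed.

Lemma sI_Y_sum l0 (m0 : 'I_(l0.*2.+1)) L (c : forall l : nat, 'I_(l.*2.+1) -> R[i]) :
  (forall l (m : 'I_(l.*2.+1)), (L < l)%N -> c l m = 0) ->
  sI (fun x => (\sum_(l < L.+1) \sum_(m < l.*2.+1) c l m * Y m x) * (Y m0 x)^*) = c l0 m0.
Proof.
move=> c0; have gc := sgood_conj (sgood_Y m0).
have E l (m : 'I_(l.*2.+1)) : sI (fun x => c l m * (Y m x * (Y m0 x)^*)) = c l m * ((l == l0) && (m == m0 :> nat))%:R.
  by rewrite sI_Z ?hY.2//; exact: sgoodM (sgood_Y m) gc.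
have g l (m : 'I_(l.*2.+1)) : sgood (fun x => c l m * (Y m x * (Y m0 x)^*)).
  by apply: sgoodZ; exact: sgoodM (sgood_Y m) gc.
transitivity (\sum_(l < L.+1) \sum_(m < l.*2.+1) c l m * ((l == l0 :> nat) && (m == m0 :> nat))%:R).
  rewrite (@sI_eq _ (fun x => \sum_(l < L.+1) \sum_(m < l.*2.+1) c l m * (Y m x * (Y m0 x)^*))).
    rewrite sI_sum => [|l]; last by apply: sgood_sum => m; exact: g.
    apply: eq_bigr => l _; rewrite sI_sum => [|m]; last exact: g.
    by apply: eq_bigr => m _; rewrite E.
  move=> x _; rewrite mulr_suml; apply: eq_bigr => l _; rewrite mulr_suml; apply: eq_bigr => m _.
  by rewrite mulrA.
have [lL|lL] := leqP l0 L; last first.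
  rewrite c0// big1// => l _; rewrite big1// => m _.
  by rewrite (_ : (l == l0 :> nat) = false) ?mulr0//; apply/negbTE; rewrite neq_ltn (leq_trans (ltn_ord l)).
have lL' : (l0 < L.+1)%N by [].
rewrite (bigD1 (Ordinal lL'))//= [X in _ + X]big1 ?addr0; last first.
  move=> l ll; rewrite big1// => m _; rewrite (_ : (l == l0 :> nat) = false) ?mulr0//.
  by apply/negbTE; move: ll; apply: contra => /eqP e; apply/eqP/val_inj.
rewrite (bigD1 m0)//= !eqxx mulr1 big1 ?addr0// => m mm.
by rewrite (_ : (m == m0 :> nat) = false) ?mulr0//; apply/negbTE; move: mm; apply: contra => /eqP e; apply/eqP/val_inj.
Qed.

(** By [harmonic_dim] there is a nontrivial relation between P and the 2 l + 1 polynomials behind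
    [Y]; orthonormality forces the coefficient of P in it to be nonzero. *)
Lemma harmonic_span l (P : V -> R[i]) : hp l P -> harmonic P ->
  exists c : 'I_(l.*2.+1) -> R[i], forall x, sphere x -> P x = \sum_m c m * Y m x.
Proof.
move=> hP hh.
have [Q hQ] : {Q : 'I_(l.*2.+1) -> V -> R[i] & forall m, hp l (Q m) /\ harmonic (Q m) /\ forall x, sphere x -> Y m x = Q m x}.
  apply: (@choice _ _ (fun (m : 'I_(l.*2.+1)) Q => hp l Q /\ harmonic Q /\ forall x, sphere x -> Y m x = Q x)) => m.
  by have [Q [/homogeneous_hp q1 q2]] := hY.1 l m; exists Q.
pose Pf (r : 'I_(l.*2.+2)) := if (r < l.*2.+1)%N then Q (inord r) else P.
have Pf1 r : hp l (Pf r) by rewrite /Pf; case: ifP => _; [exact: (hQ _).1|exact: hP].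
have Pf2 r : harmonic (Pf r) by rewrite /Pf; case: ifP => _; [exact: (hQ _).2.1|exact: hh].
have [u [r0 ur0] hu] := @harmonic_dim R l Pf Pf1 Pf2.
pose w (m : 'I_(l.*2.+1)) : 'I_(l.*2.+2) := widen_ord (leqnSn _) m.
have Pmax : Pf ord_max = P by rewrite /Pf /= ltnn.
have Pw m : Pf (w m) = Q m by rewrite /Pf /= ltn_ord inord_val.
have hu' x : \sum_m u (w m) * Q m x + u ord_max * P x = 0.
  rewrite -[RHS](hu x) [in RHS]big_ord_recr Pmax; congr (_ + _).
  by apply: eq_bigr => m _; rewrite -Pw.
have [um|um] := eqVneq (u ord_max) 0; last first.
  exists (fun m => - (u ord_max)^-1 * u (w m)) => x Sx.
  apply: (mulfI um); apply/eqP; rewrite -subr_eq0; apply/eqP.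
  rewrite -[RHS](hu' x) addrC; congr (_ + _); rewrite mulr_sumr -sumrN.
  apply: eq_bigr => m _; rewrite (hQ m).2.2// mulrA mulrA mulrN mulfV// mulN1r mulNr opprK//.
(* With a zero coefficient for P the relation involves [Y] alone, and pairing it with each [Y l m0]
   shows that all coefficients are 0. *)
exfalso; move/negP: ur0; apply; apply/eqP.
have H m0 : u (w m0) = 0.
  pose c l' (m : 'I_(l'.*2.+1)) := if l' == l then u (w (inord m)) else 0.
  have c0 l' (m : 'I_(l'.*2.+1)) : (l < l')%N -> c l' m = 0 by move=> h; rewrite /c ifN// neq_ltn h orbT.
  have := sI_Y_sum m0 c0; rewrite /c eqxx inord_val => <-.
  rewrite -[RHS](mul0r (sI (fun=> 0))) -(sI_Z 0 (sgood_cst 0)); apply: sI_eq => x Sx.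
  rewrite big_ord_recr /= big1 ?add0r; last first.
    by move=> l' _; rewrite big1// => m _; rewrite ifN ?mul0r// neq_ltn ltn_ord.
  rewrite mul0r eqxx (_ : \sum_m _ = 0) ?mul0r//.
  rewrite -[RHS](hu' x) um mul0r addr0; apply: eq_bigr => m _; by rewrite inord_val (hQ m).2.2.
have [h|h] := ltnP r0 l.*2.+1.
  by have -> : r0 = w (Ordinal h) by exact: val_inj.
by have -> : r0 = ord_max by apply: val_inj; apply/eqP; rewrite eqn_leq h -ltnS ltn_ord.
Qed.

End sphere_integrals.

(** * Norms controlled by the weighted sup norm *)

Section norm_estimates.
Variable R : realType.
Local Notation V := 'rV[R]_3.
Local Notation mR := (measurableTypeR R).
Local Notation T3 := (mR * mR * mR)%type.
Implicit Types (O Om : set V).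

(* No measurability is needed: the integral of a nonnegative function is a
   supremum over the simple functions below it. *)
Lemma le_integral_nonmeasurable d (T : measurableType d) (mu : {measure set T -> \bar R}) (A : set T)
    (f g : T -> \bar R) : (forall x, A x -> 0 <= f x)%E -> (forall x, A x -> f x <= g x)%E ->
  (\int[mu]_(x in A) f x <= \int[mu]_(x in A) g x)%E.
Proof.
move=> f0 fg; have g0 x : A x -> (0 <= g x)%E by move=> Ax; apply: le_trans (f0 x Ax) (fg x Ax).
rewrite !ge0_integralE//; apply: ereal_sup_le => _ [h hf <-]; exists h => // x.
apply: le_trans (hf x) _; rewrite !patchE; case: ifPn => //; rewrite inE; exact: fg.
Qed.

Lemma le_sqrte (a b : \bar R) : (0 <= b -> a <= b -> sqrte a <= sqrte b)%E.
Proof. by move=> b0 ab; rewrite lee_sqrt. Qed.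

Lemma L2norm_bound d (T : measurableType d) (mu : {measure set T -> \bar R}) (A : set T) (f : T -> R[i])
    (B m : R) : measurable A -> (mu A <= m%:E)%E -> 0 <= B -> (forall x, A x -> normc (f x) <= B) ->
  (L2norm mu A f <= (Num.sqrt m * B)%:E)%E.
Proof.
move=> mA Am B0 fB; have m0 : 0 <= m by rewrite -lee_fin (le_trans (measure_ge0 mu A)).
rewrite /L2norm.
have -> : (Num.sqrt m * B)%:E = sqrte (m * B ^+ 2)%:E.
  by rewrite /sqrte /= sqrtrM// sqrtr_sqr ger0_norm.
apply: le_sqrte; first by rewrite lee_fin mulr_ge0// sqr_ge0.
apply: le_trans (_ : (\int[mu]_(x in A) (cst (B ^+ 2)%:E) x <= _)%E).
  apply: le_integral_nonmeasurable => x Ax; first by rewrite lee_fin exprn_ge0// normc_ge0.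
  by rewrite lee_fin lerXn2r ?nnegrE ?normc_ge0// fB.
rewrite integral_cst// (EFinM m (B ^+ 2)) [leRHS]muleC; apply: lee_wpmul2l => //; by rewrite lee_fin sqr_ge0.
Qed.

(** Summation over dyadic boxes: the volume 8^(n+1) against the weight 2^-(2+gamma)n gives a
    geometric series of ratio q = 2^(1-gamma), which is where gamma > 1 enters. *)
Lemma weight_integral (gamma : R) : 1 < gamma -> exists2 W : R, 0 <= W &
  (\int[leb3 R]_p ((1 + enorm (vec3 p)) `^ (- (2 + gamma)))%:E <= W%:E)%E.
Proof.
move=> g1; pose q : R := 2 `^ (- (gamma - 1)).
have q1 : q < 1.
  rewrite /q powRN invf_lt1 ?powR_gt0// /powR pnatr_eq0 /= expR_gt1 mulr_gt0 ?subr_gt0// ln_gt0//.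
  by rewrite ltr1n.
have q0 : 0 <= q by exact: powR_ge0.
pose K : R := 8 * 2 `^ (2 + gamma).
have K0 : 0 <= K by rewrite mulr_ge0 ?powR_ge0.
pose a n : R := (2 ^+ n) `^ (- (2 + gamma)) * 2 `^ (2 + gamma).
have a0 n : 0 <= a n by rewrite mulr_ge0 ?powR_ge0.
pose B n : set T3 := @vec3 R @^-1` box (2 ^+ n).
have p0 n : 0 <= (2 ^+ n : R) by rewrite exprn_ge0.
have mB n : measurable (B n) by exact: measurable_box.
pose F n (p : T3) : \bar R := ((a n)%:E * (\1_(B n) p)%:E)%E.
have F0 n p : (0 <= F n p)%E by rewrite mule_ge0// lee_fin// indicE.
have mF n : measurable_fun setT (F n).
  by apply: measurable_funeM; apply/measurable_EFinP; exact: measurable_indic.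
have le (p : T3) : (((1 + enorm (vec3 p)) `^ (- (2 + gamma)))%:E <= \sum_(n <oo) F n p)%E.
  have ex : exists n, `|vec3 p| <= 2 ^+ n.
    exists (Num.truncn `|vec3 p|).+1; apply: le_trans (ltW (truncnS_gt _)) _.
    by rewrite -natrX ler_nat ltnW// ltn_expl.
  (* For the minimal n the previous box misses the point, so 2^n <= 2 (1 + |p|) and the weight at p
     is at most [a n]. *)
  case: (ex_minnP ex) => n hn mn.
  apply: le_trans (_ : F n p <= _)%E.
    rewrite /F indicE mem_set//= mule1 lee_fin.
    have n2 : 2 ^+ n <= 2 * (1 + enorm (vec3 p)).
      case: n hn mn => [|n] hn mn; first by rewrite expr0; have := enorm_ge0 (vec3 p); lra.
      have : 2 ^+ n < `|vec3 p| by rewrite ltNge; apply/negP => /mn; rewrite ltnn.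
      by rewrite exprS => h; have := norm_le_enorm (vec3 p); move: h; lra.
    have e1 : 0 < 1 + enorm (vec3 p) by rewrite ltr_pwDl// enorm_ge0.
    have -> : a n = (2 ^+ n / 2) `^ (- (2 + gamma)).
      rewrite powRM ?invr_ge0//; congr (_ * _).
      by rewrite -powR_inv1// -powRrM mulN1r opprK.
    apply: le_trans (_ : _ <= (2 ^+ n / 2) `^ (- (2 + gamma))) => //.
    rewrite !powRN lef_pV2 ?posrE ?powR_gt0 ?divr_gt0 ?exprn_gt0//.
    apply: ge0_ler_powR; rewrite ?nnegrE ?divr_ge0 ?(ltW e1)//; first by move: g1; lra.
    by rewrite ler_pdivrMr// mulrC.
  rewrite (nneseries_split _ n.+1) ?add0n => [|m _]; last exact: F0.
  rewrite big_nat_recr//= -addeA.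
  apply: le_trans (_ : 0 + (F n p + 0) <= _)%E; first by rewrite add0e adde0.
  by apply: leeD; [exact: sume_ge0|apply: leeD => //; exact: nneseries_ge0].
exists (K / (1 - q)); first by rewrite divr_ge0// subr_ge0 ltW.
apply: le_trans (@le_integral_nonmeasurable _ _ (leb3 R) setT (fun p : T3 => ((1 + enorm (vec3 p)) `^ (- (2 + gamma)))%:E) (fun p => \sum_(n <oo) F n p)%E _ _) _.
- by move=> p _; rewrite lee_fin powR_ge0.
- by move=> p _; exact: le.
rewrite integral_nneseries//.
have I n : (\int[leb3 R]_p F n p = (K * q ^+ n)%:E)%E.
  have h1 (p : T3) : setT p -> (0 <= (\1_(B n) p : R)%:E)%E by rewrite lee_fin indicE.
  have h2 : measurable_fun setT (fun p : T3 => (\1_(B n) p : R)%:E).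
    by apply/measurable_EFinP; exact: measurable_indic.
  rewrite /F (ge0_integralZl_EFin (leb3 R) measurableT h1 h2 (a0 n)).
  rewrite integral_indic// setIT leb3_box// -EFinM; congr (_%:E).
  rewrite /a /K /q.
  have E : (2 ^+ n : R) `^ (- (2 + gamma)) = (2 ^+ n)^-1 ^+ 3 * (2 `^ (- (gamma - 1))) ^+ n.
    have -> : - (2 + gamma) = - 3%:R + - (gamma - 1) :> R by rewrite opprB addrA; ring.
    rewrite powRD; last by apply/implyP => _; rewrite gt_eqF// exprn_gt0.
    congr (_ * _); first by rewrite powRN powR_mulrn// exprVn.
    by rewrite -powR_mulrn// -powRrM mulrC powRrM powR_mulrn ?powR_ge0.
  rewrite E exprMn; field; rewrite gt_eqF ?exprn_gt0//.
under eq_eseriesr => n _ do rewrite I.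
apply: lime_le; first by apply: is_cvg_nneseries => n _ _; rewrite lee_fin mulr_ge0// exprn_ge0.
apply: nearW => N; rewrite sumEFin lee_fin -mulr_sumr ler_wpM2l//.
have q1' : 1 - q != 0 by rewrite subr_eq0 gt_eqF.
have -> : \sum_(0 <= n < N) q ^+ n = (1 - q ^+ N) / (1 - q).
  rewrite big_mkord; apply: (mulfI q1'); rewrite mulrCA divff// mulr1 -opprB -[in RHS]opprB.
  by rewrite [in RHS]subrX1 mulNr.
by rewrite ler_pdivrMr ?subr_gt0// mulVf// gerBl exprn_ge0.
Qed.

Lemma weightedL2_bound (gamma : R) Om : 1 < gamma -> exists2 C : R, 0 <= C &
  forall f (e : R), 0 <= e -> (forall x, Om x -> (1 + enorm x) * normc (f x) <= e) ->
    (weightedL2 gamma Om f <= (C * e)%:E)%E.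
Proof.
move=> g1; have [W W0 hW] := weight_integral g1.
exists (Num.sqrt W); first exact: sqrtr_ge0.
move=> f e e0 fe; rewrite /weightedL2.
have -> : (Num.sqrt W * e)%:E = sqrte (W * e ^+ 2)%:E.
  by rewrite /sqrte /= sqrtrM// sqrtr_sqr ger0_norm.
apply: le_sqrte; first by rewrite lee_fin mulr_ge0// sqr_ge0.
pose w (p : T3) := (1 + enorm (vec3 p)) `^ (- (2 + gamma)).
apply: le_trans (_ : (\int[leb3 R]_p ((e ^+ 2)%:E * (w p)%:E) <= _)%E).
  rewrite integral_mkcond; apply: le_integral_nonmeasurable => p _; rewrite patchE; case: ifPn => //.
  - by move=> _; rewrite lee_fin mulr_ge0 ?exprn_ge0 ?normc_ge0 ?powR_ge0.
  - rewrite inE => Op; rewrite -EFinM lee_fin /w.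
    have n1 : 0 < 1 + enorm (vec3 p) by rewrite ltr_pwDl// enorm_ge0.
    have -> : - gamma = 2%:R + - (2 + gamma) :> R by ring.
    rewrite powRD; last by apply/implyP => _; rewrite gt_eqF.
    rewrite powR_mulrn ?(ltW n1)// mulrA -exprMn ler_wpM2r ?powR_ge0//.
    rewrite lerXn2r ?nnegrE ?mulr_ge0 ?normc_ge0 ?(ltW n1)// mulrC; exact: fe.
  - by move=> _; rewrite -EFinM lee_fin mulr_ge0 ?sqr_ge0 ?powR_ge0.
rewrite ge0_integralZl_EFin//; last 3 first.
- by move=> p _; rewrite lee_fin powR_ge0.
- apply/measurable_EFinP; apply: (@measurableT_comp _ _ _ _ _ _ (fun t : R => t `^ (- (2 + gamma)))); first exact: measurable_powR.
  apply: measurable_funD => //; exact: measurable_vec3_continuous (@enorm_cont R).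
- exact: sqr_ge0.
rewrite [leRHS](EFinM W (e ^+ 2)) [leRHS]muleC; apply: lee_wpmul2l => //.
by rewrite lee_fin sqr_ge0.
Qed.

(** * Interior Sobolev estimates *)

Section sobolev.
Variable k : R.
Hypothesis k0 : 0 < k.

Definition pds (w : seq 'I_3) (F : V -> R) := foldr (fun i G => pd i G) F w.
Definition cpds (w : seq 'I_3) (f : V -> R[i]) := foldr (fun i G => cpd i G) f w.

Lemma reP_cpds w f : reP (cpds w f) = pds w (reP f).
Proof. by elim: w => //= i w <-. Qed.

Lemma imP_cpds w f : imP (cpds w f) = pds w (imP f).
Proof. by elim: w => //= i w <-. Qed.

(** A multi-index spelled out as a list of directions, so that one integration by parts removes one
    letter; the letters come out reversed, hence the [rev] further on. *)
Definition word (b : 'I_3 -> nat) : seq 'I_3 := flatten [seq nseq (b i) i | i <- enum 'I_3].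

Lemma pdmulti_word b F : pdmulti b F = pds (word b) F.
Proof.
rewrite /pdmulti /word; elim: (enum 'I_3) => //= i s ->.
by rewrite /pds foldr_cat; elim: (b i) => //= n ->.
Qed.

Lemma size_word b : size (word b) = (\sum_(i < 3) b i)%N.
Proof.
rewrite /word size_flatten /shape -map_comp sumnE big_map big_enum /=.
by apply: eq_bigr => i _; rewrite size_nseq.
Qed.

Lemma parts_word O (F psi : V -> R) (M : R) w : open O -> (forall n, Ck n O F) -> (forall n, Ck n setT psi) ->
  near0_off O psi -> vanish_out M psi ->
  I3 (fun x => F x * pds w psi x) = (-1) ^+ size w * I3 (fun x => pds (rev w) F x * psi x).
Proof.
move=> oO cF cp nO vO; elim: w F cF => [|i w IH] F cF /=; first by rewrite expr0 mul1r.
have cw w' : forall n, Ck n setT (pds w' psi) by elim: w' => //= j w' h n; apply: Ck_pd; exact: h.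
have nw w' : near0_off O (pds w' psi) by elim: w' => //= j w' h; apply: near0_off_pd.
have vw w' : vanish_out M (pds w' psi) by elim: w' => //= j w' h; apply: vanish_out_pd.
rewrite (int_by_parts i oO (cF 1%N) (cw w 1%N) (nw w) (vw w)) (IH (pd i F)); last by move=> n; apply: Ck_pd; exact: cF.
by rewrite exprS mulN1r mulNr rev_cons /pds -cats1 foldr_cat.
Qed.

Lemma cpds_mvp O f w : open O -> mvp k O f -> mvp k O (cpds w f).
Proof. by move=> oO mf; elim: w => //= i w IH; apply: mvp_cpd. Qed.

(** Each application of the gradient estimate uses up a distance 3 r, so a word of n letters asks
    for 3 r (n + 1) of room. *)
Lemma cpds_bound r : 0 < r -> exists2 C : R, 0 <= C & forall O f w x (B : R), open O -> mvp k O f ->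
  (forall y, enorm (y - x) < 3 * r * (size w).+1%:R -> O y) -> 
  (forall y, O y -> normc (f y) <= B) -> normc (cpds w f x) <= C ^+ size w * B.
Proof.
move=> r0; have [C C0 hC] := mvp_gradient k0 r0; exists C => // O f w x B oO mf.
elim: w x => [|i w IH] x xO fB.
  by rewrite expr0 mul1r; apply: fB; apply: xO; rewrite subrr enorm0 mulr_gt0// mulr_gt0.
change (normc (cpd i (cpds w f) x) <= C ^+ (size w).+1 * B); rewrite exprS -mulrA; apply: (hC O) => [|y hy|y hy]; first exact: cpds_mvp.
  by apply: xO; apply: lt_le_trans hy _; rewrite ler_peMr ?ler1n// mulr_ge0// ltW.
apply: IH fB => z hz; apply: xO; change (size (i :: w)).+1 with (size w).+2; rewrite -(@natr1 _ (size w).+1) mulrDr mulr1.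
have -> : z - x = (z - y) + (y - x) by rewrite addrA subrK.
by apply: le_lt_trans (enormD _ _) _; rewrite ltrD.
Qed.

Lemma vol_I3 Om (g : V -> R) : (forall x, ~ Om x -> g x = 0) -> vol_integral Om g = I3 g.
Proof.
move=> g0; rewrite I3E /vol_integral Rintegral_mkcond; apply: eq_Rintegral => p _.
rewrite patchE; case: ifPn => // /negP nO; rewrite /= g0// => h; apply: nO; by rewrite inE.
Qed.

Lemma weak_parts Om O (F : V -> R) b : open O -> Om `<=` O -> (forall n, Ck n O F) ->
  real_weak_derivative Om b F (pds (rev (word b)) F).
Proof.
move=> oO OmO cF phi [cphi [cK KOm]].
set K := closure _ in cK KOm.
have off x : ~ K x -> \near x, phi x = 0.
  move=> nK; have oK : open (~` K) by rewrite openC; exact: closed_closure.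
  apply: filterS (open_nbhs_nbhs (conj oK nK)) => y ny.
  by apply/eqP/negP => /negP h; apply: ny; exact: subset_closure.
have nO A : K `<=` A -> near0_off A phi by move=> KA x nA; apply: off => /KA.
have [M vM] : exists M, vanish_out M phi.
  have [M [_ hM]] := compact_bounded cK.
  exists (M + 1) => x xM; have /off/nbhs_singleton // : ~ K x; move=> Kx.
  have M1 : M < M + 1 by rewrite ltrDl.
  by have := hM (M + 1) M1 x Kx; rewrite /= leNgt xM.
have nw w : near0_off Om (pds w phi) by elim: w => [|j w h] /=; [exact: nO|apply: near0_off_pd].
rewrite pdmulti_word !vol_I3.
- by rewrite (parts_word (M := M) (word b) oO cF cphi (nO O _) vM) ?size_word// => x /KOm/OmO.
- by move=> x /(nO Om KOm)/nbhs_singleton ->; rewrite mulr0.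
- by move=> x /(nw (word b))/nbhs_singleton ->; rewrite mulr0.
Qed.

Lemma compact_room O (K : set V) : open O -> compact K -> K `<=` O ->
  exists2 r : R, 0 < r & forall x y, K x -> enorm (y - x) < r -> O y.
Proof.
move=> oO cK KO.
have c : {within K, continuous (fun _ : V => 0 : R)} by apply: continuous_subspaceT => x; exact: contC.
have H : \forall r \near (0 : R)^'+, K `<=` [set x | forall y, enorm (y - x) < r -> O y].
  apply: (compact_near_coveringP K).1 => // x Kx.
  have /enorm_ball[e e0 he] : nbhs x O by exact: open_nbhs_nbhs (conj oO (KO x Kx)).
  exists ([set x' | enorm (x' - x) < e / 2], [set r : R | r < e / 2]).
    split => /=; first by apply/enorm_ball; exists (e / 2); rewrite ?divr_gt0.
    by apply: nbhs_right_lt; rewrite divr_gt0.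
  move=> [x' r] /= [h1 h2] y hy; apply: he.
  have -> : y - x = (y - x') + (x' - x) by rewrite addrA subrK.
  by apply: le_lt_trans (enormD _ _) _; move: h1 h2 hy; lra.
have : \forall r \near (0 : R)^'+, 0 < r /\ K `<=` [set x | forall y, enorm (y - x) < r -> O y].
  by near=> r; split; near: r => //; exact: nbhs_right_gt.
by move=> /filter_ex[r [r0 h]]; exists r => // x y Kx; apply: h.
Unshelve. all: by end_near. Qed.

Lemma sobolev_bound O Om m : open O -> inner_subdomain O Om -> exists2 C : R, 0 <= C &
  forall f (B : R), mvp k O f -> 0 <= B -> (forall x, O x -> normc (f x) <= B) ->
    (sobolev_norm m Om f <= (C * B)%:E)%E.
Proof.
move=> oO [[_ [oOm _]] [cK KO]].
have OmO : Om `<=` O by apply: subset_trans KO; exact: subset_closure.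
have [r r0 hr] := compact_room oO cK KO.
(* With this radius m derivatives fit into the room r between the closure of [Om] and the complement
   of [O]. *)
pose s := r / (3 * m.+1%:R).
have s0 : 0 < s by rewrite divr_gt0 ?mulr_gt0.
have [C C0 hC] := cpds_bound s0.
have [M [_ hM]] := compact_bounded cK.
pose M1 := `|M| + 1.
have M10 : 0 <= M1 by rewrite addr_ge0.
have OmM : Om `<=` box M1.
  move=> x /(@subset_closure _ Om) Kx; apply: (hM M1) => //.
  by rewrite /M1 (le_lt_trans (ler_norm M))// ltrDl.
have mOm : measurable (@vec3 R @^-1` Om : set T3) by exact: measurable_vec3_open.
have leOm : (leb3 R (@vec3 R @^-1` Om) <= ((2 * M1) ^+ 3)%:E)%E.
  rewrite -leb3_box//; apply: le_measure; rewrite ?inE//; first exact: measurable_box.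
  by move=> p /OmM.
pose t := Num.sqrt ((2 * M1) ^+ 3).
pose C' := (C + 1) ^+ m.
pose N := #|{ffun 'I_3 -> 'I_m.+1}|.
exists (Num.sqrt N%:R * (t * C')); first by rewrite !mulr_ge0 ?sqrtr_ge0// exprn_ge0// addr_ge0.
move=> f B mf B0 fB.
have bd (w : seq 'I_3) x : Om x -> (size w <= m)%N -> normc (cpds w f x) <= C' * B.
  move=> Ox wm; apply: le_trans (hC O f w x B oO mf _ fB) _.
    move=> y hy; apply: (hr x); first exact: subset_closure.
    apply: lt_le_trans hy _; rewrite /s.
    rewrite [leRHS](_ : r = 3 * (r / (3 * m.+1%:R)) * m.+1%:R); last first.
      have : (m.+1%:R : R) != 0 by rewrite pnatr_eq0.
      by move: (m.+1%:R : R) => z z0; field.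
    by rewrite ler_pM2l ?mulr_gt0// ler_nat ltnS.
  apply: ler_wpM2r => //; apply: le_trans (_ : (C + 1) ^+ size w <= _).
    by rewrite lerXn2r ?nnegrE ?addr_ge0// lerDl.
  by rewrite /C' ler_weXn2l// lerDr.
have L2 w : (size w <= m)%N -> (volL2 Om (cpds w f) <= (t * (C' * B))%:E)%E.
  move=> wm; apply: L2norm_bound => //; first by rewrite mulr_ge0// exprn_ge0// addr_ge0.
  by move=> p Op; exact: bd.
have vm w : vol_measurable Om (cpds w f).
  have [c _] := cpds_mvp w oO mf; split.
  - apply: (measurable_continuous_on (@measurable_vec3 R) oOm) => x /OmO/c[h _]; exact: h.
  - apply: (measurable_continuous_on (@measurable_vec3 R) oOm) => x /OmO/c[_ h]; exact: h.
have fin w : (size w <= m)%N -> (volL2 Om (cpds w f) < +oo)%E.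
  by move=> wm; apply: le_lt_trans (L2 w wm) _; rewrite ltry.
pose g (b : {ffun 'I_3 -> 'I_m.+1}) := cpds (rev (word (fun i => b i : nat))) f.
apply: ereal_inf_le; exists (sqrte (\sum_(b : {ffun 'I_3 -> 'I_m.+1} | (\sum_(i < 3) b i <= m)%N) volL2 Om (g b) ^+ 2)%E).
  split; [exact: (vm [::])|split; first exact: (fin [::])].
  exists g; split => // b hb; have sb : (size (rev (word (fun i => b i : nat))) <= m)%N by rewrite size_rev size_word.
  split; [exact: vm|split; first exact: fin].
  change (real_weak_derivative Om (fun i => b i : nat) (reP f) (reP (g b)) /\ real_weak_derivative Om (fun i => b i : nat) (imP f) (imP (g b))).
  have cf n : CkC n O f by exact: (mvp_CkC k0 n oO mf).
  pose b' i : nat := b i.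
  split.
  - have h := @weak_parts Om O (reP f) b' oO OmO (fun n => (cf n).1).
    by rewrite /g reP_cpds; exact: h.
  - have h := @weak_parts Om O (imP f) b' oO OmO (fun n => (cf n).2).
    by rewrite /g imP_cpds; exact: h.
have -> : (Num.sqrt N%:R * (t * C') * B)%:E = sqrte (N%:R * (t * (C' * B)) ^+ 2)%:E.
  have tB : 0 <= t * (C' * B) by rewrite !mulr_ge0 ?sqrtr_ge0// exprn_ge0// addr_ge0.
  by rewrite /sqrte /= sqrtrM// sqrtr_sqr ger0_norm// !mulrA.
apply: le_sqrte; first by rewrite lee_fin mulr_ge0// sqr_ge0.
apply: le_trans (_ : (\sum_(b : {ffun 'I_3 -> 'I_m.+1}) ((t * (C' * B)) ^+ 2)%:E <= _)%E).
  rewrite [leLHS]big_mkcond; apply: lee_sum => b _; case: ifPn => [hb|_]; last by rewrite lee_fin sqr_ge0.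
  rewrite EFin_expe !expe2; apply: lee_pmul; rewrite ?sqrte_ge0//;
    by apply: L2; rewrite size_rev size_word.
by rewrite sumEFin lee_fin sumr_const -/N mulr_natl.
Qed.

End sobolev.
End norm_estimates.

(** * Partitions of unity *)

Section partition_of_unity.
Variable R : realType.
Local Notation V := 'rV[R]_3.
Section products.
Variable b : nat -> V -> R.
Implicit Types (x : V) (n j : nat).

(** The product construction: partial sums telescope to 1 - prod (1 - b_i), hence equal 1 as soon as
    a single b_j does, and smoothness is that of the b_i. *)
Definition pou j x : R := b j x * \prod_(i < j) (1 - b i x).

Lemma sum_pou n x : \sum_(j < n) pou j x = 1 - \prod_(i < n) (1 - b i x).
Proof.
elim: n => [|n IH]; first by rewrite !big_ord0 subrr.
rewrite big_ord_recr IH [in RHS]big_ord_recr /= /pou; ring.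
Qed.

Lemma Ck_pou m j : (forall i : nat, Ck m setT (b i)) -> Ck m setT (pou j).
Proof.
move=> cb; apply: CkM; [exact: openT|exact: cb|].
apply: Ck_prod; first exact: openT.
by move=> i; apply: CkB; [exact: openT|exact: Ck_cst openT|exact: cb].
Qed.

Hypothesis b01 : forall j x, 0 <= b j x <= 1.

Lemma pou_ge0 j x : 0 <= pou j x.
Proof.
apply: mulr_ge0; first by case/andP: (b01 j x).
by apply: prodr_ge0 => i _; rewrite subr_ge0; case/andP: (b01 i x).
Qed.

Lemma sum_pou1 n j x : (j < n)%N -> b j x = 1 -> \sum_(i < n) pou i x = 1.
Proof.
by move=> jn bj; rewrite sum_pou (bigD1 (Ordinal jn))//= bj subrr mul0r subr0.
Qed.

Lemma pou0 j x : b j x = 0 -> pou j x = 0.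
Proof. by rewrite /pou => ->; rewrite mul0r. Qed.

End products.

Lemma small_scale (C e d : R) : 0 <= C -> 0 < e -> 0 < d -> exists2 s : R, 0 < s & s <= d /\ C * s <= e.
Proof.
move=> C0 e0 d0; have C1 : 0 < C + 1 by rewrite ltr_pwDr.
exists (Num.min d (e / (C + 1))); first by rewrite lt_min d0 divr_gt0.
set s := Num.min _ _; have s0 : 0 < s by rewrite lt_min d0 divr_gt0.
split; first by rewrite ge_min lexx.
apply: le_trans (_ : (C + 1) * s <= _); first by rewrite ler_wpM2r ?(ltW s0)// lerDl.
by rewrite mulrC -ler_pdivlMr// ge_min lexx orbT.
Qed.

Lemma compact_cover (K : set V) (r : V -> R) : compact K -> (forall x, K x -> 0 < r x) ->
  exists n (p : nat -> V), (forall j, (j < n)%N -> K (p j)) /\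
    forall x, K x -> exists2 j, (j < n)%N & enorm (x - p j) < r (p j).
Proof.
move=> cK r0; have [s sK hs] := compact_subcover cK r0.
exists (size s), (nth 0 s); split; first by move=> j js; apply: sK; exact: mem_nth.
by move=> x /hs[p ps hp]; exists (index p s); rewrite ?index_mem ?nth_index.
Qed.

Lemma compact_enorm (K : set V) : compact K -> exists2 M : R, 0 <= M & forall x, K x -> enorm x <= M.
Proof.
move=> cK; have [M [_ hM]] := compact_bounded cK.
have MM : M < `|M| + 1 by rewrite (le_lt_trans (ler_norm M))// ltrDl.
exists (2 * (`|M| + 1)); first by rewrite mulr_ge0// addr_ge0.
by move=> x Kx; apply: le_trans (enorm_le_norm x) _; rewrite ler_pM2l//; exact: (hM _ MM x Kx).
Qed.

Lemma compact_shift (K : set V) (a : V) : compact K -> compact [set x | K (x - a)].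
Proof.
move=> cK; rewrite (_ : [set x | K (x - a)] = (fun x => x + a) @` K).
  by apply: continuous_compact => //; apply: continuous_subspaceT; exact: shift_cont.
apply/seteqP; split => x /=; first by move=> Kx; exists (x - a) => //; rewrite subrK.
by move=> [z Kz <-]; rewrite addrK.
Qed.

Lemma CCc_cut (K : set V) (h f : V -> R[i]) : compact K -> CCc h -> (forall y, ~ K y -> h y = 0) ->
  (forall y, K y -> ccontinuous_at y f) -> CCc (fun y => h y * f y).
Proof.
move=> cK ch hK cf; have [M M0 vM] := CCc_vanish ch.
apply: (@CCc_intro _ _ M); last by move=> x /vM ->; rewrite mul0r.
move=> y; have [Ky|nK] := pselect (K y).
  by apply: ccM; [exact: CCc_cont ch|exact: cf].
have oK : open (~` K) by apply: closed_openC; apply: compact_closed => //; exact: norm_hausdorff.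
apply: (@cc_near _ (fun=> 0)); last exact: ccC.
by apply: filterS (open_nbhs_nbhs (conj oK nK)) => z nz; rewrite hK// mul0r.
Qed.

End partition_of_unity.

(** * Superposition of sources *)

Section superposition.
Variables (R : realType) (D : set 'rV[R]_3) (k : R) (Y : forall l : nat, 'I_(l.*2.+1) -> 'rV[R]_3 -> R[i]).
Hypothesis k0 : 0 < k.
Hypothesis D0 : D 0.
Hypothesis Yspan : forall l (P : 'rV[R]_3 -> R[i]), hp l P -> harmonic P ->
  exists c : 'I_(l.*2.+1) -> R[i], forall x, sphere x -> P x = \sum_m c m * Y m x.
Local Notation V := 'rV[R]_3.
Local Notation e_ i := (delta_mx 0 i : V).
Local Notation approx := (@approx R D k Y).
Local Notation g0 x y := (eta k 0 (dot (y - x) (y - x))).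
Hypotheses (oD : open D) (cD : connected D).

Lemma dotB_sym (x y : V) : dot (x - y) (x - y) = dot (y - x) (y - x).
Proof. by rewrite -(opprB y x) dotNl dotNr opprK. Qed.

Lemma dot_gt0 (z : V) (r : R) : 0 < r -> r <= enorm z -> 0 < dot z z.
Proof. by move=> r0 rz; rewrite -enorm_sqr exprn_gt0// (lt_le_trans r0). Qed.

Lemma dot_shift_cont (x y : V) : {for y, continuous (fun y : V => dot (y - x) (y - x))}.
Proof. exact: (Ck_cont (Ck_dist 0 x openT) I). Qed.

Lemma eta_shift_cont l (x y : V) (r : R) : 0 < r -> r <= enorm (y - x) ->
  ccontinuous_at y (fun y => eta k l (dot (y - x) (y - x))).
Proof.
move=> r0 h; apply: (@cc_comp _ _ _ (fun y : V => dot (y - x) (y - x)) (eta k l)).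
  exact: dot_shift_cont.
exact: eta_cont (dot_gt0 r0 h).
Qed.

Lemma polar1E (d z : V) : dot d d = 1 -> 0 < dot z z ->
  polar k d 1 z = - ((dot d z)%:C * eta k 1 (dot z z)).
Proof.
move=> d1 z0; have [_ _ _ h] := taylor_derive k0 d1 0 z0.
have zn : z != 0 by apply/eqP => e; move: z0; rewrite e dotE !mxE !mulr0 !addr0 ltxx.
have h2 := eta_radial k0 0 (- d) zn.
have := cd_unique h h2; rewrite add0r mul1r => ->.
by rewrite dotNl rcN mulNr.
Qed.

Section room.
Variables (K : set V) (r : R).
Hypotheses (cK : compact K) (r0 : 0 < r) (hr : forall x y, ~ D x -> K y -> r <= enorm (y - x)).

Lemma weight_bound : exists2 C : R, 0 <= C & forall x y, ~ D x -> K y -> (1 + enorm x) <= C * enorm (y - x).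
Proof.
have [M M0 hM] := compact_enorm cK.
exists ((1 + M) / r + 1); first by rewrite addr_ge0// divr_ge0 ?(ltW r0)// addr_ge0.
move=> x y nD Ky; rewrite enormB.
have w : r <= enorm (x - y) by rewrite enormB; exact: hr.
apply: le_trans (weight_le r0 w) _.
rewrite ler_wpM2r ?enorm_ge0// lerD2r ler_pM2r ?invr_gt0// lerD2l; exact: hM.
Qed.

(** A Riemann sum: a partition of unity at scale s splits the density, and each piece is replaced by
    a point source at its centre. Sources move by at most 2 s, so the weighted error is of order
    s. *)
Lemma superpose0 h : K `<=` D -> CCc h -> (forall y, ~ K y -> h y = 0) ->
  approx (fun x => cI (fun y => h y * g0 x y)).
Proof.
move=> KD ch hK; have [Cw Cw0 hCw] := weight_bound.
have [H H0 hH] := CCc_bounded ch; have [M M0 hM] := CCc_vanish ch.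
pose dl := r / 2; have dl0 : 0 < dl by rewrite divr_gt0.
pose kp := kap k dl; have kp0 : 0 <= kp by rewrite ltW// kap_gt0.
apply: approx_closed => e e0.
(* C s is the final error: 2 (2 M)^3 comes from [cI_bound], H bounds the density, 8 kp s / |x - p j|
   is [polar_diff] for a displacement of 2 s, and Cw turns the distance into the weight. *)
pose C : R := 2 * (H * (8 * kp * Cw)) * (2 * M) ^+ 3.
have C0 : 0 <= C by rewrite /C; do ! apply: mulr_ge0 => //; rewrite exprn_ge0// mulr_ge0.
have [s s0 [s1 s2]] := small_scale C0 e0 (divr_gt0 dl0 (ltr0Sn R 1)).
have [n [p [pK hp]]] := @compact_cover R K (fun=> s) cK (fun _ _ => s0).
pose b j : V -> R := bump (p j) s.
have b01 j x : 0 <= b j x <= 1 by rewrite bump_ge0 bump_le1.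
have cb j : CkC 0 setT (fun y => (pou b j y)%:C).
  by apply: CkC_real; [exact: openT|apply: Ck_pou => i; exact: Ck_bump].
pose th j y : R[i] := (pou b j y)%:C * h y.
have cth j : CCc (th j) by apply: CCcM ch => x; exact: CkC_cont (cb j) I.
have thK j y : ~ K y -> th j y = 0 by move=> nK; rewrite /th hK// mulr0.
exists (fun x => \sum_(j < n) cI (th j) * g0 x (p j)).
  apply: approx_sum => j; apply: approx_scale.
  have [t t0 ht] := all_poles k0 D0 Yspan oD cD (KD _ (pK j (ltn_ord j))).
  apply: approx_ext (ht (p j) _) _; first by rewrite subrr enorm0.
  by move=> x _; rewrite dotB_sym.
move=> x nD; have rx y : K y -> r <= enorm (y - x) by exact: hr.
have cg : CCc (fun y => h y * g0 x y).
  by apply: (CCc_cut cK ch hK) => y Ky; apply: eta_shift_cont r0 (rx y Ky).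
have cF j : CCc (fun y => g0 x (p j) * th j y) by exact: CCcZ.
have -> : \sum_(j < n) cI (th j) * g0 x (p j) = cI (fun y => \sum_(j < n) g0 x (p j) * th j y).
  rewrite cI_sum//; apply: eq_bigr => j _; by rewrite cIZ// mulrC.
rewrite -cIB//; last exact: CCc_sum.
pose E := 8 * kp * s * Cw / (1 + enorm x).
have wx : 0 < 1 + enorm x by rewrite ltr_pwDl// enorm_ge0.
have E0 : 0 <= E by rewrite /E divr_ge0 ?(ltW wx)//; do ! apply: mulr_ge0 => //; exact: ltW.
have key j y : (j < n)%N -> K y -> b j y != 0 -> normc (g0 x y - g0 x (p j)) <= E.
  move=> jn Ky /bump_supp -/(_ s0) hb.
  have Kp := pK j jn.
  have z2 : 2 * dl <= enorm (x - p j) by rewrite enormB /dl mulrC divfK ?pnatr_eq0// rx.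
  have bnd : 2 * (0%:R + 1) * (kp ^+ 1 * (2 / enorm (x - p j))) * (2 * s) <= E.
    have zp : 0 < enorm (x - p j) by apply: lt_le_trans z2; rewrite mulr_gt0.
    have := hCw x (p j) nD Kp; rewrite enormB => w.
    rewrite /E expr1 add0r ler_pdivlMr//.
    have -> : 2 * 1 * (kp * (2 / enorm (x - p j))) * (2 * s) * (1 + enorm x) = 8 * kp * s * ((1 + enorm x) / enorm (x - p j)) by field; rewrite gt_eqF.
    apply: ler_wpM2l; first by do ! apply: mulr_ge0 => //; exact: ltW.
    by rewrite ler_pdivrMr.
  have [e1|ne] := eqVneq (y - p j) 0.
    have -> : y = p j by apply/eqP; rewrite -subr_eq0 e1.
    by rewrite subrr normc0.
  have [d d1 yd] := unit_dir ne.
  have hs : `|enorm (y - p j)| <= dl by rewrite ger0_norm ?enorm_ge0//; move: hb s1; lra.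
  have := polar_diff k0 d1 dl0 0 z2 hs; rewrite -yd.
  have -> : x - p j - (y - p j) = x - y by rewrite opprB addrA subrK.
  rewrite /polar /= (dotB_sym x y) (dotB_sym x (p j)) => h1.
  apply: le_trans h1 _; apply: le_trans bnd; apply: ler_wpM2l.
    by do ! apply: mulr_ge0 => //; rewrite ?addr_ge0 ?exprn_ge0 ?invr_ge0 ?enorm_ge0.
  by rewrite ger0_norm ?enorm_ge0// ltW.
have HE : 0 <= H * E by apply: mulr_ge0.
have pt y : normc (h y * g0 x y - \sum_(j < n) g0 x (p j) * th j y) <= H * E.
  have [Ky|nK] := pselect (K y); last first.
    rewrite hK// mul0r big1 ?subrr ?normc0; first exact: HE.
    by move=> j _; rewrite thK// mulr0.
  have [j0 j0n hj0] := hp y Ky.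
  have S1 : \sum_(j < n) pou b j y = 1 by apply: sum_pou1 j0n _; exact: bump_in s0 (ltW hj0).
  have -> : h y * g0 x y - \sum_(j < n) g0 x (p j) * th j y =
      h y * \sum_(j < n) (pou b j y)%:C * (g0 x y - g0 x (p j)).
    have -> : h y * g0 x y = \sum_(j < n) h y * ((pou b j y)%:C * g0 x y).
      rewrite -mulr_sumr -mulr_suml; congr (_ * _).
      rewrite -[LHS]mul1r; congr (_ * _).
      apply: complex_eq; rewrite ?Re_sum ?Im_sum; first by rewrite [in RHS](_ : \sum_i _ = 1).
      by rewrite big1.
    rewrite mulr_sumr -sumrB; apply: eq_bigr => j _; rewrite /th; ring.
  rewrite normcM; apply: ler_pM; rewrite ?normc_ge0//.
  apply: le_trans (le_normc_sum _ _ _) _.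
  apply: le_trans (_ : \sum_(j < n) pou b j y * E <= _); last first.
    by rewrite -mulr_suml S1 mul1r.
  apply: ler_sum => j _; rewrite normcZ ger0_norm ?pou_ge0//.
  have [b0|bn] := eqVneq (b j y) 0; first by rewrite pou0// !mul0r.
  by apply: ler_wpM2l; [exact: pou_ge0|exact: key].
have vF : cvanish_out M (fun y => h y * g0 x y - \sum_(j < n) g0 x (p j) * th j y).
  move=> y hy; rewrite (hM y hy) mul0r big1 ?subrr// => j _; by rewrite /th (hM y hy) !mulr0.
have cS : CCc (fun y => \sum_(j < n) g0 x (p j) * th j y) by apply: CCc_sum => j; exact: cF.
have cI1 := cI_bound M0 (CCcB cg cS) vF pt.
apply: le_trans (ler_wpM2l (ltW wx) cI1) _.
apply: le_trans s2; rewrite /C /E; apply: le_of_eq; field.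
by rewrite gt_eqF.
Qed.

End room.

Lemma compact_room_D (K : set V) : compact K -> K `<=` D ->
  exists2 r : R, 0 < r & forall x y, ~ D x -> K y -> r <= enorm (y - x).
Proof.
move=> cK KD; have [r r0 hr] := compact_room oD cK KD; exists r => // x y nD Ky.
by rewrite leNgt; apply/negP => h; apply: nD; apply: (hr y) => //; rewrite enormB.
Qed.

Lemma superposition0 (K : set V) h : compact K -> K `<=` D -> CCc h -> (forall y, ~ K y -> h y = 0) ->
  approx (fun x => cI (fun y => h y * g0 x y)).
Proof. by move=> cK KD ch hK; have [r r0 hr] := compact_room_D cK KD; exact: (superpose0 cK r0 hr). Qed.

(** The kernel is the derivative of the monopole in the source point, so the potential is a limit of
    difference quotients of monopole potentials with shifted density. *)
Lemma superposition1 (K : set V) h i : compact K -> K `<=` D -> CCc h -> (forall y, ~ K y -> h y = 0) ->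
  approx (fun x => cI (fun y => h y * (((y - x) 0 i)%:C * eta k 1 (dot (y - x) (y - x))))).
Proof.
move=> cK KD ch hK; have [r r0 hr] := compact_room_D cK KD.
have [Cw Cw0 hCw] := weight_bound cK r0 hr.
have [H H0 hH] := CCc_bounded ch; have [M M0 hM] := CCc_vanish ch.
pose dl := r / 2; have dl0 : 0 < dl by rewrite divr_gt0.
pose kp := kap k dl; have kp0 : 0 <= kp by rewrite ltW// kap_gt0.
pose d := e_ i; have d1 : dot d d = 1.
  rewrite dotE !delta_coord; move: i @d; by apply: forall3; rewrite /= ?mulr1 ?mulr0 ?addr0 ?add0r.
apply: approx_closed => e e0.
pose C : R := 2 * (H * (16 * kp ^+ 2 * Cw)) * (2 * M) ^+ 3.
have C0 : 0 <= C by rewrite /C; do ! apply: mulr_ge0 => //; rewrite exprn_ge0// mulr_ge0.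
have [s s0 [s1 s2]] := small_scale C0 e0 (divr_gt0 dl0 (ltr0Sn R 1)).
have sn : s != 0 by rewrite gt_eqF.
have nsd : enorm (s *: d) = s by rewrite enormZ /enorm d1 sqrtr1 mulr1 gtr0_norm.
pose K' : set V := [set y | K (y - s *: d)].
have I0 := superposition0 cK KD ch hK.
have I1 : approx (fun x => cI (fun y => h (y - s *: d) * g0 x y)).
  apply: (@superposition0 K').
  - exact: compact_shift.
  - move=> y Ky; apply: contrapT => nD; have := hr _ _ nD Ky.
    by rewrite addrAC subrr sub0r enormN nsd; move: s1 r0; rewrite /dl; lra.
  - exact: CCc_shift.
  - by move=> y nK; apply: hK.
(* Shifting the density by s d displaces its sources by s d; s is small enough for the shifted
   support to remain in [D]. *)
exists (fun x => (s^-1)%:C * (cI (fun y => h (y - s *: d) * g0 x y) + -1 * cI (fun y => h y * g0 x y))).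
  apply: approx_scale; apply: approx_add => //; exact: approx_scale.
move=> x nD; have rx y : K y -> r <= enorm (y - x) by exact: hr.
have rs y : K y -> dl <= enorm (y + s *: d - x).
  move=> /rx h1; have := enormB (y + s *: d - x) (s *: d); have := enorm_triB (y - x) (- (s *: d)).
  by rewrite enormN nsd opprK addrAC; move: h1 s1; rewrite /dl; lra.
have c0 : CCc (fun y => h y * g0 x y).
  by apply: (CCc_cut cK ch hK) => y Ky; apply: eta_shift_cont r0 (rx y Ky).
have cs : CCc (fun y => h y * g0 (x - s *: d) y).
  apply: (CCc_cut cK ch hK) => y Ky; apply: eta_shift_cont dl0 _.
  by rewrite opprB addrA; exact: rs.
have c1 : CCc (fun y => h y * (((y - x) 0 i)%:C * eta k 1 (dot (y - x) (y - x)))).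
  apply: (CCc_cut cK ch hK) => y Ky; apply: ccM; last exact: eta_shift_cont r0 (rx y Ky).
  apply: cc_real; rewrite (_ : (fun _ => _) = (fun z : V => z 0 i - x 0 i)); last by apply/funext => z; rewrite !mxE.
  by apply: contB; [exact: coord_cont|exact: contC].
have -> : cI (fun y => h (y - s *: d) * g0 x y) = cI (fun y => h y * g0 (x - s *: d) y).
  rewrite -(cI_translation (- (s *: d)) cs); congr cI; apply/funext => y.
  by rewrite opprB addrA subrK.
rewrite mulN1r -(cIB cs c0) -(cIZ _ (CCcB cs c0)) -(cIB c1 (CCcZ _ (CCcB cs c0))).
have wx : 0 < 1 + enorm x by rewrite ltr_pwDl// enorm_ge0.
pose E := 16 * kp ^+ 2 * s * Cw / (1 + enorm x).
have E0 : 0 <= E by rewrite /E divr_ge0 ?(ltW wx)//; do ! apply: mulr_ge0 => //; rewrite ?exprn_ge0//; exact: ltW.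
have pt y : normc (h y * (((y - x) 0 i)%:C * eta k 1 (dot (y - x) (y - x))) -
    (s^-1)%:C * (h y * g0 (x - s *: d) y - h y * g0 x y)) <= H * E.
  have [Ky|nK] := pselect (K y); last first.
    by rewrite hK// !mul0r subrr mulr0 subr0 normc0; apply: mulr_ge0.
  rewrite (_ : _ - _ = h y * ((((y - x) 0 i)%:C * eta k 1 (dot (y - x) (y - x))) - (s^-1)%:C * (g0 (x - s *: d) y - g0 x y))); last by ring.
  rewrite normcM; apply: ler_pM; rewrite ?normc_ge0//.
  have z2 : 2 * dl <= enorm (x - y) by rewrite enormB /dl mulrC divfK ?pnatr_eq0// rx.
  have hs : `|s| <= dl by rewrite gtr0_norm//; move: s1 dl0; lra.
  have := polar_diff2 k0 d1 dl0 0 z2 hs.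
  rewrite polar1E//; last by apply: (dot_gt0 r0); rewrite enormB; exact: rx.
  have -> : polar k d 0 (x - y - s *: d) = g0 (x - s *: d) y.
    by rewrite /polar /= -dotB_sym addrAC.
  have -> : polar k d 0 (x - y) = g0 x y by rewrite /polar /= -dotB_sym.
  have -> : dot d (x - y) = - (y - x) 0 i.
    have -> : dot d (x - y) = (x - y) 0 i.
      rewrite dotE !delta_coord; move: i @d d1 {I0 I1 c1 K' nsd rs cs}; 
      by apply: forall3 => d _; rewrite /= ?mul1r ?mul0r ?addr0 ?add0r.
    by rewrite !mxE opprB.
  rewrite (dotB_sym x y) add0r mul1r rcN mulNr opprK => hh.
  rewrite -normcN opprB.
  move: hh; move: (((y - x) 0 i)%:C * eta k 1 (dot (y - x) (y - x))) (g0 (x - s *: d) y) (g0 x y) => p1 a1 a0 hh.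
  have -> : (s^-1)%:C * (a1 - a0) - p1 = (s^-1)%:C * (a1 - a0 - s%:C * p1).
    have E1 : p1 = (s^-1)%:C * (s%:C * p1) by rewrite mulrA -(rcM s^-1 s) mulVf// mul1r.
    by rewrite [in RHS]mulrBr -E1.
  rewrite normcZ gtr0_norm ?invr_gt0//.
  apply: le_trans (ler_wpM2l (ltW (_ : 0 < s^-1)) hh) _; first by rewrite invr_gt0.
  have zp : 0 < enorm (x - y) by apply: lt_le_trans z2; rewrite mulr_gt0.
  have := hCw x y nD Ky; rewrite enormB => w.
  rewrite /E ler_pdivlMr// gtr0_norm//.
  have -> : s^-1 * (2 * (0 + 1) * (2 * (1%:R + 1) * (kap k dl ^+ 2 * (2 / enorm (x - y)))) * s ^+ 2) * (1 + enorm x) =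
      16 * kp ^+ 2 * s * ((1 + enorm x) / enorm (x - y)).
    by rewrite -/kp; field; rewrite sn gt_eqF.
  apply: ler_wpM2l; first by do ! apply: mulr_ge0 => //; rewrite ?exprn_ge0//; exact: ltW.
  by rewrite ler_pdivrMr.
have vF : cvanish_out M (fun y => h y * (((y - x) 0 i)%:C * eta k 1 (dot (y - x) (y - x))) -
    (s^-1)%:C * (h y * g0 (x - s *: d) y - h y * g0 x y)).
  by move=> y hy; rewrite (hM y hy) !mul0r subrr mulr0 subr0.
have cI1 := cI_bound M0 (CCcB c1 (CCcZ _ (CCcB cs c0))) vF pt.
apply: le_trans (ler_wpM2l (ltW wx) cI1) _.
apply: le_trans s2; rewrite /C /E; apply: le_of_eq; field.
by rewrite gt_eqF.
Qed.

End superposition.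

(** * Hardy's inequality *)

Section newtonian_bound.
Variable R : realType.
Local Notation V := 'rV[R]_3.
Implicit Types (x y : V) (e : R).

Lemma shift_coord_Ck n i x : Ck n setT (fun y : V => (y - x) 0 i).
Proof.
rewrite (_ : (fun y : V => _) = (fun y : V => y 0 i - x 0 i)); last by apply/funext => y; rewrite !mxE.
by apply: CkB; [exact: openT|exact: Ck_coord openT|exact: Ck_cst openT].
Qed.

Lemma derive_eq (f : V -> R) x v (a b : R) : is_derive x v f a -> a = b -> is_derive x v f b.
Proof. by move=> h <-. Qed.

Lemma Cc_intro (f : V -> R) M : (forall y, {for y, continuous f}) -> vanish_out M f -> Cc f.
Proof. by move=> cf vf; split; [exact: cf|exists M]. Qed.

(** A smooth substitute for |y - x|^-2, so that integration by parts applies on the whole space; the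
    bounds will be uniform in e. *)
Definition sqi e x y : R := (dot (y - x) (y - x) + e ^+ 2)^-1.

Lemma sqi_den e x y : 0 < e -> 0 < dot (y - x) (y - x) + e ^+ 2.
Proof. by move=> e0; rewrite ltr_pwDr ?exprn_gt0// dot_ge0. Qed.

Lemma sqi_gt0 e x y : 0 < e -> 0 < sqi e x y.
Proof. by move=> e0; rewrite invr_gt0 sqi_den. Qed.

Lemma sqi_derive e x y i : 0 < e -> is_derive y (delta_mx 0 i) (sqi e x) (- (2 * (y - x) 0 i) * sqi e x y ^+ 2).
Proof.
move=> e0; have h := dD (d_dist x y (delta_mx 0 i)) (dC (e ^+ 2) y (delta_mx 0 i)).
have n0 : dot (y - x) (y - x) + e ^+ 2 != 0 by rewrite gt_eqF// sqi_den.
have := @dV R _ (fun y => dot (y - x) (y - x) + e ^+ 2) y _ _ n0 h; move=> H; apply: derive_eq H _.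
by rewrite addr0 exprVn; congr (- (2 * _) / _); rewrite dotE !delta_coord; move: i {h};
  apply: forall3; rewrite /= ?mul1r ?mul0r ?addr0 ?add0r.
Qed.

Lemma sqi_Ck e x : 0 < e -> Ck 1 setT (sqi e x).
Proof.
move=> e0; have c : forall y, {for y, continuous (sqi e x)}.
  move=> y; apply: contV; first by rewrite gt_eqF// sqi_den.
  by apply: contD; [exact: (Ck_cont (Ck_dist 0 x openT) I)|exact: contC].
apply: (@Ck_intro _ 0 _ _ (fun i y => - (2 * (y - x) 0 i) * sqi e x y ^+ 2)) => [y _//|i y _|i]; first exact: sqi_derive.
split => // y _; rewrite (_ : pd i (sqi e x) = (fun y => - (2 * (y - x) 0 i) * sqi e x y ^+ 2)).
  apply: contM; last exact: contX.
  by apply: contN; apply: contM; [exact: contC|exact: (Ck_cont (shift_coord_Ck 0 i x) I)].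
by apply/funext => z; apply: pd_is_derive; exact: sqi_derive.
Qed.

(* The divergence of z/(|z|^2 + e^2) dominates 1/(|z|^2 + e^2): a
   Hardy inequality. *)
Lemma hardy (th : V -> R) M : Ck 2 setT th -> vanish_out M th -> exists2 C : R, 0 <= C &
  forall x e, 0 < e -> I3 (fun y => th y ^+ 2 * sqi e x y) <= C.
Proof.
move=> ct vt; pose C : R := 4 * \sum_(i < 3) I3 (fun y => pd i th y ^+ 2).
exists C; first by rewrite mulr_ge0// sumr_ge0// => i _; apply: I3_ge0 => y; rewrite sqr_ge0.
move=> x e e0; pose s := sqi e x.
have cth y : {for y, continuous th} by exact: Ck_cont ct I.
have cs y : {for y, continuous s} by exact: Ck_cont (sqi_Ck x e0) I.
have cp i y : {for y, continuous (pd i th)} by exact: Ck_cont (Ck_pd i ct) I.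
have cc i y : {for y, continuous (fun y => (y - x) 0 i)} by exact: Ck_cont (shift_coord_Ck 0 i x) I.
have c2 (f : V -> R) y : {for y, continuous f} -> {for y, continuous (fun y : V => f y ^+ 2)} by exact: contX.
have vp i : vanish_out M (pd i th) by exact: vanish_out_pd.
pose F i y := (y - x) 0 i * s y.
have CF i : Ck 1 setT (F i) by apply: CkM; [exact: openT|exact: shift_coord_Ck|exact: sqi_Ck].
have dF i y : pd i (F i) y = s y - 2 * (F i y) ^+ 2.
  apply: pd_is_derive.
  have d1 : is_derive y (delta_mx 0 i) (fun y => (y - x) 0 i) 1.
    rewrite (_ : (fun y : V => _) = (fun y : V => y 0 i - x 0 i)); last by apply/funext => z; rewrite !mxE.
    by have := dB (d_coord i y (delta_mx 0 i)) (dC (x 0 i) y (delta_mx 0 i)); rewrite delta_coord eqxx subr0.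
  by have H := dM d1 (sqi_derive x y i e0); apply: derive_eq H _; rewrite /F -/s; ring.
have C2 : Ck 1 setT (fun y => th y ^+ 2).
  have c1 := Ck_leq (isT : (1 <= 2)%N) ct.
  rewrite (_ : (fun y => th y ^+ 2) = (fun y => th y * th y)); first exact: (CkM openT c1 c1).
  by apply/funext => y; rewrite expr2.
have v2 : vanish_out M (fun y => th y ^+ 2) by move=> y /vt ->; rewrite expr0n.
have d2 i y : pd i (fun y => th y ^+ 2) y = 2 * (th y * pd i th y).
  apply: pd_is_derive; have h := Ck_is_derive i ct (I : setT y).
  by have H := d_exp 2 h; apply: derive_eq H _; rewrite /= expr1; ring.
have CcI g : (forall y, {for y, continuous g}) -> vanish_out M g -> Cc g by move=> cg vg; split; [exact: cg|exists M].
have C0 : Cc (fun y => th y ^+ 2 * s y).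
  by apply: CcI => [y|y /vt ->]; [apply: contM => //; exact: c2|rewrite expr0n mul0r].
have C1 i : Cc (fun y => th y ^+ 2 * F i y ^+ 2).
  apply: CcI => [y|y /vt ->]; last by rewrite expr0n mul0r.
  by apply: contM; apply: c2 => //; exact: contM.
have C3 i : Cc (fun y => pd i th y ^+ 2).
  by apply: CcI => [y|y /(vp i) ->]; [apply: c2|rewrite expr0n].
have C4 i : Cc (fun y => F i y * (th y * pd i th y)).
  apply: CcI => [y|y /vt ->]; last by rewrite mul0r mulr0.
  by apply: contM; apply: contM.
have ibp i : I3 (fun y => F i y * pd i (fun y => th y ^+ 2) y) = - I3 (fun y => pd i (F i) y * th y ^+ 2).
  by apply: (@int_by_parts _ setT _ _ _ M) => //; [exact: openT|move=> y /(_ I)].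
have E1 i : I3 (fun y => F i y * pd i (fun y => th y ^+ 2) y) = 2 * I3 (fun y => F i y * (th y * pd i th y)).
  by rewrite -I3Z//; congr I3; apply/funext => y; rewrite d2; ring.
have E2 i : I3 (fun y => pd i (F i) y * th y ^+ 2) = I3 (fun y => th y ^+ 2 * s y) - 2 * I3 (fun y => th y ^+ 2 * F i y ^+ 2).
  rewrite -I3Z// -I3B//; last exact: CcZ.
  by congr I3; apply/funext => y; rewrite dF; ring.
(* With weight 1/4, and X the integral to be bounded and S the Dirichlet integral of th, the
   identities below give 3 X <= 2 X + X/2 + 2 S, that is X <= 4 S, the constant C. *)
have amgm i : - I3 (fun y => F i y * (th y * pd i th y)) <= I3 (fun y => pd i th y ^+ 2) + 4^-1 * I3 (fun y => th y ^+ 2 * F i y ^+ 2).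
  rewrite -I3N// -I3Z// -I3D//; last exact: CcZ.
  apply: le_I3; [exact: CcN|by apply: CcD => //; exact: CcZ|move=> y].
  rewrite -subr_ge0; have := sqr_ge0 (pd i th y + 2^-1 * (th y * F i y)).
  by congr (0 <= _); field.
have sumF : \sum_(i < 3) I3 (fun y => th y ^+ 2 * F i y ^+ 2) <= I3 (fun y => th y ^+ 2 * s y).
  rewrite -I3_sum//; apply: le_I3 => //; first exact: Cc_sum.
  move=> y; rewrite -mulr_sumr; apply: ler_wpM2l; first exact: sqr_ge0.
  have -> : \sum_(i < 3) F i y ^+ 2 = dot (y - x) (y - x) * s y ^+ 2.
    by rewrite dotE sum3 /F; ring.
  rewrite expr2 mulrA; apply: ler_piMl; first by rewrite ltW// sqi_gt0.
  by rewrite /s /sqi ler_pdivrMr ?sqi_den// mul1r lerDl sqr_ge0.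
have : 3 * I3 (fun y => th y ^+ 2 * s y) = 2 * \sum_(i < 3) I3 (fun y => th y ^+ 2 * F i y ^+ 2) + 2 * \sum_(i < 3) - I3 (fun y => F i y * (th y * pd i th y)).
  have E i : I3 (fun y => th y ^+ 2 * s y) = 2 * I3 (fun y => th y ^+ 2 * F i y ^+ 2) + 2 * - I3 (fun y => F i y * (th y * pd i th y)).
    have h1 := ibp i; have h2 := E1 i; have h3 := E2 i; move: h1 h2 h3.
    by move=> h1 h2 h3; rewrite mulrN -h2 h1 h3; ring.
  rewrite !sum3; have := E 0; have := E 1; have := E 2%:R.
  move: (I3 (fun y => F 0 y * (th y * pd 0 th y))) (I3 (fun y => F 1 y * (th y * pd 1 th y)))
    (I3 (fun y => F 2%:R y * (th y * pd 2%:R th y))) (I3 (fun y => th y ^+ 2 * F 0 y ^+ 2))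
    (I3 (fun y => th y ^+ 2 * F 1 y ^+ 2)) (I3 (fun y => th y ^+ 2 * F 2%:R y ^+ 2))
    (I3 (fun y => th y ^+ 2 * s y)) => q0 q1 q2 p0 p1 p2 X.
  lra.
have : \sum_(i < 3) - I3 (fun y => F i y * (th y * pd i th y)) <= \sum_(i < 3) I3 (fun y => pd i th y ^+ 2) + 4^-1 * \sum_(i < 3) I3 (fun y => th y ^+ 2 * F i y ^+ 2).
  by rewrite mulr_sumr -big_split /=; apply: ler_sum => i _; exact: amgm.
move: sumF; rewrite /C -/s.
have : 0 <= \sum_(i < 3) I3 (fun y => pd i th y ^+ 2) by apply: sumr_ge0 => i _; apply: I3_ge0 => y; exact: sqr_ge0.
move: (I3 _) (\sum_(i < 3) I3 (fun y => th y ^+ 2 * F i y ^+ 2)) (\sum_(i < 3) - I3 _) (\sum_(i < 3) I3 (fun y => pd i th y ^+ 2)) => a b c d.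
lra.
Qed.

End newtonian_bound.

(** * Uniform bounds on potentials *)

Section potential_bound.
Variables (R : realType) (k : R).
Hypothesis k0 : 0 < k.
Local Notation V := 'rV[R]_3.
Implicit Types (x y : V) (e : R).

Lemma rho_gt0 e (z : V) : 0 < e -> 0 < rho e z.
Proof. by move=> e0; rewrite lt_max e0 orbT. Qed.

Lemma rho_sqi e x y : 0 < e -> (rho e (y - x))^-1 ^+ 2 <= 2 * sqi e x y.
Proof.
move=> e0; rewrite exprVn /sqi -[leLHS]div1r ler_pdivrMr ?exprn_gt0 ?rho_gt0//.
rewrite mulrAC ler_pdivlMr ?sqi_den// mul1r mulr_natl -enorm_sqr [leRHS]mulr2n; apply: lerD.
- by rewrite lerXn2r ?nnegrE ?enorm_ge0 ?(ltW (rho_gt0 _ e0))// le_max lexx.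
- by rewrite lerXn2r ?nnegrE ?(ltW e0) ?(ltW (rho_gt0 _ e0))// le_max lexx orbT.
Qed.

Lemma potential_bound (M : R) : 0 < M -> exists2 C : R, 0 <= C & forall (f : V -> R[i]) (w : R) x e,
  0 < e -> e <= 1 -> CCc f -> cvanish_out M f -> (forall y, normc (f y) <= w) ->
  [/\ (1 + enorm x) * normc (cI (fun y => f y * Gk k e x y)) <= C * w,
      forall i, (1 + enorm x) * normc (cI (fun y => f y * cpd i (Gk k e x) y)) <= C * w &
      (1 + enorm x) * normc (cI (fun y => f y * Kk k e x y)) <= C * w].
Proof.
move=> M0; pose th : V -> R := bump 0 (2 * M).
have cth : Ck 2 setT th by exact: Ck_bump.
have M2 : 0 < 2 * M by rewrite mulr_gt0.
have vth : vanish_out (2 * (2 * M)) th.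
  move=> y hy; apply: bump_out => //; rewrite subr0; apply: le_trans (norm_le_enorm y); exact: ltW.
have [C1 C10 hC1] := hardy cth vth.
have kb := ltW (kbound_gt0 k0).
(* On the support |y| <= 2 M, so 1 + |x| is at most M3 - 2 plus the distance from x to y: one power
   of the decay absorbs the weight. *)
pose M3 := 3 + 2 * M; have M30 : 0 <= M3 by rewrite addr_ge0// ltW.
pose I2 := I3 (fun y => th y ^+ 2).
have I20 : 0 <= I2 by apply: I3_ge0 => y; exact: sqr_ge0.
pose A := 2 * (kbound k * M3 * 4 * (I2 + 2 * C1)).
pose B := 16 * kbound k * M3.
have A0 : 0 <= A by rewrite /A; do ! apply: mulr_ge0 => //; rewrite addr_ge0// mulr_ge0.
have B0 : 0 <= B by rewrite /B; do ! apply: mulr_ge0.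
exists (A + B); first exact: addr_ge0.
move=> f w x e e0 e1 cf vf fw.
have w0 : 0 <= w by apply: le_trans (fw 0); exact: normc_ge0.
have wx : 0 < 1 + enorm x by rewrite ltr_pwDl// enorm_ge0.
have fM y : f y != 0 -> enorm y <= 2 * M.
  move=> fn; have yM : `|y| <= M by rewrite leNgt; apply/negP => /vf e2; move: fn; rewrite e2 eqxx.
  by apply: le_trans (enorm_le_norm y) _; rewrite ler_pM2l.
have cG : CkC 2 setT (Gk k e x) by exact: Gk_CkC openT e0.
have cs y : {for y, continuous (sqi e x)} by exact: Ck_cont (sqi_Ck x e0) I.
have ct y : {for y, continuous (fun y => th y ^+ 2)} by apply: contX; exact: Ck_cont cth I.
have Cg (c : R) : Cc (fun y => c * (th y ^+ 2 * (1 + 2 * sqi e x y))).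
  apply: CcZ; apply: (@Cc_intro _ _ (2 * (2 * M))); last by move=> y /vth ->; rewrite expr0n mul0r.
  move=> y; apply: contM => //; apply: contD; first exact: contC.
  by apply: contM => //; exact: contC.
have Ig : I3 (fun y => th y ^+ 2 * (1 + 2 * sqi e x y)) <= I2 + 2 * C1.
  have Ct : Cc (fun y => th y ^+ 2) by apply: (@Cc_intro _ _ (2 * (2 * M))) => // y /vth ->; rewrite expr0n.
  have Cs : Cc (fun y => th y ^+ 2 * sqi e x y).
    by apply: (@Cc_intro _ _ (2 * (2 * M))) => [y|y /vth ->]; [exact: contM|rewrite expr0n mul0r].
  rewrite (_ : (fun y => _) = (fun y => th y ^+ 2 + 2 * (th y ^+ 2 * sqi e x y))); last by apply/funext => y; ring.
  rewrite I3D//; last exact: CcZ.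
  by rewrite I3Z// lerD2l ler_pM2l// hC1.
have main (g : V -> R[i]) : (forall y, ccontinuous_at y g) ->
    (forall y, normc (g y) <= kbound k * ((rho e (y - x))^-1 + (rho e (y - x))^-1 ^+ 2)) ->
    (1 + enorm x) * normc (cI (fun y => f y * g y)) <= A * w.
  move=> cg hg; have Cfg := CCcMr cf cg.
  pose c := w * (kbound k * M3 * 4 / (1 + enorm x)).
  have c0 : 0 <= c.
    by rewrite /c; apply: mulr_ge0 => //; apply: divr_ge0 (ltW wx); do ! apply: mulr_ge0.
  have h : normc (cI (fun y => f y * g y)) <= 2 * I3 (fun y => c * (th y ^+ 2 * (1 + 2 * sqi e x y))).
    apply: le_norm_cI => // y.
    have q0 := sqi_gt0 x y e0.
    have [f0|fn] := eqVneq (f y) 0.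
      rewrite f0 mul0r normc0; apply: mulr_ge0 => //; apply: mulr_ge0; first exact: sqr_ge0.
      by rewrite addr_ge0// mulr_ge0// ltW.
    rewrite /th bump_in//; last by rewrite subr0; exact: fM.
    rewrite expr1n mul1r normcM.
    apply: le_trans (ler_pM (normc_ge0 _) (normc_ge0 _) (fw y) (hg y)) _.
    rewrite /c -[leRHS]mulrA; apply: ler_wpM2l => //.
    have -> : kbound k * M3 * 4 / (1 + enorm x) * (1 + 2 * sqi e x y) = kbound k * (M3 * 4 * (1 + 2 * sqi e x y) / (1 + enorm x)).
      by field; rewrite gt_eqF.
    apply: ler_wpM2l => //; rewrite ler_pdivlMr//.
    have r0 := rho_gt0 (y - x) e0; have rs := rho_sqi x y e0.
    have xr : 1 + enorm x <= M3 - 2 + rho e (y - x).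
      have := enorm_triB x y; have := fM y fn; rewrite enormB.
      have : enorm (y - x) <= rho e (y - x) by rewrite le_max lexx.
      by rewrite /M3; lra.
    move: rs xr r0 M30; move: (rho e (y - x)) (1 + enorm x) (sqi e x y) => r u q rs ur r0 M30.
    have M31 : 1 <= M3 - 2 by rewrite /M3; move: M0; lra.
    have ri : 0 < r^-1 by rewrite invr_gt0.
    have rr : r^-1 * r = 1 by rewrite mulVf// gt_eqF.
    apply: le_trans (_ : (r^-1 + r^-1 ^+ 2) * (M3 - 2 + r) <= _).
      by apply: ler_wpM2l => //; rewrite addr_ge0 ?exprn_ge0 ?(ltW ri).
    have -> : (r^-1 + r^-1 ^+ 2) * (M3 - 2 + r) = (M3 - 2) * (r^-1 + r^-1 ^+ 2) + r^-1 * r + (r^-1 * r) * r^-1 by ring.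
    rewrite rr mul1r.
    have i1 : r^-1 <= 1 + r^-1 ^+ 2 by have := sqr_ge0 (r^-1 - 2^-1); lra.
    have i2 : (M3 - 2) * (r^-1 + r^-1 ^+ 2) <= (M3 - 2) * (1 + 2 * (2 * q)).
      by apply: ler_wpM2l; [move: M31; lra|move: i1 rs; lra].
    have q0' : 0 <= q by have := sqr_ge0 r^-1; move: rs; lra.
    have : 0 <= (M3 - 2) * q by apply: mulr_ge0 => //; move: M31; lra.
    move: i1 i2 rs M31 q0'; lra.
  apply: le_trans (ler_wpM2l (ltW wx) h) _; rewrite I3Z; last first.
    have := Cg 1; congr Cc; apply/funext => y; by rewrite mul1r.
  apply: le_trans (_ : (1 + enorm x) * (2 * (c * (I2 + 2 * C1))) <= _).
    have c2 : c * I3 (fun y => th y ^+ 2 * (1 + 2 * sqi e x y)) <= c * (I2 + 2 * C1) by apply: ler_wpM2l.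
    apply: (ler_wpM2l (ltW wx)); exact: ler_wpM2l.
  by rewrite /c /A; apply: le_of_eq; field; rewrite gt_eqF.
split.
- apply: le_trans (main _ _ _) _; last by rewrite ler_wpM2r// lerDl.
    by move=> y; exact: CkC_cont cG I.
  move=> y; apply: le_trans (normc_Gk k0 x y e0 e1) _; apply: ler_wpM2l => //.
  by rewrite lerDl exprn_ge0// invr_ge0 ltW// rho_gt0.
- move=> i; apply: le_trans (main _ _ _) _; last by rewrite ler_wpM2r// lerDl.
    by move=> y; exact: CkC_cont (CkC_pd i cG) I.
  by move=> y; exact: normc_cpd_Gk.
(* [Kk] has height e^-3 on a ball of radius e: it contributes nothing when x is far from the
   support, and has bounded mass otherwise. *)
- have [xM|xM] := leP (enorm x) (1 + 2 * M); last first.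
    rewrite (_ : (fun y => _) = (fun=> 0)); first by rewrite cI0 normc0 mulr0 mulr_ge0// addr_ge0.
    apply/funext => y; have [->|fn] := eqVneq (f y) 0; first by rewrite mul0r.
    rewrite Kk_out ?mulr0//; have := fM y fn; have := enorm_triB x y; rewrite enormB.
    by move: xM e1; lra.
  have CK : CCc (fun y => f y * Kk k e x y) by apply: (CCcMr cf) => y; exact: Kk_cont.
  have -> : cI (fun y => f y * Kk k e x y) = cI (fun y => f (y + x) * Kk k e 0 y).
    rewrite -(cI_translation x CK); congr cI; apply/funext => y; by rewrite Kk_shift addrK.
  have CK' : CCc (fun y => f (y + x) * Kk k e 0 y).
    have := CCc_shift x CK; congr CCc; apply/funext => y; by rewrite Kk_shift addrK.
  have vK : cvanish_out e (fun y => f (y + x) * Kk k e 0 y).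
    move=> y hy; rewrite Kk_out ?mulr0// subr0; apply: le_trans (norm_le_enorm y); exact: ltW.
  have bK y : normc (f (y + x) * Kk k e 0 y) <= w * (kbound k * e^-1 ^+ 3).
    rewrite normcM; apply: ler_pM; rewrite ?normc_ge0//; exact: normc_Kk.
  apply: le_trans (ler_wpM2l (ltW wx) (cI_bound (ltW e0) CK' vK bK)) _.
  have -> : 2 * (w * (kbound k * e^-1 ^+ 3)) * (2 * e) ^+ 3 = 16 * kbound k * w.
    by field; rewrite gt_eqF.
  apply: le_trans (_ : M3 * (16 * kbound k * w) <= _).
    apply: ler_wpM2r; first by do ! apply: mulr_ge0.
    by rewrite /M3; move: xM; lra.
  apply: le_trans (_ : B * w <= _); last by rewrite ler_wpM2r// lerDr.
  by rewrite /B; apply: le_of_eq; ring.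
Qed.

End potential_bound.

(** * Lipschitz boundaries *)

Section lipschitz_domains.
Variables (R : realType) (D : set 'rV[R]_3).
Local Notation V := 'rV[R]_3.
Implicit Types (x y p : V).
Hypotheses (oD : open D).

Lemma boundaryE : boundary D = closure D `&` ~` D.
Proof. by rewrite /boundary (_ : D° = D)//; apply/interior_id. Qed.

Lemma boundary_closed : closed (boundary D).
Proof. rewrite boundaryE; apply: closedI; [exact: closed_closure|exact: open_closedC]. Qed.

Lemma exterior_or_boundary x : ~ D x -> boundary D x \/ (~` D)° x.
Proof.
move=> nD; rewrite boundaryE; have [c|nc] := pselect (closure D x); first by left.
by right; rewrite interiorC.
Qed.

Lemma exterior_out x : (~` D)° x -> ~ D x.
Proof. by move=> /interior_subset. Qed.

Lemma boundary_bounded (M : R) : D `<=` [set x | enorm x <= M] -> boundary D `<=` [set x | enorm x <= M].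
Proof.
move=> DM x; rewrite boundaryE => -[cx _] /=; rewrite leNgt; apply/negP => h.
have /cx[y [Dy hy]] : nbhs x [set y | M < enorm y].
  have := @enorm_near_gt R 0 x M; rewrite subr0 => /(_ h); apply: filterS => y; by rewrite subr0.
by have := DM y Dy; rewrite /= leNgt hy.
Qed.

Lemma boundary_compact (M : R) : D `<=` [set x | enorm x <= M] -> compact (boundary D).
Proof.
move=> DM; apply: bounded_closed_compact; last exact: boundary_closed.
exists `|M|; split; first exact: num_real.
move=> N MN x /(boundary_bounded DM) /= xM; apply: ltW; apply: le_lt_trans MN.
by apply: le_trans (norm_le_enorm x) _; apply: le_trans xM (ler_norm M).
Qed.

Variables (Q : 'M[R]_3) (h : R * R -> R^o) (U : set V) (p : V).
Hypotheses (QQ : Q *m Q^T = 1%:M) (lh : lipschitz h) (pU : nbhs p U).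
Hypothesis chart : forall x, U x ->
  (D x <-> h ((x *m Q) 0 0, (x *m Q) 0 1) < (x *m Q) 0 (2%:R : 'I_3)).

Lemma dot_mul x y : dot (x *m Q) (y *m Q) = dot x y.
Proof.
have E (u v : V) : dot u v = (u *m v^T) 0 0.
  by rewrite /dot mxE; apply: eq_bigr => i _; rewrite mxE.
by rewrite !E trmx_mul mulmxA -(mulmxA x) QQ mulmx1.
Qed.

Lemma enorm_mul x : enorm (x *m Q) = enorm x.
Proof. by rewrite /enorm dot_mul. Qed.

Lemma QTQ : Q^T *m Q = 1%:M.
Proof. exact: mulmx1C. Qed.

Definition chart_dir : V := delta_mx 0 2%:R *m Q^T.

Lemma chart_dir_mul : chart_dir *m Q = delta_mx 0 2%:R.
Proof. by rewrite /chart_dir -mulmxA QTQ mulmx1. Qed.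

Lemma dot_chart_dir : dot chart_dir chart_dir = 1.
Proof. by rewrite -dot_mul chart_dir_mul dotE !delta_coord /= !mulr0 !add0r mulr1. Qed.

Lemma lip_const : exists2 L : R, 0 <= L & forall s t : R * R, `|h s - h t| <= L * (`|s.1 - t.1| + `|s.2 - t.2|).
Proof.
move: lh => [L [_ hL]]; have LM : L < `|L| + 1 by rewrite (le_lt_trans (ler_norm L))// ltrDl.
exists (`|L| + 1) => [|s t]; first by rewrite addr_ge0.
have := hL _ LM (s, t) (conj I I) => /= hst; apply: le_trans hst _.
apply: ler_wpM2l; first by rewrite addr_ge0.
by rewrite prod_normE /= ge_max lerDl lerDr !normr_ge0.
Qed.

(** In the chart [D] lies strictly above the graph; by continuity of h its closure lies weakly
    above, so any upward push lands strictly above, in [D]. *)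
Lemma closure_above x : closure D x -> nbhs x U -> h ((x *m Q) 0 0, (x *m Q) 0 1) <= (x *m Q) 0 (2%:R : 'I_3).
Proof.
move=> cx Ux; have [L L0 hL] := lip_const; apply/ler_addgt0Pr => e e0.
pose d := e / (2 * L + 1).
have L1 : 0 < 2 * L + 1 by rewrite ltr_pwDr// mulr_ge0.
have d0 : 0 < d by rewrite divr_gt0.
have : nbhs x (U `&` [set y | enorm (y - x) < d]).
  by apply: filterI => //; apply/enorm_ball; exists d.
move=> /cx[y [Dy [Uy /= yd]]].
have := (chart Uy).1 Dy; have c i : `|(x *m Q) 0 i - (y *m Q) 0 i| <= d.
  have -> : (x *m Q) 0 i - (y *m Q) 0 i = ((x - y) *m Q) 0 i by rewrite mulmxBl !mxE.
  by apply: le_trans (coord_le_enorm _ _) _; rewrite enorm_mul enormB ltW.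
have c0 := c 0; have c1 := c 1; have c2 := c 2%:R.
have := hL ((x *m Q) 0 0, (x *m Q) 0 1) ((y *m Q) 0 0, (y *m Q) 0 1); rewrite /= => h1 h2.
have h3 : `|h ((x *m Q) 0 0, (x *m Q) 0 1) - h ((y *m Q) 0 0, (y *m Q) 0 1)| <= L * (d + d).
  by apply: le_trans h1 _; apply: ler_wpM2l => //; exact: lerD.
have : L * (d + d) + d = e by rewrite /d; field; rewrite gt_eqF.
have := ler_norm (h ((x *m Q) 0 0, (x *m Q) 0 1) - h ((y *m Q) 0 0, (y *m Q) 0 1)).
move: c2; rewrite ler_norml => /andP[c2 _].
by move: h2 h3 c2; lra.
Qed.

Lemma chart_push x (t : R) : closure D x -> nbhs x U -> U (x + t *: chart_dir) -> 0 < t -> D (x + t *: chart_dir).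
Proof.
move=> cx Ux Ut t0; apply/(chart Ut).
have E : (x + t *: chart_dir) *m Q = x *m Q + t *: delta_mx 0 2%:R by rewrite mulmxDl -scalemxAl chart_dir_mul.
have Ei i : ((x + t *: chart_dir) *m Q) 0 i = (x *m Q) 0 i + t * (i == 2%:R)%:R.
  by rewrite E !mxE eqxx.
rewrite !Ei /= !mulr0 !addr0 mulr1.
by apply: le_lt_trans (closure_above cx Ux) _; rewrite ltrDl.
Qed.

(** In the chart a boundary point lies on the graph: not below it by [closure_above], not above it
    since it is not in [D]. The graph over a square is a Lipschitz image with constant 1 + L. *)
Lemma chart_area : exists2 r : R, 0 < r & (hausdorff2 (boundary D `&` [set y | (enorm (y - p) < r)%R]) < +oo)%E.
Proof.
have [r r0 hr] := (enorm_ball p U).1 pU; exists r => //.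
have [L L0 hL] := lip_const.
pose psi (s : R * R) : V := (s.1 *: delta_mx 0 0 + s.2 *: delta_mx 0 1 + h s *: delta_mx 0 2%:R) *m Q^T.
pose M := enorm p + r.
have M0 : 0 < M by rewrite ltr_wpDl// enorm_ge0.
have QQ' : Q^T *m Q^T^T = 1%:M by rewrite trmxK QTQ.
apply: le_lt_trans (@hausdorff2_lipschitz_image R psi (1 + L) M _ M0 _); first 1 last.
- exact: addr_ge0.
- move=> s t _ _ _ _.
  have -> : psi s - psi t = ((s.1 - t.1) *: delta_mx 0 0 + (s.2 - t.2) *: delta_mx 0 1 + (h s - h t) *: delta_mx 0 2%:R) *m Q^T.
    rewrite /psi -mulmxBl; congr (_ *m _); rewrite !scalerBl.
    by rewrite !opprD !addrA; congr (_ + _); rewrite -!addrA; congr (_ + _); rewrite [RHS]addrCA; congr (_ + _); rewrite addrC -!addrA; congr (_ + _); rewrite addrC.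
  have -> u : enorm (u *m Q^T) = enorm u.
    rewrite -[in RHS](mulmx1 u) -QTQ mulmxA.
    by rewrite enorm_mul.
  have e1 (i : 'I_3) : enorm (delta_mx 0 i : V) = 1.
    rewrite /enorm dotE !delta_coord; move: i; apply: forall3; by rewrite /= ?mulr0 ?mulr1 ?addr0 ?add0r sqrtr1.
  apply: le_trans (enormD _ _) _; apply: le_trans (lerD (enormD _ _) (lexx _)) _.
  rewrite !enormZ !e1 !mulr1; have := hL s t.
  by rewrite mulrDl mul1r lerD2l.
- apply: le_hausdorff2 => x []; rewrite boundaryE => -[cx nDx] /= xr.
  have Ux : nbhs x U.
    apply/enorm_ball; exists (r - enorm (x - p)); first by rewrite subr_gt0.
    move=> y hy; apply: hr; have := enormD (y - x) (x - p); rewrite addrA subrK; move: hy; lra.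
  have hx : h ((x *m Q) 0 0, (x *m Q) 0 1) = (x *m Q) 0 (2%:R : 'I_3).
    apply/eqP; rewrite eq_le closure_above//= leNgt; apply/negP => hlt; apply: nDx.
    by apply/(chart (nbhs_singleton Ux)).
  have xM i : `|(x *m Q) 0 i| <= M.
    apply: le_trans (coord_le_enorm _ _) _; rewrite enorm_mul.
    by have := enorm_triB x p; move: xr; rewrite /M; lra.
  exists ((x *m Q) 0 0, (x *m Q) 0 1); first by split; exact: xM.
  rewrite /psi hx /=; rewrite -[RHS](mulmx1 x) -QQ mulmxA; congr (_ *m _).
  apply/rowP; apply: forall3; rewrite !mxE /= ?mulr0 ?mulr1 ?addr0 ?add0r//.
Qed.

End lipschitz_domains.

(** * Geometry of distant points *)

Section radial_geometry.
Variable R : realType.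
Local Notation V := 'rV[R]_3.
Implicit Types (x y a : V).

Definition unitv (y : V) : V := (enorm y)^-1 *: y.

Lemma unitv_sphere y : 0 < enorm y -> enorm (unitv y) = 1.
Proof. by move=> y0; rewrite /unitv enormZ ger0_norm ?invr_ge0 ?enorm_ge0// mulVf// gt_eqF. Qed.

Lemma dot_unitv a : 0 < enorm a -> dot (unitv a) a = enorm a.
Proof. by move=> a0; rewrite /unitv dotZl -enorm_sqr expr2 mulrA mulVf ?mul1r// gt_eqF. Qed.

Lemma unitv_near a y : 0 < enorm a -> 0 < enorm y -> enorm (unitv y - unitv a) <= 2 * enorm (y - a) / enorm a.
Proof.
move=> a0 y0; rewrite /unitv.
have -> : (enorm y)^-1 *: y - (enorm a)^-1 *: a = (enorm a)^-1 *: (y - a) + ((enorm y)^-1 - (enorm a)^-1) *: y.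
  by apply/rowP => i; rewrite !mxE; ring.
apply: le_trans (enormD _ _) _; rewrite !enormZ (ger0_norm (_ : 0 <= (enorm a)^-1)) ?invr_ge0 ?enorm_ge0//.
have -> : `|(enorm y)^-1 - (enorm a)^-1| * enorm y = `|enorm a - enorm y| / enorm a.
  rewrite -{2}(ger0_norm (enorm_ge0 y)) -normrM mulrBl mulVf ?gt_eqF//.
  have -> : 1 - (enorm a)^-1 * enorm y = (enorm a - enorm y) * (enorm a)^-1 by field; rewrite gt_eqF.
  by rewrite normrM [X in _ * X]gtr0_norm ?invr_gt0.
have h : `|enorm a - enorm y| <= enorm (y - a).
  rewrite ler_norml; have := enorm_triB a y; have := enorm_triB y a; rewrite (enormB a y).
  by move=> h1 h2; apply/andP; split; move: h1 h2; lra.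
rewrite mulrC -mulrDl ler_pM2r ?invr_gt0//; move: h; lra.
Qed.

(* |y| - <a/|a|, y> is the defect of a plane wave front at distance |a|. *)
Lemma front_defect a y : 1 <= enorm a -> enorm (y - a) <= 1 -> 0 < enorm y ->
  0 <= enorm y - dot (unitv a) y <= (enorm y)^-1.
Proof.
move=> a1 ya y0; have a0 : 0 < enorm a by apply: lt_le_trans a1.
have ua := unitv_sphere a0; have da := dot_unitv a0.
have cs := cauchy_schwarz (unitv a) y; rewrite ua mul1r in cs.
have cs2 := cauchy_schwarz (unitv a) (y - a); rewrite ua mul1r in cs2.
have dB : dot (unitv a) (y - a) = dot (unitv a) y - enorm a by rewrite dotDr dotNr da.
have dp : 0 <= dot (unitv a) y.
  by move: cs2; rewrite dB ler_norml => /andP[h _]; move: h ya a1; lra.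
have d1 : 0 <= enorm y - dot (unitv a) y by move: cs; rewrite ler_norml subr_ge0 => /andP[].
rewrite d1 /= -(ler_pM2r y0) mulVf ?gt_eqF//.
have E : enorm (y - a) ^+ 2 = enorm y ^+ 2 - 2 * enorm a * dot (unitv a) y + enorm a ^+ 2.
  rewrite !enorm_sqr dotDl !dotDr !dotNl !dotNr opprK (dotC a y).
  have -> : dot y a = enorm a * dot (unitv a) y by rewrite /unitv dotZl mulrA divff ?gt_eqF// mul1r dotC.
  by ring.
have ya2 : enorm (y - a) ^+ 2 <= 1 by rewrite expr_le1// enorm_ge0.
have s := sqr_ge0 (enorm a - dot (unitv a) y).
have m := mulr_ge0 d1 dp.
move: E ya2 s m; move: (enorm (y - a)) (enorm y) (enorm a) (dot (unitv a) y) => p q r t; nra.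
Qed.

Lemma d_scale (F : V -> R) (c b : R) y (w : V) : is_derive (c *: y) w F b -> is_derive y w (fun z => F (c *: z)) (c * b).
Proof.
move=> h; apply/is_derive_line0.
have h0 : is_derive (c * 0 : R) (1 : R) (fun s : R => F (s *: w + c *: y)) b.
  have E : (c * 0 : R) *: w + c *: y = c *: y by rewrite mulr0 scale0r add0r.
  by apply/(@is_derive_line R _ F w (c *: y) (c * 0) b); rewrite E.
have d1 : is_derive (0 : R) (1 : R) (fun s : R => c * s) c.
  by have := dZ c (is_derive_id (0 : R) (1 : R)); rewrite mulr1.
have := dchain h0 d1; rewrite mulrC.
rewrite (_ : (fun s : R => F ((c * s) *: w + c *: y)) = (fun s : R => F (c *: (s *: w + y))))//.
by apply/funext => s; rewrite scalerDr scalerA.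
Qed.

(** By scaling: the bump of radius r is the unit bump at x / r. *)
Lemma cbump_gradient : exists2 C : R, 0 <= C & forall (r : R) y i, 0 < r ->
  normc (cpd i (cbump 0 r) y) <= C / r.
Proof.
have c1 : CkC 1 setT (cbump (0 : V) 1) by exact: cbump_CkC.
have v1 : cvanish_out 2 (cbump (0 : V) 1).
  move=> y hy; rewrite /cbump bump_out ?subr0 ?mulr1//.
  by apply: le_trans (norm_le_enorm y); exact: ltW.
have b i : exists2 B : R, 0 <= B & forall y, normc (cpd i (cbump (0 : V) 1) y) <= B.
  exact: CCc_bounded (CCc_pd i c1 v1).
have [B0 p0 h0] := b 0; have [B1 p1 h1] := b 1; have [B2 p2 h2] := b 2%:R.
exists (B0 + B1 + B2); first by rewrite !addr_ge0.
move=> r y i r0.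
have E : cpd i (cbump 0 r) y = (r^-1)%:C * cpd i (cbump 0 1) (r^-1 *: y).
  apply: cpd_cderive.
  have h := CkC_cderive i c1 (I : setT (r^-1 *: y)).
  have e : cbump (0 : V) r = (fun z => cbump 0 1 (r^-1 *: z)).
    apply/funext => z; rewrite /cbump /bump !subr0 dotZl dotZr expr1n divr1; congr ((step _)%:C).
    by rewrite mulrA -expr2 exprVn mulrC.
  have s1 := d_scale h.1; have s2 := d_scale h.2.
  by rewrite e; split; rewrite ?ReZ ?ImZ; [exact: s1|exact: s2].
rewrite E normcZ ger0_norm ?invr_ge0 ?(ltW r0)// mulrC ler_pM2r ?invr_gt0//.
by move: i {E}; apply: forall3; [apply: le_trans (h0 _) _|apply: le_trans (h1 _) _|apply: le_trans (h2 _) _]; move: p0 p1 p2; lra.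
Qed.

End radial_geometry.

(** * The far field *)

Section far_field.
Variables (R : realType) (k : R).
Hypothesis k0 : 0 < k.
Local Notation V := 'rV[R]_3.
Implicit Types (x y a : V).
Variables (v amp : V -> R[i]) (R0 : R).
Let O : set V := [set y | R0 < enorm y].
Hypothesis mv : mvp k O v.
Hypothesis R00 : 0 <= R0.
Hypothesis asym : forall e : R, 0 < e -> exists rho : R, forall x, rho < enorm x ->
  normc (v x - amp (unitv x) * (expi (k * enorm x) / (enorm x)%:C)) <= e / enorm x.

Lemma out_open : open O.
Proof.
rewrite openE => y /=; have := @enorm_near_gt R 0 y R0; rewrite subr0 => h /h.
by apply: filterS => z; rewrite subr0.
Qed.

Lemma asym_mul (e : R) : 0 < e -> exists2 rho : R, R0 < rho & forall x, rho < enorm x ->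
  normc ((enorm x)%:C * v x - amp (unitv x) * expi (k * enorm x)) <= e.
Proof.
move=> /asym[rho h]; exists (Num.max (R0 + 1) rho); first by rewrite lt_max ltrDl ltr01.
move=> x; rewrite gt_max => /andP[h1 h2]; have x0 : 0 < enorm x by move: h1 R00; lra.
have -> : (enorm x)%:C * v x - amp (unitv x) * expi (k * enorm x) =
    (enorm x)%:C * (v x - amp (unitv x) * (expi (k * enorm x) / (enorm x)%:C)).
  by field; apply: rc_neq0; rewrite gt_eqF.
by rewrite normcZ gtr0_norm// mulrC -ler_pdivlMr//; exact: h.
Qed.

Lemma sphere_compact : compact (@sphere R).
Proof.
apply: bounded_closed_compact.
  exists 1; split; first exact: num_real.
  move=> M M1 x /= x1; apply: ltW; apply: le_lt_trans M1; rewrite -[leRHS](x1 : enorm x = 1); exact: norm_le_enorm.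
have -> : @sphere R = @enorm R @^-1` [set 1] by [].
by apply: closed_comp => [x _|]; [exact: enorm_cont|exact: closed_eq].
Qed.

(** On the sphere the amplitude is, up to a unimodular constant, the uniform limit of s v(s x) as s
    grows, and these functions are continuous; this is where the uniformity of the remainder is
    used. *)
Lemma amp_unif (e : R) : 0 < e -> exists2 d : R, 0 < d & forall x y, sphere x -> sphere y ->
  enorm (y - x) < d -> normc (amp y - amp x) <= e.
Proof.
move=> e0; have e40 : 0 < e / 4 by rewrite divr_gt0.
have [rho rR hr] := asym_mul e40; pose s := rho + 1.
have s0 : 0 < s by rewrite /s; move: rR R00; lra.
pose F (x : V) := s%:C * v (s *: x).
have es x : sphere x -> enorm (s *: x) = s by move=> x1; rewrite enormZ (x1 : enorm x = 1) mulr1 gtr0_norm.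
have cF x : sphere x -> ccontinuous_at x F.
  move=> x1; apply: ccM; first exact: ccC.
  apply: (@cc_comp _ _ _ (fun z : V => s *: z) v); first exact: scaler_continuous.
  by apply: mv.1; rewrite /O /= es// /s; move: rR; lra.
have cF1 x : sphere x -> {for x, continuous (reP F)} by move=> /cF[].
have cF2 x : sphere x -> {for x, continuous (imP F)} by move=> /cF[].
have [d1 d10 h1] := compact_unif_cont sphere_compact cF1 e40.
have [d2 d20 h2] := compact_unif_cont sphere_compact cF2 e40.
exists (Num.min d1 d2); first by rewrite lt_min d10.
move=> x y x1 y1; rewrite lt_min => /andP[l1 l2].
have hF : normc (F y - F x) <= e / 2.
  apply: le_trans (normc_le_ReIm _) _; rewrite ReB ImB.
  have a1 := h1 x y x1 (le_lt_trans (norm_le_enorm _) l1).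
  have a2 := h2 x y x1 (le_lt_trans (norm_le_enorm _) l2).
  by move: a1 a2; rewrite /reP /imP; lra.
have uz z : sphere z -> unitv (s *: z) = z.
  by move=> z1; rewrite /unitv es// scalerA mulVf ?scale1r// gt_eqF.
have hA z : sphere z -> normc (F z - amp z * expi (k * s)) <= e / 4.
  move=> z1; have := hr (s *: z); rewrite es// uz//; apply; rewrite /s; lra.
have -> : normc (amp y - amp x) = normc ((amp y - amp x) * expi (k * s)) by rewrite normcM normc_expi mulr1.
have -> : (amp y - amp x) * expi (k * s) = (F y - F x) - (F y - amp y * expi (k * s)) + (F x - amp x * expi (k * s)) by ring.
apply: le_trans (le_normcD _ _) _; apply: le_trans (lerD (le_normcB _ _) (lexx _)) _.
by move: hF (hA x x1) (hA y y1); lra.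
Qed.

Lemma amp_bound : exists2 B : R, 0 <= B & forall x, sphere x -> normc (amp x) <= B.
Proof.
have [d d0 hd] := amp_unif ltr01.
have [n [p [pS hp]]] := @compact_cover R _ (fun=> d) sphere_compact (fun _ _ => d0).
exists (\sum_(j < n) normc (amp (p j)) + 1); first by rewrite addr_ge0// sumr_ge0// => j _; exact: normc_ge0.
move=> x x1; have [j jn hj] := hp x x1.
have h := hd _ _ (pS j jn) x1 hj.
have -> : amp x = amp (p j) + (amp x - amp (p j)) by rewrite addrC subrK.
apply: le_trans (le_normcD _ _) _; apply: lerD h.
rewrite (bigD1 (Ordinal jn))//= lerDl sumr_ge0// => i _; exact: normc_ge0.
Qed.

Lemma field_bound : exists2 C : R, 0 <= C & exists2 rho : R, R0 < rho & forall x, rho < enorm x -> normc (v x) <= C / enorm x.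
Proof.
have [B B0 hB] := amp_bound; have [rho rR hr] := asym_mul ltr01.
exists (B + 1); first exact: addr_ge0.
exists rho => // x hx; have x0 : 0 < enorm x by move: rR R00 hx; lra.
rewrite ler_pdivlMr// mulrC -[X in X * _](gtr0_norm x0) -normcZ.
rewrite -(subrK (amp (unitv x) * expi (k * enorm x)) (_ * v x)).
apply: le_trans (le_normcD _ _) _; rewrite addrC; apply: lerD; last exact: hr.
by rewrite normcM normc_expi mulr1; apply: hB; exact: unitv_sphere.
Qed.

Lemma plane_mvp (om : V) : sphere om -> mvp k O (plane_wave k om).
Proof.
move=> o1; apply: (@mvp_sub _ _ setT) => //; apply: helmholtz_mvp => //; first exact: openT.
  exact: plane_wave_CkC.
by move=> x _; apply: plane_wave_helmholtz; rewrite -enorm_sqr (o1 : enorm om = 1) expr1n.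
Qed.

Lemma expi_diff (s t : R) : normc (expi s - expi t) <= 2 * `|s - t|.
Proof.
have -> : expi s - expi t = expi t * (expi (s - t) - 1) by rewrite mulrBr mulr1 -expiD (addrC t) subrK.
by rewrite normcM normc_expi mul1r expi_near1.
Qed.

Lemma dot_delta (x : V) i : dot x (delta_mx 0 i) = x 0 i.
Proof. by rewrite dotE !delta_coord; move: i; apply: forall3; rewrite /= ?mulr1 ?mulr0 ?addr0 ?add0r. Qed.

(* In a unit ball far away the scattered field is close to a plane wave. *)
Lemma gradient_radiation (eta : R) : 0 < eta -> exists2 rho : R, R0 < rho & forall a i, rho < enorm a ->
  normc (cpd i v a - 'i * (k * unitv a 0 i)%:C * v a) <= eta / enorm a.
Proof.
move=> eta0; have t0 : 0 < 3^-1 :> R by rewrite invr_gt0.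
have t1 : 3 * 3^-1 = 1 :> R by rewrite divff.
have [C C0 hC] := mvp_gradient k0 t0; rewrite t1 in hC.
have [B B0 hB] := amp_bound; have [Cv Cv0 [r1 r1R hv]] := field_bound.
pose e := eta / (C + 1) / 5.
have C1 : 0 < C + 1 by rewrite ltr_pwDr.
have e0 : 0 < e by rewrite !divr_gt0.
have [d d0 hd] := amp_unif e0; have [r2 r2R hr2] := asym_mul e0.
(* Beyond rho the unit ball about a stays where the asymptotics hold; 2 / d controls the change of
   direction, and the last summand the errors of order 1/|a|. *)
pose rho := r1 + r2 + 2 + 2 / d + (2 * Cv + 4 * k * B) / e.
have p1 : 0 <= 2 / d by rewrite divr_ge0// ltW.
have p2 : 0 <= (2 * Cv + 4 * k * B) / e by apply: divr_ge0 (ltW e0); rewrite addr_ge0// !mulr_ge0// ltW.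
exists rho; first by rewrite /rho; move: R00 r1R r2R p1 p2; lra.
move=> a i ha; have aR : R0 + 2 < enorm a by move: ha; rewrite /rho; move: R00 r1R r2R p1 p2; lra.
have a2 : 2 < enorm a by move: aR R00; lra.
have a0 : 0 < enorm a by move: a2; lra.
have ar1 : r1 + 1 < enorm a by move: ha; rewrite /rho; move: R00 r1R r2R p1 p2; lra.
have ar2 : r2 + 1 < enorm a by move: ha; rewrite /rho; move: R00 r1R r2R p1 p2; lra.
have ad : 2 / enorm a < d.
  rewrite ltr_pdivrMr// mulrC -ltr_pdivrMr//; move: ha; rewrite /rho; move: R00 r1R r2R p1 p2; lra.
have ae : (2 * Cv + 4 * k * B) / enorm a <= e.
  rewrite ler_pdivrMr// [leRHS]mulrC -ler_pdivrMr// ltW//; move: ha; rewrite /rho; move: R00 r1R r2R p1 p2; lra.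
pose om := unitv a; have o1 : sphere om by exact: unitv_sphere.
(* Normalized so that c times the plane wave in the direction of a agrees with v at a. *)
pose c := v a * expi (- (k * enorm a)).
pose f y := v y - c * plane_wave k om y.
have mp : mvp k O (fun y => c * plane_wave k om y) by have h := mvpZ k0 c (plane_mvp o1); exact: h.
have mf : mvp k O f by exact: (mvpB k0 mv mp).
have aO y : enorm (y - a) < 1 -> O y.
  by rewrite /O /= => h; have := enorm_triB a y; rewrite enormB; move: h aR; lra.
have cpa : c * plane_wave k om a = v a.
  by rewrite /c /plane_wave dot_unitv// -mulrA (mulrC (expi _)) expiNK mulr1.
have df : cpd i f a = cpd i v a - 'i * (k * unitv a 0 i)%:C * v a.
  apply: cpd_cderive; rewrite -cpa.
  have -> : 'i * (k * unitv a 0 i)%:C * (c * plane_wave k om a) = c * ('i * (k * dot om (delta_mx 0 i))%:C * plane_wave k om a).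
    by rewrite dot_delta mulrCA.
  apply: cdB; last by apply: cdZ; exact: cderive_plane_wave.
  have Oa : O a by rewrite /O /=; move: aR; lra.
  exact: (mvp_cderive1 k0 _ out_open mv Oa).
rewrite -df.
have fb y : enorm (y - a) < 1 -> normc (f y) <= 5 * e / enorm a.
  move=> ya; have yt : enorm a - 1 < enorm y by have := enorm_triB a y; rewrite enormB; move: ya; lra.
  have yt2 : enorm y < enorm a + 1 by have := enorm_triB y a; move: ya; lra.
  have y0 : 0 < enorm y by move: yt a2; lra.
  have ha2 : enorm a <= 2 * enorm y by move: yt a2; lra.
  rewrite ler_pdivlMr// mulrC -[X in X * _](gtr0_norm a0) -normcZ.
  set s := enorm a; set t := enorm y.
  have ty : normc (t%:C * v y - amp (unitv y) * expi (k * t)) <= e by apply: hr2; rewrite -/t; move: yt ar2; rewrite -/s -/t; lra.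
  have ta : normc (s%:C * v a - amp om * expi (k * s)) <= e by apply: hr2; rewrite -/s; move: ar2; rewrite -/s; lra.
  have vy : normc (v y) <= Cv / t by apply: hv; move: yt ar1; rewrite -/s -/t; lra.
  pose c' := expi (- (k * s)) * plane_wave k om y.
  have nc' : normc c' = 1 by rewrite /c' normcM /plane_wave !normc_expi mulr1.
  have ec' : expi (k * s) * c' = expi (k * dot om y) by rewrite /c' mulrA expiNK mul1r.
  (* Both values of v are replaced by their asymptotics; what remains is the difference of |y| and
     |a|, the variation of the amplitude with the direction, and the phase of the spherical front
     against the plane one. *)
  have -> : s%:C * f y = (t%:C * v y - amp (unitv y) * expi (k * t)) + (s - t)%:C * v y
     - (s%:C * v a - amp om * expi (k * s)) * c'
     + ((amp (unitv y) - amp om) * expi (k * t) + amp om * (expi (k * t) - expi (k * dot om y))).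
    by rewrite -ec' /f /c -/s rcB -[_ * _ * plane_wave _ _ _]mulrA -/c'; ring.
  have b1 : normc ((s - t)%:C * v y) <= 2 * Cv / s.
    rewrite normcZ; apply: le_trans (_ : 1 * (Cv / t) <= _).
      apply: ler_pM => //; first exact: normc_ge0.
      by rewrite ler_norml; apply/andP; split; rewrite /s /t; move: yt yt2; lra.
    rewrite mul1r ler_pdivlMr// mulrAC ler_pdivrMr// -mulrA [leRHS]mulrCA; apply: ler_wpM2l => //.
  have b2 : normc ((s%:C * v a - amp om * expi (k * s)) * c') <= e by rewrite normcM nc' mulr1.
  have b3 : normc ((amp (unitv y) - amp om) * expi (k * t)) <= e.
    rewrite normcM normc_expi mulr1; apply: hd => //; first exact: unitv_sphere.
    apply: le_lt_trans (unitv_near a0 y0) _; apply: le_lt_trans ad.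
    by rewrite ler_pM2r ?invr_gt0// -[leRHS]mulr1 ler_pM2l// ltW.
  have b4 : normc (amp om * (expi (k * t) - expi (k * dot om y))) <= 4 * k * B / s.
    rewrite normcM; apply: le_trans (_ : B * (2 * (k / t)) <= _).
      apply: ler_pM; rewrite ?normc_ge0//; first exact: hB.
      apply: le_trans (expi_diff _ _) _; rewrite ler_pM2l// -mulrBr normrM (gtr0_norm k0) ler_pM2l//.
      have a1 : 1 <= enorm a by move: a2; lra.
      have /andP[q1 q2] := front_defect a1 (ltW ya) y0.
      by rewrite ger0_norm.
    have -> : 4 * k * B / s = B * (2 * (k * (2 / s))) by ring.
    apply: ler_wpM2l => //; rewrite ler_pM2l// ler_pM2l// ler_pdivlMr// mulrC ler_pdivrMr//.
  have eE : 2 * Cv / s + 4 * k * B / s <= e by rewrite -mulrDl.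
  apply: le_trans (le_normcD _ _) _.
  apply: le_trans (lerD (le_normcB _ _) (le_normcD _ _)) _.
  apply: le_trans (lerD (lerD (le_normcD _ _) (lexx _)) (lexx _)) _.
  move: ty b1 b2 b3 b4 eE e0; lra.
apply: le_trans (hC O f a i _ mf aO fb) _.
rewrite mulrA ler_pM2r ?invr_gt0// /e.
have -> : C * (5 * (eta / (C + 1) / 5)) = eta * (C / (C + 1)) by field; rewrite gt_eqF.
by rewrite ler_piMr ?(ltW eta0)// ler_pdivrMr// mul1r lerDl.
Qed.

(** The same first-order radiation relation for the kernel, here explicitly and with the better rate
    1/|y|^2. *)
Lemma kernel_radiation x : exists2 C : R, 0 <= C & forall y i, 2 * enorm x + 2 < enorm y ->
  normc (Gk k 1 x y) <= C / enorm y /\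
  normc (cpd i (Gk k 1 x) y - 'i * (k * unitv y 0 i)%:C * Gk k 1 x y) <= C / enorm y ^+ 2.
Proof.
exists (4 * k * enorm x + 4); first by rewrite addr_ge0// !mulr_ge0// ?enorm_ge0// ltW.
move=> y i hy; have x0 := enorm_ge0 x.
have y0 : 0 < enorm y by move: hy x0; lra.
pose s := enorm (y - x); pose t := enorm y.
have st : t <= 2 * s by rewrite /s /t; have := enorm_triB y x; move: hy x0; lra.
have s1 : 1 <= s by move: st hy x0; rewrite -/t; lra.
have s0 : 0 < s by apply: lt_le_trans s1.
have si : s^-1 <= 2 / t by rewrite ler_pdivlMr// mulrC ler_pdivrMr.
have sE : Num.sqrt (dot (y - x) (y - x)) = s by [].
have e11 : 0 < 1 :> R by [].
rewrite (@cpd_Gk_far R k k0 1 x i y e11 s1) (@Gk_far R k 1 x y e11 s1); rewrite eta0E; rewrite eta1E; last exact: k0.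
rewrite sE.
split.
  rewrite normcM normc_expi mul1r normc_real ger0_norm ?invr_ge0 ?(ltW s0)//.
  apply: le_trans si _; rewrite ler_pM2r ?invr_gt0//; have := mulr_ge0 (ltW k0) x0; lra.
have -> : ((y - x) 0 i)%:C * (expi (k * s) * ('i * k%:C * (s^-1 ^+ 2)%:C - (s^-1 ^+ 3)%:C)) - 'i * (k * unitv y 0 i)%:C * (expi (k * s) * (s^-1)%:C)
   = expi (k * s) * ('i * (k * s^-1 * ((y - x) 0 i * s^-1 - unitv y 0 i))%:C - ((y - x) 0 i * s^-1 ^+ 3)%:C).
  by rewrite !rcM !rcB !rcM; ring.
rewrite normcM normc_expi mul1r; apply: le_trans (le_normcB _ _) _.
rewrite normcM normc_i mul1r !normc_real.
have zs : `|(y - x) 0 i| <= s by exact: coord_le_enorm.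
have D : `|(y - x) 0 i * s^-1 - unitv y 0 i| <= 2 * enorm x / t.
  have -> : (y - x) 0 i * s^-1 - unitv y 0 i = (unitv (y - x) - unitv y) 0 i by rewrite /unitv !mxE mulrC.
  apply: le_trans (coord_le_enorm _ _) _; apply: le_trans (unitv_near y0 s0) _.
  by rewrite addrAC subrr sub0r enormN.
rewrite normrM normrM (gtr0_norm k0) gtr0_norm ?invr_gt0// normrM (gtr0_norm (_ : 0 < s^-1 ^+ 3)) ?exprn_gt0 ?invr_gt0//.
have h1 : k * s^-1 * `|(y - x) 0 i * s^-1 - unitv y 0 i| <= k * (2 / t) * (2 * enorm x / t).
  have ki : 0 <= k * s^-1 by apply: mulr_ge0; [exact: ltW|rewrite invr_ge0 ltW].
  by apply: ler_pM => //; apply: ler_wpM2l => //; exact: ltW.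
have h2 : `|(y - x) 0 i| * s^-1 ^+ 3 <= (2 / t) ^+ 2.
  apply: le_trans (_ : s * s^-1 ^+ 3 <= _); first by rewrite ler_pM2r// exprn_gt0// invr_gt0.
  have -> : s * s^-1 ^+ 3 = s^-1 ^+ 2 by field; rewrite gt_eqF.
  by rewrite lerXn2r// nnegrE; [rewrite invr_ge0 ltW|rewrite divr_ge0// ltW].
apply: le_trans (lerD h1 h2) _; rewrite -/t; apply: le_of_eq; field.
by rewrite gt_eqF.
Qed.

(** What the Helmholtz operator leaves of a large cutoff times the kernel, apart from the delta at
    x. Scale 1 suffices: for large r the derivatives of the cutoff live at distance at least 1 from
    x. *)
Definition farW (r : R) x y : R[i] := 2%:R * (\sum_(i < 3) cpd i (cbump 0 r) y * cpd i (Gk k 1 x) y) +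
  claplacian (cbump 0 r) y * Gk k 1 x y.

(** One integration by parts on the second derivatives of the cutoff turns the pairing into the
    Wronskian of v and the kernel against its gradient, where the leading radiation terms cancel. *)
Lemma far_parts r x : R0 < r -> 0 < r ->
  (forall i, CCc (fun y => (v y * cpd i (Gk k 1 x) y - Gk k 1 x y * cpd i v y) * cpd i (cbump 0 r) y)) /\
  cI (fun y => v y * farW r x y) =
  \sum_(i < 3) cI (fun y => (v y * cpd i (Gk k 1 x) y - Gk k 1 x y * cpd i v y) * cpd i (cbump 0 r) y).
Proof.
move=> rR r0; set G := Gk k 1 x; set Th := cbump 0 r.
have e11 : 0 < 1 :> R by [].
have cG : CkC 2 O G by exact: Gk_CkC out_open e11.
have cG1 : CkC 1 O G := CkC_leq (isT : (1 <= 2)%N) cG.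
have cv n : CkC n O v by exact: (mvp_CkC k0 n out_open mv).
have cT n : (n <= 3)%N -> CkC n setT Th by exact: cbump_CkC.
have cT1 i : CkC 1 setT (cpd i Th) by apply: CkC_pd; exact: cT.
have cT0 i : CkC 0 setT (cpd i Th) := CkC_leq (isT : (0 <= 1)%N) (cT1 i).
have cT2 i : CkC 0 setT (cpd i (cpd i Th)) by apply: CkC_pd.
have nT i : cnear0_off O (cpd i Th).
  move=> y nO; have yr : enorm (y - 0) < r by rewrite subr0; apply: le_lt_trans rR; rewrite leNgt; apply/negP.
  by apply: filterS (enorm_near yr) => z hz; apply: cpd_near_cst (cbump_near1 r0 hz).
have nT2 i : cnear0_off O (cpd i (cpd i Th)) by apply: cnear0_off_pd.
have vT0 : cvanish_out (2 * r) Th.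
  move=> y hy; rewrite /Th /cbump bump_out// subr0; apply: le_trans (norm_le_enorm y); exact: ltW.
have vT i : cvanish_out (2 * r) (cpd i Th) by exact: cvanish_out_pd.
have vT2 i : cvanish_out (2 * r) (cpd i (cpd i Th)) by exact: cvanish_out_pd.
have ci f g : CkC 0 O f -> CkC 0 setT g -> cnear0_off O g -> cvanish_out (2 * r) g -> CCc (fun y => f y * g y).
  move=> cf cg ng vg; have c := CkC_cut out_open cf cg ng.
  by apply: (@CCc_intro _ _ (2 * r)) => [y|y /vg ->]; [exact: CkC_cont c I|rewrite mulr0].
have cvG n : (n <= 1)%N -> CkC n O (fun y => v y * G y).
  by move=> h; apply: CkCM; [exact: out_open|exact: cv|exact: CkC_leq h cG1].
have cdG i : CkC 0 O (cpd i G) by apply: CkC_pd.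
have c1 i : CCc (fun y => (v y * cpd i G y) * cpd i Th y).
  by apply: ci => //; apply: CkCM; [exact: out_open|exact: cv|exact: cdG].
have c2 i : CCc (fun y => (v y * G y) * cpd i (cpd i Th) y) by apply: ci => //; exact: cvG.
have c3 i : CCc (fun y => (v y * cpd i G y - G y * cpd i v y) * cpd i Th y).
  apply: ci => //; rewrite (_ : (fun y => _) = (fun y => v y * cpd i G y + (-1) * (G y * cpd i v y))); last first.
    by apply/funext => y; rewrite mulN1r.
  have cdv : CkC 0 O (cpd i v) by apply: CkC_pd.
  have oO := out_open.
  apply: (CkCD oO); first by apply: (CkCM oO); [exact: cv|exact: cdG].
  apply: (CkCM oO); first exact: (CkC_cst _ _ oO).
  by apply: (CkCM oO); [exact: (CkC_leq (isT : (0 <= 2)%N) cG)|exact: cdv].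
have ibp i : cI (fun y => (v y * G y) * cpd i (cpd i Th) y) = - cI (fun y => cpd i (fun y => v y * G y) y * cpd i Th y).
  by apply: cint_by_parts (vT i) => //; [exact: out_open|exact: cvG].
split=> //; rewrite (_ : (fun y => v y * farW r x y) = (fun y => \sum_(i < 3) (2%:R * ((v y * cpd i G y) * cpd i Th y) + (v y * G y) * cpd i (cpd i Th) y))).
  rewrite cI_sum; last by move=> i; apply: CCcD; [exact: CCcZ|exact: c2].
  apply: eq_bigr => i _; rewrite cID//; last exact: CCcZ.
  rewrite cIZ// ibp.
  have -> : cI (fun y => cpd i (fun y => v y * G y) y * cpd i Th y) = cI (fun y => 2%:R * ((v y * cpd i G y) * cpd i Th y) - (v y * cpd i G y - G y * cpd i v y) * cpd i Th y).
    congr cI; apply/funext => y; have [Oy|nO] := pselect (O y).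
      by rewrite (cpdM i Oy (cv 1%N) cG1); ring.
    by rewrite (nbhs_singleton (nT i y nO)) !mulr0 subrr.
  rewrite cIB//; last exact: CCcZ.
  by rewrite cIZ//; ring.
apply/funext => y; rewrite /farW claplacianE -/G -/Th big_split /= -mulr_sumr mulrDr.
congr (_ + _).
  by rewrite mulrCA; congr (_ * _); rewrite mulr_sumr; apply: eq_bigr => i _; ring.
by rewrite mulr_suml mulr_sumr; apply: eq_bigr => i _; ring.
Qed.

Lemma far_vanish x (eta : R) : 0 < eta -> exists2 r1 : R, R0 < r1 & forall r, r1 < r ->
  normc (cI (fun y => v y * farW r x y)) <= eta.
Proof.
move=> eta0; have [C C0 hC] := @cbump_gradient R.
have [Cv Cv0 [rv rvR hv]] := field_bound.
have [CG CG0 hG] := kernel_radiation x.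
(* 768 is 3 coordinates, times 2 from [cI_bound], times the 2 halves of the Wronskian, times the 4^3
   of the volume (4 r)^3, whose r^3 cancels the decay of the integrand. *)
pose e := eta / (384 * (C + 1) * (CG + 1)) / 2.
have C1 : 0 < C + 1 by rewrite ltr_pwDr.
have CG1 : 0 < CG + 1 by rewrite ltr_pwDr.
have e0 : 0 < e.
  have n0 : (0 : R) < 384%:R by rewrite ltr0n.
  exact: (divr_gt0 (divr_gt0 eta0 (mulr_gt0 (mulr_gt0 n0 C1) CG1)) (ltr0Sn R 1)).
have [rg rgR hg] := gradient_radiation e0.
have x0 := enorm_ge0 x.
exists (rv + rg + 2 * enorm x + 2 + Cv / e).
  have : 0 <= Cv / e by rewrite divr_ge0// ltW.
  by move: rvR rgR R00 x0; lra.
move=> r hr; have ce : 0 <= Cv / e by rewrite divr_ge0// ltW.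
have r0 : 0 < r by move: hr ce rvR rgR R00 x0; lra.
have rR : R0 < r by move: hr ce rvR rgR R00 x0; lra.
have [cH ->] := far_parts x rR r0.
pose B := C / r * (2 * CG * e / r ^+ 2).
have r2 : 0 <= 2 * r by rewrite mulr_ge0// ltW.
have bd i y : normc ((v y * cpd i (Gk k 1 x) y - Gk k 1 x y * cpd i v y) * cpd i (cbump 0 r) y) <= B.
  have B0 : 0 <= B.
    exact: (mulr_ge0 (divr_ge0 C0 (ltW r0)) (divr_ge0 (mulr_ge0 (mulr_ge0 (ler0n R 2) CG0) (ltW e0)) (exprn_ge0 2 (ltW r0)))).
  have [yr|yr] := ltP (enorm (y - 0)) r.
    by rewrite (cpd_near_cst _ (cbump_near1 r0 yr)) mulr0 normc0.
  rewrite subr0 in yr; rewrite normcM mulrC /B; apply: ler_pM; rewrite ?normc_ge0//; first exact: hC.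
  have y0 : 0 < enorm y by apply: lt_le_trans yr.
  set om := 'i * (k * unitv y 0 i)%:C.
  have -> : v y * cpd i (Gk k 1 x) y - Gk k 1 x y * cpd i v y =
     v y * (cpd i (Gk k 1 x) y - om * Gk k 1 x y) - Gk k 1 x y * (cpd i v y - om * v y) by ring.
  have q1 : 2 * enorm x + 2 < enorm y by move: yr hr ce rvR rgR R00; lra.
  have q2 : rg < enorm y by move: yr hr ce rvR rgR R00 x0; lra.
  have q3 : rv < enorm y by move: yr hr ce rvR rgR R00 x0; lra.
  have [g1 g2] := hG y i q1; have g3 := hg y i q2; have g4 := hv y q3.
  have g5 : normc (v y) <= e.
    apply: le_trans g4 _; rewrite ler_pdivrMr// [leRHS]mulrC -ler_pdivrMr// ltW//.
    by move: yr hr rvR rgR R00 x0; lra.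
  have i2 : (enorm y ^+ 2)^-1 <= (r ^+ 2)^-1.
    by rewrite lef_pV2 ?posrE ?exprn_gt0// lerXn2r ?nnegrE ?(ltW r0) ?(ltW y0).
  have h1 : normc (v y * (cpd i (Gk k 1 x) y - om * Gk k 1 x y)) <= e * (CG / r ^+ 2).
    rewrite normcM; apply: ler_pM; rewrite ?normc_ge0//; apply: le_trans g2 _; exact: ler_wpM2l.
  have h2 : normc (Gk k 1 x y * (cpd i v y - om * v y)) <= e * (CG / r ^+ 2).
    rewrite normcM; apply: le_trans (ler_pM (normc_ge0 _) (normc_ge0 _) g1 g3) _.
    have -> : CG / enorm y * (e / enorm y) = e * (CG * (enorm y ^+ 2)^-1) by field; rewrite gt_eqF.
    by apply: ler_wpM2l; [exact: ltW|exact: ler_wpM2l].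
  apply: le_trans (le_normcB _ _) _; apply: le_trans (lerD h1 h2) _.
  by apply: le_of_eq; ring.
have vT i : cvanish_out (2 * r) (fun y => (v y * cpd i (Gk k 1 x) y - Gk k 1 x y * cpd i v y) * cpd i (cbump 0 r) y).
  move=> y hy; rewrite (cvanish_out_pd (f := cbump 0 r) (M := 2 * r) i _ hy) ?mulr0//.
  move=> z hz; rewrite /cbump bump_out// subr0; apply: le_trans (norm_le_enorm z); exact: ltW.
apply: le_trans (le_normc_sum _ _ _) _.
apply: le_trans (_ : \sum_(i < 3) 2 * B * (2 * (2 * r)) ^+ 3 <= _).
  by apply: ler_sum => i _; exact: cI_bound r2 (cH i) (vT i) (bd i).
rewrite sumr_const card_ord /B.
have -> : 2 * (C / r * (2 * CG * e / r ^+ 2)) * (2 * (2 * r)) ^+ 3 *+ 3 = eta * ((C / (C + 1)) * (CG / (CG + 1))).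
  by rewrite -mulr_natl /e; field; rewrite !gt_eqF.
rewrite ler_piMr ?(ltW eta0)// mulr_ile1 ?divr_ge0 ?(ltW C1) ?(ltW CG1)//.
- by rewrite ler_pdivrMr// mul1r lerDl.
- by rewrite ler_pdivrMr// mul1r lerDl.
Qed.

End far_field.

(** * Locality of smoothness and of the Laplacian *)

Section local_equalities.
Variable R : realType.
Local Notation V := 'rV[R]_3.

Lemma Ck_union n (O1 O2 : set V) (f : V -> R) : Ck n O1 f -> Ck n O2 f -> Ck n (O1 `|` O2) f.
Proof.
elim: n f => [|n IH] f [c1 h1] [c2 h2]; split => //; try by move=> x [/c1|/c2].
move=> i; have [d1 p1] := h1 i; have [d2 p2] := h2 i; split; last exact: IH.
by move=> x [/d1|/d2].
Qed.

Lemma claplacian_eq (O : set V) (f g : V -> R[i]) x : open O -> O x -> CkC 2 O f -> (forall y, O y -> f y = g y) ->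
  claplacian g x = claplacian f x.
Proof.
move=> oO Ox cf fg.
have H (f1 g1 : V -> R[i]) i y : CkC 1 O f1 -> (forall y, O y -> f1 y = g1 y) -> O y -> cpd i g1 y = cpd i f1 y.
  move=> c1 e1 Oy; apply: cpd_cderive; apply: cd_near (CkC_cderive i c1 Oy).
  by apply: filterS (open_nbhs_nbhs (conj oO Oy)) => z /e1.
rewrite !claplacianE; apply: eq_bigr => i _; apply: (H (cpd i f) (cpd i g)) => //; first exact: CkC_pd.
by move=> y Oy; apply/esym; exact: (H f g i y (CkC_leq (isT : (1 <= 2)%N) cf) fg Oy).
Qed.

End local_equalities.

(** * The source distribution on the surface *)

Section pairing.
Variables (R : realType) (k : R).
Hypothesis k0 : 0 < k.
Local Notation V := 'rV[R]_3.
Variable U : V -> R[i].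
Hypothesis cU : forall x, ccontinuous_at x U.
Implicit Types (phi psi : V -> R[i]) (e M : R) (x y w : V).

(* The distribution (Delta + k^2) U, which lives on the surface when [U] solves
   the Dirichlet problem, tested on the localized fundamental solution. *)
Definition dualT phi e x : R[i] :=
  cI (fun y => U y * (claplacian (fun y => phi y * Gk k e x y) y + (k ^+ 2)%:C * (phi y * Gk k e x y))).

Definition cutoff2 M phi := CkC 2 setT phi /\ cvanish_out M phi.

Let CCcU psi M : (forall x, ccontinuous_at x psi) -> cvanish_out M psi -> CCc (fun y => U y * psi y).
Proof.
move=> c v; apply: (@CCc_intro _ _ M) => [y|y /v ->]; [exact: ccM|by rewrite mulr0].
Qed.

Lemma dual_cont phi M e x : 0 < e -> cutoff2 M phi ->
  CCc (fun y => U y * (claplacian (fun y => phi y * Gk k e x y) y + (k ^+ 2)%:C * (phi y * Gk k e x y))).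
Proof.
move=> e0 [cp vp].
have cG : CkC 2 setT (fun y => phi y * Gk k e x y) by exact: (CkCM openT cp (Gk_CkC k0 x openT e0)).
have vG : cvanish_out M (fun y => phi y * Gk k e x y) by move=> y /vp ->; rewrite mul0r.
apply: (@CCcU _ M) => y.
  apply: ccD; last by apply: ccM; [exact: ccC|exact: CkC_cont cG I].
  rewrite (_ : claplacian _ = (fun y => \sum_(i < 3) cpd i (cpd i (fun y => phi y * Gk k e x y)) y)).
    by apply: cc_sum => i; exact: CkC_cont (CkC_pd i (CkC_pd i cG)) I.
  by apply/funext => z; rewrite claplacianE.
move=> hy; rewrite (vG _ hy) mulr0 addr0 claplacianE big1// => i _.
exact: (cvanish_out_pd i (cvanish_out_pd i vG)).
Qed.

Lemma dualD phi psi M e x (c : R[i]) : 0 < e -> cutoff2 M phi -> cutoff2 M psi ->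
  dualT (fun y => phi y + c * psi y) e x = dualT phi e x + c * dualT psi e x.
Proof.
move=> e0 cp cs; have c1 := dual_cont x e0 cp; have c2 := dual_cont x e0 cs.
rewrite /dualT -(cIZ c c2) -(cID c1 (CCcZ c c2)); congr cI; apply/funext => y.
have g1 : CkC 2 setT (fun y => phi y * Gk k e x y) by exact: (CkCM openT cp.1 (Gk_CkC k0 x openT e0)).
have g2 : CkC 2 setT (fun y => psi y * Gk k e x y) by exact: (CkCM openT cs.1 (Gk_CkC k0 x openT e0)).
rewrite (_ : (fun y => (phi y + c * psi y) * Gk k e x y) = (fun y => phi y * Gk k e x y + c * (psi y * Gk k e x y))).
  rewrite (claplacianDZ c y g1 g2).
  have Gen (u a b c' k2 p q g : R[i]) : u * (a + c' * b + k2 * ((p + c' * q) * g)) = u * (a + k2 * (p * g)) + c' * (u * (b + k2 * (q * g))) by ring.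
  exact: Gen.
by apply/funext => z; ring.
Qed.

(** Leibniz's rule with the second derivatives of the kernel collected in [Kk]: [U] is never
    differentiated, and each of the five terms is a potential covered by [potential_bound]. *)
Lemma dual_expand phi M e x : 0 < e -> cutoff2 M phi ->
  [/\ CCc (fun y => U y * phi y), forall i, CCc (fun y => U y * cpd i phi y), CCc (fun y => U y * claplacian phi y) &
  dualT phi e x = cI (fun y => U y * phi y * Kk k e x y) +
    (\sum_(i < 3) 2%:R * cI (fun y => U y * cpd i phi y * cpd i (Gk k e x) y) +
    cI (fun y => U y * claplacian phi y * Gk k e x y))].
Proof.
move=> e0 [cp vp].
have vi i : cvanish_out M (cpd i phi) by exact: cvanish_out_pd.
have vl : cvanish_out M (claplacian phi).
  move=> y hy; rewrite claplacianE big1// => i _; exact: (cvanish_out_pd i (vi i)).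
have cl y : ccontinuous_at y (claplacian phi).
  rewrite (_ : claplacian _ = (fun y => \sum_(i < 3) cpd i (cpd i phi) y)).
    by apply: cc_sum => i; exact: CkC_cont (CkC_pd i (CkC_pd i cp)) I.
  by apply/funext => z; rewrite claplacianE.
have C0 : CCc (fun y => U y * phi y) by apply: CCcU vp => y; exact: CkC_cont cp I.
have C1 i : CCc (fun y => U y * cpd i phi y) by apply: CCcU (vi i) => y; exact: CkC_cont (CkC_pd i cp) I.
have C2 : CCc (fun y => U y * claplacian phi y) by exact: CCcU vl.
split => //.
have cG : CkC 2 setT (Gk k e x) by exact: (Gk_CkC k0 x openT e0).
have D0 : CCc (fun y => U y * phi y * Kk k e x y) by apply: (CCcMr C0) => y; exact: Kk_cont.
have D1 i : CCc (fun y => U y * cpd i phi y * cpd i (Gk k e x) y).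
  by apply: (CCcMr (C1 i)) => y; exact: CkC_cont (CkC_pd i cG) I.
have D2 : CCc (fun y => U y * claplacian phi y * Gk k e x y) by apply: (CCcMr C2) => y; exact: CkC_cont cG I.
have E1 : \sum_(i < 3) 2%:R * cI (fun y => U y * cpd i phi y * cpd i (Gk k e x) y) =
    cI (fun y => \sum_(i < 3) 2%:R * (U y * cpd i phi y * cpd i (Gk k e x) y)).
  rewrite cI_sum => [|i]; last exact: CCcZ.
  by apply: eq_bigr => i _; rewrite cIZ.
have D3 : CCc (fun y => \sum_(i < 3) 2%:R * (U y * cpd i phi y * cpd i (Gk k e x) y)).
  by apply: CCc_sum => i; exact: CCcZ.
rewrite E1 -(cID D3 D2) -(cID D0 (CCcD D3 D2)) /dualT; congr cI; apply/funext => y.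
rewrite (claplacianM openT I cp cG) -(claplacian_Gk k0 x y e0).
have -> : \sum_(i < 3) 2%:R * (U y * cpd i phi y * cpd i (Gk k e x) y) = U y * (2%:R * \sum_(i < 3) cpd i phi y * cpd i (Gk k e x) y).
  by rewrite !mulr_sumr; apply: eq_bigr => i _; ring.
have Gen (u a b c' g l k2 : R[i]) : u * (a * g + 2%:R * b + c' * l + k2 * (c' * g)) = u * c' * (l + k2 * g) + (u * (2%:R * b) + u * a * g) by ring.
exact: Gen.
Qed.

(** 8 = 1 + 2 + 2 + 2 + 1, the total weight of the terms of [dual_expand]. *)
Lemma five_bound (W X : R) (a0 a1 a2 a3 a4 b0 b1 b2 b3 b4 : R[i]) : 0 <= W ->
  W * normc (a0 - b0) <= X -> W * normc (a1 - b1) <= X -> W * normc (a2 - b2) <= X ->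
  W * normc (a3 - b3) <= X -> W * normc (a4 - b4) <= X ->
  W * normc ((a0 + (2%:R * a1 + 2%:R * a2 + 2%:R * a3 + a4)) - (b0 + (2%:R * b1 + 2%:R * b2 + 2%:R * b3 + b4))) <= 8 * X.
Proof.
move=> W0 h0 h1 h2 h3 h4.
have -> : (a0 + (2%:R * a1 + 2%:R * a2 + 2%:R * a3 + a4)) - (b0 + (2%:R * b1 + 2%:R * b2 + 2%:R * b3 + b4)) =
  (a0 - b0) + (2%:C * (a1 - b1) + 2%:C * (a2 - b2) + 2%:C * (a3 - b3) + (a4 - b4)) by rewrite rc_nat; ring.
have n2 (z : R[i]) : normc (2%:C * z) = 2 * normc z by rewrite normcZ ger0_norm.
have B : normc ((a0 - b0) + (2%:C * (a1 - b1) + 2%:C * (a2 - b2) + 2%:C * (a3 - b3) + (a4 - b4))) <=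
    normc (a0 - b0) + (2 * normc (a1 - b1) + 2 * normc (a2 - b2) + 2 * normc (a3 - b3) + normc (a4 - b4)).
  apply: le_trans (le_normcD _ _) _; apply: lerD => //.
  apply: le_trans (le_normcD _ _) _; apply: lerD => //.
  apply: le_trans (le_normcD _ _) _; rewrite n2; apply: lerD => //.
  by apply: le_trans (le_normcD _ _) _; rewrite !n2.
apply: le_trans (ler_wpM2l W0 B) _.
move: h0 h1 h2 h3 h4; move: (normc _) (normc _) (normc _) (normc _) (normc _) => n0 n1 n2' n3 n4.
by rewrite !mulrDr ![W * (2 * _)]mulrCA; lra.
Qed.

Lemma kernel_shift (f : V -> R[i]) (N N' : V -> R[i]) w : CCc (fun y => f y * N' y) ->
  (forall y, N' (y - w) = N y) -> cI (fun y => f y * N' y) = cI (fun y => f (y - w) * N y).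
Proof.
move=> c h; rewrite -(cI_translation (- w) c); congr cI; apply/funext => y; by rewrite h.
Qed.

(** Displacing x amounts to displacing the densities, which are uniformly continuous; a small change
    of density is a small potential in the weighted norm, uniformly in x and in e. *)
Lemma dual_shift phi M (eta : R) : 0 <= M -> cutoff2 M phi -> 0 < eta -> exists2 d : R, 0 < d & forall w x e,
  enorm w < d -> 0 < e -> e <= 1 -> (1 + enorm x) * normc (dualT phi e (x - w) - dualT phi e x) <= eta.
Proof.
move=> M0 cp eta0.
have M10 : 0 < M + 1 by rewrite ltr_wpDl.
have [C C0 hC] := potential_bound k0 M10.
have [C1 C2 C3 _] := dual_expand 0 ltr01 cp.
pose om := eta / (8 * (C + 1)).
have Cp : 0 < C + 1 by rewrite ltr_wpDl.
have om0 : 0 < om by rewrite divr_gt0// mulr_gt0.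
have [d0 p0 h0] := CCc_unif C1 om0.
have [d1 p1 h1] := CCc_unif (C2 0) om0.
have [d2 p2 h2] := CCc_unif (C2 1) om0.
have [d3 p3 h3] := CCc_unif (C2 2%:R) om0.
have [d4 p4 h4] := CCc_unif C3 om0.
exists (Num.min 1 (Num.min d0 (Num.min d1 (Num.min d2 (Num.min d3 d4))))).
  by rewrite !lt_min ltr01 p0 p1 p2 p3 p4.
move=> w x e; rewrite !lt_min => /and5P[w1 w0 wd1 wd2 /andP[wd3 wd4]] e0 e1.
have wx : 0 < 1 + enorm x by rewrite ltr_pwDl// enorm_ge0.
have [vp0 vp1] : cvanish_out M phi /\ (forall i, cvanish_out M (cpd i phi)).
  by split => [|i]; [exact: cp.2|exact: (cvanish_out_pd i cp.2)].
have vl : cvanish_out M (claplacian phi).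
  move=> y hy; rewrite claplacianE big1// => i _; exact: (cvanish_out_pd i (vp1 i)).
have cG z : CkC 2 setT (Gk k e z) by exact: (Gk_CkC k0 z openT e0).
have one (a N N' : V -> R[i]) : CCc a -> cvanish_out M a ->
    (forall y z, `|z - y| < enorm w + 0 \/ `|z - y| <= enorm w -> normc (a z - a y) <= om) ->
    (forall y, ccontinuous_at y N) -> (forall y, ccontinuous_at y N') -> (forall y, N' (y - w) = N y) ->
    (forall f : V -> R[i], CCc f -> cvanish_out (M + 1) f -> (forall y, normc (f y) <= om) ->
       (1 + enorm x) * normc (cI (fun y => f y * N y)) <= C * om) ->
    (1 + enorm x) * normc (cI (fun y => a y * N' y) - cI (fun y => a y * N y)) <= C * om.
  move=> ca va ua cN cN' sh bd.
  rewrite (kernel_shift (CCcMr ca cN') sh).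
  have cs : CCc (fun y => a (y - w)) by exact: CCc_shift.
  rewrite -(cIB (CCcMr cs cN) (CCcMr ca cN)).
  rewrite (_ : (fun y => _) = (fun y => (a (y - w) - a y) * N y)); last by apply/funext => y; rewrite mulrBl.
  apply: bd; first exact: CCcB.
    move=> y hy; rewrite !va ?subrr//; first by apply: lt_trans hy; rewrite ltrDl.
    have := ler_normB (y - w) (- w); rewrite opprK subrK normrN.
    have := norm_le_enorm w; move: w1 hy; lra.
  move=> y; apply: ua; right; rewrite addrAC subrr sub0r normrN; exact: norm_le_enorm.
have uni (a : V -> R[i]) (dd : R) : enorm w < dd -> (forall y z, `|z - y| < dd -> normc (a z - a y) <= om) ->
    forall y z, `|z - y| < enorm w + 0 \/ `|z - y| <= enorm w -> normc (a z - a y) <= om.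
  by move=> wd h y z [hz|hz]; apply: h; apply: le_lt_trans wd; rewrite ?addr0 in hz *; [exact: ltW|].
have shG y : Gk k e (x - w) (y - w) = Gk k e x y by rewrite /Gk opprB addrA subrK.
have shK y : Kk k e (x - w) (y - w) = Kk k e x y by rewrite /Kk opprB addrA subrK.
have shd i y : cpd i (Gk k e (x - w)) (y - w) = cpd i (Gk k e x) y.
  by rewrite !cpd_Gk// opprB addrA subrK.
have [_ _ _ E1] := dual_expand (x - w) e0 cp; have [_ _ _ E2] := dual_expand x e0 cp.
have vU (g : V -> R[i]) : cvanish_out M g -> cvanish_out M (fun y => U y * g y) by move=> vg y /vg ->; rewrite mulr0.
have cK z y : ccontinuous_at y (Kk k e z) by exact: Kk_cont.
have cGz z y : ccontinuous_at y (Gk k e z) by exact: CkC_cont (cG z) I.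
have cGi i z y : ccontinuous_at y (cpd i (Gk k e z)) by exact: CkC_cont (CkC_pd i (cG z)) I.
have b0 := one _ _ _ C1 (vU _ vp0) (uni _ _ w0 h0) (cK x) (cK (x - w)) shK
  (fun f cf vf bf => let: And3 _ _ h := hC f om x e e0 e1 cf vf bf in h).
have b1 := one _ _ _ (C2 0) (vU _ (vp1 0)) (uni _ _ wd1 h1) (cGi 0 x) (cGi 0 (x - w)) (shd 0)
  (fun f cf vf bf => let: And3 _ h _ := hC f om x e e0 e1 cf vf bf in h 0).
have b2 := one _ _ _ (C2 1) (vU _ (vp1 1)) (uni _ _ wd2 h2) (cGi 1 x) (cGi 1 (x - w)) (shd 1)
  (fun f cf vf bf => let: And3 _ h _ := hC f om x e e0 e1 cf vf bf in h 1).
have b3 := one _ _ _ (C2 2%:R) (vU _ (vp1 2%:R)) (uni _ _ wd3 h3) (cGi 2%:R x) (cGi 2%:R (x - w)) (shd 2%:R)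
  (fun f cf vf bf => let: And3 _ h _ := hC f om x e e0 e1 cf vf bf in h 2%:R).
have b4 := one _ _ _ C3 (vU _ vl) (uni _ _ wd4 h4) (cGz x) (cGz (x - w)) shG
  (fun f cf vf bf => let: And3 h _ _ := hC f om x e e0 e1 cf vf bf in h).
have Com : 8 * (C * om) <= eta.
  have -> : 8 * (C * om) = eta * (C / (C + 1)) by rewrite /om; field; rewrite gt_eqF.
  by rewrite ler_piMr ?(ltW eta0)// ler_pdivrMr// mul1r lerDl.
rewrite sum3 in E1; rewrite sum3 in E2.
rewrite E1 E2; apply: le_trans Com.
exact: (five_bound (ltW wx) b0 b1 b2 b3 b4).
Qed.

End pairing.

(** * The scattering problem *)

Section scattering_problem.
Variables (R : realType) (D : set 'rV[R]_3) (rho k : R) (alpha : 'rV[R]_3)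
  (A : 'rV[R]_3 -> 'rV[R]_3 -> R[i]) (u : 'rV[R]_3 -> R[i]).
Local Notation V := 'rV[R]_3.
Hypotheses (oD : open D) (D_bounded : D `<=` [set x | enorm x <= rho]) (k0 : 0 < k)
  (alpha1 : sphere alpha) (usol : scattering_solution D k alpha A u).
Implicit Types (x y w : V).
Local Notation S := (boundary D).
Local Notation pw := (plane_wave k alpha).

Definition ext0 x : R[i] := if `[< D x >] then 0 else u x.
Local Notation U := ext0.

Lemma ext0_in x : D x -> U x = 0.
Proof. by rewrite /ext0; case: asboolP. Qed.

Lemma ext0_out x : ~ D x -> U x = u x.
Proof. by rewrite /ext0; case: asboolP. Qed.

(** The Dirichlet condition is what makes the extension by 0 continuous across the surface. *)
Lemma glue_boundary (g : V -> R) x : {within ~` D, continuous g} -> boundary D x -> g x = 0 ->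
  {for x, continuous (fun y => if `[< D y >] then 0 else g y)}.
Proof.
move=> cg bx gx; have nD : ~ D x by move: bx; rewrite boundaryE// => -[].
apply: cont_eps => e e0; case: asboolP => // _; rewrite gx.
have := (subspace_continuousP (~` D) g).1 cg x nD; rewrite gx => /cvgrPdist_le/(_ e e0).
rewrite near_withinE => /enorm_ball[d d0 hd].
exists (d / 2); first by rewrite divr_gt0.
move=> y hy; rewrite subr0; case: asboolP => [_|nDy]; first by rewrite normr0 ltW.
have := hd y; rewrite /= sub0r normrN; apply => //.
by apply: le_lt_trans (enorm_le_norm _) _; move: hy; rewrite ltr_pdivlMr// mulrC.
Qed.

Lemma ext0_cont x : ccontinuous_at x U.
Proof.
have [s1 [s2 [c1 [c2 [_ [b0 _]]]]]] := usol.
have [Dx|nD] := pselect (D x).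
  apply: (@cc_near _ (fun=> 0)); last exact: ccC.
  by apply: filterS (open_nbhs_nbhs (conj oD Dx)) => y Dy; rewrite ext0_in.
have [bx|ex] := exterior_or_boundary oD nD.
  split.
  - rewrite (_ : reP U = (fun y => if `[< D y >] then 0 else reP u y)).
      by apply: glue_boundary => //; rewrite /reP b0.
    by apply/funext => y; rewrite /reP /ext0; case: asboolP.
  - rewrite (_ : imP U = (fun y => if `[< D y >] then 0 else imP u y)).
      by apply: glue_boundary => //; rewrite /imP b0.
    by apply/funext => y; rewrite /imP /ext0; case: asboolP.
apply: (@cc_near _ u); last by split; [exact: Ck_cont s1 ex|exact: Ck_cont s2 ex].
have oe : open (~` D)° by exact: open_interior.
by apply: filterS (open_nbhs_nbhs (conj oe ex)) => y /interior_subset h; rewrite ext0_out.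
Qed.

Lemma off_boundary : ~` S = D `|` (~` D)°.
Proof.
apply/seteqP; split => x /=.
  move=> nb; have [Dx|nD] := pselect (D x); [by left|right].
  by have [] := exterior_or_boundary oD nD.
rewrite boundaryE// => -[Dx [_ nD]|ex [cx _]]; first exact: nD.
by move: ex; rewrite interiorC; apply.
Qed.

Lemma boundary_open : open (~` S).
Proof. by apply: closed_openC; exact: boundary_closed. Qed.

Lemma u_CkC : CkC 2 (~` D)° u.
Proof. by have [s1 [s2 _]] := usol. Qed.

Lemma ext0_CkC : CkC 2 (~` S) U.
Proof.
have cD : CkC 2 D U.
  by apply: (CkC_eq oD _ (CkC_cst 2 0 oD)) => x Dx; rewrite ext0_in.
have cE : CkC 2 (~` D)° U.
  apply: (CkC_eq (open_interior _) _ u_CkC) => x /interior_subset h; by rewrite ext0_out.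
by rewrite off_boundary; split; apply: Ck_union; [exact: cD.1|exact: cE.1|exact: cD.2|exact: cE.2].
Qed.

Lemma ext0_helmholtz x : (~` S) x -> claplacian U x + (k ^+ 2)%:C * U x = 0.
Proof.
rewrite off_boundary => -[Dx|ex].
  rewrite ext0_in// mulr0 addr0; apply: (@claplacian_near_cst _ _ _ 0).
  by apply: filterS (open_nbhs_nbhs (conj oD Dx)) => y; exact: ext0_in.
have [_ [_ [_ [_ [h _]]]]] := usol.
rewrite (claplacian_eq (open_interior _) ex u_CkC) ?ext0_out ?h//; first exact: interior_subset ex.
by move=> y /interior_subset hy; rewrite ext0_out.
Qed.

Lemma far_exterior x : `|rho| < enorm x -> (~` D)° x.
Proof.
move=> hx; have h : `|rho| < enorm (x - 0) by rewrite subr0.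
apply: filterS (enorm_near_gt h) => y; rewrite subr0 => hy /D_bounded /= yD.
by move: hy; rewrite ltNge (le_trans yD)// ler_norm.
Qed.

Lemma scattered_mvp : mvp k (~` D)° (fun x => u x - pw x).
Proof.
have [_ [_ [_ [_ [h _]]]]] := usol.
have oe : open (~` D)° by exact: open_interior.
apply: (mvpB k0); first by apply: (helmholtz_mvp k0 oe u_CkC).
apply: (helmholtz_mvp k0 oe); first by apply: CkC_sub (plane_wave_CkC k alpha 2).
by move=> x _; apply: plane_wave_helmholtz; rewrite -enorm_sqr (alpha1 : enorm alpha = 1) expr1n.
Qed.

Lemma scattered_asymptotics (e : R) : 0 < e -> exists r : R, forall x, r < enorm x ->
  normc (u x - pw x - A (unitv x) alpha * (expi (k * enorm x) / (enorm x)%:C)) <= e / enorm x.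
Proof.
have [_ [_ [_ [_ [_ [_ h]]]]]] := usol; move=> /h[r hr]; exists r => x /hr.
by rewrite opprD addrA.
Qed.

(** The difference of the two cutoffs vanishes near S, and off S the extended field solves the
    equation: the distribution is carried by S. *)
Lemma dual_local phi psi M e x : 0 < e -> cutoff2 M phi -> cutoff2 M psi ->
  (forall y, S y -> \near y, phi y = psi y) -> dualT k U phi e x = dualT k U psi e x.
Proof.
move=> e0 cp cs eqn; have H := dualD k0 ext0_cont x (-1) e0 cp cs.
have Z : dualT k U (fun y => phi y + -1 * psi y) e x = 0.
  apply: (@cgreen _ k (~` S) U (fun y => (phi y + -1 * psi y) * Gk k e x y) M boundary_open ext0_CkC ext0_helmholtz).
  - apply: (CkCM openT); last exact: (Gk_CkC k0 x openT e0).
    by apply: (CkCD openT cp.1); apply: (CkCM openT (CkC_cst 2 (-1) openT) cs.1).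
  - move=> y /contrapT /eqn; apply: filterS => z ->; by rewrite mulN1r subrr mul0r.
  - by move=> y hy; rewrite (cp.2 y hy) (cs.2 y hy) mulr0 addr0 mul0r.
by apply/eqP; rewrite -subr_eq0; move: H; rewrite Z mulN1r => <-.
Qed.

Section large_cutoff.
Variables (x : V) (r : R).
Hypothesis xr : enorm x + 2 < r.
Local Notation Th := (cbump (0 : V) r).
Let r0 : 0 < r. Proof. by move: xr; have := enorm_ge0 x; lra. Qed.

Lemma large_cutoff2 : cutoff2 (2 * r) Th.
Proof.
split; first exact: cbump_CkC.
move=> y hy; rewrite /cbump bump_out// subr0; apply: le_trans (norm_le_enorm y); exact: ltW.
Qed.

Lemma large_cutoff_in y : enorm y < r -> \near y, Th y = 1.
Proof. by move=> yr; apply: cbump_near1; rewrite ?subr0. Qed.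

Lemma farW_in y : enorm y < r -> farW k r x y = 0.
Proof.
move=> yr; have h := large_cutoff_in yr.
rewrite /farW (claplacian_near_cst h) mul0r addr0 big1 ?mulr0// => i _.
by rewrite (cpd_near_cst i h) mul0r.
Qed.

(** The large cutoff is 1 near x, and where it varies the kernels at scales e <= 1 and 1 coincide;
    so e survives in the [Kk] term only. *)
Lemma dual_large (F : V -> R[i]) e : (forall y, ccontinuous_at y F) -> 0 < e -> e <= 1 ->
  [/\ CCc (fun y => F y * farW k r x y) &
  dualT k F Th e x = cI (fun y => F y * Kk k e x y) + cI (fun y => F y * farW k r x y)].
Proof.
move=> cF e0 e1; have [C0 C1 C2 ->] := dual_expand k0 cF x e0 large_cutoff2.
have cG : CkC 2 setT (Gk k 1 x) by exact: (Gk_CkC k0 x openT ltr01).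
have E0 : (fun y => F y * Th y * Kk k e x y) = (fun y => F y * Kk k e x y).
  apply/funext => y; have [yr|yr] := ltP (enorm y) r.
    by rewrite (nbhs_singleton (large_cutoff_in yr)) mulr1.
  rewrite Kk_out ?mulr0//; have := enorm_triB y x; move: xr yr e1; have := enorm_ge0 x; lra.
have far y : r <= enorm y -> 1 <= enorm (y - x).
  by move=> yr; have := enorm_triB y x; move: xr yr; have := enorm_ge0 x; lra.
have E1 i : (fun y => F y * cpd i Th y * cpd i (Gk k e x) y) = (fun y => F y * cpd i Th y * cpd i (Gk k 1 x) y).
  apply/funext => y; have [yr|yr] := ltP (enorm y) r.
    by rewrite (cpd_near_cst i (large_cutoff_in yr)) mulr0 !mul0r.
  have f1 := far y yr; rewrite (cpd_Gk_far k0 i e0 (le_trans e1 f1)).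
  by rewrite (cpd_Gk_far k0 i ltr01 f1).
have E2 : (fun y => F y * claplacian Th y * Gk k e x y) = (fun y => F y * claplacian Th y * Gk k 1 x y).
  apply/funext => y; have [yr|yr] := ltP (enorm y) r.
    by rewrite (claplacian_near_cst (large_cutoff_in yr)) mulr0 !mul0r.
  have f1 := far y yr; rewrite (Gk_far k e0 (le_trans e1 f1)).
  by rewrite (Gk_far k ltr01 f1).
have D1 i : CCc (fun y => F y * cpd i Th y * cpd i (Gk k 1 x) y).
  by apply: (CCcMr (C1 i)) => y; exact: CkC_cont (CkC_pd i cG) I.
have D2 : CCc (fun y => F y * claplacian Th y * Gk k 1 x y) by apply: (CCcMr C2) => y; exact: CkC_cont cG I.
have D3 : CCc (fun y => \sum_(i < 3) 2%:R * (F y * cpd i Th y * cpd i (Gk k 1 x) y)).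
  by apply: CCc_sum => i; exact: CCcZ.
have EW : (fun y => F y * farW k r x y) = (fun y => \sum_(i < 3) 2%:R * (F y * cpd i Th y * cpd i (Gk k 1 x) y) + F y * claplacian Th y * Gk k 1 x y).
  apply/funext => y; rewrite /farW mulrDr; congr (_ + _); last by rewrite mulrA.
  by rewrite mulrA mulr_sumr; apply: eq_bigr => i _; ring.
split; first by rewrite EW; exact: CCcD.
rewrite E0 E2; congr (_ + _); rewrite EW (cID D3 D2); congr (_ + _).
rewrite cI_sum => [|i]; last exact: CCcZ.
by apply: eq_bigr => i _; rewrite E1 cIZ.
Qed.

Lemma dual_plane e : 0 < e -> dualT k pw Th e x = 0.
Proof.
move=> e0; apply: (@cgreen _ k setT pw (fun y => Th y * Gk k e x y) (2 * r) openT).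
- exact: plane_wave_CkC.
- by move=> y _; apply: plane_wave_helmholtz; rewrite -enorm_sqr (alpha1 : enorm alpha = 1) expr1n.
- apply: (CkCM openT); [exact: large_cutoff2.1|exact: (Gk_CkC k0 x openT e0)].
- by move=> y /(_ I).
- by move=> y /large_cutoff2.2 ->; rewrite mul0r.
Qed.

End large_cutoff.

(* The regularized duals converge to the scattered field: the source at x
   contributes its value, and the sphere at infinity contributes nothing by
   the radiation condition. *)
Lemma dual_limit phi M x (eta : R) : ~ D x -> cutoff2 M phi -> (forall y, S y -> \near y, phi y = 1) -> 0 < eta ->
  exists2 d : R, 0 < d & forall e, 0 < e -> e < d -> normc (dualT k U phi e x + delta_const k * (u x - pw x)) <= eta.
Proof.
move=> nD cp p1 eta0; have eta3 : 0 < eta / 3 by rewrite divr_gt0.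
have mv : mvp k [set y | `|rho| < enorm y] (fun x => u x - pw x).
  by apply: mvp_sub scattered_mvp => y; exact: far_exterior.
have [r1 r1R hfar] := @far_vanish R k k0 (fun x => u x - pw x) (fun b => A b alpha) `|rho| mv (normr_ge0 rho) scattered_asymptotics x _ eta3.
pose r := r1 + (enorm x + 3).
have x0 := enorm_ge0 x; have n0 := normr_ge0 rho.
have xr : enorm x + 2 < r by rewrite /r; move: r1R n0; lra.
have r1r : r1 < r by rewrite /r; move: x0; lra.
have rr : `|rho| < r by move: r1R r1r; lra.
have cT := large_cutoff2 xr.
pose M' := Num.max M (2 * r).
have wid (f : V -> R[i]) N : N <= M' -> cutoff2 N f -> cutoff2 M' f.
  by move=> NM [c v]; split => // y hy; apply: v; apply: le_lt_trans hy.
have cU := ext0_cont.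
have cpw y : ccontinuous_at y pw by exact: CkC_cont (plane_wave_CkC k alpha 0) I.
have T1 : forall y, [set: V] y -> ccontinuous_at y U by move=> y _; exact: cU.
have T2 : forall y, [set: V] y -> ccontinuous_at y pw by move=> y _; exact: cpw.
have ball1 y : enorm (y - x) <= 2 * 1 -> [set: V] y by [].
have [d1 d10 h1] := delta_bound k0 ltr01 ball1 T1 eta3.
have [d2 d20 h2] := delta_bound k0 ltr01 ball1 T2 eta3.
exists (Num.min 1 (Num.min d1 d2)); first by rewrite !lt_min ltr01 d10.
move=> e e0; rewrite !lt_min => /and3P[/ltW e1 ed1 ed2].
(* Both cutoffs equal 1 near S, so the small one may be exchanged for one that reaches out to the
   far field. *)
have -> : dualT k U phi e x = dualT k U (cbump 0 r) e x.
  apply: (@dual_local _ _ M') => //; first by apply: wid cp; rewrite le_max lexx.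
    by apply: wid cT; rewrite le_max lexx orbT.
  move=> y Sy; have yr : enorm y < r.
    by apply: le_lt_trans rr; apply: le_trans (boundary_bounded oD D_bounded Sy) (ler_norm rho).
  apply: filterS (filterI (p1 y Sy) (large_cutoff_in xr yr)) => z [-> ->] //.
have [cW1 E1] := dual_large xr cU e0 e1; have [cW2 E2] := dual_large xr cpw e0 e1.
(* The plane wave is an entire solution, so its pairing is 0; subtracting it turns the far term into
   one for the scattered field, which radiates. *)
have := dual_plane xr e0; rewrite E2 => Z.
have EW : cI (fun y => (u y - pw y) * farW k r x y) = cI (fun y => U y * farW k r x y) - cI (fun y => pw y * farW k r x y).
  rewrite -(cIB cW1 cW2); congr cI; apply/funext => y; have [yr|yr] := ltP (enorm y) r.
    by rewrite (farW_in xr yr) !mulr0 subrr.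
  have nDy : ~ D y by exact: (exterior_out (far_exterior (lt_le_trans rr yr))).
  by rewrite (ext0_out nDy) mulrBl.
have := hfar r r1r; rewrite EW E1; have := h1 e e0 ed1; have := h2 e e0 ed2; rewrite (ext0_out nD).
move: Z; move: (cI (fun y => U y * Kk k e x y)) (cI (fun y => pw y * Kk k e x y)) (cI (fun y => U y * farW k r x y)) (cI (fun y => pw y * farW k r x y)) => a b c d Z n2 n1 n3.
have -> : a + c + delta_const k * (u x - pw x) = (a + delta_const k * u x) - (b + delta_const k * pw x) + (c - d) + (b + d) by ring.
rewrite Z addr0; apply: le_trans (le_normcD _ _) _; apply: le_trans (lerD (le_normcB _ _) (lexx _)) _.
by move: n1 n2 n3; lra.
Qed.

End scattering_problem.

(** * Approximation of the scattered field *)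

Section approximation_of_the_scattered_field.
Variables (R : realType) (D : set 'rV[R]_3) (rho k : R) (alpha : 'rV[R]_3)
  (A : 'rV[R]_3 -> 'rV[R]_3 -> R[i]) (u : 'rV[R]_3 -> R[i])
  (Y : forall l : nat, 'I_(l.*2.+1) -> 'rV[R]_3 -> R[i]).
Local Notation V := 'rV[R]_3.
Hypotheses (oD : open D) (cD : connected D) (D0 : D 0)
  (D_bounded : D `<=` [set x | enorm x <= rho]) (k0 : 0 < k)
  (alpha1 : sphere alpha) (usol : scattering_solution D k alpha A u).
Hypothesis Yspan : forall l (P : 'rV[R]_3 -> R[i]), hp l P -> harmonic P ->
  exists c : 'I_(l.*2.+1) -> R[i], forall x, sphere x -> P x = \sum_m c m * Y m x.
Implicit Types (x y w : V).
Local Notation S := (boundary D).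
Local Notation pw := (plane_wave k alpha).
Local Notation U := (ext0 D u).
Local Notation approx := (@approx R D k Y).
Let cU := ext0_cont oD usol.

Lemma common_lower_bound n (d : 'I_n -> R) : (forall j, 0 < d j) -> exists2 e : R, 0 < e & forall j, e <= d j.
Proof.
move=> d0; have s0 : 0 <= \sum_j (d j)^-1 by apply: sumr_ge0 => j _; rewrite invr_ge0 ltW.
exists (\sum_j (d j)^-1 + 1)^-1; first by rewrite invr_gt0 ltr_wpDl.
move=> j; rewrite -[leRHS]invrK lef_pV2 ?posrE ?invr_gt0 ?ltr_wpDl//.
rewrite (bigD1 j)//= -addrA lerDl addr_ge0// sumr_ge0// => i _; by rewrite invr_ge0 ltW.
Qed.

Lemma compact_of_bounded (K : set V) M : closed K -> (forall y, K y -> enorm y <= M) -> compact K.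
Proof.
move=> clK KM; apply: bounded_closed_compact => //; exists `|M|; split; first exact: num_real.
move=> N MN y Ky /=; apply: ltW; apply: le_lt_trans MN.
by apply: le_trans (norm_le_enorm y) _; apply: le_trans (KM y Ky) (ler_norm M).
Qed.

Lemma closed_ball_compact (p : V) (r : R) : compact [set y | enorm (y - p) <= r].
Proof.
apply: (@compact_of_bounded _ (r + enorm p)).
  have -> : [set y | enorm (y - p) <= r] = (fun y : V => enorm (y - p)) @^-1` [set t | t <= r] by [].
  apply: closed_comp => [y _|]; last exact: closed_le.
  have c : {for y, continuous (fun y : V => enorm (y - p))}.
    have cs : {for y, continuous (fun y : V => y - p)} by exact: (@shift_cont R (- p)).
    exact: (contcomp cs (@enorm_cont R _)).
  exact: c.
by move=> y /= h; have := enorm_triB y p; move: h; lra.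
Qed.

(* Moving the sources of a localized dual by w brings them into D. *)
Lemma dual_push phi M (K : set V) w : cutoff2 M phi -> compact K -> (forall y, ~ K y -> \near y, phi y = 0) ->
  (forall y, S y -> K y -> D (y + w)) ->
  exists2 d : R, 0 < d & exists2 F, approx F & forall x e, ~ D x -> 0 < e -> e <= d -> dualT k U phi e (x - w) = F x.
Proof.
move=> cp cK nK KD; have cS := boundary_compact oD D_bounded.
pose C := S `&` K; have cC : compact C.
  apply: compact_closedI => //; apply: compact_closed => //; exact: norm_hausdorff.
pose Cw := [set z | C (z - w)]; have cCw : compact Cw by exact: compact_shift.
have CwD : Cw `<=` D by move=> z [Sz Kz]; rewrite -(subrK w z); exact: KD.
have [r r0 hr] := compact_room oD cCw CwD.
(* The new cutoff lives within 3 dl of the centres; after a further dl this stays well inside the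
   room r = 8 dl about the shifted centres. *)
pose dl := r / 8; have dl0 : 0 < dl by rewrite divr_gt0.
have r8 : r = 8 * dl by rewrite /dl; field.
have [n [p [pC hp]]] := @compact_cover R C (fun=> dl) cC (fun _ _ => dl0).
pose b j : V -> R := bump (p j) dl.
have b01 j x : 0 <= b j x <= 1 by rewrite bump_ge0 bump_le1.
pose chi y : R := \sum_(j < n) pou b j y.
have cchi : Ck 2 setT chi.
  apply: Ck_sum; first exact: openT.
  by move=> j; apply: Ck_pou => i; exact: Ck_bump.
(* The pairing sees a cutoff only near S. Multiplying by [chi], equal to 1 near the part of S in
   [K], shrinks the support to a thin neighbourhood that the shift carries into [D]. *)
pose psi y : R[i] := (chi y)%:C * phi y.
have cs : cutoff2 M psi.
  split; last by move=> y /cp.2; rewrite /psi => ->; rewrite mulr0.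
  by apply: (CkCM openT); [exact: (CkC_real openT cchi)|exact: cp.1].
have loc y : S y -> \near y, phi y = psi y.
  move=> Sy; have [Ky|nKy] := pselect (K y); last first.
    by apply: filterS (nK y nKy) => z; rewrite /psi => ->; rewrite mulr0.
  have [j jn hj] := hp y (conj Sy Ky).
  apply: filterS (enorm_near hj) => z hz; rewrite /psi /chi (@sum_pou1 _ b n j) ?mul1r//.
  by rewrite /b bump_in// ltW.
pose K2 := closure [set y | chi y != 0].
have K2p y : K2 y -> exists2 j, (j < n)%N & enorm (y - p j) < 3 * dl.
  move=> cy; have : nbhs y [set z | enorm (z - y) < dl] by apply/enorm_ball; exists dl.
  move=> /cy[z [/= chz hz]].
  have [j hj] : exists j : 'I_n, pou b j z != 0.
    apply: contrapT => H; move: chz; rewrite /chi big1 ?eqxx// => j _.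
    by apply/eqP; apply: contrapT => h; apply: H; exists j; apply/negP.
  exists j => //; have bz : b j z != 0 by apply: contra hj => /eqP h; rewrite pou0.
  have := bump_supp dl0 bz; have := enormD (y - z) (z - p j); rewrite addrA subrK (enormB y z).
  by move: hz; lra.
have Cwp j : (j < n)%N -> Cw (p j + w) by move=> jn; rewrite /Cw /= addrK; exact: pC.
have K2D y : K2 y -> D (y + w).
  move=> /K2p[j jn hj]; apply: (hr (p j + w)); first exact: Cwp.
  by rewrite opprD addrACA subrr addr0; move: hj r8 dl0; lra.
have K2far x y : ~ D x -> K2 y -> dl <= enorm (y - (x - w)).
  move=> nD /K2p[j jn hj]; rewrite leNgt; apply/negP => h; apply: nD.
  apply: (hr (p j + w)); first exact: Cwp.
  have -> : x - (p j + w) = (y - p j) - (y - (x - w)).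
    by rewrite opprB addrC -addrA opprD; apply/rowP => i; rewrite !mxE; ring.
  apply: le_lt_trans (enormD _ _) _; rewrite enormN; move: h hj r8 dl0; lra.
have cK2 : compact K2.
  apply: (@compact_of_bounded _ (rho + 3 * dl)); first exact: closed_closure.
  move=> y /K2p[j jn hj]; have := boundary_bounded oD D_bounded (pC j jn).1.
  by rewrite /=; have := enorm_triB y (p j); move: hj; lra.
have nK2 y : ~ K2 y -> \near y, psi y = 0.
  move=> h; have oK : open (~` K2) by apply: closed_openC; exact: closed_closure.
  apply: filterS (open_nbhs_nbhs (conj oK h)) => z nz; rewrite /psi.
  rewrite (_ : chi z = 0) ?mul0r//; apply/eqP; apply: contrapT => /negP hz; apply: nz.
  exact: subset_closure.
have pK2 i y : ~ K2 y -> cpd i psi y = 0 by move=> /nK2; exact: cpd_near_cst.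
have lK2 y : ~ K2 y -> claplacian psi y = 0 by move=> /nK2; exact: claplacian_near_cst.
pose K' := [set z | K2 (z - w)]; have cK' : compact K' by exact: compact_shift.
have K'D : K' `<=` D by move=> z h; rewrite -(subrK w z); exact: K2D.
have [C0 C1 C2 _] := dual_expand k0 cU 0 ltr01 cs.
pose N1 i x y : R[i] := ((y - x) 0 i)%:C * eta k 1 (dot (y - x) (y - x)).
pose N0 x y : R[i] := eta k 0 (dot (y - x) (y - x)).
pose F x := \sum_(i < 3) 2%:R * cI (fun y => U (y - w) * cpd i psi (y - w) * N1 i x y) +
  cI (fun y => U (y - w) * claplacian psi (y - w) * N0 x y).
exists dl => //; exists F.
  apply: approx_add.
    apply: approx_sum => i; apply: approx_scale.
    apply: (superposition1 k0 D0 Yspan oD cD i cK' K'D).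
      exact: (CCc_shift (- w) (C1 i)).
    by move=> y nKy; rewrite pK2 ?mulr0.
  apply: (superposition0 k0 D0 Yspan oD cD cK' K'D).
    exact: (CCc_shift (- w) C2).
  by move=> y nKy; rewrite lK2 ?mulr0.
move=> x e nD e0 ed.
rewrite (dual_local oD k0 usol (x - w) e0 cp cs loc).
have [_ _ _ ->] := dual_expand k0 cU (x - w) e0 cs.
have cG : CkC 2 setT (Gk k e (x - w)) by exact: (Gk_CkC k0 (x - w) openT e0).
(* x - w stays at distance at least dl >= e from the support: the delta term vanishes and the other
   kernels take their unregularized form, so the result is independent of e. *)
have Z0 : (fun y => U y * psi y * Kk k e (x - w) y) = (fun=> 0).
  apply/funext => y; have [Ky|nKy] := pselect (K2 y).
    by rewrite (Kk_out k0 e0) ?mulr0//; apply: le_trans ed (K2far x y nD Ky).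
  by rewrite (nbhs_singleton (nK2 y nKy)) mulr0 mul0r.
rewrite Z0 cI0 add0r; congr (_ + _).
- apply: eq_bigr => i _; congr (_ * _).
  have E : (fun y => U y * cpd i psi y * cpd i (Gk k e (x - w)) y) = (fun y => U y * cpd i psi y * N1 i (x - w) y).
    apply/funext => y; have [Ky|nKy] := pselect (K2 y); last by rewrite pK2// mulr0 !mul0r.
    by rewrite (cpd_Gk_far k0 i e0)//; apply: le_trans ed (K2far x y nD Ky).
  have D1 : CCc (fun y => U y * cpd i psi y * N1 i (x - w) y).
    by rewrite -E; apply: (CCcMr (C1 i)) => y; exact: CkC_cont (CkC_pd i cG) I.
  rewrite E; apply: (@kernel_shift R (fun y => U y * cpd i psi y) (N1 i x) (N1 i (x - w)) w D1).
  by move=> y; rewrite /N1 opprB addrA subrK.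
- have E : (fun y => U y * claplacian psi y * Gk k e (x - w) y) = (fun y => U y * claplacian psi y * N0 (x - w) y).
    apply/funext => y; have [Ky|nKy] := pselect (K2 y); last by rewrite lK2// mulr0 !mul0r.
    by rewrite (Gk_far k e0)//; apply: le_trans ed (K2far x y nD Ky).
  have D2 : CCc (fun y => U y * claplacian psi y * N0 (x - w) y).
    by rewrite -E; apply: (CCcMr C2) => y; exact: CkC_cont cG I.
  rewrite E; apply: (@kernel_shift R (fun y => U y * claplacian psi y) (N0 x) (N0 (x - w)) w D2).
  by move=> y; rewrite /N0 opprB addrA subrK.
Qed.

Lemma dual_sum (phi : nat -> V -> R[i]) M n e x : 0 < e -> (forall j, (j < n)%N -> cutoff2 M (phi j)) ->
  cutoff2 M (fun y => \sum_(j < n) phi j y) /\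
  dualT k U (fun y => \sum_(j < n) phi j y) e x = \sum_(j < n) dualT k U (phi j) e x.
Proof.
move=> e0; elim: n => [|n IH] cp.
  have c0 : cutoff2 M (fun=> 0) by split; [exact: CkC_cst openT|].
  have E : (fun y : V => \sum_(j < 0) phi j y) = (fun=> 0) by apply/funext => y; rewrite big_ord0.
  rewrite E big_ord0; split => //.
  have := dualD k0 cU x (-1) e0 c0 c0.
  rewrite (_ : (fun y : V => 0 + -1 * 0) = (fun=> 0)); last by apply/funext => y; rewrite mulr0 addr0.
  by move=> {1}->; rewrite mulN1r subrr.
have [c1 E1] := IH (fun j jn => cp j (ltnW jn)); have c2 := cp n (ltnSn n).
have E : (fun y => \sum_(j < n.+1) phi j y) = (fun y => \sum_(j < n) phi j y + 1 * phi n y).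
  by apply/funext => y; rewrite big_ord_recr /= mul1r.
rewrite E big_ord_recr /= -E1 (dualD k0 cU x 1 e0 c1 c2) mul1r; split => //.
split; last by move=> y hy; rewrite (c1.2 y hy) (c2.2 y hy) mulr0 addr0.
by apply: (CkCD openT c1.1); apply: (CkCM openT (CkC_cst 2 1 openT) c2.1).
Qed.

Hypothesis D_lipschitz : lipschitz_boundary D.

(** The graph direction of the chart at p, with a radius that serves all surface points nearby and
    all small lengths at once. *)
Lemma inward_direction p : S p -> exists2 r : R, 0 < r & exists2 d : V, dot d d = 1 &
  forall y (t : R), S y -> enorm (y - p) <= 2 * r -> 0 < t -> t <= r -> D (y + t *: d).
Proof.
move=> Sp; have [Q [h [W [QQ [lh [pW chart]]]]]] := D_lipschitz Sp.
have [s s0 hs] := (enorm_ball p W).1 pW.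
(* With r = s/4, points within 2 r of p pushed by at most r remain inside the chart ball of radius 4
   r. *)
exists (s / 4); first by rewrite divr_gt0.
exists (chart_dir Q); first exact: dot_chart_dir.
move=> y t; rewrite boundaryE// => -[cy _] yp t0 ts.
have nt : enorm (t *: chart_dir Q) = t by rewrite enormZ /enorm dot_chart_dir// sqrtr1 mulr1 gtr0_norm.
apply: (chart_push QQ lh chart cy _ _ t0).
  apply/enorm_ball; exists (s / 4); first by rewrite divr_gt0.
  move=> z hz; apply: hs; have := enormD (z - y) (y - p); rewrite addrA subrK; move: hz yp s0; lra.
apply: hs; have := enormD (t *: chart_dir Q) (y - p); rewrite addrA [t *: _ + y]addrC nt; move: yp ts s0; lra.
Qed.

(** The shift lengths come first, from bounds uniform in e and x. Then [dual_push] gives potentials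
    that are approximable and equal the shifted duals for all small e. Finally e tends to 0 at each
    x, and the sum of the duals becomes a multiple of the scattered field. *)
Theorem scattered_approx : approx (fun x => u x - pw x).
Proof.
have cS := boundary_compact oD D_bounded.
have [rd hrd] : exists rd : V -> R * V, forall p, S p -> [/\ 0 < (rd p).1, dot (rd p).2 (rd p).2 = 1 &
    forall y (t : R), S y -> enorm (y - p) <= 2 * (rd p).1 -> 0 < t -> t <= (rd p).1 -> D (y + t *: (rd p).2)].
  suff /choice[f hf] : forall p, exists q : R * V, S p -> [/\ 0 < q.1, dot q.2 q.2 = 1 &
    forall y (t : R), S y -> enorm (y - p) <= 2 * q.1 -> 0 < t -> t <= q.1 -> D (y + t *: q.2)] by exists f.
  move=> p.
  have [Sp|nS] := pselect (S p); last by exists (0, 0).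
  by have [r r0 [d d1 h]] := inward_direction Sp; exists (r, d).
pose r p := (rd p).1; pose dir p := (rd p).2.
have r0 p : S p -> 0 < r p by move=> /hrd[].
have [n [p [pS hp]]] := compact_cover cS r0.
pose b j : V -> R := bump (p j) (r (p j)).
have b01 j x : 0 <= b j x <= 1 by rewrite bump_ge0 bump_le1.
pose phi j y : R[i] := (pou b j y)%:C.
pose M : R := \sum_(j < n) (enorm (p j) + 2 * r (p j)).
have tj0 j : (j < n)%N -> 0 <= enorm (p j) + 2 * r (p j).
  by move=> jn; rewrite addr_ge0 ?enorm_ge0// mulr_ge0// ltW// r0//; exact: pS.
have M0 : 0 <= M by apply: sumr_ge0 => j _; exact: tj0.
have supp j y : (j < n)%N -> 2 * r (p j) < enorm (y - p j) -> \near y, phi j y = 0.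
  move=> jn hy; have rp := r0 _ (pS j jn).
  apply: filterS (cbump_near0 rp hy) => z /complexI h; by rewrite /phi pou0.
have cp j : (j < n)%N -> cutoff2 M (phi j).
  move=> jn; split.
    by apply: (CkC_real openT); apply: Ck_pou => i; exact: Ck_bump.
  move=> y hy; have pM : enorm (p j) + 2 * r (p j) <= M.
    rewrite /M (bigD1 (Ordinal jn))//= lerDl sumr_ge0// => i _; exact: tj0.
  have far : 2 * r (p j) < enorm (y - p j).
    by have := enorm_triB y (p j); have := norm_le_enorm y; move: hy pM; lra.
  exact: (nbhs_singleton (supp j y jn far)).
have one y : S y -> \near y, \sum_(j < n) phi j y = 1.
  move=> /hp[j jn hj]; apply: filterS (enorm_near hj) => z hz.
  rewrite /phi -[RHS]/(1%:C); apply: complex_eq; rewrite ?Re_sum ?Im_sum; last by rewrite big1.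
  by apply: (@sum_pou1 _ b n j) => //; rewrite /b bump_in ?(ltW hz)//; exact: r0 (pS j jn).
have dn := delta_const_neq0 k0; set dc := delta_const k in dn.
apply: approx_closed => e0 e00.
pose q := normc dc^-1; have q0 : 0 <= q by exact: normc_ge0.
have q1 : 0 < q + 1 by rewrite ltr_wpDl.
(* One share for replacing the duals by pushed potentials, one for the limit in e; q is the size of
   the inverse delta constant. *)
pose eta' := e0 / (2 * (q + 1)); have eta0 : 0 < eta' by rewrite divr_gt0// mulr_gt0.
have n1 : 0 < n%:R + 1 :> R by rewrite ltr_wpDl.
have etan : 0 < eta' / (n%:R + 1) by rewrite divr_gt0.
have H (j : 'I_n) : exists q : R * (V -> R[i]), [/\ 0 < q.1, approx q.2 &
    forall x e, ~ D x -> 0 < e -> e <= q.1 -> e <= 1 ->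
      (1 + enorm x) * normc (q.2 x - dualT k U (phi j) e x) <= eta' / (n%:R + 1)].
  have jn := ltn_ord j; have Sp := pS j jn; have [rp d1 push] := hrd _ Sp.
  have [d d0 hd] := dual_shift k0 cU M0 (cp j jn) etan.
  pose t := Num.min (d / 2) (r (p j)); have t0 : 0 < t by rewrite lt_min divr_gt0// r0.
  have tr : t <= r (p j) by rewrite ge_min lexx orbT.
  have td : t < d by apply: le_lt_trans (_ : d / 2 < d); [rewrite ge_min lexx|rewrite ltr_pdivrMr// ltr_pMr// ltr1n].
  have nw : enorm (t *: dir (p j)) < d by rewrite enormZ /enorm d1 sqrtr1 mulr1 gtr0_norm.
  have KD y : S y -> [set y | enorm (y - p j) <= 2 * r (p j)] y -> D (y + t *: dir (p j)).
    by move=> Sy Ky; exact: push.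
  have off y : ~ [set y | enorm (y - p j) <= 2 * r (p j)] y -> \near y, phi j y = 0.
    by move=> /= h; apply: supp => //; rewrite ltNge; apply/negP.
  have [dl dl0 [F iF hF]] := dual_push (cp j jn) (@closed_ball_compact (p j) (2 * r (p j))) off KD.
  exists (dl, F); split => // x e nD e1 e2 e3 /=.
  by rewrite -(hF x e nD e1 e2); exact: hd.
have [DF hDF] := choice H.
have [dm dm0 hdm] := @common_lower_bound n (fun j => (DF j).1) (fun j => let: And3 h _ _ := hDF j in h).
exists (fun x => - dc^-1 * \sum_(j < n) (DF j).2 x).
  apply: approx_scale; apply: approx_sum => j; by have [_ h _] := hDF j.
move=> x nD; have wx : 0 < 1 + enorm x by rewrite ltr_pwDl// enorm_ge0.
have [cP _] := dual_sum 0 ltr01 cp.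
have [dt dt0 hdt] := dual_limit oD D_bounded k0 alpha1 usol nD cP one (divr_gt0 eta0 wx).
(* e is chosen after x: the rate of [dual_limit] depends on x, whereas [dm] and the shift bounds do
   not. *)
pose e := Num.min 1 (Num.min (dt / 2) dm).
have e1 : 0 < e by rewrite !lt_min ltr01 divr_gt0.
have e2 : e <= 1 by rewrite ge_min lexx.
have e3 : e < dt.
  apply: le_lt_trans (_ : dt / 2 < dt); first by rewrite !ge_min lexx orbT.
  by rewrite ltr_pdivrMr// ltr_pMr// ltr1n.
have e4 : e <= dm by rewrite !ge_min lexx !orbT.
have h1 := hdt e e1 e3; have [_ E] := dual_sum x e1 cp; rewrite E in h1.
have h2 : (1 + enorm x) * normc (\sum_(j < n) ((DF j).2 x - dualT k U (phi j) e x)) <= eta'.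
  apply: le_trans (ler_wpM2l (ltW wx) (le_normc_sum _ _ _)) _; rewrite mulr_sumr.
  apply: le_trans (_ : \sum_(j < n) eta' / (n%:R + 1) <= _).
    apply: ler_sum => j _; have [_ _ h] := hDF j; apply: h => //; exact: le_trans e4 (hdm j).
  rewrite sumr_const card_ord -[_ *+ n]mulr_natl mulrCA ler_piMr ?(ltW eta0)//.
  by rewrite ler_pdivrMr// mul1r lerDl.
have -> : u x - pw x - - dc^-1 * \sum_(j < n) (DF j).2 x =
    dc^-1 * ((\sum_(j < n) dualT k U (phi j) e x + dc * (u x - pw x)) + \sum_(j < n) ((DF j).2 x - dualT k U (phi j) e x)).
  rewrite sumrB; move: (\sum_(j < n) dualT k U (phi j) e x) (\sum_(j < n) (DF j).2 x) (u x - pw x) => a c z.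
  have -> : a + dc * z + (c - a) = dc * z + c by ring.
  by rewrite mulrDr mulrA mulVf// mul1r mulNr opprK.
rewrite normcM -/q mulrCA.
have h3 : (1 + enorm x) * normc (\sum_(j < n) dualT k U (phi j) e x + dc * (u x - pw x)) <= eta'.
  by rewrite mulrC -ler_pdivlMr.
apply: le_trans (_ : q * (2 * eta') <= _); last first.
  have -> : q * (2 * eta') = e0 * (q / (q + 1)) by rewrite /eta'; field; rewrite gt_eqF.
  by rewrite ler_piMr ?(ltW e00)// ler_pdivrMr// mul1r lerDl.
apply: ler_wpM2l => //; apply: le_trans (ler_wpM2l (ltW wx) (le_normcD _ _)) _.
by rewrite mulrDr; move: h2 h3; lra.
Qed.

End approximation_of_the_scattered_field.

(** * Outgoing sums at infinity *)

Section outgoing_waves_at_infinity.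
Variables (R : realType) (k : R).
Hypothesis k0 : 0 < k.
Local Notation V := 'rV[R]_3.
Implicit Types (x y : V) (O : set V).

Lemma hp_eta_helmholtz l (P : V -> R[i]) O : open O -> ~ O 0 -> hp l P -> harmonic P ->
  CkC 2 O (fun x => P x * eta k l (dot x x)) /\
  forall x, O x -> claplacian (fun x => P x * eta k l (dot x x)) x + (k ^+ 2)%:C * (P x * eta k l (dot x x)) = 0.
Proof.
move=> oO nO hP aP.
have pos x : O x -> 0 < dot x x.
  move=> Ox; rewrite -enorm_sqr exprn_gt0// enorm_gt0//; apply/eqP => e; by rewrite e in Ox.
have E : (fun x : V => eta k l (dot x x)) = (fun x => eta k l (dot (x - 0) (x - 0))).
  by apply/funext => x; rewrite subr0.
have ce : CkC 2 O (fun x => eta k l (dot x x)).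
  rewrite E; apply: (@CkC_comp _ _ O [set q | 0 < q] (eta k l) (fun x : V => dot (x - 0) (x - 0)) oO).
  - by move=> x /pos; rewrite subr0.
  - have [h1 _] := eta_Dn k0 l 2; exact: h1.
  - have [_ h2] := eta_Dn k0 l 2; exact: h2.
  - exact: Ck_dist.
have cP : CkC 2 O P by apply: CkC_sub (hp_CkC 2 hP).
split; first exact: (CkCM oO cP ce).
move=> x Ox; rewrite (claplacianM oO Ox cP ce) aP mul0r add0r.
have q0 := pos x Ox; have xn : x != 0 by apply/eqP => e; move: Ox; rewrite e.
have ci i : cpd i (fun x => eta k l (dot x x)) x = (x 0 i)%:C * eta k l.+1 (dot x x).
  by apply: cpd_cderive; have := eta_radial k0 l (delta_mx 0 i) xn; rewrite dotC dot_delta.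
have D1 (q : R) : 0 < q -> cderive q (1 : R) (eta k l) ((2^-1)%:C * eta k l.+1 q) by move=> h; exact: eta_deriv.
have D2 (q : R) : 0 < q -> cderive q (1 : R) (fun q => (2^-1)%:C * eta k l.+1 q) ((2^-1)%:C * ((2^-1)%:C * eta k l.+2 q)).
  by move=> h; apply: cdZ; exact: eta_deriv.
have L : claplacian (fun x => eta k l (dot x x)) x = 3%:R * eta k l.+1 (dot x x) + (dot x x)%:C * eta k l.+2 (dot x x).
  rewrite E (@claplacian_radial _ O 0 (eta k l) (fun q => (2^-1)%:C * eta k l.+1 q) (fun q => (2^-1)%:C * ((2^-1)%:C * eta k l.+2 q)) x oO Ox).
  - rewrite subr0; have -> : (4 * dot x x)%:C = 4%:R * (dot x x)%:C :> R[i] by rewrite rcM rc_nat.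
    have -> : (2^-1)%:C = 2%:R^-1 :> R[i] by rewrite rcV rc_nat.
    by field.
  - by move=> y /pos h; rewrite subr0; exact: D1.
  - by rewrite subr0; exact: D2.
have S : \sum_(i < 3) cpd i P x * cpd i (fun x => eta k l (dot x x)) x = l%:R * P x * eta k l.+1 (dot x x).
  rewrite -(hp_euler x hP) mulr_suml; apply: eq_bigr => i _; rewrite ci; ring.
have o := eta_ode k0 l q0; rewrite L S -[RHS](mulr0 (P x)) -o natrD natrM; ring.
Qed.

Variable Y : forall l : nat, 'I_(l.*2.+1) -> V -> R[i].
Hypothesis hY : orthonormal_spherical_harmonics Y.

Lemma Psi_hp l (m : 'I_(l.*2.+1)) : exists P (c : R[i]), [/\ hp l P, harmonic P &
  forall x, x != 0 -> Psi k Y m x = c * (P x * eta k l (dot x x))].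
Proof.
have [P [/homogeneous_hp hP [aP eP]]] := hY.1 l m.
pose w : R[i] := ('i * k%:C) ^+ l.
have wn : w != 0.
  have i0 : ('i : R[i]) != 0.
    by apply/eqP => h; have := normc_i R; rewrite h normc0 => /eqP; rewrite eq_sym oner_eq0.
  have kn : k%:C != 0 :> R[i] by apply: rc_neq0; rewrite gt_eqF.
  by apply: expf_neq0; exact: (mulf_neq0 i0 kn).
exists P, w^-1; split => // x xn; have x0 := enorm_gt0 xn.
have q0 : 0 < dot x x by rewrite -enorm_sqr exprn_gt0.
rewrite /Psi eP; last by rewrite /sphere /= enormZ ger0_norm ?invr_ge0 ?enorm_ge0// mulVf// gt_eqF.
rewrite (hp_scale x _ hP) (eta_hankel k0 l q0) -/w -[Num.sqrt (dot x x)]/(enorm x).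
move: (hankel k l _) (P x) (((enorm x)^-1 ^+ l)%:C) => a b c.
have G (w1 w2 : R[i]) : w1 * (b * (w2 * c * a)) = (w1 * w2) * (c * b * a) by ring.
by rewrite G mulVf// mul1r.
Qed.

Lemma mvp_sum O (I : Type) (s : seq I) (F : I -> V -> R[i]) : open O ->
  (forall a : I, mvp k O (F a)) -> mvp k O (fun x => \sum_(a <- s) F a x).
Proof.
move=> oO h; elim: s => [|a s IH].
  rewrite (_ : (fun x => _) = (fun=> 0)); last by apply/funext => x; rewrite big_nil.
  apply: (helmholtz_mvp k0 oO); first exact: CkC_cst.
  by move=> x _; rewrite mulr0 addr0; apply: (@claplacian_near_cst R (fun=> 0) x 0); exact: filterE.
rewrite (_ : (fun x => _) = (fun x => F a x - -1 * \sum_(a <- s) F a x)).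
  by apply: (mvpB k0) => //; exact: (mvpZ k0).
by apply/funext => x; rewrite big_cons mulN1r opprK.
Qed.

(** [Psi] coincides with a smooth solution off the origin, which [O] avoids, and the identity only
    involves values in a ball inside [O], since the kernel vanishes beyond 2 r. *)
Lemma outgoing_mvp O L (c : forall l : nat, 'I_(l.*2.+1) -> R[i]) : open O -> ~ O 0 ->
  mvp k O (outgoing_sum k Y L c).
Proof.
move=> oO nO; apply: mvp_sum => // l; apply: mvp_sum => // m; apply: (mvpZ k0).
have [P [w [hP aP e]]] := Psi_hp m; have [c2 hz] := hp_eta_helmholtz oO nO hP aP.
have xn x : O x -> x != 0 by move=> Ox; apply/eqP => x0; rewrite x0 in Ox.
pose g x := w * (P x * eta k l (dot x x)).
have cg : CkC 2 O g by exact: (CkCM oO (CkC_cst 2 w oO) c2).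
have gm : mvp k O g by apply: (mvpZ k0); exact: (helmholtz_mvp k0 oO c2 hz).
have [gc gi] := gm; split => [x Ox|a r s r0 rs aO].
  apply: (@cc_near _ g); last exact: gc.
  by apply: filterS (open_nbhs_nbhs (conj oO Ox)) => y /xn yn; rewrite (e y yn).
have Oa : O a by apply: aO; rewrite subrr enorm0; move: r0 rs; lra.
rewrite (e a (xn a Oa)) -(gi a r s r0 rs aO); congr cI; apply/funext => y.
have [h|h] := leP (enorm (y - a)) (2 * r); last by rewrite Wk_out ?mulr0.
by rewrite e//; apply: xn; apply: aO; exact: le_lt_trans rs.
Qed.

(** The far field along a ray: r e^(-ikr) removes the common factor of outgoing waves. A rate K / r
    is recorded because sums inherit it. *)
Definition far_limit (b : V) (f : V -> R[i]) (a : R[i]) := exists2 K : R, 0 <= K & forall r : R, 1 <= r ->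
  normc (r%:C * expi (- (k * r)) * f (r *: b) - a) <= K / r.

Lemma far_limit_sum (b : V) (I : Type) (s : seq I) (F : I -> V -> R[i]) (G : I -> R[i]) :
  (forall a : I, far_limit b (F a) (G a)) -> far_limit b (fun x => \sum_(a <- s) F a x) (\sum_(a <- s) G a).
Proof.
move=> h; elim: s => [|a s [K K0 hK]].
  by exists 0 => // r r1; rewrite !big_nil mulr0 subrr normc0 mul0r.
have [K1 K10 hK1] := h a; exists (K1 + K); first exact: addr_ge0.
move=> r r1; rewrite !big_cons mulrDl.
have -> (z p q p' q' : R[i]) : z * (p + q) - (p' + q') = (z * p - p') + (z * q - q') by ring.
by apply: le_trans (le_normcD _ _) _; apply: lerD; [exact: hK1|exact: hK].
Qed.

Lemma far_limitZ (b : V) f (a c : R[i]) : far_limit b f a -> far_limit b (fun x => c * f x) (c * a).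
Proof.
move=> [K K0 hK]; exists (normc c * K); first by rewrite mulr_ge0// normc_ge0.
move=> r r1; have -> (z p : R[i]) : z * (c * p) - c * a = c * (z * p - a) by ring.
by rewrite normcM -[leRHS]mulrA; apply: ler_wpM2l; [exact: normc_ge0|exact: hK].
Qed.

(** The Hankel function is e^(ikr) / r times a polynomial in 1/r with constant term 1. *)
Lemma hankel_far l : exists2 K : R, 0 <= K & forall r : R, 1 <= r ->
  normc (r%:C * expi (- (k * r)) * hankel k l (k * r) - 1) <= K / r.
Proof.
pose a j : R := acoef R l j * k^-1 ^+ j.
have E (r : R) : 1 <= r -> r%:C * expi (- (k * r)) * hankel k l (k * r) = \sum_(j < l.+1) 'i ^+ j * (a j * r^-1 ^+ j)%:C.
  move=> r1; have r0 : 0 < r by apply: lt_le_trans r1.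
  rewrite /hankel /hankel1.
  have -> (Sg : R[i]) : r%:C * expi (- (k * r)) * (k%:C * 'i ^+ l.+1 * (expi (k * r) * Sg)) =
      expi (k * r) * expi (- (k * r)) * (r%:C * k%:C * 'i ^+ l.+1 * Sg) by ring.
  rewrite expiNK mul1r mulr_sumr; apply: eq_bigr => j _.
  have -> (z : R[i]) : r%:C * k%:C * 'i ^+ l.+1 * ('i ^+ j * (- 'i) ^+ l.+1 * z) = 'i ^+ j * ('i ^+ l.+1 * (- 'i) ^+ l.+1) * (r%:C * k%:C * z) by ring.
  rewrite -exprMn mulrN sqr_i' opprK expr1n mulr1 -!rcM; congr (_ * _%:C).
  rewrite /a /acoef exprS !exprMn !exprVn; field.
  by rewrite !gt_eqF ?exprn_gt0 ?ltr0n ?muln_gt0 ?expn_gt0 ?fact_gt0.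
have a00 : a 0%N = 1 by rewrite /a acoef0 expr0 mulr1.
exists (\sum_(j < l) `|a j.+1|); first by apply: sumr_ge0.
move=> r r1; have r0 : 0 < r by apply: lt_le_trans r1.
rewrite E// big_ord_recl /= a00 !expr0 !mul1r addrC addKr.
apply: le_trans (le_normc_sum _ _ _) _; rewrite mulr_suml; apply: ler_sum => j _.
rewrite normcM normcX normc_i expr1n mul1r normc_real normrM; apply: ler_wpM2l => //.
rewrite ger0_norm ?exprn_ge0 ?invr_ge0 ?(ltW r0)// exprS ler_piMr ?invr_ge0 ?(ltW r0)//.
by rewrite exprn_ile1 ?invr_ge0 ?(ltW r0)// invf_le1.
Qed.

Lemma outgoing_far (b : V) L (c : forall l : nat, 'I_(l.*2.+1) -> R[i]) : sphere b ->
  far_limit b (outgoing_sum k Y L c) (\sum_(l < L.+1) \sum_(m < l.*2.+1) c l m * Y m b).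
Proof.
move=> b1; apply: far_limit_sum => l; apply: far_limit_sum => m; apply: far_limitZ.
have [K K0 hK] := hankel_far l; exists (normc (Y m b) * K); first by rewrite mulr_ge0// normc_ge0.
move=> r r1; have r0 : 0 < r by apply: lt_le_trans r1.
have e : enorm (r *: b) = r by rewrite enormZ (b1 : enorm b = 1) mulr1 gtr0_norm.
rewrite /Psi e scalerA mulVf ?gt_eqF// scale1r.
have -> (z h : R[i]) : z * (Y m b * h) - Y m b = Y m b * (z * h - 1) by ring.
by rewrite normcM -[leRHS]mulrA; apply: ler_wpM2l; [exact: normc_ge0|exact: hK].
Qed.

End outgoing_waves_at_infinity.

(** * Coefficients of the far field *)

Section far_field_coefficients.
Variables (R : realType) (D : set 'rV[R]_3) (rho k : R) (alpha : 'rV[R]_3)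
  (A : 'rV[R]_3 -> 'rV[R]_3 -> R[i]) (u : 'rV[R]_3 -> R[i])
  (Y : forall l : nat, 'I_(l.*2.+1) -> 'rV[R]_3 -> R[i]).
Local Notation V := 'rV[R]_3.
Hypotheses (oD : open D) (D_bounded : D `<=` [set x | enorm x <= rho]) (k0 : 0 < k)
  (alpha1 : sphere alpha) (usol : scattering_solution D k alpha A u)
  (hY : orthonormal_spherical_harmonics Y).
Local Notation pw := (plane_wave k alpha).
Let amp (b : V) := A b alpha.
Let mv : mvp k [set y | `|rho| < enorm y] (fun x => u x - pw x).
Proof. by apply: mvp_sub (scattered_mvp k0 alpha1 usol) => y; exact: far_exterior. Qed.
Let asym := scattered_asymptotics usol.

(** Continuity along the sphere does not give continuity at its points in space, so the amplitude is
    first replaced by its extension constant along rays. *)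
Lemma amplitude_sgood : sgood amp.
Proof.
have [B B0 hB] := @amp_bound R k (fun x => u x - pw x) amp `|rho| mv (normr_ge0 rho) asym.
have u1 x : sphere x -> unitv x = x by move=> x1; rewrite /unitv (x1 : enorm x = 1) invr1 scale1r.
apply: (@sgood_eq _ (fun x => amp (unitv x))); first by move=> x /u1 ->.
apply: (@sgood_cont _ _ B); last by move=> x x1; apply: hB; rewrite u1.
move=> x xn; have x0 := enorm_gt0 xn; apply: cc_eps => e e0.
have [d d0 hd] := @amp_unif R k (fun x => u x - pw x) amp `|rho| mv (normr_ge0 rho) asym _ e0.
exists (Num.min (enorm x / 4) (d * enorm x / 8)); first by rewrite lt_min !divr_gt0// mulr_gt0.
move=> y; rewrite lt_min => /andP[h1 h2].
have yx := enorm_le_norm (y - x).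
have y0 : 0 < enorm y by have := enorm_triB x y; rewrite enormB; move: h1 yx x0; lra.
apply: hd; [exact: unitv_sphere|exact: unitv_sphere|].
apply: le_lt_trans (unitv_near x0 y0) _; rewrite ltr_pdivrMr//.
by have := mulr_gt0 d0 x0; move: h2 yx; lra.
Qed.

(** At distance r the weight exceeds r, so r times the error is at most e along each ray; letting r
    grow, the bound passes to the far fields. *)
Lemma amplitude_approx L (c : forall l : nat, 'I_(l.*2.+1) -> R[i]) (e : R) :
  (forall x, ~ D x -> (1 + enorm x) * normc (outgoing_sum k Y L c x - (u x - pw x)) <= e) ->
  forall b, sphere b -> normc (\sum_(l < L.+1) \sum_(m < l.*2.+1) c l m * Y m b - amp b) <= e.
Proof.
move=> h b b1; apply/ler_addgt0Pr => d d0; have d20 : 0 < d / 2 by rewrite divr_gt0.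
have [K K0 hK] := @outgoing_far R k k0 Y b L c b1.
have [r1 r1R hr] := @asym_mul R k (fun x => u x - pw x) amp `|rho| (normr_ge0 rho) asym _ d20.
have r10 : 0 <= r1 by apply: ltW; apply: le_lt_trans r1R; exact: normr_ge0.
pose r := r1 + 1 + K / (d / 2).
have Kd : 0 <= K / (d / 2) by rewrite divr_ge0// ltW.
have rr : r1 < r by rewrite /r; move: Kd; lra.
have r11 : 1 <= r by rewrite /r; move: Kd r10; lra.
have r0 : 0 < r by apply: lt_le_trans r11.
have er : enorm (r *: b) = r by rewrite enormZ (b1 : enorm b = 1) mulr1 gtr0_norm.
have nD : ~ D (r *: b).
  by apply: (exterior_out (far_exterior D_bounded _)); rewrite er; apply: lt_trans r1R rr.
have n1 := hK r r11.
have n2 : K / r <= d / 2.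
  rewrite ler_pdivrMr// mulrC -ler_pdivrMr// /r; move: r10; lra.
have n3 := h (r *: b) nD; rewrite er in n3.
have n4 := hr (r *: b); rewrite er in n4; have {}n4 := n4 rr.
have ub : unitv (r *: b) = b by rewrite /unitv er scalerA mulVf ?scale1r// gt_eqF.
rewrite ub in n4.
set z := r%:C * expi (- (k * r)) in n1.
set s := \sum_(l < L.+1) _ in n1 *; set os := outgoing_sum k Y L c (r *: b) in n1 n3.
set v := u (r *: b) - pw (r *: b) in n3 n4.
have n4' : normc (z * v - amp b) <= d / 2.
  have <- : expi (- (k * r)) * (r%:C * v - amp b * expi (k * r)) = z * v - amp b.
    have := expiNK (k * r); rewrite /z; move: (expi (k * r)) (expi (- (k * r))) => p q pq.
    have -> : q * (r%:C * v - amp b * p) = r%:C * q * v - amp b * (p * q) by ring.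
    by rewrite pq mulr1.
  by rewrite normcM normc_expi mul1r.
have n3' : normc (z * (os - v)) <= e.
  rewrite normcM /z normcM normc_expi mulr1 normc_real gtr0_norm//.
  by apply: le_trans n3; rewrite ler_wpM2r ?normc_ge0// lerDr.
have -> : s - amp b = - (z * os - s) + z * (os - v) + (z * v - amp b) by ring.
apply: le_trans (le_normcD _ _) _; apply: le_trans (lerD (le_normcD _ _) (lexx _)) _.
by rewrite normcN; move: n1 n2 n3' n4'; lra.
Qed.

(** By orthonormality each coefficient of the sum is the corresponding coefficient of its far field,
    so the difference is a single integral of the far-field error. *)
Lemma coefficient_bound l (m : 'I_(l.*2.+1)) : exists2 C : R, 0 <= C &
  forall L (c : forall l : nat, 'I_(l.*2.+1) -> R[i]) (e : R), 0 <= e ->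
  (forall l (m : 'I_(l.*2.+1)), (L < l)%N -> c l m = 0) ->
  (forall x, ~ D x -> (1 + enorm x) * normc (outgoing_sum k Y L c x - (u x - pw x)) <= e) ->
  normc (c l m - amplitude_coef Y A alpha m) <= C * e.
Proof.
have [_ [_ [BY hBY]]] := sgood_Y hY m.
have gc := sgood_conj (sgood_Y hY m).
pose BY' := `|BY|; have B0 : 0 <= BY' by exact: normr_ge0.
pose ar := fine (hausdorff2 (@sphere R)); have a0 : 0 <= ar by apply: fine_ge0; exact: hausdorff2_ge0.
exists (2 * BY' * ar); first by rewrite !mulr_ge0.
move=> L c e e0 cL he; have ap := amplitude_approx he.
pose AL b := \sum_(l < L.+1) \sum_(m < l.*2.+1) c l m * Y m b.
have gA : sgood AL.
  by apply: sgood_sum => l'; apply: sgood_sum => m'; apply: sgoodZ; exact: sgood_Y.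
have g1 : sgood (fun b => AL b * (Y m b)^*) by exact: sgoodM.
have g2 : sgood (fun b => amp b * (Y m b)^*) by apply: sgoodM => //; exact: amplitude_sgood.
have -> : c l m - amplitude_coef Y A alpha m = sphere_integral (fun b => (AL b - amp b) * (Y m b)^*).
  rewrite -(sI_Y_sum hY m cL) /amplitude_coef -/AL.
  rewrite -mulN1r -(sI_Z hY (-1) g2) -(sI_D hY g1 (sgoodZ (-1) g2)).
  by apply: sI_eq => b _; rewrite mulN1r -mulrBl.
have -> : 2 * BY' * ar * e = 2 * (e * BY') * ar by ring.
apply: (sI_bound hY).
  apply: (@sgood_eq _ (fun b => AL b * (Y m b)^* + -1 * (amp b * (Y m b)^*))).
    by move=> b _; rewrite mulN1r -mulrBl.
  by apply: sgoodD => //; exact: sgoodZ.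
move=> b b1; rewrite normcM normc_conj; apply: ler_pM; rewrite ?normc_ge0//; first exact: ap.
by apply: le_trans (hBY b b1) (ler_norm BY).
Qed.

End far_field_coefficients.

(** * Conclusion from the weighted approximation *)

Lemma boundary_area (R : realType) (D : set 'rV[R]_3) (rho : R) : open D -> D `<=` [set x | enorm x <= rho] ->
  lipschitz_boundary D -> exists2 m : R, 0 <= m & (hausdorff2 (boundary D) <= m%:E)%E.
Proof.
move=> oD Drho lD; have cS := boundary_compact oD Drho.
have fS : (hausdorff2 (boundary D) < +oo)%E.
  apply: compact_hausdorff2 => // p Sp.
  have [Q [h [U [QQ [lh [pU chart]]]]]] := lD p Sp.
  exact: (chart_area oD QQ lh pU chart).
exists (fine (hausdorff2 (boundary D))); first exact: fine_ge0 (hausdorff2_ge0 _).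
by rewrite fineK// ge0_fin_numE// hausdorff2_ge0.
Qed.

Theorem theorem2p1 (R : realType) (D : set 'rV[R]_3) (rho k : R)
    (alpha : 'rV[R]_3) (A : 'rV[R]_3 -> 'rV[R]_3 -> R[i])
    (u : 'rV[R]_3 -> R[i])
    (Y : forall l : nat, 'I_(l.*2.+1) -> 'rV[R]_3 -> R[i])
    (domD : domain D)
    (D_bounded : D `<=` [set x | enorm x <= rho])
    (D_lipschitz : lipschitz_boundary D)
    (D_exterior : domain (~` D)°)
    (D_origin : D 0)
    (k_gt0 : 0 < k)
    (alpha_unit : sphere alpha)
    (Y_harmonics : orthonormal_spherical_harmonics Y)
    (u_solution : scattering_solution D k alpha A u) :
  let u0 := plane_wave k alpha in
  let v := fun x => u x - u0 x in
  exists (L : R -> nat) (c : R -> forall l : nat, 'I_(l.*2.+1) -> R[i]),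
    let veps := fun eps : R => outgoing_sum k Y (L eps) (c eps) in
    (forall eps : R, 0 < eps ->
      (0 < L eps)%N /\
      (forall (l : nat) (m : 'I_(l.*2.+1)), (L eps < l)%N -> c eps l m = 0) /\
      (surfL2 (boundary D) (fun x => (u0 x + veps eps x)%R) <= eps%:E)%E /\
      (surfL2 (boundary D) (fun x => (veps eps x - v x)%R) <= eps%:E)%E) /\
    (forall (m : nat) (gamma : R) (Om : set 'rV[R]_3),
      (0 < m)%N -> 1 < gamma -> inner_subdomain (~` D)° Om ->
      exists C eps0 : R, 0 < C /\ 0 < eps0 /\
        forall eps : R, 0 < eps -> eps < eps0 ->
          (sobolev_norm m Om (fun x => (veps eps x - v x)%R) +
           weightedL2 gamma (~` D) (fun x => (veps eps x - v x)%R)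
             <= (C * eps)%:E)%E) /\
    (forall (l : nat) (m : 'I_(l.*2.+1)),
      normc (c eps l m - amplitude_coef Y A alpha m) @[eps --> (0 : R)^'+]
        --> (0 : R)).
Proof.
move=> u0 v; have [_ [oD cD]] := domD.
have iV : approx D k Y v := scattered_approx oD cD D_origin D_bounded k_gt0 alpha_unit u_solution
  (@harmonic_span R Y Y_harmonics) D_lipschitz.
have [ar ar0 har] := boundary_area oD D_bounded D_lipschitz.
(* Approximating to within eps / q makes the surface norm at most sqrt(ar) eps / q <= eps, and q >=
   1 gives eps / q <= eps for the other norms. *)
pose q := Num.sqrt ar + 1; have q1 : 1 <= q by rewrite lerDr sqrtr_ge0.
have q0 : 0 < q by apply: lt_le_trans q1.
have [Lc hLc] : exists Lc : R -> nat * (forall l : nat, 'I_(l.*2.+1) -> R[i]), forall eps, 0 < eps ->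
    [/\ (0 < (Lc eps).1)%N, forall l (m : 'I_(l.*2.+1)), ((Lc eps).1 < l)%N -> (Lc eps).2 l m = 0 &
      forall x, ~ D x -> (1 + enorm x) * normc (outgoing_sum k Y (Lc eps).1 (Lc eps).2 x - v x) <= eps / q].
  suff /choice[f hf] : forall eps : R, exists p : nat * (forall l : nat, 'I_(l.*2.+1) -> R[i]), 0 < eps ->
    [/\ (0 < p.1)%N, forall l (m : 'I_(l.*2.+1)), (p.1 < l)%N -> p.2 l m = 0 &
      forall x, ~ D x -> (1 + enorm x) * normc (outgoing_sum k Y p.1 p.2 x - v x) <= eps / q] by exists f.
  move=> eps; have [e0|e0] := ltP 0 eps; last by exists (0%N, fun _ _ => 0).
  have [w [L [c [cL ew]]] hw] := iV _ (divr_gt0 e0 q0).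
  (* The statement asks for a positive degree; raising L to 1 adds vanishing terms only. *)
  exists (maxn L 1, c) => _ /=; split; first by rewrite leq_max orbT.
    by move=> l m; rewrite gtn_max => /andP[h _]; exact: cL.
  move=> x nD; rewrite (outgoing_sum_widen _ _ _ (leq_maxl L 1) cL) -ew// normcB; exact: hw.
exists (fun eps => (Lc eps).1), (fun eps => (Lc eps).2) => veps.
have le1 x (z : R[i]) : normc z <= (1 + enorm x) * normc z.
  by rewrite ler_peMl ?normc_ge0// lerDl enorm_ge0.
have leq eps : 0 < eps -> eps / q <= eps by move=> e0; rewrite ler_pdivrMr// ler_peMr// ltW.
have qar eps : 0 < eps -> Num.sqrt ar * (eps / q) <= eps.
  move=> e0; rewrite mulrCA ler_piMr ?(ltW e0)// ler_pdivrMr// mul1r lerDl//.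
have mS : measurable (boundary D : set (caratheodory_type (hausdorff2_outer R))).
  rewrite -(setCK (boundary D)); apply: measurableC; apply: area_open_measurable.
  exact: boundary_open.
have Sout x : boundary D x -> ~ D x by rewrite boundaryE// => -[].
split; [|split].
- move=> eps e0; have [L0 cL hv] := hLc eps e0; split => //; split => //.
  have bd x : boundary D x -> normc (veps eps x - v x) <= eps / q.
    by move=> Sx; apply: le_trans (le1 x _) (hv x (Sout x Sx)).
  have eq0 : 0 <= eps / q by rewrite divr_ge0// ltW.
  have S2 f : (forall x, boundary D x -> normc (f x) <= eps / q) -> (surfL2 (boundary D) f <= eps%:E)%E.
    move=> hf; have B := @L2norm_bound R _ _ (area R) (boundary D) f (eps / q) ar mS har eq0 hf.
    by apply: le_trans B _; rewrite lee_fin qar.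
  split; last exact: S2.
  (* On the surface u = 0, so v = - u0 and both surface estimates are the same. *)
  apply: S2 => x Sx; have := bd x Sx; rewrite /v.
  have [_ [_ [_ [_ [_ [ub _]]]]]] := u_solution.
  by rewrite (ub x Sx) sub0r opprK addrC.
- move=> m gamma Om m0 g1 iOm.
  have oE : open (~` D)° by exact: open_interior.
  have nE : ~ (~` D)° 0 by move=> /interior_subset; apply.
  have [C1 C10 h1] := sobolev_bound k_gt0 m oE iOm.
  have [C2 C20 h2] := weightedL2_bound (~` D) g1.
  (* The estimate holds for every eps > 0, so the threshold 1 is arbitrary; the added 1 makes the
     constant positive. *)
  exists (C1 + C2 + 1), 1; split; first by rewrite ltr_wpDl// addr_ge0.
  split => // eps e0 _; have [L0 cL hv] := hLc eps e0.
  have eq0 : 0 <= eps / q by rewrite divr_ge0// ltW.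
  have mf : mvp k (~` D)° (fun x => veps eps x - v x).
    apply: (mvpB k_gt0); first exact: outgoing_mvp.
    exact: (scattered_mvp k_gt0 alpha_unit u_solution).
  have s1 := h1 _ (eps / q) mf eq0 (fun x ex => le_trans (le1 x _) (hv x (exterior_out ex))).
  have s2 := h2 _ (eps / q) eq0 hv.
  apply: le_trans (leeD s1 s2) _; rewrite -EFinD lee_fin -mulrDl.
  apply: le_trans (_ : (C1 + C2) * eps <= _).
    by apply: ler_wpM2l; [exact: addr_ge0|exact: leq].
  by rewrite ler_wpM2r ?(ltW e0)// lerDl.
- move=> l m; have [C C0 hC] := coefficient_bound D_bounded k_gt0 alpha_unit u_solution Y_harmonics m.
  have C1 : 0 < C + 1 by rewrite ltr_wpDl.
  apply/cvgrPdist_le => e e0; have eC : 0 < e / (C + 1) by exact: divr_gt0.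
  near=> eps.
  have eps0 : 0 < eps by near: eps; exact: nbhs_right_gt.
  have [L0 cL hv] := hLc eps eps0.
  have eq0 : 0 <= eps / q by rewrite divr_ge0// ltW.
  rewrite sub0r normrN ger0_norm ?normc_ge0//.
  apply: le_trans (hC _ _ _ eq0 cL hv) _.
  apply: le_trans (_ : (C + 1) * eps <= _).
    by apply: ler_pM => //; [rewrite lerDl|exact: leq].
  by rewrite mulrC -ler_pdivlMr//; near: eps; exact: nbhs_right_le.
Unshelve. all: by end_near. Qed.
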